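(* For all $n\in\mathbb{N}$, \[ B_{2n}^{*}\!\left(-\tfrac32\right)+B_{2n}^{*}=2\sum_{m=1}^{\infty}\left((-1)^{n}\pi Y_{2n}(8\pi m)+\frac{1}{2\sqrt{2m}}\right)-n-\frac12\left(U_{2n-1}\!\left(\tfrac14\right)+U_{2n-1}\!\left(\tfrac34\right)\right)-\frac{1}{\sqrt2}\zeta\!\left(\tfrac12\right)+\frac{1}{2^{4n-1}}\sum_{m=1}^{\infty}\frac{\left(m+4-\sqrt{m(m+8)}\right)^{2n}}{\sqrt{m(m+8)}}. \]
   Context: $B_r(x)$ denotes the Bernoulli polynomials. The Zagier polynomials are $B_{n}^{*}(x)=\sum_{r=0}^{n}\binom{n+r}{2r}\frac{B_r(x)}{n+r}$ for $n\ge1$, and $B_n^*:=B_n^*(0)$. $Y_{n}$ is the Bessel function of the second kind of integer order $n$, $U_k$ the Chebyshev polynomial of the second kind, and $\zeta$ the Riemann zeta function. *)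

(* Defs.v *)
From Stdlib Require Import Reals Lra Lia Arith ClassicalEpsilon.
Open Scope R_scope.

(* Value of a convergent real series sum_{k>=0} f k (arbitrary if divergent). *)
Definition series (f : nat -> R) : R :=
  epsilon (inhabits 0) (fun l => infinite_sum f l).

(* Limit of a convergent real sequence (arbitrary if divergent). *)
Definition seq_lim (u : nat -> R) : R :=
  epsilon (inhabits 0) (fun l => Un_cv u l).

(* Bernoulli numbers with B_1 = -1/2, via
   B_0 = 1, B_m = -1/(m+1) * sum_{k=0}^{m-1} C(m+1,k) B_k. *)
Fixpoint bern_aux (n : nat) : nat -> R :=
  match n with
  | O => fun _ => 1
  | S p => let f := bern_aux p in
           fun k => if (k <=? p)%nat then f k
                    else - / INR (p + 2) * sum_f_R0 (fun j => C (p + 2) j * f j) p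
  end.
Definition bernoulli (k : nat) : R := bern_aux k k.

Definition bernoulli_poly (r : nat) (x : R) : R :=
  sum_f_R0 (fun k => C r k * bernoulli k * x ^ (r - k)) r.

Definition zagier_poly (n : nat) (x : R) : R :=
  sum_f_R0 (fun r => C (n + r) (2 * r) * bernoulli_poly r x / INR (n + r)) n.

(* Chebyshev polynomials of the second kind: U_0 = 1, U_1 = 2x,
   U_{k+2} = 2x U_{k+1} - U_k. cheb_pair k x = (U_k x, U_{k+1} x). *)
Fixpoint cheb_pair (k : nat) (x : R) : R * R :=
  match k with
  | O => (1, 2 * x)
  | S p => let (a, b) := cheb_pair p x in (b, 2 * x * b - a)
  end.
Definition chebU (k : nat) (x : R) : R := fst (cheb_pair k x).

Fixpoint harmonic (k : nat) : R :=
  match k with O => 0 | S p => harmonic p + / INR (S p) end.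

Definition euler_gamma : R := seq_lim (fun N => harmonic N - ln (INR N)).

(* Digamma at positive integers: psi(k+1) = -gamma + H_k. *)
Definition digamma_nat1 (k : nat) : R := - euler_gamma + harmonic k.

Definition besselJ (n : nat) (x : R) : R :=
  series (fun k => (-1) ^ k / (INR (fact k) * INR (fact (n + k))) * (x / 2) ^ (2 * k + n)).

(* Bessel function of the second kind of integer order n >= 0, for x > 0
   (DLMF 10.8.1). *)
Definition besselY (n : nat) (x : R) : R :=
  2 / PI * besselJ n x * ln (x / 2)
  - / PI * sum_f_R0 (fun k => INR (fact (n - k - 1)) / INR (fact k)
                               * (x / 2) ^ (2 * k) / (x / 2) ^ n) (n - 1)
        * (if (n =? 0)%nat then 0 else 1)
  - / PI * series (fun k => (digamma_nat1 k + digamma_nat1 (n + k)) * (-1) ^ k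
                            * (x / 2) ^ (2 * k + n)
                            / (INR (fact k) * INR (fact (n + k)))).

(* Riemann zeta for real s > 0, s <> 1, via the Dirichlet eta function:
   zeta(s) = (1 - 2^(1-s))^(-1) * sum_{k>=1} (-1)^(k-1) k^(-s). *)
Definition zeta_real (s : R) : R :=
  / (1 - Rpower 2 (1 - s)) * series (fun k => (-1) ^ k * Rpower (INR (k + 1)) (- s)).

(* Main.v *)
Require Import Defs.
From Stdlib Require Import Reals Lra Lia Arith Factorial ClassicalEpsilon.
From Coquelicot Require Import Coquelicot.
Open Scope R_scope.

(** Write N = 2n, U = U_(N-1), x_m = 8 pi m and h(z) = 1 - z f(z), where f(z) is the Laplace
    transform of 1/(1+t^2). Integrating the expansion of f at the origin against
    sin(N t) sin t and comparing with the power series of Y_N gives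
      (-1)^n pi Y_N(x_m) = R_m - 1/(pi n) int_0^pi U(cos t) (1 + cos t) h(2 pi m v) dt,  v = 8 sin^2(t/2).
    Let A(y) = B*_N(y/2) + B*_N((y+1)/2). Since A(y+1) - A(y) = U(1 + y/4)/2, repeated
    integration by parts identifies R_m with the m-th cosine coefficient of A on [0,1], and
    the Fourier series of A at the end point sums the R_m.
    In the same way 1/(2 sqrt(2m)) is a multiple of int_0^oo h(2 pi m u^2) du, and
    sum_m h(2 pi m v) = (sum_k v/(k+v)^2 + 1/(2v) - 1)/2. Summing the remaining integrals over m
    and then evaluating them for each k, the regularised sum of k^(-1/2) produces zeta(1/2) and
    a Poisson kernel integral produces (t-s)^N/s with t = 1 + k/4, s = sqrt(t^2-1), which is the
    summand of the last series. *)


(** The obstacle is the sum over [m]: both [1/(2 sqrt(2m))] and the integral of [h(2 pi m v)] are of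
    order [m^(-1/2)], so neither can be summed alone. The substitution [u = sqrt 8 sin(t/2)] turns
    the half-line integral, up to [u = sqrt 8], into one over the angle with weight proportional to
    [cos(t/2)], and [cos(t/2) - U (1 + cos t)/(4n)] vanishes at [t = 0] like [v]. This factor
    compensates the [1/(4v)] in the sum of the [h(2 pi m v)]. The rest of the half line is cut at a
    large [X]; what lies beyond contributes [O(1/X)], uniformly in the number of terms. The
    arguments [8 pi m] enter through [cos x = 1] and [sin x = 0]: the expansion at the origin is one
    of [cos x f - sin x f'], taken at [x (1 - c)], and then it is one of [f] itself. Complex
    analysis is avoided. The expansion is proved by showing that two pairs of functions solve the
    same linear system and agree in the limit at 0; moments come from recursions; and every sum of
    cosine coefficients rests on one [L^1] bound, with explicit rate, for the remainder of the
    sawtooth series. *)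

(** * Elementary calculus: continuity, derivatives and integrals of real functions *)

Lemma cont_plus (f g : R -> R) x :
  continuous f x -> continuous g x -> continuous (fun y => f y + g y) x.
Proof. intros; now apply @continuous_plus. Qed.
Lemma cont_minus (f g : R -> R) x :
  continuous f x -> continuous g x -> continuous (fun y => f y - g y) x.
Proof. intros; now apply @continuous_minus. Qed.
Lemma cont_mult (f g : R -> R) x :
  continuous f x -> continuous g x -> continuous (fun y => f y * g y) x.
Proof. intros; now apply @continuous_mult. Qed.
Lemma cont_opp (f : R -> R) x :
  continuous f x -> continuous (fun y => - f y) x.
Proof. intros; now apply @continuous_opp. Qed.
Lemma cont_pow (f : R -> R) n x :
  continuous f x -> continuous (fun y => f y ^ n) x.
Proof.
  intros H; induction n as [|n IH]; simpl.
  - apply continuous_const.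
  - now apply cont_mult.
Qed.
Lemma cont_cos (f : R -> R) x :
  continuous f x -> continuous (fun y => cos (f y)) x.
Proof. intros H; apply (continuous_comp f cos); [exact H | apply continuous_cos]. Qed.
Lemma cont_sin (f : R -> R) x :
  continuous f x -> continuous (fun y => sin (f y)) x.
Proof. intros H; apply (continuous_comp f sin); [exact H | apply continuous_sin]. Qed.
Lemma cont_exp (f : R -> R) x :
  continuous f x -> continuous (fun y => exp (f y)) x.
Proof. intros H; apply (continuous_comp f exp); [exact H | apply continuous_exp]. Qed.
Lemma cont_sqrt (f : R -> R) x :
  continuous f x -> continuous (fun y => sqrt (f y)) x.
Proof. intros H; apply (continuous_comp f sqrt); [exact H | apply continuous_sqrt]. Qed.
Lemma cont_Rabs (f : R -> R) x :
  continuous f x -> continuous (fun y => Rabs (f y)) x.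
Proof. intros H; apply (continuous_comp f Rabs); [exact H | apply continuous_Rabs]. Qed.
Lemma cont_inv (f : R -> R) x :
  f x <> 0 -> continuous f x -> continuous (fun y => / f y) x.
Proof. intros; now apply continuous_Rinv_comp. Qed.
Lemma cont_div (f g : R -> R) x :
  g x <> 0 -> continuous f x -> continuous g x -> continuous (fun y => f y / g y) x.
Proof. intros; apply cont_mult; [assumption | now apply cont_inv]. Qed.
Lemma cont_ln (f : R -> R) x :
  0 < f x -> continuous f x -> continuous (fun y => ln (f y)) x.
Proof.
  intros H H1; apply (continuous_comp f ln); [exact H1 | ].
  apply (ex_derive_continuous (V := R_NormedModule)). exists (/ f x). now apply is_derive_ln.
Qed.
Lemma cont_atan (f : R -> R) x :
  continuous f x -> continuous (fun y => atan (f y)) x.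
Proof.
  intros H; apply (continuous_comp f atan); [exact H | ].
  apply (ex_derive_continuous (V := R_NormedModule)). eexists; apply is_derive_atan.
Qed.

(** Equations obtained from normed-module lemmas are typed in a carrier only convertible to [R];
    restated at [R], they are within reach of [ring] and [field]. *)
Ltac req := match goal with |- @eq _ ?a ?b => change (@eq R a b) end.
Ltac rfield := req; field.
Ltac rring := req; ring.

Lemma cont_const (c x : R) : continuous (fun _ : R => c) x.
Proof. apply continuous_const. Qed.
Lemma cont_id (x : R) : continuous (fun y : R => y) x.
Proof. apply continuous_id. Qed.

Ltac cont_step :=
  first [ assumption
        | match goal with H : forall _, continuous ?f _ |- continuous ?f _ => apply H end
        | match goal with H : forall _, _ -> continuous ?f _ |- continuous ?f _ => apply H end
        | simple apply cont_const | simple apply cont_id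
        | simple apply cont_plus | simple apply cont_minus | simple apply cont_mult | simple apply cont_opp
        | simple apply cont_pow | simple apply cont_cos | simple apply cont_sin | simple apply cont_exp
        | simple apply cont_sqrt | simple apply cont_Rabs | simple apply cont_atan
        | simple apply cont_div | simple apply cont_inv | simple apply cont_ln ].
Ltac cont := repeat cont_step.

Lemma der_mult (f g : R -> R) x df dg : is_derive f x df -> is_derive g x dg ->
  is_derive (fun y => f y * g y) x (df * g x + f x * dg).
Proof. intros; apply @is_derive_mult; [assumption.. | intros; apply Rmult_comm]. Qed.
Lemma der_eq (f : R -> R) x d d' : is_derive f x d -> d = d' -> is_derive f x d'.
Proof. now intros H <-. Qed.
Lemma der_id (x : R) : is_derive (fun y : R => y) x 1.
Proof. apply @is_derive_id. Qed.
Lemma der_const (k x : R) : is_derive (fun _ : R => k) x 0.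
Proof. apply @is_derive_const. Qed.
Lemma der_pow n x : is_derive (fun y => y ^ n) x (INR n * x ^ pred n).
Proof.
  replace (INR n * x ^ pred n) with (INR n * 1 * x ^ pred n) by ring.
  apply (is_derive_pow (fun y => y)), der_id.
Qed.
Lemma der_plus (f g : R -> R) x df dg : is_derive f x df -> is_derive g x dg ->
  is_derive (fun y => f y + g y) x (df + dg).
Proof. intros; now apply @is_derive_plus. Qed.
Lemma der_minus (f g : R -> R) x df dg : is_derive f x df -> is_derive g x dg ->
  is_derive (fun y => f y - g y) x (df - dg).
Proof. intros; now apply @is_derive_minus. Qed.
Lemma der_scal (f : R -> R) k x df : is_derive f x df ->
  is_derive (fun y => k * f y) x (k * df).
Proof. intros; now apply @is_derive_scal. Qed.
Lemma der_cont (f : R -> R) x df : is_derive f x df -> continuous f x.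
Proof. intros; apply (ex_derive_continuous (V := R_NormedModule)). now exists df. Qed.

Lemma ex_RInt_cont (f : R -> R) a b :
  a <= b -> (forall x, a <= x <= b -> continuous f x) -> ex_RInt f a b.
Proof.
  intros ab H; apply (ex_RInt_continuous (V := R_CompleteNormedModule)).
  intros x Hx; apply H. rewrite Rmin_left, Rmax_right in Hx; lra.
Qed.

Lemma RInt_FTC (F f : R -> R) a b :
  a <= b -> (forall x, a <= x <= b -> is_derive F x (f x)) ->
  (forall x, a <= x <= b -> continuous f x) -> RInt f a b = F b - F a.
Proof.
  intros ab HF Hf. apply is_RInt_unique.
  apply (is_RInt_derive (V := R_CompleteNormedModule)); intros x Hx;
  rewrite Rmin_left, Rmax_right in Hx by lra; auto.
Qed.

Lemma mono_le (F f : R -> R) a b :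
  a <= b -> (forall x, a <= x <= b -> is_derive F x (f x)) ->
  (forall x, a <= x <= b -> 0 <= f x) -> F a <= F b.
Proof.
  intros ab HF Hf.
  destruct (MVT_gen F a b f) as [c [Hc He]].
  - intros x Hx; rewrite Rmin_left, Rmax_right in Hx by lra. apply HF; lra.
  - intros x Hx; rewrite Rmin_left, Rmax_right in Hx by lra.
    apply continuity_pt_filterlim, (ex_derive_continuous (V := R_NormedModule)).
    eexists; apply HF; lra.
  - rewrite Rmin_left, Rmax_right in Hc by lra.
    specialize (Hf c Hc). nra.
Qed.

Lemma RInt_plus' (f g : R -> R) a b : ex_RInt f a b -> ex_RInt g a b ->
  RInt (fun x => f x + g x) a b = RInt f a b + RInt g a b.
Proof. intros; now apply (RInt_plus (V := R_CompleteNormedModule)). Qed.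
Lemma RInt_minus' (f g : R -> R) a b : ex_RInt f a b -> ex_RInt g a b ->
  RInt (fun x => f x - g x) a b = RInt f a b - RInt g a b.
Proof. intros; now apply (RInt_minus (V := R_CompleteNormedModule)). Qed.
Lemma RInt_scal' (f : R -> R) k a b : ex_RInt f a b ->
  RInt (fun x => k * f x) a b = k * RInt f a b.
Proof. intros; now apply (RInt_scal (V := R_CompleteNormedModule)). Qed.
Lemma RInt_const' k a b : RInt (fun _ => k) a b = (b - a) * k.
Proof. exact (RInt_const (V := R_CompleteNormedModule) a b k). Qed.
Lemma ex_RInt_plus' (f g : R -> R) a b : ex_RInt f a b -> ex_RInt g a b ->
  ex_RInt (fun x => f x + g x) a b.
Proof. intros; now apply (ex_RInt_plus (V := R_NormedModule)). Qed.
Lemma ex_RInt_minus' (f g : R -> R) a b : ex_RInt f a b -> ex_RInt g a b ->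
  ex_RInt (fun x => f x - g x) a b.
Proof. intros; now apply (ex_RInt_minus (V := R_NormedModule)). Qed.
Lemma ex_RInt_scal' (f : R -> R) k a b : ex_RInt f a b ->
  ex_RInt (fun x => k * f x) a b.
Proof. intros; now apply (ex_RInt_scal (V := R_NormedModule)). Qed.

Lemma RInt_Chasles' (f : R -> R) a b c : ex_RInt f a b -> ex_RInt f b c ->
  RInt f a c = RInt f a b + RInt f b c.
Proof. intros H1 H2. symmetry. exact (RInt_Chasles (V := R_CompleteNormedModule) f a b c H1 H2). Qed.

Lemma RInt_lin (f g : R -> R) k l a b : ex_RInt f a b -> ex_RInt g a b ->
  RInt (fun x => k * f x + l * g x) a b = k * RInt f a b + l * RInt g a b.
Proof.
  intros. rewrite (RInt_plus' (fun x => k * f x) (fun x => l * g x)); try now apply ex_RInt_scal'.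
  now rewrite !RInt_scal'.
Qed.

Lemma RInt_Rabs_le (f g : R -> R) a b :
  a <= b -> ex_RInt f a b -> ex_RInt g a b ->
  (forall x, a < x < b -> Rabs (f x) <= g x) -> Rabs (RInt f a b) <= RInt g a b.
Proof.
  intros ab Hf Hg H. apply Rabs_le. split.
  - replace (- RInt g a b) with (RInt (fun x => -1 * g x) a b)
      by (rewrite RInt_scal' by assumption; rring).
    apply RInt_le; try assumption. now apply ex_RInt_scal'.
    intros x Hx. specialize (H x Hx). apply Rabs_le_between in H. lra.
  - apply RInt_le; try assumption.
    intros x Hx. specialize (H x Hx). apply Rabs_le_between in H. lra.
Qed.

(** * Fourier series at an end point *)

(** With [u = x/2]: [sin x = 2 sin u cos u >= 2 u (cos u)^2 = u (1 + cos x) >= u], the first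
    inequality being [u cos u <= sin u]. *)
Lemma sin_ge_half x : 0 <= x <= PI / 2 -> x / 2 <= sin x.
Proof.
  intros Hx. pose proof PI_RGT_0.
  assert (H1 : (x / 2) * cos (x / 2) <= sin (x / 2)).
  { assert (sin 0 - 0 * cos 0 <= sin (x / 2) - x / 2 * cos (x / 2)).
    { apply (mono_le (fun z => sin z - z * cos z) (fun z => z * sin z)); [lra | |].
      - intros z Hz. auto_derive; [trivial | rring].
      - intros z Hz. apply Rmult_le_pos; [lra | apply sin_ge_0; lra]. }
    rewrite sin_0 in H0. lra. }
  replace x with (2 * (x / 2)) at 2 by rfield.
  rewrite sin_2a.
  assert (H2 : 0 <= cos x) by (apply cos_ge_0; lra).
  replace x with (2 * (x / 2)) in H2 by rfield. rewrite cos_2a_cos in H2.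
  assert (0 <= cos (x / 2)) by (apply cos_ge_0; lra).
  nra.
Qed.

Lemma sum_nS (a : nat -> R) n : sum_f_R0 a (S n) = sum_f_R0 a n + a (S n).
Proof. reflexivity. Qed.
Lemma sum_0 (a : nat -> R) : sum_f_R0 a 0 = a 0%nat.
Proof. reflexivity. Qed.
Lemma sum_mult (a : nat -> R) k n : sum_f_R0 (fun i => k * a i) n = k * sum_f_R0 a n.
Proof. rewrite scal_sum. apply sum_eq; intros; rring. Qed.

Definition Fsum (M : nat) (y : R) : R :=
  sum_f_R0 (fun k => sin (2 * PI * INR (S k) * y) / INR (S k)) M.

Lemma dirichlet_kernel M y :
  (1 + 2 * sum_f_R0 (fun k => cos (2 * PI * INR (S k) * y)) M) * sin (PI * y)
  = sin ((2 * INR M + 3) * PI * y).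
Proof.
  induction M as [|M IH].
  - rewrite sum_0. simpl INR.
    replace (2 * PI * 1 * y) with (2 * (PI * y)) by rring.
    replace ((2 * 0 + 3) * PI * y) with (2 * (PI * y) + PI * y) by rring.
    rewrite sin_plus, cos_2a_sin, sin_2a.
    pose proof (sin2_cos2 (PI * y)) as H. unfold Rsqr in H.
    set (s := sin (PI * y)) in *. set (c := cos (PI * y)) in *.
    replace (2 * s * c * c) with (2 * s * (c * c)) by rring.
    replace (c * c) with (1 - s * s) by lra. rring.
  - rewrite sum_nS.
    rewrite Rmult_plus_distr_l, <- Rplus_assoc, Rmult_plus_distr_r.
    rewrite IH.
    rewrite !S_INR.
    replace ((2 * (INR M + 1) + 3) * PI * y)
      with (2 * PI * (INR M + 1 + 1) * y + PI * y) by rring.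
    replace ((2 * INR M + 3) * PI * y)
      with (2 * PI * (INR M + 1 + 1) * y - PI * y) by rring.
    rewrite sin_plus, sin_minus. rring.
Qed.

Lemma is_derive_Fsum M y :
  is_derive (Fsum M) y (2 * PI * sum_f_R0 (fun k => cos (2 * PI * INR (S k) * y)) M).
Proof.
  assert (Hd : forall r, r <> 0 ->
    is_derive (fun y => sin (2 * PI * r * y) / r) y (2 * PI * cos (2 * PI * r * y))).
  { intros r Hr. auto_derive; [trivial | now rfield]. }
  unfold Fsum. induction M as [|M IH].
  - apply (is_derive_ext (fun y => sin (2 * PI * INR 1 * y) / INR 1)).
    { intros t. now rewrite sum_0. }
    rewrite sum_0. apply Hd, not_0_INR; lia.
  - apply (is_derive_ext (fun y => sum_f_R0 (fun k => sin (2 * PI * INR (S k) * y) / INR (S k)) M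
       + sin (2 * PI * INR (S (S M)) * y) / INR (S (S M)))).
    { intros t. now rewrite sum_nS. }
    rewrite sum_nS.
    rewrite Rmult_plus_distr_l.
    apply @is_derive_plus; [exact IH|].
    apply Hd, not_0_INR; lia.
Qed.

(* Partial sum of the Fourier series of the sawtooth [PI * (1/2 - y)], minus its limit. *)
Definition Frem M y := Fsum M y + PI * (y - / 2).

Lemma is_derive_Frem M y :
  is_derive (Frem M) y (PI * (1 + 2 * sum_f_R0 (fun k => cos (2 * PI * INR (S k) * y)) M)).
Proof.
  unfold Frem. replace (PI * _) with (2 * PI * sum_f_R0 (fun k => cos (2 * PI * INR (S k) * y)) M + PI) by rring.
  apply @is_derive_plus; [apply is_derive_Fsum|]. auto_derive; [trivial | rring].
Qed.

Lemma Fsum_sym M y : Fsum M (1 - y) = - Fsum M y.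
Proof.
  assert (H : forall k, sin (2 * PI * INR (S k) * (1 - y)) = - sin (2 * PI * INR (S k) * y)).
  { intros k. replace (2 * PI * INR (S k) * (1 - y)) with (- (2 * PI * INR (S k) * y) + 2 * INR (S k) * PI) by rring.
    rewrite sin_period. apply sin_neg. }
  unfold Fsum. induction M as [|M IH].
  - rewrite !sum_0, H. rfield. apply not_0_INR; lia.
  - rewrite !sum_nS. rewrite IH, H. rfield. apply not_0_INR; lia.
Qed.

Lemma Frem_sym M y : Frem M (1 - y) = - Frem M y.
Proof. unfold Frem. rewrite Fsum_sym. rfield. Qed.

Lemma Frem_half M : Frem M (/ 2) = 0.
Proof. pose proof (Frem_sym M (/ 2)) as H. replace (1 - / 2) with (/ 2) in H by rfield. lra. Qed.

Lemma sin_nat_PI k : sin (INR k * PI) = 0.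
Proof.
  induction k as [|k IH]; [simpl; rewrite Rmult_0_l; apply sin_0|].
  rewrite S_INR, Rmult_plus_distr_r, Rmult_1_l, neg_sin, IH. rring.
Qed.

(** [Frem M] has derivative [PI sin(L PI t) / sin(PI t)] with [L = 2M + 3]. Adding
    [(cos(L PI t) - e) / (L sin(PI t))] removes the oscillating numerator: the derivative becomes
    nonnegative for [e = 1] and nonpositive for [e = -1]. Monotonicity up to [t = 1/2], where
    [Frem M] vanishes, gives bounds from both sides. *)
Lemma Frem_bound1 M y : 0 < y <= / 2 ->
  Rabs (Frem M y) <= 4 / ((2 * INR M + 3) * y).
Proof.
  intros Hy. pose proof PI_RGT_0 as Hpi. pose proof PI2_3_2 as Hpi3.
  pose proof (pos_INR M) as HM.
  set (L := 2 * INR M + 3). assert (HL : 0 < L) by (unfold L; lra).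
  assert (Hsin : forall t, y <= t <= / 2 -> 0 < sin (PI * t)).
  { intros t Ht. apply sin_gt_0; nra. }
  assert (Hc2 : cos (L * PI * / 2) = 0).
  { unfold L. replace ((2 * INR M + 3) * PI * / 2) with (INR (S M) * PI + PI / 2)
      by (rewrite S_INR; rfield).
    rewrite cos_plus, cos_PI2, sin_nat_PI. rring. }
  set (D := fun t => PI * (1 + 2 * sum_f_R0 (fun k => cos (2 * PI * INR (S k) * t)) M)).
  assert (HD : forall t, D t * sin (PI * t) = PI * sin (L * PI * t)).
  { intros t. unfold D, L. rewrite Rmult_assoc, dirichlet_kernel. reflexivity. }
  assert (Hder : forall e t, y <= t <= / 2 ->
     is_derive (fun t => Frem M t + (/ L) * (cos (L * PI * t) - e) / sin (PI * t)) t
       ((/ L) * (PI * cos (PI * t)) * (e - cos (L * PI * t)) / (sin (PI * t)) ^ 2)).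
  { intros e t Ht. specialize (Hsin t Ht). specialize (HD t).
    replace (/ L * (PI * cos (PI * t)) * (e - cos (L * PI * t)) / sin (PI * t) ^ 2)
     with (D t + (/ L * (PI * cos (PI * t)) * (e - cos (L * PI * t)) / sin (PI * t) ^ 2 - PI * sin (L * PI * t) / sin (PI * t))).
    2:{ rewrite <- HD. rfield. lra. }
    apply @is_derive_plus; [apply is_derive_Frem|].
    auto_derive; [lra|]. rfield. lra. }
  assert (Hend : forall e, Frem M (/ 2) + (/ L) * (cos (L * PI * / 2) - e) / sin (PI * / 2) = - (e / L)).
  { intros e. rewrite Frem_half, Hc2. replace (PI * / 2) with (PI / 2) by rfield. rewrite sin_PI2. rfield. lra. }
  assert (Hcp : forall t, y <= t <= / 2 -> 0 <= PI * cos (PI * t)).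
  { intros t Ht. apply Rmult_le_pos; [lra|]. apply cos_ge_0; nra. }
  assert (HiL : 0 < / L) by now apply Rinv_0_lt_compat.
  assert (H1 : Frem M y + (/ L) * (cos (L * PI * y) - 1) / sin (PI * y) <= - (1 / L)).
  { rewrite <- (Hend 1).
    apply (mono_le (fun t => Frem M t + (/ L) * (cos (L * PI * t) - 1) / sin (PI * t)) _ y (/ 2)
      (proj2 Hy) (Hder 1)).
    intros t Ht. specialize (Hsin t Ht). specialize (Hcp t Ht).
    pose proof (COS_bound (L * PI * t)).
    apply Rmult_le_pos; [| left; apply Rinv_0_lt_compat, pow_lt; lra].
    apply Rmult_le_pos; [apply Rmult_le_pos |]; lra. }
  assert (H2 : - (Frem M y + (/ L) * (cos (L * PI * y) - -1) / sin (PI * y)) <= - (- (-1 / L))).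
  { rewrite <- (Hend (-1)).
    apply (mono_le (fun t => - (Frem M t + (/ L) * (cos (L * PI * t) - -1) / sin (PI * t))) 
       (fun t => - ((/ L) * (PI * cos (PI * t)) * (-1 - cos (L * PI * t)) / (sin (PI * t)) ^ 2)) y (/ 2)
      (proj2 Hy)).
    { intros t Ht. apply @is_derive_opp, Hder, Ht. }
    intros t Ht. specialize (Hsin t Ht). specialize (Hcp t Ht).
    pose proof (COS_bound (L * PI * t)).
    replace (- (/ L * (PI * cos (PI * t)) * (-1 - cos (L * PI * t)) / sin (PI * t) ^ 2))
     with ((/ L * (PI * cos (PI * t)) * (1 + cos (L * PI * t)) / sin (PI * t) ^ 2)) by (rfield; lra).
    apply Rmult_le_pos; [| left; apply Rinv_0_lt_compat, pow_lt; lra].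
    apply Rmult_le_pos; [apply Rmult_le_pos |]; lra. }
  assert (Hs : y <= sin (PI * y)).
  { pose proof (sin_ge_half (PI * y)). nra. }
  specialize (Hsin y ltac:(lra)).
  set (s := sin (PI * y)) in *. set (q := cos (L * PI * y)) in *.
  pose proof (COS_bound (L * PI * y)) as Hq. fold q in Hq.
  assert (Hb : 4 / (L * s) <= 4 / (L * y)).
  { apply Rmult_le_compat_l; [lra|]. apply Rinv_le_contravar; nra. }
  apply Rle_trans with (2 := Hb). 
  assert (Hb2 : forall z, -1 <= z <= 1 -> Rabs (/ L * (z - 1) / s) <= 2 / (L * s) /\ Rabs (/ L * (z - -1) / s) <= 2 / (L * s)).
  { intros z Hz. assert (0 < / (L * s)) by (apply Rinv_0_lt_compat; nra).
    replace (/ L * (z - 1) / s) with ((z - 1) * / (L * s)) by (rfield; lra).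
    replace (/ L * (z - -1) / s) with ((z + 1) * / (L * s)) by (rfield; lra).
    rewrite !Rabs_mult, (Rabs_pos_eq (/ (L * s))) by lra.
    split; apply Rmult_le_compat_r; try lra; apply Rabs_le; lra. }
  destruct (Hb2 q Hq) as [B1 B2].
  apply Rabs_le_between in B1. apply Rabs_le_between in B2.
  assert (Hb3 : 4 / (L * s) = 2 / (L * s) + 2 / (L * s)) by (rfield; lra).
  assert (Hb4 : 0 < 2 / (L * s)) by (apply Rdiv_lt_0_compat; nra).
  assert (Hb5 : 0 < 1 / L) by (apply Rdiv_lt_0_compat; lra).
  replace (- (- (-1 / L))) with (- (1 / L)) in H2 by (rfield; lra).
  apply Rabs_le. lra.
Qed.
(** Away from the end points this is [Frem_bound1]; where [L y < 2/3] it follows from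
    [Frem M 0 = - PI/2] and the mean value theorem. The bound [10/(1 + L y)] is weakened to an
    inverse square root, whose integral is elementary and still of order [L^(-1/2)]. *)
Lemma Frem_bound2 M y : 0 <= y <= 1 ->
  Rabs (Frem M y) <= 10 / sqrt (1 + (2 * INR M + 3) * y) + 10 / sqrt (1 + (2 * INR M + 3) * (1 - y)).
Proof.
  pose proof (pos_INR M) as HM. pose proof PI_RGT_0 as Hpi. pose proof PI_4 as Hpi4.
  set (L := 2 * INR M + 3). assert (HL : 3 <= L) by (unfold L; lra).
  assert (Hsq : forall s, 1 <= s -> 0 < sqrt s <= s).
  { intros s Hs. split; [apply sqrt_lt_R0; lra|].
    rewrite <- (sqrt_square s) at 2 by lra. apply sqrt_le_1_alt. nra. }
  assert (Hhalf : forall y, 0 <= y <= / 2 -> Rabs (Frem M y) <= 10 / sqrt (1 + L * y)).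
  { intros z Hz.
    assert (Hz2 : 10 / (1 + L * z) <= 10 / sqrt (1 + L * z)).
    { apply Rmult_le_compat_l; [lra|]. apply Rinv_le_contravar; apply Hsq; nra. }
    apply Rle_trans with (2 := Hz2).
    destruct (Rle_lt_dec (2 / 3) (L * z)) as [Hc|Hc].
    - assert (Hz0 : 0 < z) by nra.
      apply Rle_trans with (1 := Frem_bound1 M z (conj Hz0 (proj2 Hz))). fold L.
      apply Rmult_le_reg_r with ((L * z) * (1 + L * z)); [nra|].
      field_simplify; nra.
    - assert (Hd : Rabs (Frem M z - Frem M 0) <= PI * L * z).
      { destruct (MVT_gen (Frem M) 0 z (fun y => PI * (1 + 2 * sum_f_R0 (fun k => cos (2 * PI * INR (S k) * y)) M)))
          as [c [_ Hc2]].
        - intros; apply is_derive_Frem.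
        - intros; apply continuity_pt_filterlim, (ex_derive_continuous (V := R_NormedModule)).
          eexists; apply is_derive_Frem.
        - rewrite Hc2, Rabs_mult, Rminus_0_r, (Rabs_pos_eq z) by lra.
          apply Rmult_le_compat_r; [lra|].
          rewrite Rabs_mult, (Rabs_pos_eq PI) by lra. apply Rmult_le_compat_l; [lra|].
          assert (Hs : Rabs (sum_f_R0 (fun k => cos (2 * PI * INR (S k) * c)) M) <= INR M + 1).
          { clear -M. induction M as [|M IH].
            - rewrite sum_0. simpl INR. rewrite Rplus_0_l. apply Rabs_le, COS_bound.
            - rewrite sum_nS, (S_INR M). apply Rle_trans with (1 := Rabs_triang _ _).
              apply Rplus_le_compat; [exact IH|]. apply Rabs_le, COS_bound. }
          apply Rabs_le_between in Hs. apply Rabs_le. unfold L. lra. }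
      assert (H0 : Frem M 0 = - (PI / 2)).
      { unfold Frem. replace (Fsum M 0) with 0; [rfield|].
        pose proof (Fsum_sym M 0). clear -M. unfold Fsum. symmetry.
        induction M as [|M IH]; [rewrite sum_0 | rewrite sum_nS, IH];
          rewrite Rmult_0_r, sin_0; unfold Rdiv; rring. }
      rewrite H0 in Hd. apply Rabs_le_between in Hd.
      apply Rle_trans with 6.
      + apply Rabs_le. nra.
      + apply Rmult_le_reg_r with (1 + L * z); [nra|]. field_simplify; nra. }
  assert (Hp : forall s, 1 <= s -> 0 < 10 / sqrt s).
  { intros s Hs. apply Rdiv_lt_0_compat; [lra | apply Hsq; lra]. }
  intros Hy. destruct (Rle_lt_dec y (/ 2)) as [Hc|Hc].
  - pose proof (Hhalf y ltac:(lra)). pose proof (Hp (1 + L * (1 - y)) ltac:(nra)). lra.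
  - pose proof (Hhalf (1 - y) ltac:(lra)) as H1. rewrite Frem_sym, Rabs_Ropp in H1.
    pose proof (Hp (1 + L * y) ltac:(nra)). lra.
Qed.

(** An upper bound for the integral over [[0,1]] of the majorant in [Frem_bound2], of order
    [M^(-1/2)]; the error scale of the later Fourier estimates. *)
Definition Feps (M : nat) : R := 40 * sqrt (4 + 2 * INR M) / (2 * INR M + 3).

Lemma Frem_cont M y : continuous (Frem M) y.
Proof.
  apply (ex_derive_continuous (V := R_NormedModule)). eexists; apply is_derive_Frem.
Qed.

Lemma Frem_L1 M : RInt (fun y => Rabs (Frem M y)) 0 1 <= Feps M.
Proof.
  pose proof (pos_INR M) as HM.
  set (L := 2 * INR M + 3). assert (HL : 3 <= L) by (unfold L; lra).
  assert (Hc : forall y, continuous (Frem M) y) by apply Frem_cont.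
  assert (Hsq : forall s, 1 <= s -> 0 < sqrt s) by (intros s Hs; apply sqrt_lt_R0; lra).
  assert (Hi : RInt (fun y => 10 / sqrt (1 + L * y) + 10 / sqrt (1 + L * (1 - y))) 0 1
     = (20 / L * sqrt (1 + L * 1) - 20 / L * sqrt (1 + L * (1 - 1)))
     - (20 / L * sqrt (1 + L * 0) - 20 / L * sqrt (1 + L * (1 - 0)))).
  { apply (RInt_FTC (fun y => 20 / L * sqrt (1 + L * y) - 20 / L * sqrt (1 + L * (1 - y)))); [lra| |].
    - intros x Hx. assert (H1 := Hsq (1 + L * x) ltac:(nra)).
      assert (H2 := Hsq (1 + L * (1 - x)) ltac:(nra)).
      unfold Rminus in *. auto_derive; [repeat split; nra|]. rfield. lra.
    - intros x Hx. assert (H1 := Hsq (1 + L * x) ltac:(nra)).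
      assert (H2 := Hsq (1 + L * (1 - x)) ltac:(nra)). cont; lra. }
  apply Rle_trans with (RInt (fun y => 10 / sqrt (1 + L * y) + 10 / sqrt (1 + L * (1 - y))) 0 1).
  - apply RInt_le; [lra | | |].
    + apply ex_RInt_cont; [lra|]. intros; cont.
    + apply ex_RInt_cont; [lra|]. intros x Hx. assert (H1 := Hsq (1 + L * x) ltac:(nra)).
      assert (H2 := Hsq (1 + L * (1 - x)) ltac:(nra)). cont; lra.
    + intros x Hx. apply Frem_bound2; lra.
  - rewrite Hi, Rminus_eq_0, !Rminus_0_r, Rmult_0_r, Rplus_0_r, sqrt_1, Rmult_1_r.
    unfold Feps. fold L. replace (4 + 2 * INR M) with (1 + L) by (unfold L; rring).
    assert (0 < 20 / L) by (apply Rdiv_lt_0_compat; lra).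
    replace (40 * sqrt (1 + L) / L) with (20 / L * sqrt (1 + L) + 20 / L * sqrt (1 + L)) by (rfield; lra).
    lra.
Qed.

Lemma Feps_lim : is_lim_seq Feps 0.
Proof.
  apply is_lim_seq_le_le_loc with (fun _ => 0) (fun M => 80 / sqrt (INR M)).
  - exists 1%nat. intros M HM. apply le_INR in HM. simpl in HM.
    assert (0 < sqrt (INR M)) by (apply sqrt_lt_R0; lra).
    assert (Hq : sqrt (INR M) * sqrt (INR M) = INR M) by (apply sqrt_sqrt; lra).
    unfold Feps. split.
    + apply Rmult_le_pos; [|left; apply Rinv_0_lt_compat; lra].
      apply Rmult_le_pos; [lra | apply sqrt_pos].
    + apply Rle_trans with (40 * (4 * sqrt (INR M)) / (2 * INR M + 3)).
      * apply Rmult_le_compat_r; [left; apply Rinv_0_lt_compat; lra|].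
        apply Rmult_le_compat_l; [lra|].
        rewrite <- (sqrt_square (4 * sqrt (INR M))) by lra.
        apply sqrt_le_1_alt. nra.
      * apply Rmult_le_reg_r with ((2 * INR M + 3) * sqrt (INR M)); [nra|].
        field_simplify; nra.
  - apply is_lim_seq_const.
  - replace (Finite 0) with (Rbar_mult 80 (Rbar_inv p_infty)) by (simpl; f_equal; rring).
    apply is_lim_seq_scal_l, is_lim_seq_inv; [|discriminate].
    apply (filterlim_comp _ _ _ INR sqrt eventually (Rbar_locally p_infty)).
    + apply is_lim_seq_INR.
    + apply filterlim_sqrt_p.
Qed.

Lemma Feps_pos M : 0 <= Feps M.
Proof.
  pose proof (pos_INR M). unfold Feps. apply Rmult_le_pos; [|left; apply Rinv_0_lt_compat; lra].
  apply Rmult_le_pos; [lra | apply sqrt_pos].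
Qed.

Lemma RInt_sum (f : nat -> R -> R) a b M : (forall k, ex_RInt (f k) a b) ->
  ex_RInt (fun x => sum_f_R0 (fun k => f k x) M) a b /\
  RInt (fun x => sum_f_R0 (fun k => f k x) M) a b = sum_f_R0 (fun k => RInt (f k) a b) M.
Proof.
  intros H. induction M as [|M [IH1 IH2]].
  - split.
    + apply (ex_RInt_ext (f 0%nat)); [intros; now rewrite sum_0 | apply H].
    + rewrite sum_0. apply RInt_ext. intros; now rewrite sum_0.
  - assert (Hs : forall x, sum_f_R0 (fun k => f k x) (S M) = sum_f_R0 (fun k => f k x) M + f (S M) x)
      by (intros; apply sum_nS).
    split.
    + apply (ex_RInt_ext (fun x => sum_f_R0 (fun k => f k x) M + f (S M) x)); [intros; now rewrite Hs|].
      now apply ex_RInt_plus'.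
    + rewrite sum_nS, <- IH2, <- RInt_plus' by auto.
      apply RInt_ext. intros; now rewrite Hs.
Qed.

(** Integration by parts turns the cosine coefficients of [F] into sine coefficients of [F'], so the
    error is [- 1/PI] times the integral of [F' * Frem M]. The bound depends on [F] only through
    [B], hence is uniform along a sequence of functions with uniformly bounded derivatives. *)
Theorem fourier_end (F F' : R -> R) (B : R) (M : nat) :
  (forall y, 0 <= y <= 1 -> is_derive F y (F' y)) ->
  (forall y, 0 <= y <= 1 -> continuous F' y) ->
  (forall y, 0 <= y <= 1 -> Rabs (F' y) <= B) ->
  Rabs (sum_f_R0 (fun k => 2 * RInt (fun y => F y * cos (2 * PI * INR (S k) * y)) 0 1) M
        - ((F 0 + F 1) / 2 - RInt F 0 1)) <= B * Feps M.
Proof.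
  intros HF HF' HB. pose proof PI_RGT_0 as Hpi.
  assert (HFc : forall y, 0 <= y <= 1 -> continuous F y).
  { intros y Hy. apply (ex_derive_continuous (V := R_NormedModule)). eexists; now apply HF. }
  assert (Hterm : forall k, 2 * RInt (fun y => F y * cos (2 * PI * INR (S k) * y)) 0 1
     = - / PI * RInt (fun y => F' y * (sin (2 * PI * INR (S k) * y) / INR (S k))) 0 1).
  { intros k. assert (Hk : INR (S k) <> 0) by (apply not_0_INR; lia).
    set (r := INR (S k)) in *.
    assert (Hr : sin (2 * PI * r * 1) = 0).
    { replace (2 * PI * r * 1) with (INR (2 * S k) * PI) by (rewrite mult_INR; unfold r; simpl (INR 2); rring).
      apply sin_nat_PI. }
    assert (E : RInt (fun y => 2 * (F y * cos (2 * PI * r * y)) + / PI * (F' y * (sin (2 * PI * r * y) / r))) 0 1 = 0).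
    { rewrite (RInt_FTC (fun y => / PI * (F y * (sin (2 * PI * r * y) / r)))).
      - rewrite Hr, Rmult_0_r, sin_0. rfield. lra.
      - lra.
      - intros y Hy. 
        replace (2 * (F y * cos (2 * PI * r * y)) + / PI * (F' y * (sin (2 * PI * r * y) / r)))
         with (/ PI * (F' y * (sin (2 * PI * r * y) / r) + F y * (2 * PI * cos (2 * PI * r * y)))) by (rfield; lra).
        apply (der_scal (fun y => F y * (sin (2 * PI * r * y) / r)) (/ PI)).
        apply (der_mult F (fun y => sin (2 * PI * r * y) / r)); [now apply HF |].
        auto_derive; [trivial|]. rfield. lra.
      - intros; cont. }
    assert (E1 : ex_RInt (fun y => F y * cos (2 * PI * r * y)) 0 1) by (apply ex_RInt_cont; [lra|]; intros; cont).
    assert (E2 : ex_RInt (fun y => F' y * (sin (2 * PI * r * y) / r)) 0 1) by (apply ex_RInt_cont; [lra|]; intros; cont).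
    rewrite (RInt_lin (fun y => F y * cos (2 * PI * r * y)) (fun y => F' y * (sin (2 * PI * r * y) / r)) 2 (/ PI) 0 1 E1 E2) in E.
    lra. }
  assert (Hmean : (F 0 + F 1) / 2 - RInt F 0 1 = RInt (fun y => F' y * (y - / 2)) 0 1).
  { assert (E : RInt (fun y => F y + F' y * (y - / 2)) 0 1 = (F 0 + F 1) / 2).
    { rewrite (RInt_FTC (fun y => F y * (y - / 2))).
      - rfield.
      - lra.
      - intros y Hy. replace (F y + F' y * (y - / 2)) with (F' y * (y - / 2) + F y * 1) by rring.
        apply (der_mult F (fun y => y - / 2)); [now apply HF |].
        auto_derive; [trivial | rring].
      - intros; cont. }
    rewrite (RInt_plus' F (fun y => F' y * (y - / 2))) in E by (apply ex_RInt_cont; [lra|]; intros; cont). lra. }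
  rewrite (sum_eq _ _ M (fun k _ => Hterm k)), Hmean.
  assert (Hex : forall k, ex_RInt (fun y => F' y * (sin (2 * PI * INR (S k) * y) / INR (S k))) 0 1).
  { intros k. apply ex_RInt_cont; [lra|]; intros; cont. apply not_0_INR; lia. }
  assert (Hsum : sum_f_R0 (fun k => - / PI * RInt (fun y => F' y * (sin (2 * PI * INR (S k) * y) / INR (S k))) 0 1) M
     = - / PI * RInt (fun y => F' y * Fsum M y) 0 1).
  { replace (RInt (fun y => F' y * Fsum M y) 0 1)
     with (sum_f_R0 (fun k => RInt (fun y => F' y * (sin (2 * PI * INR (S k) * y) / INR (S k))) 0 1) M).
    - apply (sum_mult (fun k => RInt (fun y => F' y * (sin (2 * PI * INR (S k) * y) / INR (S k))) 0 1)).
    - rewrite <- (proj2 (RInt_sum _ 0 1 M Hex)). apply RInt_ext. intros y _.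
      apply (sum_mult (fun k => sin (2 * PI * INR (S k) * y) / INR (S k))). }
  rewrite Hsum.
  assert (HcS : forall y, continuous (Fsum M) y).
  { intros y. apply (ex_derive_continuous (V := R_NormedModule)). eexists; apply is_derive_Fsum. }
  assert (HcR : forall y, continuous (Frem M) y) by apply Frem_cont.
  replace (- / PI * RInt (fun y => F' y * Fsum M y) 0 1 - RInt (fun y => F' y * (y - / 2)) 0 1)
   with (- / PI * RInt (fun y => F' y * Frem M y) 0 1).
  2:{ rewrite (RInt_ext _ (fun y => 1 * (F' y * Fsum M y) + PI * (F' y * (y - / 2)))).
      - rewrite (RInt_lin (fun y => F' y * Fsum M y) (fun y => F' y * (y - / 2)) 1 PI);
          try (apply ex_RInt_cont; [lra|]; intros; cont).
        rfield. lra.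
      - intros; unfold Frem; rring. }
  rewrite Rabs_mult, Rabs_Ropp, Rabs_pos_eq by (left; now apply Rinv_0_lt_compat).
  assert (Hle : Rabs (RInt (fun y => F' y * Frem M y) 0 1) <= B * Feps M).
  { apply Rle_trans with (RInt (fun y => B * Rabs (Frem M y)) 0 1).
    - apply RInt_Rabs_le; [lra | | |].
      + apply ex_RInt_cont; [lra|]; intros; cont.
      + apply ex_RInt_cont; [lra|]; intros; cont.
      + intros y Hy. rewrite Rabs_mult. apply Rmult_le_compat_r; [apply Rabs_pos | apply HB; lra].
    - rewrite RInt_scal' by (apply ex_RInt_cont; [lra|]; intros; cont).
      apply Rmult_le_compat_l; [|apply Frem_L1].
      apply Rle_trans with (1 := Rabs_pos (F' 0)), HB. lra. }
  assert (Hpi1 : / PI <= 1) by (rewrite <- Rinv_1; apply Rinv_le_contravar; pose proof PI2_3_2; lra).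
  assert (0 < / PI) by now apply Rinv_0_lt_compat.
  pose proof (Rabs_pos (RInt (fun y => F' y * Frem M y) 0 1)). nra.
Qed.

(** * Parameter integrals and Laplace transforms of [t^j / (1 + t^2)] *)

Lemma cont_RInt_param (F : R -> R -> R) a b x : a <= b ->
  (forall u v, continuity_2d_pt F u v) ->
  continuous (fun u => RInt (fun v => F u v) a b) x.
Proof.
  intros ab HF.
  assert (Hc1 : forall u v, continuous (F u) v).
  { intros u v. apply continuity_pt_filterlim. intros eps Heps.
    destruct (HF u v (mkposreal eps Heps)) as [d Hd]. exists d. split; [apply cond_pos|].
    intros w [_ Hw]. apply Hd; [rewrite Rminus_eq_0, Rabs_R0; apply cond_pos | exact Hw]. }
  apply continuity_pt_filterlim. intros eps Heps.
  assert (He : 0 < eps / (2 * (b - a + 1))) by (apply Rdiv_lt_0_compat; lra).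
  destruct (uniform_continuity_2d_1d' F a b x (fun v _ => HF x v) (mkposreal _ He)) as [d Hd].
  exists d. split; [apply cond_pos|]. intros y [_ Hy]. unfold dist, R_met in *. simpl in *. unfold Rdist in *.
  rewrite <- RInt_minus' by (apply ex_RInt_cont; auto).
  apply Rle_lt_trans with (RInt (fun _ => eps / (2 * (b - a + 1))) a b).
  - apply RInt_Rabs_le; [assumption | | |].
    + apply ex_RInt_minus'; apply ex_RInt_cont; auto.
    + apply ex_RInt_const.
    + intros v Hv. left.
      apply Rabs_lt_between in Hy. pose proof (cond_pos d).
      apply (Hd v x v y); try lra. rewrite Rminus_eq_0, Rabs_R0. apply cond_pos.
  - rewrite RInt_const'. apply Rmult_lt_reg_r with (2 * (b - a + 1)); [lra|].
    field_simplify; nra.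
Qed.

(** As functions of the upper limit [b], both sides vanish at [a] and have the same derivative, the
    integral of [F b] over [[c,d]]. *)
Lemma fubini (F : R -> R -> R) a b c d : a <= b -> c <= d ->
  (forall u v, continuity_2d_pt F u v) ->
  RInt (fun x => RInt (fun y => F x y) c d) a b = RInt (fun y => RInt (fun x => F x y) a b) c d.
Proof.
  intros ab cd HF.
  assert (HF' : forall u v, continuity_2d_pt (fun y x => F x y) u v).
  { intros u v eps. destruct (HF v u eps) as [e He]. exists e. intros; apply He; assumption. }
  assert (Hc1 : forall v u, continuous (fun x => F x v) u).
  { intros v u. apply continuity_pt_filterlim. intros eps Heps.
    destruct (HF u v (mkposreal eps Heps)) as [e He]. exists e. split; [apply cond_pos|].
    intros w [_ Hw]. apply He; [exact Hw | rewrite Rminus_eq_0, Rabs_R0; apply cond_pos]. }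
  assert (Hex : forall v p q, ex_RInt (fun x => F x v) p q).
  { intros v p q. apply (ex_RInt_continuous (V := R_CompleteNormedModule)). intros; apply Hc1. }
  assert (Hd : forall v p q, is_derive (fun X => RInt (fun x => F x v) p X) q (F q v)).
  { intros v p q. apply (is_derive_RInt (V := R_NormedModule) (fun x => F x v) _ p).
    - apply filter_forall. intros X. apply (RInt_correct (V := R_CompleteNormedModule)), Hex.
    - apply Hc1. }
  set (Phi := fun X => RInt (fun x => RInt (fun y => F x y) c d) a X - RInt (fun y => RInt (fun x => F x y) a X) c d).
  assert (HPhi : forall X, a <= X -> is_derive Phi X 0).
  { intros X HX. unfold Phi.
    replace 0 with (RInt (fun y => F X y) c d - RInt (fun y => F X y) c d) by ring.
    apply der_minus.
    - apply (is_derive_RInt (V := R_NormedModule) (fun x => RInt (fun y => F x y) c d) _ a).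
      + apply filter_forall. intros Z. apply (RInt_correct (V := R_CompleteNormedModule)).
        apply (ex_RInt_continuous (V := R_CompleteNormedModule)). intros; now apply cont_RInt_param.
      + now apply cont_RInt_param.
    - rewrite (RInt_ext (fun y => F X y) (fun t => Derive (fun u => RInt (fun x => F x t) a u) X)).
      2:{ intros y _. symmetry. apply is_derive_unique, Hd. }
      apply (is_derive_RInt_param (fun X y => RInt (fun x => F x y) a X)).
      + apply filter_forall. intros Z t _. eexists; apply Hd.
      + intros t _. apply (continuity_2d_pt_ext F); [|apply HF].
        intros; symmetry; apply is_derive_unique, Hd.
      + exists (mkposreal 1 Rlt_0_1). intros Z _. 
        apply (ex_RInt_continuous (V := R_CompleteNormedModule)). intros z _.
        destruct (Rle_lt_dec a Z) as [Hz|Hz].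
        * now apply (cont_RInt_param (fun y x => F x y)).
        * apply (continuous_ext (fun y => - RInt (fun x => F x y) Z a)).
          { intros y. apply (opp_RInt_swap (V := R_CompleteNormedModule)), Hex. }
          apply cont_opp. apply (cont_RInt_param (fun y x => F x y)); [lra | assumption]. }
  assert (H0 : Phi a = 0).
  { unfold Phi. rewrite RInt_point, (RInt_ext (fun y => RInt (fun x => F x y) a a) (fun _ => 0)).
    - rewrite RInt_const'. unfold zero; simpl. ring.
    - intros; apply (RInt_point (V := R_CompleteNormedModule)). }
  assert (H1 : Phi b = 0).
  { destruct ab as [ab|ab]; [|now rewrite <- ab].
    rewrite <- H0. symmetry. apply eq_is_derive; [|assumption]. intros; apply HPhi; lra. }
  unfold Phi in H1. lra.
Qed.

Lemma RInt_ge_0' (f : R -> R) a b : a <= b -> ex_RInt f a b ->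
  (forall x, a < x < b -> 0 <= f x) -> 0 <= RInt f a b.
Proof. apply RInt_ge_0. Qed.

Lemma lim_incr_bounded (u : nat -> R) M :
  (forall n, u n <= u (S n)) -> (forall n, u n <= M) -> is_lim_seq u (real (Lim_seq u)).
Proof. intros H1 H2. apply Lim_seq_correct', ex_finite_lim_seq_incr with M; assumption. Qed.

(** A quadratic remainder is what the estimates for [Lap], and for [y * ysq_ln y] at 0, provide
    directly. *)
Lemma der_quad (F : R -> R) z l d C : 0 < d ->
  (forall h, Rabs h < d -> Rabs (F (z + h) - F z - h * l) <= C * h ^ 2) -> is_derive F z l.
Proof.
  intros Hd H. apply is_derive_Reals. intros eps Heps.
  assert (HC : 0 < Rabs C + 1) by (pose proof (Rabs_pos C); lra).
  assert (Hm : 0 < Rmin d (eps / (Rabs C + 1))) by (apply Rmin_pos; [assumption | now apply Rdiv_lt_0_compat]).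
  exists (mkposreal _ Hm). intros h Hh0 Hh. simpl in Hh.
  specialize (H h (Rlt_le_trans _ _ _ Hh (Rmin_l _ _))).
  replace ((F (z + h) - F z) / h - l) with ((F (z + h) - F z - h * l) * / h) by (field; assumption).
  rewrite Rabs_mult, Rabs_inv. apply Rabs_pos_lt in Hh0.
  apply Rmult_lt_reg_r with (Rabs h); [assumption|].
  rewrite Rmult_assoc, Rinv_l, Rmult_1_r by lra.
  apply Rle_lt_trans with (1 := H).
  rewrite <- (pow2_abs h).
  assert (Rabs h < eps / (Rabs C + 1)) by (apply Rlt_le_trans with (1 := Hh), Rmin_r).
  assert (E : (Rabs C + 1) * (eps / (Rabs C + 1)) = eps) by (field; lra).
  pose proof (Rle_abs C). 
  assert ((Rabs C + 1) * Rabs h < eps) by (rewrite <- E; apply Rmult_lt_compat_l; assumption).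
  simpl. nra.
Qed.

Definition lap_int (j : nat) (z t : R) : R := t ^ j * exp (- (z * t)) / (1 + t ^ 2).
(* [int_0^oo t^j exp (- z t) / (1 + t^2) dt], meaningful only when the limit exists. *)
Definition Lap (j : nat) (z : R) : R :=
  real (Lim_seq (fun N => RInt (lap_int j z) 0 (INR N))).

Lemma one_sq_pos t : 0 < 1 + t ^ 2.
Proof. pose proof (pow2_ge_0 t); lra. Qed.

Lemma lap_int_cont j z t : continuous (lap_int j z) t.
Proof. unfold lap_int. pose proof (one_sq_pos t). cont; lra. Qed.

Lemma exp_RInt z N : 0 < z -> 0 <= N ->
  RInt (fun t => (1 + t) * exp (- (z * t))) 0 N <= / z + / z ^ 2.
Proof.
  intros Hz HN.
  rewrite (RInt_FTC (fun t => - (((1 + t) / z + / z ^ 2) * exp (- (z * t))))).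
  - rewrite Rmult_0_r, Ropp_0, exp_0.
    assert (0 < exp (- (z * N))) by apply exp_pos.
    assert (0 < / z) by now apply Rinv_0_lt_compat.
    assert (0 < / z ^ 2) by (apply Rinv_0_lt_compat, pow_lt; assumption).
    assert (0 <= (1 + N) / z) by (apply Rmult_le_pos; lra).
    replace ((1 + 0) / z) with (/ z) by (field; lra). nra.
  - assumption.
  - intros x _. auto_derive; [trivial|]. field. lra.
  - intros. cont.
Qed.

Lemma lap_int_bound j z t : (j <= 3)%nat -> 0 <= t -> 0 <= lap_int j z t <= (1 + t) * exp (- (z * t)).
Proof.
  intros Hj Ht. pose proof (one_sq_pos t). pose proof (exp_pos (- (z * t))) as He. unfold lap_int.
  replace (t ^ j * exp (- (z * t)) / (1 + t ^ 2)) with (t ^ j / (1 + t ^ 2) * exp (- (z * t))) by (field; lra).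
  assert (Hp : 0 <= t ^ j) by now apply pow_le.
  assert (Hq : 0 <= t ^ j / (1 + t ^ 2)) by (apply Rmult_le_pos; [assumption | left; now apply Rinv_0_lt_compat]).
  split; [apply Rmult_le_pos; lra|].
  apply Rmult_le_compat_r; [lra|].
  apply Rmult_le_reg_r with (1 + t ^ 2); [assumption|].
  unfold Rdiv. rewrite Rmult_assoc, Rinv_l, Rmult_1_r by lra.
  destruct j as [|[|[|[|j]]]]; try lia; simpl in *; nra.
Qed.

Lemma RInt_tail_mono (f : R -> R) n : (forall t, 0 <= t -> continuous f t) -> (forall t, 0 <= t -> 0 <= f t) ->
  RInt f 0 (INR n) <= RInt f 0 (INR (S n)).
Proof.
  intros Hc Hp. pose proof (pos_INR n). rewrite S_INR.
  rewrite <- (RInt_Chasles (V := R_CompleteNormedModule) f 0 (INR n) (INR n + 1)).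
  - assert (0 <= RInt f (INR n) (INR n + 1)).
    { apply RInt_ge_0'; [lra | | intros; apply Hp; lra]. apply ex_RInt_cont; [lra|]. intros; apply Hc; lra. }
    unfold plus; simpl. lra.
  - apply ex_RInt_cont; [lra|]; intros; apply Hc; lra.
  - apply ex_RInt_cont; [lra|]; intros; apply Hc; lra.
Qed.

Lemma Lap_lim j z : (j <= 3)%nat -> 0 < z ->
  is_lim_seq (fun N => RInt (lap_int j z) 0 (INR N)) (Lap j z).
Proof.
  intros Hj Hz. apply lim_incr_bounded with (/ z + / z ^ 2).
  - intros n. apply RInt_tail_mono; [intros; apply lap_int_cont|].
    intros; now apply lap_int_bound.
  - intros n. apply Rle_trans with (2 := exp_RInt z (INR n) Hz (pos_INR n)).
    apply RInt_le; [apply pos_INR | | |].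
    + apply ex_RInt_cont; [apply pos_INR|]. intros; apply lap_int_cont.
    + apply ex_RInt_cont; [apply pos_INR|]. intros; cont.
    + intros x Hx. apply lap_int_bound; [assumption | lra].
Qed.

Lemma ex_lap j z n : ex_RInt (lap_int j z) 0 (INR n).
Proof. apply ex_RInt_cont; [apply pos_INR|]. intros; apply lap_int_cont. Qed.

Lemma lim_le_const (u : nat -> R) l M : is_lim_seq u (Finite l) -> (forall n, u n <= M) -> l <= M.
Proof.
  intros H1 H2. exact (is_lim_seq_le u (fun _ => M) l M H2 H1 (is_lim_seq_const M)).
Qed.
Lemma lim_ge_const (u : nat -> R) l M : is_lim_seq u (Finite l) -> (forall n, M <= u n) -> M <= l.
Proof.
  intros H1 H2. exact (is_lim_seq_le (fun _ => M) u M l H2 (is_lim_seq_const M) H1).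
Qed.

Lemma Lap_pos j z : (j <= 3)%nat -> 0 < z -> 0 <= Lap j z.
Proof.
  intros Hj Hz. apply lim_ge_const with (1 := Lap_lim j z Hj Hz). intros n.
  apply RInt_ge_0'; [apply pos_INR | apply ex_lap |]. intros; apply lap_int_bound; [assumption | lra].
Qed.

(** Only [1 + x <= exp x] at [d] and [- d] is used. The minimum in the exponent selects the larger
    of the two exponentials, so that one formula serves both signs of [d]. *)
Lemma exp_taylor a d : 0 <= exp (- (a + d)) - exp (- a) + d * exp (- a) <= d ^ 2 * exp (- Rmin a (a + d)).
Proof.
  rewrite Ropp_plus_distr, exp_plus. pose proof (exp_pos (- a)) as Ha.
  assert (H1 : 1 + - d <= exp (- d)) by apply exp_ineq1_le.
  assert (H2 : 1 + d <= exp d) by apply exp_ineq1_le.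
  assert (H3 : exp d * exp (- d) = 1) by (rewrite <- exp_plus, Rplus_opp_r; apply exp_0).
  pose proof (exp_pos (- d)). pose proof (exp_pos d).
  split; [nra|].
  assert (H4 : exp (- d) - 1 + d <= d * (1 - exp (- d))) by nra.
  destruct (Rle_lt_dec 0 d) as [Hd|Hd].
  - rewrite Rmin_left by lra.
    assert (d * (1 - exp (- d)) <= d ^ 2) by nra.
    replace (exp (- a) * exp (- d) - exp (- a) + d * exp (- a)) with ((exp (- d) - 1 + d) * exp (- a)) by ring.
    apply Rmult_le_compat_r; lra.
  - rewrite Rmin_right by lra. rewrite Ropp_plus_distr, exp_plus.
    assert (H5 : (1 + d) * exp (- d) <= 1) by (rewrite <- H3; apply Rmult_le_compat_r; lra).
    assert (d * (1 - exp (- d)) <= d ^ 2 * exp (- d)).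
    { assert (0 <= (- d) * (1 - (1 + d) * exp (- d))) by (apply Rmult_le_pos; lra). simpl; lra. }
    replace (exp (- a) * exp (- d) - exp (- a) + d * exp (- a)) with ((exp (- d) - 1 + d) * exp (- a)) by ring.
    replace (d ^ 2 * (exp (- a) * exp (- d))) with (d ^ 2 * exp (- d) * exp (- a)) by ring.
    apply Rmult_le_compat_r; lra.
Qed.

(** For [|h| < z/2] all exponentials are at most [exp(- z t / 2)], and the second-order remainder
    brings a factor [(h t)^2] whose [t^2] is absorbed by [1 + t^2]. The truncated integrals
    therefore satisfy a quadratic bound independent of [N], which passes to the limit. *)
Lemma is_derive_Lap j z : (j <= 1)%nat -> 0 < z -> is_derive (Lap j) z (- Lap (S j) z).
Proof.
  intros Hj Hz. set (zeta := z / 2).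
  apply der_quad with zeta (/ zeta + / zeta ^ 2); [unfold zeta; lra|].
  intros h Hh. assert (Hh2 := Hh). apply Rabs_lt_between in Hh2. unfold zeta in Hh2.
  assert (Hzh : 0 < z + h) by lra.
  assert (HL : is_lim_seq (fun N => RInt (lap_int j (z + h)) 0 (INR N) - RInt (lap_int j z) 0 (INR N)
      + h * RInt (lap_int (S j) z) 0 (INR N)) (Lap j (z + h) - Lap j z + h * Lap (S j) z)).
  { apply is_lim_seq_plus'; [apply is_lim_seq_minus'; apply Lap_lim; try lia; lra|].
    apply (is_lim_seq_scal_l _ h (Lap (S j) z)). apply Lap_lim; [lia | lra]. }
  replace (Lap j (z + h) - Lap j z - h * - Lap (S j) z) with (Lap j (z + h) - Lap j z + h * Lap (S j) z) by ring.
  assert (HB : forall N, Rabs (RInt (lap_int j (z + h)) 0 (INR N) - RInt (lap_int j z) 0 (INR N)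
      + h * RInt (lap_int (S j) z) 0 (INR N)) <= (/ zeta + / zeta ^ 2) * h ^ 2).
  { intros N.
    replace (RInt (lap_int j (z + h)) 0 (INR N) - RInt (lap_int j z) 0 (INR N) + h * RInt (lap_int (S j) z) 0 (INR N))
     with (RInt (fun t => (lap_int j (z + h) t - lap_int j z t) + h * lap_int (S j) z t) 0 (INR N)).
    2:{ assert (E1 := ex_lap j (z + h) N). assert (E2 := ex_lap j z N). assert (E3 := ex_lap (S j) z N).
        rewrite (RInt_plus' (fun t => lap_int j (z + h) t - lap_int j z t) (fun t => h * lap_int (S j) z t) _ _
          (ex_RInt_minus' _ _ _ _ E1 E2) (ex_RInt_scal' _ h _ _ E3)).
        now rewrite (RInt_minus' _ _ _ _ E1 E2), (RInt_scal' _ h _ _ E3). }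
    apply Rle_trans with (RInt (fun t => h ^ 2 * ((1 + t) * exp (- (zeta * t)))) 0 (INR N)).
    - apply RInt_Rabs_le; [apply pos_INR | | |].
      + apply (ex_RInt_plus' (fun t => lap_int j (z + h) t - lap_int j z t) (fun t => h * lap_int (S j) z t));
        [apply (ex_RInt_minus' (lap_int j (z + h))); apply ex_lap | apply (ex_RInt_scal' (lap_int (S j) z)), ex_lap].
      + apply ex_RInt_cont; [apply pos_INR|]. intros; cont.
      + intros t Ht. unfold lap_int. pose proof (one_sq_pos t) as Hsq.
        replace (t ^ j * exp (- ((z + h) * t)) / (1 + t ^ 2) - t ^ j * exp (- (z * t)) / (1 + t ^ 2) +
           h * (t ^ S j * exp (- (z * t)) / (1 + t ^ 2)))
        with (t ^ j / (1 + t ^ 2) * (exp (- (z * t + h * t)) - exp (- (z * t)) + (h * t) * exp (- (z * t))))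
        by (replace ((z + h) * t) with (z * t + h * t) by ring; simpl; field; simpl in Hsq; lra).
        destruct (exp_taylor (z * t) (h * t)) as [E1 E2].
        assert (Hq : 0 <= t ^ j / (1 + t ^ 2)).
        { apply Rmult_le_pos; [apply pow_le; lra | left; now apply Rinv_0_lt_compat]. }
        rewrite Rabs_mult, !Rabs_pos_eq by assumption.
        apply Rle_trans with (t ^ j / (1 + t ^ 2) * ((h * t) ^ 2 * exp (- (zeta * t)))).
        * apply Rmult_le_compat_l; [assumption|]. apply Rle_trans with (1 := E2).
          apply Rmult_le_compat_l; [apply pow2_ge_0|].
          assert (zeta * t <= Rmin (z * t) (z * t + h * t)) by (apply Rmin_glb; unfold zeta; nra).
          destruct H as [H|H]; [left; apply exp_increasing; lra | rewrite H; lra].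
        * replace (t ^ j / (1 + t ^ 2) * ((h * t) ^ 2 * exp (- (zeta * t))))
           with (h ^ 2 * ((t ^ j * (t ^ 2 / (1 + t ^ 2))) * exp (- (zeta * t)))) by (field; lra).
          apply Rmult_le_compat_l; [apply pow2_ge_0|].
          apply Rmult_le_compat_r; [left; apply exp_pos|].
          assert (t ^ 2 / (1 + t ^ 2) <= 1).
          { apply Rmult_le_reg_r with (1 + t ^ 2); [assumption|].
            unfold Rdiv; rewrite Rmult_assoc, Rinv_l, Rmult_1_r by lra. lra. }
          assert (0 <= t ^ j) by (apply pow_le; lra).
          assert (t ^ j <= 1 + t) by (destruct j as [|[|j]]; try lia; simpl; lra).
          nra.
    - rewrite RInt_scal' by (apply ex_RInt_cont; [apply pos_INR|]; intros; cont).
      rewrite Rmult_comm. apply Rmult_le_compat_r; [apply pow2_ge_0|].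
      apply exp_RInt; [unfold zeta; lra | apply pos_INR]. }
  apply Rabs_le. split.
  - apply lim_ge_const with (1 := HL). intros n. specialize (HB n). apply Rabs_le_between in HB. lra.
  - apply lim_le_const with (1 := HL). intros n. specialize (HB n). apply Rabs_le_between in HB. lra.
Qed.

Lemma RInt_exp_neg z N : 0 < z -> RInt (fun t => exp (- (z * t))) 0 (INR N) = / z - / z * exp (- z) ^ N.
Proof.
  intros Hz. rewrite (RInt_FTC (fun t => - (/ z * exp (- (z * t))))).
  - rewrite Rmult_0_r, Ropp_0, exp_0.
    replace (exp (- (z * INR N))) with (exp (- z) ^ N).
    + rring.
    + rewrite <- Rpower_pow by apply exp_pos. unfold Rpower. rewrite ln_exp. f_equal. ring.
  - apply pos_INR.
  - intros. auto_derive; [trivial|]. rfield. lra.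
  - intros; cont.
Qed.

(** Together with [is_derive_Lap] this is the differential equation [f'' + f = 1/z] of
    [f = Lap 0]. *)
Lemma Lap_02 z : 0 < z -> Lap 0 z + Lap 2 z = / z.
Proof.
  intros Hz.
  assert (H1 : is_lim_seq (fun N => RInt (lap_int 0 z) 0 (INR N) + RInt (lap_int 2 z) 0 (INR N)) (Lap 0 z + Lap 2 z)).
  { apply is_lim_seq_plus'; apply Lap_lim; try lia; lra. }
  assert (H2 : is_lim_seq (fun N => RInt (lap_int 0 z) 0 (INR N) + RInt (lap_int 2 z) 0 (INR N)) (/ z)).
  { apply is_lim_seq_ext with (fun N => / z - / z * exp (- z) ^ N).
    - intros N. rewrite <- (RInt_plus' _ _ _ _ (ex_lap 0 z N) (ex_lap 2 z N)), <- (RInt_exp_neg z N Hz).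
      apply RInt_ext. intros t _. unfold lap_int. pose proof (one_sq_pos t). simpl in *. rfield. lra.
    - replace (/ z) with (/ z - / z * 0) at 1 by ring.
      apply is_lim_seq_minus'; [apply is_lim_seq_const|].
      apply (is_lim_seq_scal_l _ (/ z) 0). apply is_lim_seq_geom.
      rewrite Rabs_pos_eq by (left; apply exp_pos). rewrite <- exp_0. apply exp_increasing; lra. }
  apply is_lim_seq_unique in H1. apply is_lim_seq_unique in H2. congruence.
Qed.

Definition hfun (z : R) : R := 1 - z * Lap 0 z.

(** This form shows that [hfun] is nonnegative and decays like [2/z^2]; the defining form shows that
    it is at most 1. *)
Lemma hfun_Lap2 z : 0 < z -> hfun z = z * Lap 2 z.
Proof.
  intros Hz. unfold hfun. replace (Lap 0 z) with (/ z - Lap 2 z) by (rewrite <- (Lap_02 z Hz); ring).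
  field. lra.
Qed.

Lemma hfun_pos z : 0 < z -> 0 <= hfun z.
Proof. intros Hz. rewrite hfun_Lap2 by assumption. apply Rmult_le_pos; [lra | apply Lap_pos; [lia | assumption]]. Qed.

Lemma hfun_le_1 z : 0 < z -> hfun z <= 1.
Proof. intros Hz. unfold hfun. pose proof (Lap_pos 0 z ltac:(lia) Hz). nra. Qed.

Lemma exp_sq_RInt z N : 0 < z -> 0 <= N -> RInt (fun t => t ^ 2 * exp (- (z * t))) 0 N <= 2 / z ^ 3.
Proof.
  intros Hz HN.
  rewrite (RInt_FTC (fun t => - ((t ^ 2 / z + 2 * t / z ^ 2 + 2 / z ^ 3) * exp (- (z * t))))).
  - replace (- (z * 0)) with 0 by ring. rewrite exp_0.
    pose proof (exp_pos (- (z * N))) as He.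
    assert (0 < z ^ 2) by (apply pow_lt; lra). assert (0 < z ^ 3) by (apply pow_lt; lra).
    assert (0 <= N ^ 2 / z + 2 * N / z ^ 2 + 2 / z ^ 3).
    { apply Rplus_le_le_0_compat; [apply Rplus_le_le_0_compat|];
      (apply Rmult_le_pos; [|left; apply Rinv_0_lt_compat; assumption]); [apply pow2_ge_0 | lra | lra]. }
    replace (0 ^ 2 / z + 2 * 0 / z ^ 2 + 2 / z ^ 3) with (2 / z ^ 3) by (field; lra). nra.
  - assumption.
  - intros x _. auto_derive; [trivial|]. rfield. lra.
  - intros; cont.
Qed.

Lemma hfun_decay z : 0 < z -> hfun z <= 2 / z ^ 2.
Proof.
  intros Hz. rewrite hfun_Lap2 by assumption.
  assert (Lap 2 z <= 2 / z ^ 3).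
  { apply lim_le_const with (1 := Lap_lim 2 z ltac:(lia) Hz). intros N.
    apply Rle_trans with (2 := exp_sq_RInt z (INR N) Hz (pos_INR N)).
    apply RInt_le; [apply pos_INR | apply ex_lap | |].
    - apply ex_RInt_cont; [apply pos_INR|]; intros; cont.
    - intros t Ht. unfold lap_int. pose proof (one_sq_pos t).
      rewrite <- (Rmult_1_r (t ^ 2 * exp _)) at 2. apply Rmult_le_compat_l.
      + apply Rmult_le_pos; [apply pow2_ge_0 | left; apply exp_pos].
      + rewrite <- Rinv_1. apply Rinv_le_contravar; [lra|]. pose proof (pow2_ge_0 t); lra. }
  replace (2 / z ^ 2) with (z * (2 / z ^ 3)) by (field; lra).
  apply Rmult_le_compat_l; lra.
Qed.

Lemma inv_one_sq_cont t : continuous (fun t => / (1 + t ^ 2)) t.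
Proof. pose proof (one_sq_pos t). cont; lra. Qed.

Lemma is_derive_atan' t : is_derive atan t (/ (1 + t ^ 2)).
Proof. pose proof (one_sq_pos t). auto_derive; [trivial|]. rfield. simpl in *; lra. Qed.

Lemma atan_le x : 0 <= x -> atan x <= x.
Proof.
  intros Hx.
  assert (0 - atan 0 <= x - atan x).
  { apply (mono_le (fun x => x - atan x) (fun x => 1 - / (1 + x ^ 2))); [assumption | |].
    - intros y _. apply der_minus; [apply @is_derive_id | apply is_derive_atan'].
    - intros y _. pose proof (one_sq_pos y). pose proof (pow2_ge_0 y).
      assert (/ (1 + y ^ 2) <= / 1) by (apply Rinv_le_contravar; lra). lra. }
  rewrite atan_0 in H. lra.
Qed.

Lemma Lap0_le z : 0 < z -> Lap 0 z <= PI / 2.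
Proof.
  intros Hz. apply lim_le_const with (1 := Lap_lim 0 z ltac:(lia) Hz). intros N.
  pose proof (atan_bound (INR N)). apply Rle_trans with (atan (INR N)); [|lra].
  replace (atan (INR N)) with (RInt (fun t => / (1 + t ^ 2)) 0 (INR N)).
  - apply RInt_le; [apply pos_INR | apply ex_lap | |].
    + apply ex_RInt_cont; [apply pos_INR|]; intros; apply inv_one_sq_cont.
    + intros t Ht. unfold lap_int. pose proof (one_sq_pos t).
      rewrite <- (Rmult_1_l (/ (1 + t ^ 2))). apply Rmult_le_compat_r; [left; now apply Rinv_0_lt_compat|].
      rewrite pow_O, Rmult_1_l, <- exp_0. assert (- (z * t) < 0) by nra. left; now apply exp_increasing.
  - rewrite (RInt_FTC atan); [rewrite atan_0; rring | apply pos_INR | |].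
    + intros t _. apply is_derive_atan'.
    + intros t _. apply inv_one_sq_cont.
Qed.

(** Cutting the integral at [N] and using [exp(- z t) >= exp(- z N) >= 1 - z N] leaves
    [(1 - z N) atan N]. Choosing first [N] large and then [z] small gives the limit [PI/2]. *)
Lemma Lap0_ge z N : 0 < z -> (1 <= N)%nat -> PI / 2 - / INR N - PI / 2 * z * INR N <= Lap 0 z.
Proof.
  intros Hz HN. apply le_INR in HN. simpl in HN.
  assert (H1 : exp (- (z * INR N)) * atan (INR N) <= Lap 0 z).
  { apply Rle_trans with (RInt (lap_int 0 z) 0 (INR N)).
    - replace (exp (- (z * INR N)) * atan (INR N)) with (RInt (fun t => exp (- (z * INR N)) * / (1 + t ^ 2)) 0 (INR N)).
      + apply RInt_le; [apply pos_INR | | apply ex_lap |].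
        * apply ex_RInt_cont; [apply pos_INR|]; intros x Hx. apply cont_mult; [apply cont_const | apply inv_one_sq_cont].
        * intros t Ht. unfold lap_int. pose proof (one_sq_pos t).
          apply Rmult_le_compat_r; [left; now apply Rinv_0_lt_compat|].
          rewrite pow_O, Rmult_1_l. assert (- (z * INR N) < - (z * t)) by nra. left; now apply exp_increasing.
      + rewrite (RInt_FTC (fun t => exp (- (z * INR N)) * atan t)); [rewrite atan_0; rring | apply pos_INR | |].
        * intros t _. apply (der_scal atan), is_derive_atan'.
        * intros t _. apply cont_mult; [apply cont_const | apply inv_one_sq_cont].
    - apply (is_lim_seq_incr_compare _ _ (Lap_lim 0 z ltac:(lia) Hz)).
      intros n. apply RInt_tail_mono; [intros; apply lap_int_cont|].
      intros; apply lap_int_bound; [lia | assumption]. }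
  assert (H2 : 1 + - (z * INR N) <= exp (- (z * INR N))) by apply exp_ineq1_le.
  assert (H3 : atan (INR N) = PI / 2 - atan (/ INR N)).
  { rewrite atan_inv by lra. ring. }
  assert (H4 : atan (/ INR N) <= / INR N) by (apply atan_le; left; apply Rinv_0_lt_compat; lra).
  pose proof (atan_bound (INR N)) as H5. pose proof (atan_increasing 0 (INR N) ltac:(lra)) as H6.
  rewrite atan_0 in H6.
  assert (H7 : (1 + - (z * INR N)) * atan (INR N) <= Lap 0 z).
  { apply Rle_trans with (2 := H1). apply Rmult_le_compat_r; lra. }
  assert (H8 : z * INR N * atan (INR N) <= z * INR N * (PI / 2)) by (apply Rmult_le_compat_l; nra).
  lra.
Qed.

Lemma Lap0_lim (z : nat -> R) : (forall j, 0 < z j) -> is_lim_seq z 0 ->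
  is_lim_seq (fun j => Lap 0 (z j)) (PI / 2).
Proof.
  intros Hz Hl. pose proof PI_RGT_0 as Hpi. apply is_lim_seq_spec. intros [eps Heps]. simpl.
  destruct (nfloor_ex (2 / eps)) as [N [_ HN]]; [apply Rlt_le, Rdiv_lt_0_compat; lra|].
  rewrite <- S_INR in HN. set (M := S N) in *.
  assert (HM : 0 < INR M) by (apply lt_0_INR; unfold M; lia).
  apply is_lim_seq_spec in Hl.
  assert (He : 0 < eps / (PI * INR M)) by (apply Rdiv_lt_0_compat; nra).
  destruct (Hl (mkposreal _ He)) as [J HJ]. exists J. intros j Hj. specialize (HJ j Hj). simpl in HJ.
  rewrite Rminus_0_r, Rabs_pos_eq in HJ by (left; apply Hz).
  pose proof (Lap0_le (z j) (Hz j)). pose proof (Lap0_ge (z j) M (Hz j) ltac:(unfold M; lia)).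
  assert (/ INR M < eps / 2).
  { apply Rmult_lt_reg_r with (INR M); [assumption|]. rewrite Rinv_l by lra.
    apply Rmult_lt_reg_r with (2 / eps); [apply Rdiv_lt_0_compat; lra|].
    replace (eps / 2 * INR M * (2 / eps)) with (INR M) by (field; lra). lra. }
  assert (PI / 2 * z j * INR M < eps / 2).
  { apply Rmult_lt_reg_r with (2 / (PI * INR M)); [apply Rdiv_lt_0_compat; nra|].
    replace (PI / 2 * z j * INR M * (2 / (PI * INR M))) with (z j) by (field; lra).
    replace (eps / 2 * (2 / (PI * INR M))) with (eps / (PI * INR M)) by (field; lra). assumption. }
  apply Rabs_lt_between. lra.
Qed.

(** * Euler's constant *)

(** [seq_lim] and [series] are chosen by [epsilon], so their values are known only once a limit has
    been exhibited; uniqueness of limits then identifies them. *)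
Lemma seq_lim_eq u l : is_lim_seq u (Finite l) -> seq_lim u = l.
Proof.
  intros H. apply is_lim_seq_Reals in H. unfold seq_lim.
  pose proof (epsilon_spec (inhabits 0) (fun l => Un_cv u l) (ex_intro _ l H)) as H1.
  exact (UL_sequence u _ _ H1 H).
Qed.

Lemma series_eq f l : is_series f l -> series f = l.
Proof.
  intros H. apply is_series_Reals in H. unfold series.
  pose proof (epsilon_spec (inhabits 0) (fun l => infinite_sum f l) (ex_intro _ l H)) as H1.
  exact (uniqueness_sum f _ _ H1 H).
Qed.

Lemma is_series_lim (a : nat -> R) l : is_series a l <-> is_lim_seq (sum_f_R0 a) l.
Proof.
  split; intros H.
  - apply is_series_Reals in H. apply is_lim_seq_Reals. exact H.
  - apply is_series_Reals. apply is_lim_seq_Reals in H. exact H.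
Qed.

Lemma ex_series_bounded (a : nat -> R) M : (forall k, 0 <= a k) ->
  (forall n, sum_f_R0 a n <= M) -> ex_series a.
Proof.
  intros H1 H2. exists (real (Lim_seq (sum_f_R0 a))). apply is_series_lim.
  apply lim_incr_bounded with M; [|assumption].
  intros n. simpl. specialize (H1 (S n)). lra.
Qed.

Lemma sum_inv_sq_le n : sum_f_R0 (fun k => / INR (S k) ^ 2) n <= 2.
Proof.
  apply Rle_trans with (2 - / INR (S n)).
  - induction n as [|n IH]; [simpl; lra|].
    cbn [sum_f_R0]. pose proof (pos_INR n) as Hn.
    assert (/ INR (S (S n)) ^ 2 <= / INR (S n) - / INR (S (S n))); [|lra].
    rewrite !S_INR in *.
    replace (/ (INR n + 1) - / (INR n + 1 + 1)) with (/ ((INR n + 1) * (INR n + 1 + 1))) by (field; lra).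
    apply Rinv_le_contravar; nra.
  - assert (0 < / INR (S n)) by (apply Rinv_0_lt_compat, lt_0_INR; lia). lra.
Qed.

Lemma ex_series_inv_sq : ex_series (fun k => / INR (S k) ^ 2).
Proof.
  apply ex_series_bounded with 2; [|apply sum_inv_sq_le].
  intros k. left. apply Rinv_0_lt_compat, pow_lt, lt_0_INR. lia.
Qed.

Lemma Rabs_Series_le (a b : nat -> R) : (forall k, Rabs (a k) <= b k) -> ex_series b ->
  ex_series a /\ Rabs (Series a) <= Series b.
Proof.
  intros H Hb.
  assert (Ha : ex_series (fun k => Rabs (a k))).
  { apply (ex_series_le (K := R_AbsRing) (V := R_CompleteNormedModule) _ b); [|assumption].
    intros k. unfold norm; simpl. unfold abs; simpl. rewrite Rabs_Rabsolu. apply H. }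
  split; [now apply ex_series_Rabs|].
  apply Rle_trans with (1 := Series_Rabs a Ha). apply Series_le; [|assumption].
  intros k; split; [apply Rabs_pos | apply H].
Qed.

Lemma ex_series_shift (b : nat -> R) K : ex_series b -> ex_series (fun n => b (K + n)%nat).
Proof. intros H. now apply (ex_series_incr_n b K). Qed.

Lemma Series_tail_lim (b : nat -> R) : ex_series b ->
  is_lim_seq (fun K => Series (fun n => b (S K + n)%nat)) 0.
Proof.
  intros Hb. apply is_lim_seq_ext with (fun K => Series b - sum_f_R0 b K).
  - intros K. rewrite (Series_incr_n b (S K)) by (lia || assumption). simpl pred. ring.
  - replace 0 with (Series b - Series b) by ring.
    apply is_lim_seq_minus'; [apply is_lim_seq_const|].
    apply is_series_lim, Series_correct, Hb.
Qed.

(** Dominated convergence for series: beyond [K] the tails are bounded by that of [b] uniformly in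
    [j], and the first [K + 1] terms form a finite sum. *)
Lemma tannery (a : nat -> nat -> R) (b l : nat -> R) : (forall j k, Rabs (a j k) <= b k) ->
  ex_series b -> (forall k, is_lim_seq (fun j => a j k) (l k)) ->
  is_lim_seq (fun j => Series (a j)) (Series l).
Proof.
  intros Hab Hb Hl.
  assert (Hlb : forall k, Rabs (l k) <= b k).
  { intros k. apply Rabs_le. split.
    - apply (lim_ge_const _ _ _ (Hl k)). intros j. specialize (Hab j k). apply Rabs_le_between in Hab. lra.
    - apply (lim_le_const _ _ _ (Hl k)). intros j. specialize (Hab j k). apply Rabs_le_between in Hab. lra. }
  apply is_lim_seq_spec. intros eps. pose proof (cond_pos eps) as Heps.
  pose proof (Series_tail_lim b Hb) as Ht. apply is_lim_seq_spec in Ht.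
  assert (He3 : 0 < eps / 3) by lra.
  destruct (Ht (mkposreal _ He3)) as [K HK]. specialize (HK K (le_n K)). simpl pos in HK.
  rewrite Rminus_0_r in HK. apply Rabs_lt_between in HK.
  assert (Hs : is_lim_seq (fun j => sum_f_R0 (a j) K) (sum_f_R0 l K)).
  { generalize K as K'. induction K' as [|K' IH]; simpl; [apply Hl|]. now apply is_lim_seq_plus'. }
  apply is_lim_seq_spec in Hs. destruct (Hs (mkposreal _ He3)) as [J HJ]. exists J. intros j Hj.
  specialize (HJ j Hj). simpl pos in HJ.
  assert (Ha : ex_series (a j)) by exact (proj1 (Rabs_Series_le _ _ (Hab j) Hb)).
  assert (Hll : ex_series l) by exact (proj1 (Rabs_Series_le _ _ Hlb Hb)).
  rewrite (Series_incr_n (a j) (S K)), (Series_incr_n l (S K)) by (lia || assumption). simpl pred.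
  assert (Hbt := ex_series_shift b (S K) Hb).
  pose proof (proj2 (Rabs_Series_le (fun n => a j (S K + n)%nat) (fun n => b (S K + n)%nat) (fun k => Hab j _) Hbt)) as E1.
  pose proof (proj2 (Rabs_Series_le (fun n => l (S K + n)%nat) (fun n => b (S K + n)%nat) (fun k => Hlb _) Hbt)) as E2.
  apply Rabs_le_between in E1. apply Rabs_le_between in E2. apply Rabs_lt_between in HJ.
  apply Rabs_lt_between. lra.
Qed.

Lemma ln_le_sub1 x : 0 < x -> ln x <= x - 1.
Proof.
  intros Hx. pose proof (exp_ineq1_le (ln x)) as H. rewrite exp_ln in H by assumption. lra.
Qed.

Lemma ln_ge_inv x : 0 < x -> 1 - / x <= ln x.
Proof.
  intros Hx. pose proof (ln_le_sub1 (/ x) (Rinv_0_lt_compat _ Hx)) as H. rewrite ln_Rinv in H by assumption. lra.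
Qed.

Lemma harmonic_ln_ex : exists l : R, is_lim_seq (fun n => harmonic n - ln (INR n)) l.
Proof.
  set (u := fun n => - (harmonic (S n) - ln (INR (S n)))).
  assert (Hu : forall n, u n <= u (S n)).
  { intros n. unfold u. cbn [harmonic].
    assert (Hn : 0 < INR (S n)) by (apply lt_0_INR; lia).
    pose proof (ln_ge_inv (INR (S (S n)) / INR (S n))) as H.
    rewrite ln_div in H by (apply lt_0_INR; lia || assumption).
    replace (1 - / (INR (S (S n)) / INR (S n))) with (/ INR (S (S n))) in H.
    - apply Ropp_le_contravar. enough (/ INR (S (S n)) <= ln (INR (S (S n))) - ln (INR (S n))) by (cbn [harmonic] in *; lra).
      apply H. apply Rdiv_lt_0_compat; [apply lt_0_INR; lia | assumption].
    - rewrite (S_INR (S n)). field. lra. }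
  assert (Hb : forall n, u n <= 0).
  { intros n. unfold u. enough (ln (INR (S n)) <= harmonic (S n)) by lra.
    apply Rle_trans with (ln (INR (S (S n)))).
    - left. apply ln_increasing; [apply lt_0_INR; lia | apply lt_INR; lia].
    - induction n as [|n IH].
      + simpl. pose proof (ln_le_sub1 (1 + 1) ltac:(lra)). lra.
      + replace (harmonic (S (S n))) with (harmonic (S n) + / INR (S (S n))) by reflexivity.
        assert (0 < INR (S (S n))) by (apply lt_0_INR; lia).
        assert (0 < INR (S (S (S n)))) by (apply lt_0_INR; lia).
        pose proof (ln_le_sub1 (INR (S (S (S n))) / INR (S (S n))) ltac:(apply Rdiv_lt_0_compat; lra)) as H1.
        rewrite ln_div in H1 by lra.
        replace (INR (S (S (S n))) / INR (S (S n)) - 1) with (/ INR (S (S n))) in H1; [lra|].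
        rewrite (S_INR (S (S n))). field. lra. }
  exists (- real (Lim_seq u)). apply is_lim_seq_incr_1.
  apply is_lim_seq_ext with (fun n => - u n); [intros; unfold u; ring|].
  apply (is_lim_seq_opp u (Finite (real (Lim_seq u)))). now apply lim_incr_bounded with 0.
Qed.

Lemma euler_gamma_lim : is_lim_seq (fun n => harmonic n - ln (INR n)) euler_gamma.
Proof.
  destruct harmonic_ln_ex as [l Hl]. unfold euler_gamma. now rewrite (seq_lim_eq _ l).
Qed.

(** The integral of [t / (1 + t^2)] over [[k, k+1]], to be compared with [1/(k+1)]. *)
Definition dE (k : nat) : R := / 2 * ln (1 + INR (S k) ^ 2) - / 2 * ln (1 + INR k ^ 2).

Lemma is_derive_E t : is_derive (fun t => / 2 * ln (1 + t ^ 2)) t (t / (1 + t ^ 2)).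
Proof. pose proof (one_sq_pos t). auto_derive; [simpl in *; lra|]. rfield. simpl in *; lra. Qed.

Lemma dE_bound k : Rabs (dE k - / INR (S k)) <= 2 * / INR (S k) ^ 2.
Proof.
  destruct (MVT_gen (fun t => / 2 * ln (1 + t ^ 2)) (INR k) (INR (S k)) (fun t => t / (1 + t ^ 2))) as [t [Ht He]].
  - intros; apply is_derive_E.
  - intros; apply continuity_pt_filterlim, (der_cont _ _ _ (is_derive_E x)).
  - pose proof (pos_INR k) as Hk. rewrite S_INR in *. rewrite Rmin_left, Rmax_right in Ht by lra.
    unfold dE. rewrite S_INR, He. pose proof (one_sq_pos t) as Hs. pose proof (pow2_ge_0 t) as Hs0.
    set (m := INR k) in *.
    replace (t / (1 + t ^ 2) * (m + 1 - m) - / (m + 1)) with ((t * (m + 1 - t) - 1) / ((1 + t ^ 2) * (m + 1))) by (field; lra).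
    unfold Rdiv. rewrite Rabs_mult, Rabs_inv, (Rabs_pos_eq ((1 + t ^ 2) * (m + 1))) by nra.
    apply Rmult_le_reg_r with ((1 + t ^ 2) * (m + 1) ^ 2); [nra|].
    replace (Rabs (t * (m + 1 - t) - 1) * / ((1 + t ^ 2) * (m + 1)) * ((1 + t ^ 2) * (m + 1) ^ 2)) with (Rabs (t * (m + 1 - t) - 1) * (m + 1)) by (field; lra).
    replace (2 * / (m + 1) ^ 2 * ((1 + t ^ 2) * (m + 1) ^ 2)) with (2 * (1 + t ^ 2)) by (field; lra).
    assert (Ht1 : 0 <= t * (m + 1 - t)) by (apply Rmult_le_pos; lra).
    assert (Ht2 : t * (m + 1 - t) <= t * 1) by (apply Rmult_le_compat_l; lra).
    assert (Rabs (t * (m + 1 - t) - 1) <= t + 1) by (apply Rabs_le; lra).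
    apply Rle_trans with ((t + 1) * (t + 1)).
    2:{ pose proof (pow2_ge_0 (t - 1)). simpl in *. lra. }
    apply Rmult_le_compat; try lra. apply Rabs_pos.
Qed.

Lemma dE_sum n : sum_f_R0 dE n = / 2 * ln (1 + INR (S n) ^ 2).
Proof.
  induction n as [|n IH].
  - cbn [sum_f_R0]. unfold dE. replace (1 + INR 0 ^ 2) with 1 by (simpl; ring). rewrite ln_1. ring.
  - cbn [sum_f_R0]. rewrite IH. unfold dE. ring.
Qed.

Lemma harmonic_sum n : sum_f_R0 (fun k => / INR (S k)) n = harmonic (S n).
Proof.
  induction n as [|n IH]; [simpl; lra|]. cbn [sum_f_R0]. rewrite IH. reflexivity.
Qed.

(** The [dE] telescope to [ln(1 + (n+1)^2) / 2], which differs from [ln(n+1)] by a null sequence;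
    subtracting the harmonic number leaves minus the sequence that defines Euler's constant. *)
Lemma dE_series : is_series (fun k => dE k - / INR (S k)) (- euler_gamma).
Proof.
  apply is_series_lim.
  apply is_lim_seq_ext with (fun n => / 2 * ln (1 + / INR (S n) ^ 2) - (harmonic (S n) - ln (INR (S n)))).
  - intros n. rewrite (minus_sum dE (fun k => / INR (S k))), dE_sum, harmonic_sum.
    assert (Hn : 0 < INR (S n)) by (apply lt_0_INR; lia).
    replace (1 + INR (S n) ^ 2) with ((1 + / INR (S n) ^ 2) * (INR (S n) * INR (S n))) by (field; lra).
    assert (0 < / INR (S n) ^ 2) by (apply Rinv_0_lt_compat, pow_lt; lra).
    rewrite !ln_mult by nra. field.
  - replace (- euler_gamma) with (/ 2 * 0 - euler_gamma) by ring.
    apply is_lim_seq_minus'.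
    + apply (is_lim_seq_scal_l _ (/ 2) 0). 
      apply is_lim_seq_le_le with (fun _ => 0) (fun n => / INR (S n)).
      * intros n. assert (Hn : 1 <= INR (S n)) by (apply (le_INR 1); lia).
        assert (0 < / INR (S n) ^ 2) by (apply Rinv_0_lt_compat, pow_lt; lra).
        split.
        -- rewrite <- ln_1. left. apply ln_increasing; lra.
        -- apply Rle_trans with (1 := ln_le_sub1 (1 + / INR (S n) ^ 2) ltac:(lra)).
           replace (1 + / INR (S n) ^ 2 - 1) with (/ INR (S n) ^ 2) by ring.
           apply Rinv_le_contravar; nra.
      * apply is_lim_seq_const.
      * apply (is_lim_seq_incr_1 (fun n => / INR n)). 
        replace (Finite 0) with (Rbar_inv p_infty) by reflexivity.
        apply is_lim_seq_inv; [apply is_lim_seq_INR | discriminate].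
    + apply (is_lim_seq_incr_1 (fun n => harmonic n - ln (INR n))), euler_gamma_lim.
Qed.

(** The partial sum plus [ln(1 - x)] has derivative [- x^(n+1) / (1 - x)], which on [[0,q]] lies
    between [- q^(n+1) / (1 - q)] and 0. Comparison from 0 to [q] gives a geometric error. *)
Lemma log_series q : 0 < q < 1 -> is_series (fun k => q ^ S k / INR (S k)) (- ln (1 - q)).
Proof.
  intros Hq. apply is_series_lim.
  assert (Hd : forall n x, x < 1 -> is_derive (fun x => sum_f_R0 (fun k => x ^ S k / INR (S k)) n + ln (1 - x)) x
     (- (x ^ S n / (1 - x)))).
  { intros n x Hx.
    replace (- (x ^ S n / (1 - x))) with (sum_f_R0 (fun k => x ^ k) n + - / (1 - x)).
    2:{ rewrite tech3 by lra. field. lra. }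
    apply der_plus.
    - induction n as [|n IH].
      + cbn [sum_f_R0]. auto_derive; [trivial|]. simpl. rfield.
      + cbn [sum_f_R0]. apply (der_plus (fun x => sum_f_R0 (fun k => x ^ S k / INR (S k)) n)); [exact IH|].
        assert (Hn : INR (S (S n)) <> 0) by (apply not_0_INR; lia).
        replace (x ^ S n) with (/ INR (S (S n)) * (INR (S (S n)) * x ^ pred (S (S n)))) by (simpl pred; field; assumption).
        apply (is_derive_ext (fun x => / INR (S (S n)) * x ^ S (S n))); [intros; rfield; assumption|].
        apply der_scal. rewrite <- (Rmult_1_r (_ * _)). 
        apply (is_derive_ext (fun x => x ^ S (S n))); [reflexivity|].
        replace (INR (S (S n)) * x ^ Init.Nat.pred (S (S n)) * 1) with (INR (S (S n)) * 1 * x ^ Init.Nat.pred (S (S n))) by ring.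
        apply is_derive_pow, @is_derive_id.
    - auto_derive; [lra|]. rfield. lra. }
  assert (Hb : forall n, - (q ^ S n * (q / (1 - q))) <= sum_f_R0 (fun k => q ^ S k / INR (S k)) n + ln (1 - q) <= 0).
  { intros n.
    assert (H0 : sum_f_R0 (fun k => 0 ^ S k / INR (S k)) n + ln (1 - 0) = 0).
    { rewrite Rminus_0_r, ln_1, Rplus_0_r. apply sum_eq_R0. intros; simpl; unfold Rdiv; ring. }
    assert (Hx : forall x, 0 <= x <= q -> 0 <= x ^ S n / (1 - x) <= q ^ S n / (1 - q)).
    { intros x Hx. assert (0 < / (1 - x)) by (apply Rinv_0_lt_compat; lra).
      assert (0 <= x ^ S n) by (apply pow_le; lra).
      split; [apply Rmult_le_pos; lra|]. apply Rmult_le_compat; try lra.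
      - apply pow_incr; lra.
      - apply Rinv_le_contravar; lra. }
    split.
    - assert (sum_f_R0 (fun k => 0 ^ S k / INR (S k)) n + ln (1 - 0) + q ^ S n / (1 - q) * 0 <=
        sum_f_R0 (fun k => q ^ S k / INR (S k)) n + ln (1 - q) + q ^ S n / (1 - q) * q).
      { apply (mono_le (fun x => sum_f_R0 (fun k => x ^ S k / INR (S k)) n + ln (1 - x) + q ^ S n / (1 - q) * x)
         (fun x => - (x ^ S n / (1 - x)) + q ^ S n / (1 - q) * 1)); [lra| |].
        - intros x Hx2. apply (der_plus (fun x => sum_f_R0 (fun k => x ^ S k / INR (S k)) n + ln (1 - x))).
          + apply Hd; lra.
          + apply der_scal. apply @is_derive_id.
        - intros x Hx2. specialize (Hx x Hx2). lra. }
      rewrite H0 in H.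
      replace (q ^ S n * (q / (1 - q))) with (q ^ S n / (1 - q) * q) by (field; lra). lra.
    - apply Ropp_le_cancel. rewrite <- H0 at 1.
      apply (mono_le (fun x => - (sum_f_R0 (fun k => x ^ S k / INR (S k)) n + ln (1 - x))) (fun x => - - (x ^ S n / (1 - x)))); [lra| |].
      + intros x Hx2. apply @is_derive_opp, Hd. lra.
      + intros x Hx2. specialize (Hx x Hx2). lra. }
  apply is_lim_seq_le_le with (fun n => - ln (1 - q) - q ^ S n * (q / (1 - q))) (fun _ => - ln (1 - q)).
  - intros n. specialize (Hb n). lra.
  - replace (Finite (- ln (1 - q))) with (Finite (- ln (1 - q) - 0 * (q / (1 - q)))) by (f_equal; ring).
    apply is_lim_seq_minus'; [apply is_lim_seq_const|].
    apply (is_lim_seq_scal_r _ (q / (1 - q)) 0). apply (is_lim_seq_incr_1 (fun n => q ^ n)), is_lim_seq_geom.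
    rewrite Rabs_pos_eq; lra.
  - apply is_lim_seq_const.
Qed.

(** On [[k, k+1]] the factor [exp(- z t)] lies between [exp(- z)^(k+1)] and [exp(- z)^k], so the two
    bounds differ exactly by the factor [exp(- z)]. *)
Lemma lap1_sum_bounds z n : 0 < z ->
  sum_f_R0 (fun k => exp (- z) ^ S k * dE k) n <= RInt (lap_int 1 z) 0 (INR (S n))
  <= sum_f_R0 (fun k => exp (- z) ^ k * dE k) n.
Proof.
  intros Hz.
  assert (Hpow : forall k, exp (- z) ^ k = exp (- (z * INR k))).
  { intros k. rewrite <- Rpower_pow by apply exp_pos. unfold Rpower. rewrite ln_exp. f_equal. ring. }
  assert (Hk : forall k, exp (- z) ^ S k * dE k <= RInt (lap_int 1 z) (INR k) (INR (S k)) <= exp (- z) ^ k * dE k).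
  { intros k. pose proof (pos_INR k) as Hk.
    assert (Hkk : INR k <= INR (S k)) by (rewrite S_INR; lra).
    assert (Hc : forall t, continuous (fun t => t / (1 + t ^ 2)) t).
    { intros t. pose proof (one_sq_pos t). cont; lra. }
    assert (HE : forall c, RInt (fun t => c * (t / (1 + t ^ 2))) (INR k) (INR (S k)) = c * dE k).
    { intros c. rewrite (RInt_FTC (fun t => c * (/ 2 * ln (1 + t ^ 2)))).
      - unfold dE. rring.
      - assumption.
      - intros t _. apply (der_scal (fun t => / 2 * ln (1 + t ^ 2))), is_derive_E.
      - intros t _. apply cont_mult; [apply cont_const | apply Hc]. }
    assert (Hl : ex_RInt (lap_int 1 z) (INR k) (INR (S k))).
    { apply ex_RInt_cont; [assumption|]. intros; apply lap_int_cont. }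
    assert (Hr : forall c, ex_RInt (fun t => c * (t / (1 + t ^ 2))) (INR k) (INR (S k))).
    { intros c. apply ex_RInt_cont; [assumption|]. intros; apply cont_mult; [apply cont_const | apply Hc]. }
    assert (Hpt : forall t c, INR k < t -> c <= exp (- (z * t)) -> c * (t / (1 + t ^ 2)) <= lap_int 1 z t).
    { intros t c Ht Hct. unfold lap_int. pose proof (one_sq_pos t).
      replace (t ^ 1 * exp (- (z * t)) / (1 + t ^ 2)) with (exp (- (z * t)) * (t / (1 + t ^ 2))) by (field; lra).
      apply Rmult_le_compat_r; [|assumption]. apply Rmult_le_pos; [lra | left; now apply Rinv_0_lt_compat]. }
    assert (Hpt2 : forall t c, INR k < t -> exp (- (z * t)) <= c -> lap_int 1 z t <= c * (t / (1 + t ^ 2))).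
    { intros t c Ht Hct. unfold lap_int. pose proof (one_sq_pos t).
      replace (t ^ 1 * exp (- (z * t)) / (1 + t ^ 2)) with (exp (- (z * t)) * (t / (1 + t ^ 2))) by (field; lra).
      apply Rmult_le_compat_r; [|assumption]. apply Rmult_le_pos; [lra | left; now apply Rinv_0_lt_compat]. }
    rewrite <- !HE. split; apply RInt_le; auto.
    - intros t Ht. apply Hpt; [lra|]. rewrite Hpow. left. apply exp_increasing. nra.
    - intros t Ht. apply Hpt2; [lra|]. rewrite Hpow. left. apply exp_increasing. nra. }
  induction n as [|n IH]; [exact (Hk 0%nat)|].
  cbn [sum_f_R0]. specialize (Hk (S n)).
  rewrite (RInt_Chasles' (lap_int 1 z) 0 (INR (S n)) (INR (S (S n)))).
  - lra.
  - apply ex_lap.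
  - apply ex_RInt_cont; [rewrite (S_INR (S n)); lra|]. intros; apply lap_int_cont.
Qed.

(** Chosen to make [1 - exp(- zseq j) = 1/(j+2)], so that the logarithmic series has the exact sum
    [ln(j+2)]. One sequence tending to 0 is enough, because the limits at 0 serve only to evaluate a
    function already known to be constant. *)
Definition zseq (j : nat) : R := ln (INR (S (S j)) / INR (S j)).

Lemma zseq_bounds j : / INR (S (S j)) <= zseq j <= / INR (S j).
Proof.
  assert (H1 : 0 < INR (S j)) by (apply lt_0_INR; lia).
  assert (H2 : 0 < INR (S (S j))) by (apply lt_0_INR; lia).
  assert (H3 : 0 < INR (S (S j)) / INR (S j)) by (apply Rdiv_lt_0_compat; lra).
  unfold zseq. split.
  - replace (/ INR (S (S j))) with (1 - / (INR (S (S j)) / INR (S j))); [now apply ln_ge_inv|].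
    rewrite (S_INR (S j)) in *. field. lra.
  - replace (/ INR (S j)) with (INR (S (S j)) / INR (S j) - 1); [now apply ln_le_sub1|].
    rewrite (S_INR (S j)) in *. field. lra.
Qed.

Lemma zseq_pos j : 0 < zseq j.
Proof.
  apply Rlt_le_trans with (2 := proj1 (zseq_bounds j)). apply Rinv_0_lt_compat, lt_0_INR; lia.
Qed.

Lemma inv_INR_lim k : is_lim_seq (fun j => / INR (k + j)) 0.
Proof.
  apply (is_lim_seq_ext (fun j => / INR (j + k))); [intros; do 2 f_equal; lia|].
  apply (is_lim_seq_incr_n (fun n => / INR n) k).
  replace (Finite 0) with (Rbar_inv p_infty) by reflexivity.
  apply is_lim_seq_inv; [apply is_lim_seq_INR | discriminate].
Qed.

Lemma zseq_lim : is_lim_seq zseq 0.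
Proof.
  apply is_lim_seq_le_le with (fun _ => 0) (fun j => / INR (1 + j)).
  - intros j. split; [left; apply zseq_pos | apply zseq_bounds].
  - apply is_lim_seq_const.
  - apply inv_INR_lim.
Qed.

Lemma ln_INR_over : is_lim_seq (fun j => ln (INR (S (S j))) * / INR (S j)) 0.
Proof.
  apply is_lim_seq_le_le with (fun _ => 0) (fun j => 4 / sqrt (INR (S j))).
  - intros j. assert (H1 : 1 <= INR (S j)) by (apply (le_INR 1); lia).
    assert (Hs : 0 < sqrt (INR (S j))) by (apply sqrt_lt_R0; lra).
    assert (Hq : sqrt (INR (S j)) * sqrt (INR (S j)) = INR (S j)) by (apply sqrt_sqrt; lra).
    rewrite (S_INR (S j)). split.
    + apply Rmult_le_pos; [|left; apply Rinv_0_lt_compat; lra].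
      rewrite <- ln_1. left; apply ln_increasing; lra.
    + assert (Hs2 : 0 < sqrt (INR (S j) + 1)) by (apply sqrt_lt_R0; lra).
      assert (ln (INR (S j) + 1) <= 2 * sqrt (INR (S j) + 1)).
      { rewrite <- (sqrt_sqrt (INR (S j) + 1)) at 1 by lra. rewrite ln_mult by assumption.
        pose proof (ln_le_sub1 _ Hs2). lra. }
      assert (sqrt (INR (S j) + 1) <= 2 * sqrt (INR (S j))).
      { rewrite <- (sqrt_square (2 * sqrt (INR (S j)))) by lra. apply sqrt_le_1_alt. nra. }
      replace (4 / sqrt (INR (S j))) with (4 * sqrt (INR (S j)) * / (sqrt (INR (S j)) * sqrt (INR (S j)))) by (field; lra).
      rewrite Hq. apply Rmult_le_compat_r; [left; apply Rinv_0_lt_compat; lra | lra].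
  - apply is_lim_seq_const.
  - replace (Finite 0) with (Rbar_mult 4 (Rbar_inv p_infty)) by (simpl; f_equal; ring).
    apply is_lim_seq_scal_l, is_lim_seq_inv; [|discriminate].
    apply (filterlim_comp _ _ _ (fun j => INR (S j)) sqrt eventually (Rbar_locally p_infty)).
    + apply (is_lim_seq_incr_1 INR), is_lim_seq_INR.
    + apply filterlim_sqrt_p.
Qed.

(* Comparison of [Lap 1 z] with [sum q^k / k = - ln (1 - q)], [q = exp (-z) = 1 - 1/(j+2)]. *)
Lemma Lap1_lim : is_lim_seq (fun j => Lap 1 (zseq j) + ln (zseq j)) (- euler_gamma).
Proof.
  set (q := fun j => INR (S j) / INR (S (S j))).
  assert (Hp1 : forall j, 0 < INR (S j)) by (intros; apply lt_0_INR; lia).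
  assert (Hq : forall j, 0 < q j < 1).
  { intros j. unfold q. specialize (Hp1 j). split; [apply Rdiv_lt_0_compat; auto|].
    - apply lt_0_INR; lia.
    - apply Rmult_lt_reg_r with (INR (S (S j))); [apply lt_0_INR; lia|].
      unfold Rdiv. rewrite Rmult_assoc, Rinv_l, (S_INR (S j)); [lra|]. apply not_0_INR; lia. }
  assert (Hqe : forall j, exp (- zseq j) = q j).
  { intros j. unfold zseq, q. rewrite <- ln_Rinv by (apply Rdiv_lt_0_compat; apply Hp1).
    rewrite exp_ln by (apply Rinv_0_lt_compat, Rdiv_lt_0_compat; apply Hp1).
    field. split; apply not_0_INR; lia. }
  assert (Hq1 : forall j, - ln (1 - q j) = ln (INR (S (S j)))).
  { intros j. rewrite <- ln_Rinv by (specialize (Hq j); lra). f_equal. unfold q.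
    rewrite (S_INR (S j)). pose proof (Hp1 j). field. lra. }
  set (A := fun j => Series (fun k => q j ^ S k * (dE k - / INR (S k)))).
  assert (Hb : ex_series (fun k => 2 * / INR (S k) ^ 2)) by apply (ex_series_scal_l (K := R_AbsRing) 2 (fun k => / INR (S k) ^ 2)), ex_series_inv_sq.
  assert (Hqk : forall j k, 0 <= q j ^ k <= 1).
  { intros j k. specialize (Hq j). split; [apply pow_le; lra|]. rewrite <- (pow1 k). apply pow_incr; lra. }
  assert (Hab : forall j k, Rabs (q j ^ S k * (dE k - / INR (S k))) <= 2 * / INR (S k) ^ 2).
  { intros j k. rewrite Rabs_mult, (Rabs_pos_eq (q j ^ S k)) by apply Hqk.
    rewrite <- (Rmult_1_l (2 * _)). apply Rmult_le_compat; [apply Hqk | apply Rabs_pos | apply Hqk | apply dE_bound]. }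
  assert (HAlim : is_lim_seq A (- euler_gamma)).
  { unfold A. rewrite <- (is_series_unique _ _ dE_series).
    apply (tannery (fun j k => q j ^ S k * (dE k - / INR (S k))) _ _ Hab Hb).
    intros k. replace (Finite (dE k - / INR (S k))) with (Finite (1 * (dE k - / INR (S k)))) by (f_equal; ring).
    apply (is_lim_seq_scal_r (fun j => q j ^ S k) (dE k - / INR (S k)) 1).
    assert (Hql : is_lim_seq q 1).
    { apply is_lim_seq_ext with (fun j => 1 - / INR (2 + j)).
      - intros j. unfold q. change (2 + j)%nat with (S (S j)). rewrite (S_INR (S j)). pose proof (Hp1 j). field. lra.
      - replace (Finite 1) with (Finite (1 - 0)) by (f_equal; ring).
        apply is_lim_seq_minus'; [apply is_lim_seq_const | apply inv_INR_lim]. }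
    generalize (S k) as m. induction m as [|m IH].
    - apply is_lim_seq_const.
    - simpl. replace (Finite 1) with (Finite (1 * 1)) by (f_equal; ring). now apply is_lim_seq_mult'. }
  set (P := fun j => A j + ln (INR (S (S j)))).
  assert (HP : forall j, is_series (fun k => q j ^ S k * dE k) (P j)).
  { intros j. unfold P. rewrite <- Hq1.
    apply (is_series_ext (fun k => q j ^ S k * (dE k - / INR (S k)) + q j ^ S k / INR (S k))).
    - intros k. rfield. apply not_0_INR; lia.
    - apply (is_series_plus (K := R_AbsRing) (V := R_NormedModule)); [|apply log_series, Hq].
      apply Series_correct. exact (proj1 (Rabs_Series_le _ _ (Hab j) Hb)). }
  assert (HL : forall j, P j <= Lap 1 (zseq j) <= P j / q j).
  { intros j. pose proof (Lap_lim 1 (zseq j) ltac:(lia) (zseq_pos j)) as H.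
    apply is_lim_seq_incr_1 in H. pose proof (HP j) as H1. apply is_series_lim in H1. split.
    - refine (is_lim_seq_le _ _ _ _ _ H1 H). intros n. pose proof (lap1_sum_bounds (zseq j) n (zseq_pos j)) as B.
      rewrite Hqe in B. apply B.
    - assert (H2 : is_lim_seq (fun n => sum_f_R0 (fun k => q j ^ S k * dE k) n / q j) (P j / q j)).
      { apply (is_lim_seq_scal_r _ (/ q j) (P j)), H1. }
      refine (is_lim_seq_le _ _ _ _ _ H H2). intros n. pose proof (lap1_sum_bounds (zseq j) n (zseq_pos j)) as B.
      rewrite Hqe in B. apply Rle_trans with (1 := proj2 B). right.
      unfold Rdiv. rewrite Rmult_comm, <- sum_mult. apply sum_eq. intros i _. simpl. field.
      specialize (Hq j); lra. }
  assert (Hzl : forall j, - ln (INR (S (S j))) <= ln (zseq j) <= - ln (INR (S (S j))) + / INR (S j)).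
  { intros j. pose proof (zseq_bounds j) as Hz. pose proof (Hp1 j). pose proof (Hp1 (S j)).
    assert (0 < / INR (S (S j))) by now apply Rinv_0_lt_compat.
    assert (Hln : forall a b, 0 < a -> a <= b -> ln a <= ln b).
    { intros a b Ha [Hab2|Hab2]; [left; now apply ln_increasing | subst; lra]. }
    split.
    - rewrite <- ln_Rinv by assumption. apply Hln; lra.
    - apply Rle_trans with (- ln (INR (S j))).
      + rewrite <- ln_Rinv by assumption. apply Hln; [apply zseq_pos | lra].
      + pose proof (proj2 (zseq_bounds j)) as Hz2. unfold zseq in Hz2. rewrite ln_div in Hz2 by assumption. lra. }
  (* [1 / q j = 1 + 1/(j+1)], so the bounds [P j] and [P j / q j] differ by
     [(A j + ln(j+2)) / (j+1)]; the last [1/(j+1)] pays for replacing [ln (zseq j)] by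
     [- ln(j+2)]. *)
  apply is_lim_seq_le_le with A
    (fun j => A j + A j * / INR (1 + j) + ln (INR (S (S j))) * / INR (S j) + / INR (1 + j)).
  - intros j. specialize (HL j). specialize (Hzl j). unfold P in HL. split; [lra|].
    assert (E : (A j + ln (INR (S (S j)))) / q j = (A j + ln (INR (S (S j)))) * (1 + / INR (S j))).
    { unfold q. pose proof (Hp1 j). rewrite (S_INR (S j)). field. lra. }
    rewrite E in HL. change (1 + j)%nat with (S j). lra.
  - exact HAlim.
  - replace (- euler_gamma) with (- euler_gamma + - euler_gamma * 0 + 0 + 0) by ring.
    repeat apply is_lim_seq_plus'; try apply inv_INR_lim; try exact HAlim.
    + apply is_lim_seq_mult'; [exact HAlim | apply inv_INR_lim].
    + apply ln_INR_over.
Qed.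

(** * The sum of [h (2 pi m v)] over [m] *)

Lemma cont2_cos f x y : continuity_2d_pt f x y -> continuity_2d_pt (fun u v => cos (f u v)) x y.
Proof. intros; apply (continuity_1d_2d_pt_comp cos); [apply continuity_cos | assumption]. Qed.
Lemma cont2_exp f x y : continuity_2d_pt f x y -> continuity_2d_pt (fun u v => exp (f u v)) x y.
Proof. intros; apply (continuity_1d_2d_pt_comp exp); [apply derivable_continuous, derivable_exp | assumption]. Qed.
Ltac cont2 := repeat first
  [ simple apply continuity_2d_pt_const | simple apply continuity_2d_pt_id1 | simple apply continuity_2d_pt_id2
  | simple apply cont2_cos | simple apply cont2_exp | simple apply continuity_2d_pt_plus
  | simple apply continuity_2d_pt_minus | simple apply continuity_2d_pt_mult | simple apply continuity_2d_pt_opp ].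

(** [1/(y+v)^2] is the integral of [w^2 s exp(- (y+v) w s)] over [s > 0]. After exchanging the
    integrals, the one in [y] runs over full periods, so the cosine has equal values at both ends;
    what remains is [w s^2 / (1 + s^2)] times the difference of [exp(- w v s)] and
    [exp(- w (v+1) s)]. The term [err] is the cost of truncating at [s = N]. *)
Lemma cos_int_telescope m v : 0 < v ->
  RInt (fun y => cos (2 * PI * INR (S m) * y) / (y + v) ^ 2) 0 1
  = hfun (2 * PI * INR (S m) * v) / v - hfun (2 * PI * INR (S m) * (v + 1)) / (v + 1).
Proof.
  intros Hv. pose proof PI_RGT_0 as Hpi.
  assert (Hm : 0 < INR (S m)) by (apply lt_0_INR; lia).
  set (w := 2 * PI * INR (S m)). assert (Hw : 0 < w) by (unfold w; nra).
  assert (Hw1 : cos (w * 1) = 1 /\ sin (w * 1) = 0).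
  { replace (w * 1) with (0 + 2 * INR (S m) * PI) by (unfold w; ring).
    now rewrite cos_period, sin_period, cos_0, sin_0. }
  rewrite !hfun_Lap2 by nra.
  replace (w * v * Lap 2 (w * v) / v - w * (v + 1) * Lap 2 (w * (v + 1)) / (v + 1))
   with (w * Lap 2 (w * v) + - w * Lap 2 (w * (v + 1))) by (field; lra).
  set (F := fun y s => cos (w * y) * (w ^ 2 * s * exp (- ((y + v) * w * s)))).
  set (err := fun N y => exp (- ((y + v) * w * INR N)) * (w * INR N / (y + v) + / (y + v) ^ 2)).
  assert (HG : forall N y, 0 <= y -> RInt (fun s => F y s) 0 (INR N) = cos (w * y) / (y + v) ^ 2 - cos (w * y) * err N y).
  { intros N y Hy. unfold F, err.
    rewrite (RInt_FTC (fun s => cos (w * y) * - (exp (- ((y + v) * w * s)) * (w * s / (y + v) + / (y + v) ^ 2)))).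
    - rewrite !Rmult_0_r, Ropp_0, exp_0. rfield. lra.
    - apply pos_INR.
    - intros s _. apply (der_scal (fun s => - (exp (- ((y + v) * w * s)) * (w * s / (y + v) + / (y + v) ^ 2)))). auto_derive; [lra|]. rfield. lra.
    - intros; cont. }
  assert (HH : forall s, RInt (fun y => F y s) 0 1 = w * lap_int 2 (w * v) s + - w * lap_int 2 (w * (v + 1)) s).
  { intros s. unfold F. assert (Hs := one_sq_pos s).
    rewrite (RInt_FTC (fun y => s * exp (- ((y + v) * w * s)) * (w * sin (w * y) - w * s * cos (w * y)) / (1 + s ^ 2))).
    - destruct Hw1 as [-> ->]. rewrite Rmult_0_r, cos_0, sin_0. unfold lap_int.
      replace ((0 + v) * w * s) with (w * v * s) by ring.
      replace ((1 + v) * w * s) with (w * (v + 1) * s) by ring. rfield. lra.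
    - lra.
    - intros y _. auto_derive; [lra|]. simpl in *. rfield. lra.
    - intros; cont. }
  assert (Hfub : forall N, RInt (fun y => cos (w * y) / (y + v) ^ 2 - cos (w * y) * err N y) 0 1
     = w * RInt (lap_int 2 (w * v)) 0 (INR N) + - w * RInt (lap_int 2 (w * (v + 1))) 0 (INR N)).
  { intros N. rewrite <- (RInt_lin _ _ w (- w) _ _ (ex_lap 2 (w * v) N) (ex_lap 2 (w * (v + 1)) N)).
    transitivity (RInt (fun y => RInt (fun s => F y s) 0 (INR N)) 0 1).
    - symmetry. apply RInt_ext. intros y Hy. rewrite Rmin_left in Hy by lra. apply HG; lra.
    - transitivity (RInt (fun s => RInt (fun y => F y s) 0 1) 0 (INR N)).
      + apply fubini; [lra | apply pos_INR |]. intros u x. unfold F, pow. cont2.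
      + apply RInt_ext. intros; apply HH. }
  assert (Hex1 : ex_RInt (fun y => cos (w * y) / (y + v) ^ 2) 0 1).
  { apply ex_RInt_cont; [lra|]. intros x Hx. cont. apply pow_nonzero; lra. }
  assert (Hex2 : forall N, ex_RInt (fun y => cos (w * y) * err N y) 0 1).
  { intros N. apply ex_RInt_cont; [lra|]. intros x Hx. unfold err. cont; try apply pow_nonzero; lra. }
  assert (Herr : forall N, Rabs (RInt (fun y => cos (w * y) * err N y) 0 1) <= exp (- (v * w)) ^ N * (w * INR N / v + / v ^ 2)).
  { intros N. replace (exp (- (v * w)) ^ N * (w * INR N / v + / v ^ 2))
      with (RInt (fun _ => exp (- (v * w)) ^ N * (w * INR N / v + / v ^ 2)) 0 1) by (rewrite RInt_const'; rring).
    apply RInt_Rabs_le; [lra | apply Hex2 | apply ex_RInt_const |].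
    intros y Hy. pose proof (pos_INR N). unfold err.
    assert (H1 : 0 <= w * INR N / (y + v) + / (y + v) ^ 2 <= w * INR N / v + / v ^ 2).
    { assert (0 < / (y + v)) by (apply Rinv_0_lt_compat; lra).
      assert (0 < / (y + v) ^ 2) by (apply Rinv_0_lt_compat, pow_lt; lra).
      assert (/ (y + v) <= / v) by (apply Rinv_le_contravar; lra).
      assert (/ (y + v) ^ 2 <= / v ^ 2) by (apply Rinv_le_contravar; [apply pow_lt; lra | apply pow_incr; lra]).
      assert (0 <= w * INR N) by nra. split.
      - apply Rplus_le_le_0_compat; [apply Rmult_le_pos; lra | lra].
      - apply Rplus_le_compat; [apply Rmult_le_compat_l; lra | assumption]. }
    assert (H2 : exp (- ((y + v) * w * INR N)) <= exp (- (v * w)) ^ N).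
    { rewrite <- Rpower_pow by apply exp_pos. unfold Rpower. rewrite ln_exp.
      assert (H3 : - ((y + v) * w * INR N) <= INR N * - (v * w)).
      { assert (0 <= y * (w * INR N)) by (apply Rmult_le_pos; [lra | nra]). lra. }
      destruct H3 as [H3|H3]; [left; now apply exp_increasing | rewrite H3; lra]. }
    pose proof (exp_pos (- ((y + v) * w * INR N))).
    rewrite !Rabs_mult, (Rabs_pos_eq (exp _)), (Rabs_pos_eq (_ + _)) by lra.
    rewrite <- (Rmult_1_l (exp (- (v * w)) ^ N * _)).
    apply Rmult_le_compat; [apply Rabs_pos | apply Rmult_le_pos; lra | apply Rabs_le, COS_bound |].
    apply Rmult_le_compat; lra. }
  assert (Hlim0 : is_lim_seq (fun N => exp (- (v * w)) ^ N * (w * INR N / v + / v ^ 2)) 0).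
  { assert (Hr : 0 < exp (- (v * w)) < 1).
    { split; [apply exp_pos|]. rewrite <- exp_0. apply exp_increasing. nra. }
    set (r := exp (- (v * w))) in *.
    assert (Hs0 : 0 < sqrt r) by now apply sqrt_lt_R0.
    assert (Hs1 : sqrt r < 1) by (rewrite <- sqrt_1; apply sqrt_lt_1_alt; lra).
    assert (Hss : sqrt r * sqrt r = r) by (apply sqrt_sqrt; lra).
    (* Write [r^N = sqrt r ^ N * sqrt r ^ N]. One factor absorbs [N]: the powers [sqrt r ^ i] with
       [i <= N] are all at least [sqrt r ^ N], and their sum is at most [1 / (1 - sqrt r)]. *)
    assert (HN : forall N, INR N * sqrt r ^ N <= / (1 - sqrt r)).
    { intros N. apply Rle_trans with (sum_f_R0 (fun i => sqrt r ^ i) N).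
      - assert (Hd : forall k, (k <= N)%nat -> sqrt r ^ N <= sqrt r ^ k).
        { intros k Hk. replace N with (k + (N - k))%nat by lia. rewrite pow_add.
          rewrite <- (Rmult_1_r (sqrt r ^ k)) at 2. apply Rmult_le_compat_l; [apply pow_le; lra|].
          rewrite <- (pow1 (N - k)). apply pow_incr; lra. }
        assert (Hd2 : forall k, (k <= N)%nat -> INR (S k) * sqrt r ^ N <= sum_f_R0 (fun i => sqrt r ^ i) k).
        { induction k as [|k IH]; intros Hk.
          - simpl. rewrite Rmult_1_l. apply (Hd 0%nat Hk).
          - rewrite (S_INR (S k)). cbn [sum_f_R0]. specialize (IH ltac:(lia)). specialize (Hd (S k) Hk). lra. }
        specialize (Hd2 N (le_n N)). rewrite S_INR in Hd2. assert (0 <= sqrt r ^ N) by (apply pow_le; lra). lra.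
      - rewrite tech3 by lra. apply Rmult_le_reg_r with (1 - sqrt r); [lra|]. 
        unfold Rdiv. rewrite Rmult_assoc, !Rinv_l by lra. assert (0 <= sqrt r ^ S N) by (apply pow_le; lra). lra. }
    apply is_lim_seq_le_le with (fun _ => 0) (fun N => sqrt r ^ N * (w / v * / (1 - sqrt r) + / v ^ 2)).
    - intros N. pose proof (pos_INR N).
      assert (0 < / v ^ 2) by (apply Rinv_0_lt_compat, pow_lt; lra).
      assert (0 < w / v) by (apply Rdiv_lt_0_compat; lra).
      assert (0 <= sqrt r ^ N <= 1) by (split; [apply pow_le; lra | rewrite <- (pow1 N); apply pow_incr; lra]).
      split.
      + apply Rmult_le_pos; [apply pow_le; lra|]. apply Rplus_le_le_0_compat; [|lra].
        unfold Rdiv. rewrite Rmult_assoc, (Rmult_comm (INR N)), <- Rmult_assoc. apply Rmult_le_pos; [unfold Rdiv in *; lra | assumption].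
      + rewrite <- Hss at 1. rewrite Rpow_mult_distr, Rmult_assoc. apply Rmult_le_compat_l; [lra|].
        replace (sqrt r ^ N * (w * INR N / v + / v ^ 2)) with (w / v * (INR N * sqrt r ^ N) + sqrt r ^ N * / v ^ 2) by (field; lra).
        apply Rplus_le_compat; [apply Rmult_le_compat_l; [lra | apply HN]|].
        rewrite <- (Rmult_1_l (/ v ^ 2)) at 2. apply Rmult_le_compat_r; lra.
    - apply is_lim_seq_const.
    - replace (Finite 0) with (Finite (0 * (w / v * / (1 - sqrt r) + / v ^ 2))) by (f_equal; ring).
      apply (is_lim_seq_scal_r (fun N => sqrt r ^ N) _ 0), is_lim_seq_geom. rewrite Rabs_pos_eq; lra. }
  assert (L1 : is_lim_seq (fun N => RInt (fun y => cos (w * y) / (y + v) ^ 2 - cos (w * y) * err N y) 0 1)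
     (w * Lap 2 (w * v) + - w * Lap 2 (w * (v + 1)))).
  { apply (is_lim_seq_ext (fun N => w * RInt (lap_int 2 (w * v)) 0 (INR N) + - w * RInt (lap_int 2 (w * (v + 1))) 0 (INR N))).
    - intros N; symmetry; apply Hfub.
    - apply is_lim_seq_plus'.
      + apply (is_lim_seq_scal_l _ w (Lap 2 (w * v))), Lap_lim; [lia | nra].
      + apply (is_lim_seq_scal_l _ (- w) (Lap 2 (w * (v + 1)))), Lap_lim; [lia | nra]. }
  assert (L2 : is_lim_seq (fun N => RInt (fun y => cos (w * y) / (y + v) ^ 2 - cos (w * y) * err N y) 0 1)
     (RInt (fun y => cos (w * y) / (y + v) ^ 2) 0 1)).
  { apply (is_lim_seq_ext (fun N => RInt (fun y => cos (w * y) / (y + v) ^ 2) 0 1 - RInt (fun y => cos (w * y) * err N y) 0 1)).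
    - intros N; symmetry. apply (RInt_minus' _ _ _ _ Hex1 (Hex2 N)).
    - set (I1 := RInt (fun y => cos (w * y) / (y + v) ^ 2) 0 1).
      replace (Finite I1) with (Finite (I1 - 0)) by (f_equal; ring).
      apply is_lim_seq_minus'; [apply is_lim_seq_const|].
      apply is_lim_seq_abs_0. apply is_lim_seq_le_le with (fun _ => 0) (fun N => exp (- (v * w)) ^ N * (w * INR N / v + / v ^ 2)).
      + intros N. split; [apply Rabs_pos | apply Herr].
      + apply is_lim_seq_const.
      + exact Hlim0. }
  apply is_lim_seq_unique in L1. apply is_lim_seq_unique in L2. congruence.
Qed.

(** The trigamma function at [v + 1]. *)
Definition T2 (v : R) : R := Series (fun k => / (INR (S k) + v) ^ 2).
(** The closed form of the sum over [m >= 1] of [hfun (2 PI m v)], as [hfun_sum] shows. *)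
Definition Hs (v : R) : R := / 2 * (v * T2 v + / (2 * v) - 1).

Lemma T2_ex v : 0 <= v -> is_series (fun k => / (INR (S k) + v) ^ 2) (T2 v).
Proof.
  intros Hv. apply Series_correct.
  assert (H : forall k, Rabs (/ (INR (S k) + v) ^ 2) <= / INR (S k) ^ 2).
  { intros k. assert (0 < INR (S k)) by (apply lt_0_INR; lia).
    rewrite Rabs_inv, Rabs_pos_eq by (apply pow_le; lra).
    apply Rinv_le_contravar; [apply pow_lt; lra | apply pow_incr; lra]. }
  exact (proj1 (Rabs_Series_le _ _ H ex_series_inv_sq)).
Qed.

Lemma T2_bounds v : 0 <= v -> 0 <= T2 v <= 2.
Proof.
  intros Hv. pose proof (T2_ex v Hv) as H. apply is_series_lim in H.
  assert (Hk : forall k, 0 < INR (S k)) by (intros; apply lt_0_INR; lia).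
  split.
  - apply (lim_ge_const _ _ _ H). intros n. apply cond_pos_sum. intros k. specialize (Hk k).
    left. apply Rinv_0_lt_compat, pow_lt. lra.
  - apply (lim_le_const _ _ _ H). intros n.
    apply Rle_trans with (sum_f_R0 (fun k => / INR (S k) ^ 2) n).
    + apply sum_Rle. intros k _. specialize (Hk k). apply Rinv_le_contravar; [apply pow_lt; lra | apply pow_incr; lra].
    + apply sum_inv_sq_le.
Qed.

(** [fourier_end] is applied to [FL L], the sum of [1/(y+k+v)^2] over [k <= L]. By
    [cos_int_telescope] its cosine coefficients telescope to [hfun (w v) / v] minus a term that
    vanishes as [L] grows, and its derivative is bounded independently of [L], so the estimate
    survives the limit in [L]. Multiplication by [v/2] gives the stated constant. *)
Lemma hfun_sum_approx M v : 0 < v ->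
  Rabs (sum_f_R0 (fun m => hfun (2 * PI * INR (S m) * v)) M - Hs v) <= (/ v ^ 2 + 2 * v) * Feps M.
Proof.
  intros Hv. pose proof PI_RGT_0 as Hpi.
  set (f := fun k y => / (y + (INR k + v)) ^ 2).
  set (f' := fun k y => - (2 * / (y + (INR k + v)) ^ 3)).
  assert (Hpos : forall k y, 0 <= y -> 0 < y + (INR k + v)) by (intros k y Hy; pose proof (pos_INR k); lra).
  set (FL := fun L y => sum_f_R0 (fun k => f k y) L).
  set (FL' := fun L y => sum_f_R0 (fun k => f' k y) L).
  assert (Hder : forall L y, 0 <= y -> is_derive (FL L) y (FL' L y)).
  { intros L y Hy.
    assert (Hd1 : forall k, is_derive (f k) y (f' k y)).
    { intros k. unfold f, f'. specialize (Hpos k y Hy). auto_derive; [apply Rgt_not_eq; simpl; nra|]. simpl. rfield. lra. }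
    induction L as [|L IH]; [exact (Hd1 0%nat)|].
    unfold FL, FL'. cbn [sum_f_R0]. apply (der_plus (FL L) (f (S L))); [exact IH | apply Hd1]. }
  assert (Hcf : forall k y, 0 <= y -> continuous (f k) y).
  { intros k y Hy. specialize (Hpos k y Hy). unfold f. cont. apply pow_nonzero; lra. }
  assert (Hcont : forall L y, 0 <= y -> continuous (FL' L) y).
  { intros L y Hy.
    assert (Hd1 : forall k, continuous (f' k) y).
    { intros k. unfold f'. specialize (Hpos k y Hy). cont. apply pow_nonzero; lra. }
    induction L as [|L IH]; [exact (Hd1 0%nat)|].
    unfold FL'. cbn [sum_f_R0]. apply (cont_plus (FL' L) (f' (S L))); [exact IH | apply Hd1]. }
  (* The term [k = 0] contributes at most [2/v^3], the others at most [2/k^2] each and hence at most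
     4 together. *)
  assert (HB : forall L y, 0 <= y -> Rabs (FL' L y) <= 2 / v ^ 3 + 4).
  { intros L y Hy.
    assert (H0 : forall k, Rabs (f' k y) <= 2 * (if k then / v ^ 3 else / INR k ^ 2)).
    { intros k. specialize (Hpos k y Hy). unfold f'. pose proof (pos_INR k).
      rewrite Rabs_Ropp, Rabs_mult, (Rabs_pos_eq 2), Rabs_inv, Rabs_pos_eq by (try apply pow_le; lra).
      apply Rmult_le_compat_l; [lra|]. destruct k as [|k].
      - apply Rinv_le_contravar; [apply pow_lt; lra | apply pow_incr; simpl; lra].
      - assert (1 <= INR (S k)) by (apply (le_INR 1); lia).
        apply Rinv_le_contravar; [apply pow_lt; lra|].
        apply Rle_trans with (INR (S k) ^ 3); [|apply pow_incr; lra].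
        assert (0 <= INR (S k) ^ 2) by (apply pow_le; lra).
        replace (INR (S k) ^ 3) with (INR (S k) ^ 2 * INR (S k)) by ring. nra. }
    apply Rle_trans with (sum_f_R0 (fun k => 2 * (if k then / v ^ 3 else / INR k ^ 2)) L).
    - apply Rle_trans with (1 := Rsum_abs _ _). apply sum_Rle. intros; apply H0.
    - rewrite sum_mult. destruct L as [|L]; [cbn [sum_f_R0]; unfold Rdiv; lra|].
      rewrite decomp_sum by lia. simpl pred.
      pose proof (sum_inv_sq_le L). unfold Rdiv. lra. }
  assert (Hmain := fun L => fourier_end (FL L) (FL' L) _ M (fun y Hy => Hder L y (proj1 Hy)) (fun y Hy => Hcont L y (proj1 Hy)) (fun y Hy => HB L y (proj1 Hy))).
  set (D := fun m v => hfun (2 * PI * INR (S m) * v) / v).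
  assert (Hterm : forall L m, RInt (fun y => FL L y * cos (2 * PI * INR (S m) * y)) 0 1 = D m v - D m (v + INR (S L))).
  { intros L m.
    assert (Hk : forall k, ex_RInt (fun y => f k y * cos (2 * PI * INR (S m) * y)) 0 1).
    { intros k. apply ex_RInt_cont; [lra|]. intros y Hy. apply cont_mult; [apply Hcf; lra | cont]. }
    transitivity (RInt (fun y => sum_f_R0 (fun k => f k y * cos (2 * PI * INR (S m) * y)) L) 0 1).
    - apply RInt_ext. intros y _. unfold FL. rewrite Rmult_comm, <- sum_mult.
      apply sum_eq. intros; apply Rmult_comm.
    - rewrite (proj2 (RInt_sum (fun k y => f k y * cos (2 * PI * INR (S m) * y)) 0 1 L Hk)).
      assert (Hone : forall k, RInt (fun y => f k y * cos (2 * PI * INR (S m) * y)) 0 1 = D m (v + INR k) - D m (v + INR (S k))).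
      { intros k. unfold D. rewrite (S_INR k), <- (Rplus_assoc v (INR k) 1). rewrite <- cos_int_telescope by (pose proof (pos_INR k); lra).
        apply RInt_ext. intros y _. unfold f. rewrite (Rplus_comm v). unfold Rdiv. apply Rmult_comm. }
      induction L as [|L IH].
      + cbn [sum_f_R0]. rewrite Hone. simpl INR. now rewrite Rplus_0_r.
      + cbn [sum_f_R0]. rewrite IH, Hone. rring. }
  assert (Hmean : forall L, (FL L 0 + FL L 1) / 2 - RInt (FL L) 0 1 =
     / 2 * / v ^ 2 + sum_f_R0 (fun k => / (INR (S k) + v) ^ 2) L - / 2 * / (INR (S L) + v) ^ 2 - (/ v - / (INR (S L) + v))).
  { intros L. f_equal.
    - unfold FL, f. induction L as [|L IH].
      + cbn [sum_f_R0]. simpl INR. rewrite !Rplus_0_l. field. lra.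
      + cbn [sum_f_R0] in *. rewrite !S_INR in *.
        replace (0 + (INR L + 1 + v)) with (INR L + 1 + v) by ring.
        replace (1 + (INR L + 1 + v)) with (INR L + 1 + 1 + v) by ring. lra.
    - f_equal. unfold FL. rewrite (proj2 (RInt_sum f 0 1 L ltac:(intros k; apply ex_RInt_cont; [lra|]; intros y Hy; apply Hcf; lra))).
      assert (Hone : forall k, RInt (f k) 0 1 = / (INR k + v) - / (INR (S k) + v)).
      { intros k. rewrite (RInt_FTC (fun y => - / (y + (INR k + v)))).
        - rewrite S_INR, Rplus_0_l. replace (1 + (INR k + v)) with (INR k + 1 + v) by ring. rring.
        - lra.
        - intros y Hy. specialize (Hpos k y (proj1 Hy)). unfold f. auto_derive; [lra|]. simpl. rfield. lra.
        - intros y Hy. apply Hcf; lra. }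
      induction L as [|L IH]; cbn [sum_f_R0]; rewrite Hone; [simpl INR; now rewrite Rplus_0_l | rewrite IH; rring]. }
  assert (HLv : is_lim_seq (fun L => / (INR (S L) + v)) 0).
  { apply is_lim_seq_le_le with (fun _ => 0) (fun L => / INR (1 + L)).
    - intros L. assert (0 < INR (S L)) by (apply lt_0_INR; lia). split.
      + left. apply Rinv_0_lt_compat; lra.
      + apply Rinv_le_contravar; [assumption | change (1 + L)%nat with (S L); lra].
    - apply is_lim_seq_const.
    - apply inv_INR_lim. }
  assert (HD : forall m, is_lim_seq (fun L => D m (v + INR (S L))) 0).
  { intros m. apply is_lim_seq_le_le with (fun _ => 0) (fun L => / (INR (S L) + v)).
    - intros L. assert (HL : 0 < INR (S L)) by (apply lt_0_INR; lia). assert (Hm : 0 < INR (S m)) by (apply lt_0_INR; lia).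
      unfold D. set (z := v + INR (S L)). assert (Hz : 0 < z) by (unfold z; lra).
      assert (Hwz : 0 < 2 * PI * INR (S m) * z) by (apply Rmult_lt_0_compat; [nra | assumption]).
      replace (INR (S L) + v) with z by (unfold z; ring).
      assert (0 < / z) by now apply Rinv_0_lt_compat.
      pose proof (hfun_pos _ Hwz). pose proof (hfun_le_1 _ Hwz). unfold Rdiv. nra.
    - apply is_lim_seq_const.
    - exact HLv. }
  (* The limit of the end point mean minus the integral: both telescope, and half of the first term
     [1/v^2] survives. *)
  set (K0 := / 2 * / v ^ 2 + T2 v - / v).
  assert (Hlim : is_lim_seq (fun L => sum_f_R0 (fun m => 2 * RInt (fun y => FL L y * cos (2 * PI * INR (S m) * y)) 0 1) M
        - ((FL L 0 + FL L 1) / 2 - RInt (FL L) 0 1)) (sum_f_R0 (fun m => 2 * D m v) M - K0)).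
  { apply is_lim_seq_minus'.
    - apply is_lim_seq_ext with (fun L => sum_f_R0 (fun m => 2 * (D m v - D m (v + INR (S L)))) M).
      + intros L. apply sum_eq. intros m _. now rewrite Hterm.
      + generalize M as M'. assert (Hone : forall m, is_lim_seq (fun L => 2 * (D m v - D m (v + INR (S L)))) (2 * D m v)).
        { intros m. replace (Finite (2 * D m v)) with (Rbar_mult 2 (D m v - 0)) by (simpl; f_equal; ring).
          apply is_lim_seq_scal_l. apply is_lim_seq_minus'; [apply is_lim_seq_const | apply HD]. }
        induction M' as [|M' IH]; [apply Hone|]. cbn [sum_f_R0]. apply is_lim_seq_plus'; [apply IH | apply Hone].
    - apply (is_lim_seq_ext _ _ _ (fun L => eq_sym (Hmean L))).
      replace K0 with (/ 2 * / v ^ 2 + T2 v - / 2 * 0 - (/ v - 0)) by (unfold K0; ring).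
      apply is_lim_seq_minus'; [apply is_lim_seq_minus'; [apply is_lim_seq_plus'; [apply is_lim_seq_const|]|]|].
      + apply is_series_lim, T2_ex. lra.
      + apply (is_lim_seq_scal_l _ (/ 2) 0).
        apply is_lim_seq_ext with (fun L => / (INR (S L) + v) * / (INR (S L) + v)).
        { intros L. assert (0 < INR (S L)) by (apply lt_0_INR; lia). field. lra. }
        replace (Finite 0) with (Finite (0 * 0)) by (f_equal; ring). now apply is_lim_seq_mult'.
      + apply is_lim_seq_minus'; [apply is_lim_seq_const | exact HLv]. }
  assert (Hfin : Rabs (sum_f_R0 (fun m => 2 * D m v) M - K0) <= (2 / v ^ 3 + 4) * Feps M).
  { apply Rabs_le. split.
    - apply (lim_ge_const _ _ _ Hlim). intros L. specialize (Hmain L). apply Rabs_le_between in Hmain. lra.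
    - apply (lim_le_const _ _ _ Hlim). intros L. specialize (Hmain L). apply Rabs_le_between in Hmain. lra. }
  replace (sum_f_R0 (fun m => hfun (2 * PI * INR (S m) * v)) M - Hs v) with (v / 2 * (sum_f_R0 (fun m => 2 * D m v) M - K0)).
  - rewrite Rabs_mult, Rabs_pos_eq by lra.
    replace ((/ v ^ 2 + 2 * v) * Feps M) with (v / 2 * ((2 / v ^ 3 + 4) * Feps M)) by (field; lra).
    apply Rmult_le_compat_l; [lra | exact Hfin].
  - rewrite Rmult_minus_distr_l. f_equal.
    + rewrite <- sum_mult. apply sum_eq. intros m _. unfold D. field. lra.
    + unfold Hs, K0. field. lra.
Qed.

Lemma hfun_sum v : 0 < v -> is_series (fun m => hfun (2 * PI * INR (S m) * v)) (Hs v).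
Proof.
  intros Hv. apply is_series_lim.
  apply is_lim_seq_ext with (fun M => Hs v + (sum_f_R0 (fun m => hfun (2 * PI * INR (S m) * v)) M - Hs v)); [intros; ring|].
  replace (Finite (Hs v)) with (Finite (Hs v + 0)) by (f_equal; ring).
  apply is_lim_seq_plus'; [apply is_lim_seq_const|]. apply is_lim_seq_abs_0.
  apply is_lim_seq_le_le with (fun _ => 0) (fun M => (/ v ^ 2 + 2 * v) * Feps M).
  - intros M. split; [apply Rabs_pos | now apply hfun_sum_approx].
  - apply is_lim_seq_const.
  - replace (Finite 0) with (Rbar_mult (/ v ^ 2 + 2 * v) 0) by (simpl; f_equal; ring).
    apply is_lim_seq_scal_l, Feps_lim.
Qed.

(** * The integral of [h (u^2)] over the half line *)

Definition Gauss (x : R) : R := RInt (fun s => exp (- s ^ 2)) 0 x.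

Lemma gauss_cont s : continuous (fun s => exp (- s ^ 2)) s.
Proof. cont. Qed.

Lemma is_derive_Gauss x : is_derive Gauss x (exp (- x ^ 2)).
Proof.
  apply (is_derive_RInt (V := R_NormedModule) (fun s => exp (- s ^ 2)) _ 0).
  - apply filter_forall. intros X. apply (RInt_correct (V := R_CompleteNormedModule)).
    apply (ex_RInt_continuous (V := R_CompleteNormedModule)). intros; apply gauss_cont.
  - apply gauss_cont.
Qed.

(** The left side has derivative 0: the substitution [s = x t] identifies the derivative of the
    second term with [- 2 exp(- x^2) Gauss x]. At [x = 0] its value is [atan 1]. *)
Lemma Gauss_sq x : 0 <= x ->
  Gauss x ^ 2 + RInt (fun t => exp (- (x ^ 2 * (1 + t ^ 2))) / (1 + t ^ 2)) 0 1 = PI / 4.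
Proof.
  intros Hx.
  set (K := fun x t => exp (- (x ^ 2 * (1 + t ^ 2))) / (1 + t ^ 2)).
  set (K' := fun x t => - (2 * x * exp (- x ^ 2)) * exp (- (x * t) ^ 2)).
  assert (HK : forall x t, is_derive (fun x => K x t) x (K' x t)).
  { intros y t. unfold K, K'. pose proof (one_sq_pos t) as Ht. auto_derive; [trivial|].
    replace (- (y * (y * 1) * (1 + t * (t * 1)))) with (- y ^ 2 + - (y * t) ^ 2) by ring.
    rewrite exp_plus. simpl in *. rfield. lra. }
  assert (Hcont2 : forall y t, continuity_2d_pt K' y t).
  { intros y t. unfold K', pow. 
    repeat first [simple apply continuity_2d_pt_const | simple apply continuity_2d_pt_id1 | simple apply continuity_2d_pt_id2
     | simple apply cont2_exp | simple apply continuity_2d_pt_mult | simple apply continuity_2d_pt_opp]. }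
  assert (Hder : forall y, is_derive (fun y => RInt (fun t => K y t) 0 1) y (RInt (fun t => K' y t) 0 1)).
  { intros y. rewrite (RInt_ext (fun t => K' y t) (fun t => Derive (fun u => K u t) y)).
    2:{ intros t _. symmetry. apply is_derive_unique, HK. }
    apply (is_derive_RInt_param K).
    - apply filter_forall. intros z t _. eexists; apply HK.
    - intros t _. apply (continuity_2d_pt_ext K'); [|apply Hcont2].
      intros; symmetry; apply is_derive_unique, HK.
    - apply filter_forall. intros z. apply ex_RInt_cont; [lra|]. intros t _. unfold K.
      pose proof (one_sq_pos t). cont; lra. }
  assert (HK'int : forall y, RInt (fun t => K' y t) 0 1 = - (2 * exp (- y ^ 2)) * Gauss y).
  { intros y. unfold K', Gauss.
    pose proof (RInt_comp_lin (V := R_CompleteNormedModule) (fun s => exp (- s ^ 2)) y 0 0 1) as H.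
    rewrite Rmult_0_r, Rmult_1_r, !Rplus_0_r in H.
    rewrite <- H by (apply (ex_RInt_continuous (V := R_CompleteNormedModule)); intros; apply gauss_cont).
    rewrite <- RInt_scal'.
    - apply RInt_ext. intros t _. unfold scal; simpl. unfold mult; simpl. rewrite Rplus_0_r. rring.
    - apply ex_RInt_cont; [lra|]. intros t _. unfold scal; simpl. unfold mult; simpl. cont. }
  set (Phi := fun x => Gauss x ^ 2 + RInt (fun t => K x t) 0 1).
  assert (HPhi : forall y, is_derive Phi y 0).
  { intros y. refine (der_eq _ _ _ _ (der_plus (fun x => Gauss x ^ 2) (fun x => RInt (fun t => K x t) 0 1) _ _ _ _ (Hder y)) _).
    - apply is_derive_pow, is_derive_Gauss.
    - rewrite (HK'int y). simpl. ring. }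
  assert (H0 : Phi 0 = PI / 4).
  { unfold Phi, Gauss. rewrite RInt_point. unfold zero; simpl. rewrite Rmult_0_l, Rplus_0_l.
    rewrite (RInt_ext _ (fun t => / (1 + t ^ 2))).
    - rewrite (RInt_FTC atan); [rewrite atan_0, atan_1; rring | lra | |].
      + intros t _. apply is_derive_atan'.
      + intros t _. apply inv_one_sq_cont.
    - intros t _. unfold K. rewrite pow_ne_zero, Rmult_0_l, Ropp_0, exp_0 by lia. pose proof (one_sq_pos t). rfield. lra. }
  rewrite <- H0. symmetry. destruct Hx as [Hx|Hx].
  - apply (eq_is_derive Phi 0 x); [intros; apply HPhi | assumption].
  - now rewrite <- Hx.
Qed.

(** With [r = sqrt PI / 2], [Gauss_sq] reads [(r - Gauss x) (r + Gauss x) = I1] where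
    [0 <= I1 <= exp(- x^2)], and the second factor is at least [1/2]. *)
Lemma Gauss_bound x : 0 <= x -> 0 <= sqrt PI / 2 - Gauss x <= 2 * exp (- x ^ 2).
Proof.
  intros Hx. pose proof PI_RGT_0 as Hpi. pose proof PI2_3_2 as Hpi2.
  pose proof (Gauss_sq x Hx) as HG.
  assert (Hc : forall t, continuous (fun t => exp (- (x ^ 2 * (1 + t ^ 2))) / (1 + t ^ 2)) t).
  { intros t. pose proof (one_sq_pos t). cont; lra. }
  assert (HI : 0 <= RInt (fun t => exp (- (x ^ 2 * (1 + t ^ 2))) / (1 + t ^ 2)) 0 1 <= exp (- x ^ 2)).
  { split.
    - apply RInt_ge_0'; [lra | apply ex_RInt_cont; [lra | auto] |]. intros t _. pose proof (one_sq_pos t).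
      apply Rmult_le_pos; [left; apply exp_pos | left; now apply Rinv_0_lt_compat].
    - replace (exp (- x ^ 2)) with (RInt (fun _ => exp (- x ^ 2)) 0 1) by (rewrite RInt_const'; rring).
      apply RInt_le; [lra | apply ex_RInt_cont; [lra | auto] | apply ex_RInt_const |]. intros t _.
      pose proof (one_sq_pos t). pose proof (pow2_ge_0 t). pose proof (pow2_ge_0 x).
      apply Rle_trans with (exp (- (x ^ 2 * (1 + t ^ 2))) * 1).
      + apply Rmult_le_compat_l; [left; apply exp_pos|]. rewrite <- Rinv_1. apply Rinv_le_contravar; lra.
      + rewrite Rmult_1_r. assert (H3 : - (x ^ 2 * (1 + t ^ 2)) <= - x ^ 2) by nra.
        destruct H3 as [H3|H3]; [left; now apply exp_increasing | rewrite H3; lra]. }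
  assert (HGp : 0 <= Gauss x).
  { apply RInt_ge_0'; [assumption | |].
    - apply ex_RInt_cont; [assumption|]. intros; apply gauss_cont.
    - intros; left; apply exp_pos. }
  assert (Hs : sqrt PI * sqrt PI = PI) by (apply sqrt_sqrt; lra).
  assert (Hs1 : 1 <= sqrt PI) by (rewrite <- sqrt_1; apply sqrt_le_1_alt; lra).
  set (r := sqrt PI / 2) in *. assert (Hr : r * r = PI / 4) by (unfold r; lra).
  assert (Hr1 : / 2 <= r) by (unfold r; lra).
  set (I1 := RInt _ 0 1) in *.
  assert (HGr : (r - Gauss x) * (r + Gauss x) = I1) by (simpl in HG; lra).
  split.
  - destruct (Rle_lt_dec (Gauss x) r) as [H|H]; [lra|]. exfalso. nra.
  - destruct (Rle_lt_dec (r - Gauss x) 0) as [H|H]; [pose proof (exp_pos (- x ^ 2)); lra|].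
    assert ((r - Gauss x) * / 2 <= I1); [|lra].
    rewrite <- HGr. apply Rmult_le_compat_l; lra.
Qed.

Definition G2 (x : R) : R := RInt (fun s => s ^ 2 * exp (- s ^ 2)) 0 x.

Lemma G2_bound x : 0 < x -> Rabs (G2 x - sqrt PI / 4) <= 3 / 2 / x.
Proof.
  intros Hx.
  assert (HG2 : G2 x = / 2 * (Gauss x - x * exp (- x ^ 2))).
  { unfold G2. rewrite (RInt_FTC (fun x => / 2 * (Gauss x - x * exp (- x ^ 2)))).
    - unfold Gauss at 2. rewrite RInt_point. unfold zero; simpl. rring.
    - lra.
    - intros s _. 
      replace (s ^ 2 * exp (- s ^ 2)) with (/ 2 * (exp (- s ^ 2) - (exp (- s ^ 2) - 2 * s ^ 2 * exp (- s ^ 2)))) by field.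
      apply (der_scal (fun x => Gauss x - x * exp (- x ^ 2))). apply der_minus; [apply is_derive_Gauss|].
      auto_derive; [trivial|]. simpl. rring.
    - intros; cont. }
  pose proof (Gauss_bound x ltac:(lra)) as HG.
  assert (Hx2 : 0 < x ^ 2) by (apply pow_lt; lra).
  assert (He : 1 + x ^ 2 <= exp (x ^ 2)) by apply exp_ineq1_le.
  assert (He2 : exp (- x ^ 2) <= / (1 + x ^ 2)).
  { rewrite exp_Ropp. apply Rinv_le_contravar; lra. }
  assert (Hi : 0 < / (1 + x ^ 2)) by (apply Rinv_0_lt_compat; lra).
  assert (H1 : exp (- x ^ 2) <= / x).
  { apply Rle_trans with (1 := He2). apply Rinv_le_contravar; [assumption|]. pose proof (pow2_ge_0 (x - 1)); simpl in *; nra. }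
  assert (H2 : x * exp (- x ^ 2) <= / x).
  { apply Rle_trans with (x * / (1 + x ^ 2)); [apply Rmult_le_compat_l; lra|].
    apply Rmult_le_reg_r with (x * (1 + x ^ 2)); [nra|]. field_simplify; [nra|lra|lra]. }
  pose proof (exp_pos (- x ^ 2)). assert (0 <= x * exp (- x ^ 2)) by nra.
  rewrite HG2. apply Rabs_le. unfold Rdiv. lra.
Qed.
(** The square keeps the argument of [hfun] nonnegative, the range in which [Lap] is controlled. At
    [u = 0] the product [z * Lap 0 z] is 0 and tends to 0 by the bound [Lap 0 z <= PI/2]. *)
Lemma hfun_sq_cont a u : 0 < a -> continuous (fun u => hfun (a * u ^ 2)) u.
Proof.
  intros Ha. pose proof PI_RGT_0 as Hpi. destruct (Req_dec u 0) as [->|Hu].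
  - apply continuity_pt_filterlim. intros eps Heps.
    assert (Hd : 0 < Rmin 1 (eps / (a * PI))) by (apply Rmin_pos; [lra | apply Rdiv_lt_0_compat; nra]).
    exists (Rmin 1 (eps / (a * PI))). split; [exact Hd|]. intros y [[_ Hy0] Hy].
    simpl in *. unfold Rdist in *. rewrite Rminus_0_r in Hy.
    assert (Hy1 : 0 < Rabs y) by (apply Rabs_pos_lt; intros E; apply Hy0; now symmetry).
    assert (Hy2 : y ^ 2 = Rabs y * Rabs y) by (rewrite <- pow2_abs; ring).
    assert (Hz : 0 < a * y ^ 2) by (rewrite Hy2; apply Rmult_lt_0_compat; [assumption | nra]).
    unfold hfun. 
    replace (1 - a * (y * (y * 1)) * Lap 0 (a * (y * (y * 1))) - (1 - a * (0 * (0 * 1)) * Lap 0 (a * (0 * (0 * 1)))))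
      with (- (a * y ^ 2 * Lap 0 (a * y ^ 2))) by (simpl; ring).
    pose proof (Lap_pos 0 _ ltac:(lia) Hz). pose proof (Lap0_le _ Hz).
    rewrite Rabs_Ropp, Rabs_pos_eq by (apply Rmult_le_pos; lra).
    apply Rle_lt_trans with (a * y ^ 2 * (PI / 2)); [apply Rmult_le_compat_l; lra|].
    rewrite Hy2. pose proof (Rmin_l 1 (eps / (a * PI))). pose proof (Rmin_r 1 (eps / (a * PI))).
    assert (Rabs y * (a * PI) < eps).
    { apply Rmult_lt_reg_r with (/ (a * PI)); [apply Rinv_0_lt_compat; nra|].
      rewrite Rmult_assoc, Rinv_r, Rmult_1_r by nra. unfold Rdiv in *. lra. }
    assert (Rabs y * Rabs y <= Rabs y) by nra.
    assert (0 < a * PI) by nra. nra.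
  - assert (Hz : 0 < a * u ^ 2).
    { apply Rmult_lt_0_compat; [assumption|]. destruct (pow2_ge_0 u) as [H|H]; [assumption|].
      symmetry in H. apply Rsqr_0_uniq in H || (exfalso; nra). }
    unfold hfun. apply cont_minus; [apply cont_const|]. apply cont_mult; [cont|].
    apply (continuous_comp (fun u => a * u ^ 2) (Lap 0)); [cont|].
    eapply der_cont. apply is_derive_Lap; [lia | exact Hz].
Qed.

(** Partial fractions over [1 + r^4 = (r^2 - sqrt 2 r + 1) (r^2 + sqrt 2 r + 1)]. *)
Lemma rational_quartic r : is_derive (fun r => / sqrt 2 * (atan (sqrt 2 * r + 1) + atan (sqrt 2 * r - 1))
  + / (2 * sqrt 2) * (ln (r ^ 2 - sqrt 2 * r + 1) - ln (r ^ 2 + sqrt 2 * r + 1))) r (2 * r ^ 2 / (1 + r ^ 4)).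
Proof.
  assert (Hs : sqrt 2 * sqrt 2 = 2) by (apply sqrt_sqrt; lra).
  assert (Hs0 : 0 < sqrt 2) by (apply sqrt_lt_R0; lra).
  set (s := sqrt 2) in *.
  assert (H1 : 0 < r ^ 2 - s * r + 1) by (pose proof (pow2_ge_0 (r - s / 2)); simpl in *; nra).
  assert (H2 : 0 < r ^ 2 + s * r + 1) by (pose proof (pow2_ge_0 (r + s / 2)); simpl in *; nra).
  assert (H3 : 1 + (s * r + 1) ^ 2 = 2 * (r ^ 2 + s * r + 1)) by (simpl; nra).
  assert (H4 : 1 + (s * r - 1) ^ 2 = 2 * (r ^ 2 - s * r + 1)) by (simpl; nra).
  assert (H5 : (r ^ 2 - s * r + 1) * (r ^ 2 + s * r + 1) = 1 + r ^ 4) by (simpl; nra).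
  assert (Ha : forall b, is_derive (fun r => atan (s * r + b)) r (s / (1 + (s * r + b) ^ 2))).
  { intros b. pose proof (one_sq_pos (s * r + b)). auto_derive; [trivial|]. rfield. simpl in *; lra. }
  apply der_eq with (/ s * (s / (1 + (s * r + 1) ^ 2) + s / (1 + (s * r + - 1) ^ 2))
    + / (2 * s) * ((2 * r - s) / (r ^ 2 - s * r + 1) - (2 * r + s) / (r ^ 2 + s * r + 1))).
  - apply der_plus.
    + apply (der_scal (fun r => atan (s * r + 1) + atan (s * r - 1))). apply der_plus; apply Ha.
    + apply (der_scal (fun r => ln (r ^ 2 - s * r + 1) - ln (r ^ 2 + s * r + 1))). apply der_minus.
      * auto_derive; [simpl in *; lra|]. simpl in *. rfield. lra.
      * auto_derive; [simpl in *; lra|]. simpl in *. rfield. lra.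
  - replace (s * r + -1) with (s * r - 1) by ring. rewrite H3, H4, <- H5. rfield. repeat split; lra.
Qed.

Lemma quartic_int_lim : is_lim_seq (fun k => RInt (fun r => 2 * r ^ 2 / (1 + r ^ 4)) 0 (INR k)) (PI / sqrt 2).
Proof.
  assert (Hs : sqrt 2 * sqrt 2 = 2) by (apply sqrt_sqrt; lra).
  assert (Hs0 : 0 < sqrt 2) by (apply sqrt_lt_R0; lra).
  assert (Hq : forall r, 0 < 1 + r ^ 4) by (intros r; replace (r ^ 4) with ((r ^ 2) ^ 2) by ring; pose proof (pow2_ge_0 (r ^ 2)); lra).
  set (s := sqrt 2) in *.
  apply is_lim_seq_ext with (fun k => / s * (atan (s * INR k + 1) + atan (s * INR k - 1))
    + / (2 * s) * (ln (INR k ^ 2 - s * INR k + 1) - ln (INR k ^ 2 + s * INR k + 1))).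
  - intros k. symmetry. rewrite (RInt_FTC _ _ _ _ (pos_INR k) (fun r _ => rational_quartic r)).
    + fold s. rewrite Rmult_0_r, Rplus_0_l. replace (0 - 1) with (- (1)) by ring. rewrite atan_opp.
      replace (0 ^ 2 - 0 + 1) with 1 by ring. replace (0 ^ 2 + 0 + 1) with 1 by ring. rring.
    + intros r _. specialize (Hq r). cont; lra.
  - assert (Hs1 : 1 <= s) by nra.
    assert (Hlin : forall b, -1 <= b -> is_lim_seq (fun k => atan (s * INR k + b)) (PI / 2)).
    { intros b Hb. apply is_lim_seq_incr_1, is_lim_seq_incr_1.
      apply is_lim_seq_le_le with (fun k => PI / 2 - / INR (1 + k)) (fun _ => PI / 2).
      - intros k. change (1 + k)%nat with (S k). rewrite (S_INR (S k)).
        assert (Hk : 1 <= INR (S k)) by (apply (le_INR 1); lia). set (x := INR (S k)) in *.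
        assert (Hy : x <= s * (x + 1) + b) by nra. set (y := s * (x + 1) + b) in *.
        split; [|left; apply atan_bound].
        replace (atan y) with (PI / 2 - atan (/ y)) by (rewrite atan_inv by lra; ring).
        assert (/ y <= / x) by (apply Rinv_le_contravar; lra).
        assert (0 < / y) by (apply Rinv_0_lt_compat; lra).
        pose proof (atan_le (/ y) ltac:(lra)). lra.
      - replace (Finite (PI / 2)) with (Finite (PI / 2 - 0)) by (f_equal; ring).
        apply is_lim_seq_minus'; [apply is_lim_seq_const | apply inv_INR_lim].
      - apply is_lim_seq_const. }
    replace (PI / s) with (/ s * (PI / 2 + PI / 2) + / (2 * s) * 0) by (field; lra).
    apply is_lim_seq_plus'.
    + apply (is_lim_seq_scal_l _ (/ s) (PI / 2 + PI / 2)). apply is_lim_seq_plus'; apply Hlin; lra.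
    + apply (is_lim_seq_scal_l _ (/ (2 * s)) 0).
      assert (Hp : forall x, 0 < x ^ 2 - s * x + 1) by (intros x; pose proof (pow2_ge_0 (x - s / 2)); simpl in *; nra).
      assert (Hm : forall x, 0 < x ^ 2 + s * x + 1) by (intros x; pose proof (pow2_ge_0 (x + s / 2)); simpl in *; nra).
      apply is_lim_seq_incr_1.
      apply is_lim_seq_le_le with (fun k => - (10 * / INR (1 + k))) (fun _ => 0).
      * intros k. change (1 + k)%nat with (S k). assert (Hk : 1 <= INR (S k)) by (apply (le_INR 1); lia).
        set (x := INR (S k)) in *. specialize (Hp x). specialize (Hm x). split.
        -- apply Ropp_le_cancel. rewrite Ropp_involutive, Ropp_minus_distr.
           rewrite <- ln_div by assumption.
           apply Rle_trans with (1 := ln_le_sub1 _ (Rdiv_lt_0_compat _ _ Hm Hp)).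
           replace ((x ^ 2 + s * x + 1) / (x ^ 2 - s * x + 1) - 1) with (2 * s * x / (x ^ 2 - s * x + 1)) by (field; lra).
           assert (Hs2 : s <= 3 / 2) by nra.
           apply Rmult_le_reg_r with (x * (x ^ 2 - s * x + 1)); [nra|].
           replace (2 * s * x / (x ^ 2 - s * x + 1) * (x * (x ^ 2 - s * x + 1))) with (2 * s * x * x) by (field; lra).
           replace (10 * / x * (x * (x ^ 2 - s * x + 1))) with (10 * (x ^ 2 - s * x + 1)) by (field; lra).
           assert (s * x <= 3 / 2 * x) by (apply Rmult_le_compat_r; lra).
           assert (2 * s * x * x <= 3 * x * x) by (apply Rmult_le_compat_r; nra).
           pose proof (pow2_ge_0 (x - 15 / 14)). simpl in *. nra.
        -- apply Rle_minus. left. apply ln_increasing; [assumption|]. nra.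
      * replace (Finite 0) with (Finite (- (10 * 0))) by (f_equal; ring).
        apply (is_lim_seq_opp _ (Finite (10 * 0))). apply (is_lim_seq_scal_l _ 10 0), inv_INR_lim.
      * apply is_lim_seq_const.
Qed.
Lemma quartic_pos r : 0 < 1 + r ^ 4.
Proof. replace (r ^ 4) with ((r ^ 2) ^ 2) by rring. pose proof (pow2_ge_0 (r ^ 2)). lra. Qed.

Lemma is_derive_G2 x : is_derive G2 x (x ^ 2 * exp (- x ^ 2)).
Proof.
  assert (Hc : forall s, continuous (fun s => s ^ 2 * exp (- s ^ 2)) s) by (intros; cont).
  apply (is_derive_RInt (V := R_NormedModule) (fun s => s ^ 2 * exp (- s ^ 2)) _ 0).
  - apply filter_forall. intros X. apply (RInt_correct (V := R_CompleteNormedModule)).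
    apply (ex_RInt_continuous (V := R_CompleteNormedModule)). intros; apply Hc.
  - apply Hc.
Qed.

(** Putting [t = r^2] in the Laplace integral makes [hfun (u^2)] the integral over [r] of
    [2 u^2 r^5 exp(- u^2 r^2) / (1 + r^4)]. Integrating over [u] first gives
    [2 r^2 / (1 + r^4) * G2 (X r)], and [G2] tends to [sqrt PI / 4]; the constant is this limit
    times the quartic integral. *)
Lemma hfun_half1 X : 0 < X ->
  Rabs (RInt (fun u => hfun (u ^ 2)) 0 X - sqrt PI / 4 * (PI / sqrt 2)) <= 3 * PI / (4 * X).
Proof.
  intros HX. pose proof PI_RGT_0 as Hpi.
  set (F := fun u r => 2 * u ^ 2 * r ^ 5 * exp (- (u ^ 2 * r ^ 2)) * / (1 + r ^ 4)).
  assert (HF2 : forall u r, continuity_2d_pt F u r).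
  { intros u r. unfold F. apply continuity_2d_pt_mult.
    - unfold pow. cont2.
    - apply continuity_2d_pt_inv; [unfold pow; cont2 | pose proof (quartic_pos r); lra]. }
  (* Truncation at [r <= k] corresponds to [t <= k^2] in the Laplace integral, whence the bound
     [k * k] in [Ha]. *)
  set (Lk := fun k u => RInt (fun r => F u r) 0 (INR k)).
  assert (Ha : forall k u, Lk k u = u ^ 2 * RInt (lap_int 2 (u ^ 2)) 0 (INR (k * k))).
  { intros k u. unfold Lk.
    pose proof (RInt_comp (V := R_CompleteNormedModule) (lap_int 2 (u ^ 2)) (fun r => r ^ 2) (fun r => 2 * r) 0 (INR k)) as H.
    rewrite mult_INR. replace (INR k * INR k) with (INR k ^ 2) by rring.
    cbv beta in H. rewrite pow_ne_zero in H by lia. rewrite <- H.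
    - rewrite <- RInt_scal'.
      + apply RInt_ext. intros r _. unfold F, lap_int, scal; simpl. unfold mult; simpl. 
        pose proof (quartic_pos r) as Hr. simpl in Hr. rfield. simpl. lra.
      + apply ex_RInt_cont; [apply pos_INR|]. intros r _. unfold scal; simpl. unfold mult; simpl.
        apply cont_mult; [cont|]. apply (continuous_comp (fun r => r * (r * 1)) (lap_int 2 (u * (u * 1)))); [cont | apply lap_int_cont].
    - intros; apply lap_int_cont.
    - intros r _. split; [auto_derive; [trivial | rring] | cont]. }
  (* The part beyond [k^2] is at most [exp(- k^2 u^2) <= 1/(1 + k^2 u^2)], whose integral over [u]
     is at most [PI/(2k)] whatever [X] is. *)
  assert (Hb : forall k u, 0 < u -> (1 <= k)%nat -> Rabs (hfun (u ^ 2) - Lk k u) <= / (1 + INR k ^ 2 * u ^ 2)).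
  { intros k u Hu Hk. assert (Hz : 0 < u ^ 2) by now apply pow_lt.
    set (z := u ^ 2) in *. rewrite Ha. fold z. rewrite hfun_Lap2 by assumption.
    assert (Hmono : forall n m, (n <= m)%nat -> 0 <= RInt (lap_int 2 z) 0 (INR m) - RInt (lap_int 2 z) 0 (INR n)
        <= / z * (exp (- (z * INR n)) - exp (- (z * INR m)))).
    { intros n m Hnm. apply le_INR in Hnm. pose proof (pos_INR n).
      assert (Ex : ex_RInt (lap_int 2 z) (INR n) (INR m)) by (apply ex_RInt_cont; [assumption|]; intros; apply lap_int_cont).
      rewrite (RInt_Chasles' (lap_int 2 z) 0 (INR n) (INR m) (ex_lap _ _ _) Ex).
      replace (RInt (lap_int 2 z) 0 (INR n) + RInt (lap_int 2 z) (INR n) (INR m) - RInt (lap_int 2 z) 0 (INR n)) with (RInt (lap_int 2 z) (INR n) (INR m)) by lra.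
      split.
      - apply RInt_ge_0'; [assumption | assumption |]. intros; apply lap_int_bound; [lia | lra].
      - apply Rle_trans with (RInt (fun t => exp (- (z * t))) (INR n) (INR m)).
        + apply RInt_le; [assumption | assumption | apply ex_RInt_cont; [assumption|]; intros; cont |].
          intros t Ht. unfold lap_int. pose proof (one_sq_pos t). pose proof (pow2_ge_0 t).
          rewrite <- (Rmult_1_l (exp (- (z * t)))) at 2. unfold Rdiv. rewrite Rmult_assoc, (Rmult_comm (exp _)), <- Rmult_assoc.
          apply Rmult_le_compat_r; [left; apply exp_pos|].
          apply Rmult_le_reg_r with (1 + t ^ 2); [assumption|]. rewrite Rmult_assoc, Rinv_l by lra. lra.
        + rewrite (RInt_FTC (fun t => - (/ z * exp (- (z * t))))).
          * right. rring.
          * assumption.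
          * intros. auto_derive; [trivial|]. rfield. lra.
          * intros; cont. }
    pose proof (Lap_lim 2 z ltac:(lia) Hz) as HL.
    assert (Hlo : RInt (lap_int 2 z) 0 (INR (k * k)) <= Lap 2 z).
    { apply (is_lim_seq_incr_compare _ _ HL). intros n. specialize (Hmono n (S n) ltac:(lia)). lra. }
    assert (Hhi : Lap 2 z <= RInt (lap_int 2 z) 0 (INR (k * k)) + / z * exp (- (z * INR (k * k)))).
    { apply is_lim_seq_incr_n with (N := (k * k)%nat) in HL.
      apply (lim_le_const _ _ _ HL). intros n. specialize (Hmono (k * k)%nat (n + k * k)%nat ltac:(lia)).
      assert (0 < / z * exp (- (z * INR (n + k * k)))) by (apply Rmult_lt_0_compat; [now apply Rinv_0_lt_compat | apply exp_pos]). lra. }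
    rewrite <- Rmult_minus_distr_l, Rabs_pos_eq by (apply Rmult_le_pos; lra).
    apply Rle_trans with (z * (/ z * exp (- (z * INR (k * k))))); [apply Rmult_le_compat_l; lra|].
    rewrite <- Rmult_assoc, Rinv_r, Rmult_1_l, exp_Ropp by lra.
    rewrite mult_INR. replace (z * (INR k * INR k)) with (INR k ^ 2 * z) by rring.
    assert (0 <= INR k ^ 2 * z) by (apply Rmult_le_pos; [apply pow2_ge_0 | lra]).
    apply Rinv_le_contravar; [lra | apply exp_ineq1_le]. }
  assert (Exh : ex_RInt (fun u => hfun (u ^ 2)) 0 X).
  { apply ex_RInt_cont; [lra|]. intros u _.
    apply (continuous_ext (fun u => hfun (1 * u ^ 2))); [intros; now rewrite Rmult_1_l | apply hfun_sq_cont; lra]. }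
  assert (ExL : forall k, ex_RInt (Lk k) 0 X).
  { intros k. apply ex_RInt_cont; [lra|]. intros u _. apply cont_RInt_param; [apply pos_INR | exact HF2]. }
  assert (Hd : forall k, (1 <= k)%nat -> Rabs (RInt (fun u => hfun (u ^ 2)) 0 X - RInt (Lk k) 0 X) <= PI / 2 * / INR k).
  { intros k Hk. assert (Hk1 : 1 <= INR k) by now apply (le_INR 1).
    rewrite <- (RInt_minus' _ _ _ _ Exh (ExL k)).
    assert (Hp : forall u, 0 < 1 + INR k ^ 2 * u ^ 2).
    { intros u. pose proof (pow2_ge_0 (INR k)). pose proof (pow2_ge_0 u). nra. }
    apply Rle_trans with (RInt (fun u => / (1 + INR k ^ 2 * u ^ 2)) 0 X).
    - apply RInt_Rabs_le; [lra | now apply ex_RInt_minus' | |].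
      + apply ex_RInt_cont; [lra|]. intros u _. specialize (Hp u). cont. lra.
      + intros u Hu. apply Hb; [lra | assumption].
    - rewrite (RInt_FTC (fun u => / INR k * atan (INR k * u))).
      + rewrite Rmult_0_r, atan_0, Rmult_0_r, Rminus_0_r. rewrite Rmult_comm. 
        apply Rmult_le_compat_r; [left; apply Rinv_0_lt_compat; lra | left; apply atan_bound].
      + lra.
      + intros u _. specialize (Hp u). auto_derive; [trivial|]. rfield. simpl in *. split; lra.
      + intros u _. specialize (Hp u). cont. lra. }
  assert (HG2c : forall x, continuous G2 x) by (intros; eapply der_cont; apply is_derive_G2).
  assert (Hc : forall k, RInt (Lk k) 0 X = RInt (fun r => 2 * r ^ 2 / (1 + r ^ 4) * G2 (X * r)) 0 (INR k)).
  { intros k. unfold Lk. rewrite fubini by (lra || apply pos_INR || exact HF2).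
    apply RInt_ext. intros r Hr. rewrite Rmin_left in Hr by apply pos_INR.
    pose proof (quartic_pos r) as Hq.
    rewrite (RInt_FTC (fun u => 2 * r ^ 2 / (1 + r ^ 4) * G2 (u * r))).
    - rewrite Rmult_0_l. unfold G2 at 2. rewrite RInt_point. unfold zero; simpl. rring.
    - lra.
    - intros u _. refine (der_eq _ _ _ _ (der_scal (fun u => G2 (u * r)) _ u _ _) _).
      + apply (is_derive_comp G2 (fun u => u * r)); [apply is_derive_G2|]. auto_derive; [trivial | reflexivity].
      + unfold F, scal; simpl. unfold mult; simpl. replace (u * r * (u * r * 1)) with (u * (u * 1) * (r * (r * 1))) by rring. rfield. simpl in Hq; lra.
    - intros u _. unfold F. cont. }
  assert (He : forall k, Rabs (RInt (Lk k) 0 X - sqrt PI / 4 * RInt (fun r => 2 * r ^ 2 / (1 + r ^ 4)) 0 (INR k)) <= 3 * PI / (4 * X)).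
  { intros k. pose proof (pos_INR k) as Hk.
    assert (E1 : ex_RInt (fun r => 2 * r ^ 2 / (1 + r ^ 4) * G2 (X * r)) 0 (INR k)).
    { apply ex_RInt_cont; [assumption|]. intros r _. pose proof (quartic_pos r). apply cont_mult; [cont; lra|].
      apply (continuous_comp (fun r => X * r) G2); [cont | apply HG2c]. }
    assert (E2 : ex_RInt (fun r => 2 * r ^ 2 / (1 + r ^ 4)) 0 (INR k)).
    { apply ex_RInt_cont; [assumption|]. intros r _. pose proof (quartic_pos r). cont; lra. }
    rewrite Hc, <- (RInt_scal' _ (sqrt PI / 4) _ _ E2), <- (RInt_minus' _ _ _ _ E1 (ex_RInt_scal' _ _ _ _ E2)).
    apply Rle_trans with (RInt (fun r => 3 / 2 / X * (2 * r / (1 + r ^ 4))) 0 (INR k)).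
    - apply RInt_Rabs_le; [assumption | apply (ex_RInt_minus' _ _ _ _ E1 (ex_RInt_scal' _ _ _ _ E2)) | |].
      + apply ex_RInt_cont; [assumption|]. intros r _. pose proof (quartic_pos r). cont; lra.
      + intros r Hr. pose proof (quartic_pos r) as Hq.
        replace (2 * r ^ 2 / (1 + r ^ 4) * G2 (X * r) - sqrt PI / 4 * (2 * r ^ 2 / (1 + r ^ 4))) with (2 * r ^ 2 / (1 + r ^ 4) * (G2 (X * r) - sqrt PI / 4)) by rring.
        assert (Hp : 0 <= 2 * r ^ 2 / (1 + r ^ 4)) by (apply Rmult_le_pos; [pose proof (pow2_ge_0 r); lra | left; now apply Rinv_0_lt_compat]).
        rewrite Rabs_mult, Rabs_pos_eq by assumption.
        replace (3 / 2 / X * (2 * r / (1 + r ^ 4))) with (2 * r ^ 2 / (1 + r ^ 4) * (3 / 2 / (X * r))) by (field; repeat split; nra).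
        apply Rmult_le_compat_l; [assumption|]. apply G2_bound. nra.
    - rewrite (RInt_FTC (fun r => 3 / 2 / X * atan (r ^ 2))).
      + rewrite pow_ne_zero, atan_0, Rmult_0_r, Rminus_0_r by lia.
        replace (3 * PI / (4 * X)) with (3 / 2 / X * (PI / 2)) by (field; lra).
        apply Rmult_le_compat_l; [unfold Rdiv; apply Rmult_le_pos; [lra | left; apply Rinv_0_lt_compat; lra]|].
        left; apply atan_bound.
      + assumption.
      + intros r _. pose proof (quartic_pos r). apply (der_scal (fun r => atan (r ^ 2))). auto_derive; [trivial|]. simpl in *. rfield. 
        lra.
      + intros r _. pose proof (quartic_pos r). cont; lra. }
  set (J := RInt (fun u => hfun (u ^ 2)) 0 X) in *.
  set (Qk := fun k => RInt (fun r => 2 * r ^ 2 / (1 + r ^ 4)) 0 (INR k)) in *.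
  assert (Hlim : is_lim_seq (fun k => J - sqrt PI / 4 * Qk (S k)) (J - sqrt PI / 4 * (PI / sqrt 2))).
  { apply is_lim_seq_minus'; [apply is_lim_seq_const|].
    apply (is_lim_seq_scal_l _ (sqrt PI / 4) (PI / sqrt 2)). apply (is_lim_seq_incr_1 Qk), quartic_int_lim. }
  assert (Hbd : forall k, Rabs (J - sqrt PI / 4 * Qk (S k)) <= 3 * PI / (4 * X) + PI / 2 * / INR (1 + k)).
  { intros k. replace (J - sqrt PI / 4 * Qk (S k)) with ((RInt (Lk (S k)) 0 X - sqrt PI / 4 * Qk (S k)) + (J - RInt (Lk (S k)) 0 X)) by rring.
    apply Rle_trans with (1 := Rabs_triang _ _). apply Rplus_le_compat; [apply He | apply Hd; lia]. }
  assert (Hlim2 : is_lim_seq (fun k => 3 * PI / (4 * X) + PI / 2 * / INR (1 + k)) (3 * PI / (4 * X))).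
  { replace (Finite (3 * PI / (4 * X))) with (Finite (3 * PI / (4 * X) + PI / 2 * 0)) by (f_equal; ring).
    apply is_lim_seq_plus'; [apply is_lim_seq_const|]. apply (is_lim_seq_scal_l _ (PI / 2) 0), inv_INR_lim. }
  apply (is_lim_seq_abs _ (Finite _)) in Hlim.
  exact (is_lim_seq_le _ _ _ _ Hbd Hlim Hlim2).
Qed.

(* The constant is the integral over the half line. *)
Lemma hfun_half a X : 0 < a -> 0 < X ->
  0 <= sqrt PI / 4 * (PI / sqrt 2) / sqrt a - RInt (fun u => hfun (a * u ^ 2)) 0 X <= 2 / (3 * a ^ 2 * X ^ 3).
Proof.
  intros Ha HX. pose proof PI_RGT_0 as Hpi.
  assert (Hsa : 0 < sqrt a) by now apply sqrt_lt_R0.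
  assert (Hss : sqrt a * sqrt a = a) by (apply sqrt_sqrt; lra).
  set (C0 := sqrt PI / 4 * (PI / sqrt 2)).
  assert (Ex : forall p q, p <= q -> ex_RInt (fun u => hfun (a * u ^ 2)) p q).
  { intros p q Hpq. apply ex_RInt_cont; [assumption|]. intros; now apply hfun_sq_cont. }
  assert (Hscale : forall Y, 0 < Y -> Rabs (RInt (fun u => hfun (a * u ^ 2)) 0 Y - C0 / sqrt a) <= 3 * PI / (4 * a * Y)).
  { intros Y HY.
    assert (Hc1 : forall u, continuous (fun u => hfun (u ^ 2)) u).
    { intros u. apply (continuous_ext (fun u => hfun (1 * u ^ 2))); [intros; now rewrite Rmult_1_l | apply hfun_sq_cont; lra]. }
    pose proof (RInt_comp_lin (V := R_CompleteNormedModule) (fun u => hfun (u ^ 2)) (sqrt a) 0 0 Y) as H.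
    rewrite Rmult_0_r, !Rplus_0_r in H.
    assert (H1 : sqrt a * RInt (fun u => hfun (a * u ^ 2)) 0 Y = RInt (fun u => hfun (u ^ 2)) 0 (sqrt a * Y)).
    { rewrite <- H by (apply (ex_RInt_continuous (V := R_CompleteNormedModule)); intros; apply Hc1).
      rewrite <- (RInt_scal' _ (sqrt a) _ _ (Ex 0 Y ltac:(lra))).
      apply RInt_ext. intros u _. unfold scal; simpl. unfold mult; simpl. rewrite Rplus_0_r.
      do 2 f_equal. rewrite <- Hss at 1. ring. }
    assert (Hgen : forall s b, 0 < s -> s * s = b -> 3 * PI / (4 * b * Y) = / s * (3 * PI / (4 * (s * Y)))).
    { intros s b Hs <-. field. lra. }
    pose proof (hfun_half1 (sqrt a * Y) ltac:(nra)) as H2. rewrite <- H1 in H2. fold C0 in H2.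
    replace (RInt (fun u => hfun (a * u ^ 2)) 0 Y - C0 / sqrt a) with (/ sqrt a * (sqrt a * RInt (fun u => hfun (a * u ^ 2)) 0 Y - C0)) by (field; lra).
    rewrite Rabs_mult, Rabs_pos_eq by (left; now apply Rinv_0_lt_compat).
    replace (3 * PI / (4 * a * Y)) with (/ sqrt a * (3 * PI / (4 * (sqrt a * Y)))) by (symmetry; apply Hgen; assumption).
    apply Rmult_le_compat_l; [left; now apply Rinv_0_lt_compat | assumption]. }
  assert (Hlim : is_lim_seq (fun k => RInt (fun u => hfun (a * u ^ 2)) 0 (X + INR k) - RInt (fun u => hfun (a * u ^ 2)) 0 X)
     (C0 / sqrt a - RInt (fun u => hfun (a * u ^ 2)) 0 X)).
  { apply is_lim_seq_minus'; [|apply is_lim_seq_const].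
    apply is_lim_seq_ext with (fun k => C0 / sqrt a + (RInt (fun u => hfun (a * u ^ 2)) 0 (X + INR k) - C0 / sqrt a)); [intros; ring|].
    replace (Finite (C0 / sqrt a)) with (Finite (C0 / sqrt a + 0)) by (f_equal; ring).
    apply is_lim_seq_plus'; [apply is_lim_seq_const|]. apply is_lim_seq_abs_0. apply is_lim_seq_incr_1.
    apply is_lim_seq_le_le with (fun _ => 0) (fun k => 3 * PI / (4 * a) * / INR (1 + k)).
    - intros k. change (1 + k)%nat with (S k). assert (Hk : 0 < INR (S k)) by (apply lt_0_INR; lia).
      split; [apply Rabs_pos|]. apply Rle_trans with (1 := Hscale (X + INR (S k)) ltac:(lra)).
      replace (3 * PI / (4 * a * (X + INR (S k)))) with (3 * PI / (4 * a) * / (X + INR (S k))) by (field; lra).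
      apply Rmult_le_compat_l; [apply Rmult_le_pos; [lra | left; apply Rinv_0_lt_compat; lra]|].
      apply Rinv_le_contravar; lra.
    - apply is_lim_seq_const.
    - replace (Finite 0) with (Rbar_mult (3 * PI / (4 * a)) 0) by (simpl; f_equal; ring).
      apply is_lim_seq_scal_l, inv_INR_lim. }
  assert (Hdiff : forall k, 0 <= RInt (fun u => hfun (a * u ^ 2)) 0 (X + INR k) - RInt (fun u => hfun (a * u ^ 2)) 0 X <= 2 / (3 * a ^ 2 * X ^ 3)).
  { intros k. pose proof (pos_INR k) as Hk.
    rewrite (RInt_Chasles' _ 0 X (X + INR k) (Ex 0 X ltac:(lra)) (Ex X (X + INR k) ltac:(lra))).
    replace (RInt (fun u => hfun (a * u ^ 2)) 0 X + RInt (fun u => hfun (a * u ^ 2)) X (X + INR k) - RInt (fun u => hfun (a * u ^ 2)) 0 X)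
      with (RInt (fun u => hfun (a * u ^ 2)) X (X + INR k)) by lra.
    assert (Hz : forall u, X <= u -> 0 < a * u ^ 2) by (intros u Hu; apply Rmult_lt_0_compat; [assumption | apply pow_lt; lra]).
    split.
    - apply RInt_ge_0'; [lra | apply Ex; lra|]. intros u Hu. apply hfun_pos, Hz; lra.
    - apply Rle_trans with (RInt (fun u => 2 / a ^ 2 * / u ^ 4) X (X + INR k)).
      + apply RInt_le; [lra | apply Ex; lra | |].
        * apply ex_RInt_cont; [lra|]. intros u Hu. cont; apply pow_nonzero; lra.
        * intros u Hu. apply Rle_trans with (1 := hfun_decay _ (Hz u ltac:(lra))). right. field. split; lra.
      + rewrite (RInt_FTC (fun u => - (2 / (3 * a ^ 2) * / u ^ 3))).
        * replace (2 / (3 * a ^ 2 * X ^ 3)) with (2 / (3 * a ^ 2) * / X ^ 3) by (field; split; lra).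
          assert (0 < 2 / (3 * a ^ 2)) by (apply Rdiv_lt_0_compat; [lra | apply Rmult_lt_0_compat; [lra | now apply pow_lt]]).
          assert (0 < / (X + INR k) ^ 3) by (apply Rinv_0_lt_compat, pow_lt; lra). nra.
        * lra.
        * intros u Hu. auto_derive; [apply Rgt_not_eq; assert (0 < u ^ 3) by (apply pow_lt; lra); simpl in *; lra|]. simpl. rfield. split; lra.
        * intros u Hu. cont; apply pow_nonzero; lra. }
  split.
  - apply (lim_ge_const _ _ _ Hlim). intros; apply Hdiff.
  - apply (lim_le_const _ _ _ Hlim). intros; apply Hdiff.
Qed.

(** * Expansion of the Laplace transforms at the origin *)

(** [cs p] and [sn p] are the values at 0 of the p-th derivatives of cosine and sine. *)
Fixpoint cs (p : nat) : R :=
  match p with O => 1 | S q => match q with O => 0 | S r => - cs r end end.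
Definition sn (p : nat) : R := match p with O => 0 | S q => cs q end.

Lemma cs_S p : cs (S p) = - sn p.
Proof. destruct p; simpl; ring. Qed.
Lemma sn_S p : sn (S p) = cs p.
Proof. reflexivity. Qed.

Lemma cs_sn_bound p : Rabs (cs p) <= 1 /\ Rabs (sn p) <= 1.
Proof.
  induction p as [|p [IH1 IH2]]; simpl sn.
  - simpl. rewrite Rabs_R1, Rabs_R0. lra.
  - rewrite cs_S, Rabs_Ropp. tauto.
Qed.

(* The sine and cosine series with [E p] in place of the p-th power:
   [E p = c ^ p] gives [sin (c x)] and [cos (c x)]. *)
Definition TS (E : nat -> R) (x : R) : R := PSeries (fun p => sn p * E p / INR (fact p)) x.
Definition TC (E : nat -> R) (x : R) : R := PSeries (fun p => cs p * E p / INR (fact p)) x.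
(** Geometric growth, which makes [TS E] and [TC E] converge on the whole line. *)
Definition geo (E : nat -> R) : Prop := exists M B, 0 <= M /\ 0 <= B /\ forall p, Rabs (E p) <= M * B ^ p.

Lemma pow_fact_le_exp y p : 0 <= y -> y ^ p / INR (fact p) <= exp y.
Proof.
  intros Hy. pose proof (is_exp_Reals y) as H. apply is_pseries_R, is_series_lim in H.
  apply Rle_trans with (sum_f_R0 (fun n => / INR (fact n) * y ^ n) p).
  - assert (Hp : forall n, 0 <= / INR (fact n) * y ^ n).
    { intros n. apply Rmult_le_pos; [left; apply Rinv_0_lt_compat, INR_fact_lt_0 | now apply pow_le]. }
    destruct p as [|p]; cbn [sum_f_R0]; [unfold Rdiv; rewrite Rmult_comm; lra|].
    pose proof (cond_pos_sum _ p Hp). unfold Rdiv. rewrite (Rmult_comm (y ^ S p)). lra.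
  - refine (is_lim_seq_incr_compare _ _ H _ p). intros n. cbn [sum_f_R0].
    assert (0 <= / INR (fact (S n)) * y ^ S n); [|lra].
    apply Rmult_le_pos; [left; apply Rinv_0_lt_compat, INR_fact_lt_0 | now apply pow_le].
Qed.

Lemma geo_radius (s E : nat -> R) x : (forall p, Rabs (s p) <= 1) -> geo E ->
  Rbar_lt (Rabs x) (CV_radius (fun p => s p * E p / INR (fact p))).
Proof.
  intros Hs [M [B [HM [HB HE]]]].
  apply Rbar_lt_le_trans with (Rabs x + 1); [simpl; lra|].
  apply (proj1 (CV_radius_bounded _)). exists (M * exp (B * (Rabs x + 1))). intros n.
  pose proof (Rabs_pos x) as Hx. pose proof (INR_fact_lt_0 n) as Hf.
  unfold Rdiv. rewrite !Rabs_mult, Rabs_inv, (Rabs_pos_eq (INR (fact n))), <- RPow_abs, (Rabs_pos_eq (Rabs x + 1)) by lra.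
  apply Rle_trans with (1 * (M * B ^ n) * / INR (fact n) * (Rabs x + 1) ^ n).
  - apply Rmult_le_compat_r; [apply pow_le; lra|]. apply Rmult_le_compat_r; [left; now apply Rinv_0_lt_compat|].
    apply Rmult_le_compat; try apply Rabs_pos; auto.
  - replace (1 * (M * B ^ n) * / INR (fact n) * (Rabs x + 1) ^ n) with (M * ((B * (Rabs x + 1)) ^ n / INR (fact n))).
    + apply Rmult_le_compat_l; [assumption|]. apply pow_fact_le_exp. nra.
    + rewrite Rpow_mult_distr. field. lra.
Qed.

Lemma radius_S E x : geo E -> Rbar_lt (Rabs x) (CV_radius (fun p => sn p * E p / INR (fact p))).
Proof. apply geo_radius. intros; apply cs_sn_bound. Qed.
Lemma radius_C E x : geo E -> Rbar_lt (Rabs x) (CV_radius (fun p => cs p * E p / INR (fact p))).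
Proof. apply geo_radius. intros; apply cs_sn_bound. Qed.

Lemma is_derive_TS E x : geo E -> is_derive (TS E) x (TC (fun p => E (S p)) x).
Proof.
  intros HE. unfold TS, TC. rewrite (PSeries_ext _ (PS_derive (fun p => sn p * E p / INR (fact p)))).
  - apply is_derive_PSeries, radius_S, HE.
  - intros p. unfold PS_derive. rewrite sn_S, fact_simpl, mult_INR. pose proof (INR_fact_lt_0 p).
    field. split; [lra | apply not_0_INR; lia].
Qed.

Lemma is_derive_TC E x : geo E -> is_derive (TC E) x (- TS (fun p => E (S p)) x).
Proof.
  intros HE. unfold TS, TC. rewrite <- PSeries_opp. rewrite (PSeries_ext _ (PS_derive (fun p => cs p * E p / INR (fact p)))).
  - apply is_derive_PSeries, radius_C, HE.
  - intros p. unfold PS_derive, PS_opp. rewrite cs_S, fact_simpl, mult_INR. pose proof (INR_fact_lt_0 p).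
    pose proof (not_0_INR (S p) ltac:(lia)) as Hr. set (r := INR (S p)) in *.
    unfold opp; simpl. rfield. split; lra.
Qed.

Lemma TS_ext E F x : (forall p, E p = F p) -> TS E x = TS F x.
Proof. intros H. apply PSeries_ext. intros; now rewrite H. Qed.
Lemma TC_ext E F x : (forall p, E p = F p) -> TC E x = TC F x.
Proof. intros H. apply PSeries_ext. intros; now rewrite H. Qed.

Lemma TS_lin E F a b x : geo E -> geo F ->
  TS (fun p => a * E p + b * F p) x = a * TS E x + b * TS F x.
Proof.
  intros HE HF. unfold TS. rewrite <- !PSeries_scal, <- PSeries_plus.
  - apply PSeries_ext. intros p. unfold PS_plus, PS_scal, plus, scal; simpl. unfold mult; simpl. rfield. apply INR_fact_neq_0.
  - apply (ex_pseries_scal (K := R_AbsRing) (V := R_NormedModule)); [apply Rmult_comm | apply CV_radius_inside, radius_S, HE].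
  - apply (ex_pseries_scal (K := R_AbsRing) (V := R_NormedModule)); [apply Rmult_comm | apply CV_radius_inside, radius_S, HF].
Qed.

Lemma TC_lin E F a b x : geo E -> geo F ->
  TC (fun p => a * E p + b * F p) x = a * TC E x + b * TC F x.
Proof.
  intros HE HF. unfold TC. rewrite <- !PSeries_scal, <- PSeries_plus.
  - apply PSeries_ext. intros p. unfold PS_plus, PS_scal, plus, scal; simpl. unfold mult; simpl. rfield. apply INR_fact_neq_0.
  - apply (ex_pseries_scal (K := R_AbsRing) (V := R_NormedModule)); [apply Rmult_comm | apply CV_radius_inside, radius_C, HE].
  - apply (ex_pseries_scal (K := R_AbsRing) (V := R_NormedModule)); [apply Rmult_comm | apply CV_radius_inside, radius_C, HF].
Qed.

Lemma geo_pow c : geo (fun p => c ^ p).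
Proof. exists 1, (Rabs c). split; [lra|]. split; [apply Rabs_pos|]. intros p. rewrite RPow_abs. lra. Qed.

Lemma const_on_R (F : R -> R) : (forall x, is_derive F x 0) -> forall x y, F x = F y.
Proof.
  intros H. assert (H1 : forall x y, x < y -> F x = F y) by (intros x y Hxy; apply eq_is_derive; [intros; apply H | assumption]).
  intros x y. destruct (Rtotal_order x y) as [Hxy|[Hxy|Hxy]]; [auto | now subst | symmetry; auto].
Qed.

(** The series and the functions solve the same linear system, so the sum of the squares of their
    differences has derivative 0, and it vanishes at 0. *)
Lemma TSC_pow c x : TS (fun p => c ^ p) x = sin (c * x) /\ TC (fun p => c ^ p) x = cos (c * x).
Proof.
  assert (HS : forall x, is_derive (TS (fun p => c ^ p)) x (c * TC (fun p => c ^ p) x)).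
  { intros y. eapply der_eq; [apply is_derive_TS, geo_pow|].
    rewrite (TC_ext _ (fun p => c * c ^ p + 0 * c ^ p)) by (intros; simpl; ring).
    rewrite (TC_lin (fun p => c ^ p) (fun p => c ^ p)) by apply geo_pow. rring. }
  assert (HC : forall x, is_derive (TC (fun p => c ^ p)) x (- (c * TS (fun p => c ^ p) x))).
  { intros y. eapply der_eq; [apply is_derive_TC, geo_pow|].
    rewrite (TS_ext _ (fun p => c * c ^ p + 0 * c ^ p)) by (intros; simpl; ring).
    rewrite (TS_lin (fun p => c ^ p) (fun p => c ^ p)) by apply geo_pow. rring. }
  set (S := TS (fun p => c ^ p)) in *. set (K := TC (fun p => c ^ p)) in *.
  set (F := fun x => (S x - sin (c * x)) ^ 2 + (K x - cos (c * x)) ^ 2).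
  assert (HF : forall y, is_derive F y 0).
  { intros y. eapply der_eq.
    - apply der_plus; apply is_derive_pow; apply der_minus; [apply HS | | apply HC |].
      + auto_derive; [trivial | reflexivity].
      + auto_derive; [trivial | reflexivity].
    - simpl. rring. }
  assert (H0 : F 0 = 0).
  { unfold F, S, K, TS, TC. rewrite !PSeries_0, Rmult_0_r, sin_0, cos_0. simpl. field. }
  assert (Hx : F x = 0) by (rewrite (const_on_R F HF x 0); exact H0).
  unfold F in Hx. pose proof (pow2_ge_0 (S x - sin (c * x))). pose proof (pow2_ge_0 (K x - cos (c * x))).
  split; apply Rminus_diag_uniq; apply Rsqr_0_uniq; rewrite Rsqr_pow2; lra.
Qed.

(* Chosen so that [Lam p c := c ^ p * ln (1 - c) + Ep c p] satisfies [Lam p' = p * Lam (p - 1) - 1 / (1 - c)]: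
   differentiating the expansion of the Laplace transform in [x] then closes up. *)
Fixpoint Ep (c : R) (p : nat) : R :=
  match p with O => 0 | S q => c * Ep c q + (1 - c ^ S q) / INR (S q) end.

Lemma Ep_bound c p : -1 <= c <= 1 -> Rabs (Ep c p) <= 2 * INR p.
Proof.
  intros Hc. assert (Hc1 : Rabs c <= 1) by now apply Rabs_le.
  induction p as [|p IH]; [simpl; rewrite Rabs_R0; lra|].
  cbn [Ep]. apply Rle_trans with (1 := Rabs_triang _ _). rewrite (S_INR p), Rmult_plus_distr_l.
  apply Rplus_le_compat.
  - rewrite Rabs_mult. pose proof (Rabs_pos c). pose proof (Rabs_pos (Ep c p)). nra.
  - rewrite <- S_INR. assert (H1 : 1 <= INR (S p)) by (apply (le_INR 1); lia).
    unfold Rdiv. rewrite Rabs_mult, Rabs_inv, (Rabs_pos_eq (INR (S p))) by lra.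
    assert (Hp : Rabs (c ^ S p) <= 1).
    { rewrite <- RPow_abs, <- (pow1 (S p)). apply pow_incr. split; [apply Rabs_pos | assumption]. }
    assert (H2 : Rabs (1 - c ^ S p) <= 2) by (apply Rabs_le_between in Hp; apply Rabs_le; lra).
    assert (H3 : 0 < / INR (S p) <= 1).
    { split; [apply Rinv_0_lt_compat; lra|]. rewrite <- Rinv_1. apply Rinv_le_contravar; lra. }
    pose proof (Rabs_pos (1 - c ^ S p)). nra.
Qed.

Lemma INR_le_pow2 p : INR p <= 2 ^ p.
Proof. induction p as [|p IH]; [simpl; lra|]. rewrite S_INR. pose proof (pow_lt 2 p ltac:(lra)). 
  assert (1 <= 2 ^ p) by (apply pow_R1_Rle; lra). simpl. lra. Qed.

Lemma geo_Ep c : -1 <= c <= 1 -> geo (Ep c).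
Proof.
  intros Hc. exists 2, 2. split; [lra|]. split; [lra|]. intros p.
  apply Rle_trans with (1 := Ep_bound c p Hc). pose proof (INR_le_pow2 p). lra.
Qed.

(** Differentiation shifts [Ep], and its recursion splits the shifted sequence into [c * Ep c p] and
    [(1 - c^(p+1)) / (p+1)]. In the second part the denominator [p+1] completes the factorial,
    giving the sine series of [sin x - sin (c x)] divided by [x]. *)
Lemma is_derive_TS_Ep c x : -1 <= c <= 1 -> 0 < x ->
  is_derive (TS (Ep c)) x (c * TC (Ep c) x + (sin x - sin (c * x)) / x).
Proof.
  intros Hc Hx. eapply der_eq; [apply is_derive_TS, geo_Ep, Hc|].
  set (G := fun p => (1 * 1 ^ S p + (- c) * c ^ p) / INR (S p)).
  assert (HG : geo G).
  { exists 2, 1. split; [lra|]. split; [lra|]. intros p. rewrite pow1, Rmult_1_r. unfold G.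
    assert (H1 : 1 <= INR (S p)) by (apply (le_INR 1); lia).
    unfold Rdiv. rewrite Rabs_mult, Rabs_inv, (Rabs_pos_eq (INR (S p))), pow1 by lra.
    assert (Hc1 : Rabs c <= 1) by now apply Rabs_le.
    assert (Hp : Rabs (c ^ S p) <= 1).
    { rewrite <- RPow_abs, <- (pow1 (S p)). apply pow_incr. split; [apply Rabs_pos | assumption]. }
    replace (1 * 1 + - c * c ^ p) with (1 - c ^ S p) by (simpl; ring).
    assert (H2 : Rabs (1 - c ^ S p) <= 2) by (apply Rabs_le_between in Hp; apply Rabs_le; lra).
    assert (H3 : 0 < / INR (S p) <= 1).
    { split; [apply Rinv_0_lt_compat; lra|]. rewrite <- Rinv_1. apply Rinv_le_contravar; lra. }
    pose proof (Rabs_pos (1 - c ^ S p)). nra. }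
  rewrite (TC_ext _ (fun p => c * Ep c p + 1 * G p)).
  2:{ intros p. cbn [Ep]. unfold G. rewrite pow1. change (c ^ S p) with (c * c ^ p). rfield. apply not_0_INR; lia. }
  rewrite TC_lin by (apply geo_Ep, Hc || exact HG). f_equal. rewrite Rmult_1_l.
  apply Rmult_eq_reg_l with x; [|lra]. replace (x * ((sin x - sin (c * x)) / x)) with (1 * sin (1 * x) + - 1 * sin (c * x)) by (rewrite (Rmult_1_l x); field; lra).
  rewrite <- (proj1 (TSC_pow 1 x)), <- (proj1 (TSC_pow c x)), <- TS_lin by apply geo_pow.
  unfold TC. rewrite <- PSeries_incr_1. apply PSeries_ext. intros [|p]; [simpl; unfold zero; simpl; rfield|].
  unfold PS_incr_1. rewrite sn_S. unfold G. rewrite fact_simpl, mult_INR. simpl pow. rewrite pow1.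
  pose proof (INR_fact_lt_0 p). field. split; [lra | apply not_0_INR; lia].
Qed.

Lemma is_derive_TC_Ep c x : -1 <= c <= 1 -> 0 < x ->
  is_derive (TC (Ep c)) x (- c * TS (Ep c) x + (cos x - cos (c * x)) / x).
Proof.
  intros Hc Hx. eapply der_eq; [apply is_derive_TC, geo_Ep, Hc|].
  set (G := fun p => (1 * 1 ^ S p + (- c) * c ^ p) / INR (S p)).
  assert (HG : geo G).
  { exists 2, 1. split; [lra|]. split; [lra|]. intros p. rewrite pow1, Rmult_1_r. unfold G.
    assert (H1 : 1 <= INR (S p)) by (apply (le_INR 1); lia).
    unfold Rdiv. rewrite Rabs_mult, Rabs_inv, (Rabs_pos_eq (INR (S p))), pow1 by lra.
    assert (Hc1 : Rabs c <= 1) by now apply Rabs_le.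
    assert (Hp : Rabs (c ^ S p) <= 1).
    { rewrite <- RPow_abs, <- (pow1 (S p)). apply pow_incr. split; [apply Rabs_pos | assumption]. }
    replace (1 * 1 + - c * c ^ p) with (1 - c ^ S p) by (simpl; ring).
    assert (H2 : Rabs (1 - c ^ S p) <= 2) by (apply Rabs_le_between in Hp; apply Rabs_le; lra).
    assert (H3 : 0 < / INR (S p) <= 1).
    { split; [apply Rinv_0_lt_compat; lra|]. rewrite <- Rinv_1. apply Rinv_le_contravar; lra. }
    pose proof (Rabs_pos (1 - c ^ S p)). nra. }
  rewrite (TS_ext _ (fun p => c * Ep c p + 1 * G p)).
  2:{ intros p. cbn [Ep]. unfold G. rewrite pow1. change (c ^ S p) with (c * c ^ p). rfield. apply not_0_INR; lia. }
  rewrite TS_lin by (apply geo_Ep, Hc || exact HG).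
  apply Rmult_eq_reg_l with x; [|lra].
  replace (x * (- c * TS (Ep c) x + (cos x - cos (c * x)) / x)) with (- x * c * TS (Ep c) x + (1 * cos (1 * x) + - 1 * cos (c * x))) by (rewrite (Rmult_1_l x); field; lra).
  rewrite <- (proj2 (TSC_pow 1 x)), <- (proj2 (TSC_pow c x)), <- TC_lin by apply geo_pow.
  replace (TC (fun p => 1 * 1 ^ p + - 1 * c ^ p) x) with (- (x * TS G x)); [ring|].
  unfold TS, TC. rewrite <- PSeries_incr_1, <- PSeries_opp. apply PSeries_ext. intros [|p].
  - unfold PS_opp, PS_incr_1, opp, zero; simpl. rfield.
  - unfold PS_opp, PS_incr_1. rewrite cs_S. unfold G. rewrite fact_simpl, mult_INR. simpl pow. rewrite pow1.
    pose proof (INR_fact_lt_0 p). pose proof (not_0_INR (S p) ltac:(lia)) as Hr. set (r := INR (S p)) in *.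
    unfold opp; simpl. rfield. split; lra.
Qed.
Lemma zseq_ln_lim : is_lim_seq (fun j => zseq j * ln (zseq j)) 0.
Proof.
  apply is_lim_seq_abs_0.
  apply is_lim_seq_le_le with (fun _ => 0) (fun j => ln (INR (S (S j))) * / INR (S j) + 1 * / INR (1 + j)).
  - intros j. split; [apply Rabs_pos|]. change (1 + j)%nat with (S j).
    pose proof (zseq_bounds j) as [Hz1 Hz2]. pose proof (zseq_pos j) as Hz.
    assert (H1 : 1 <= INR (S j)) by (apply (le_INR 1); lia).
    assert (H2 : 2 <= INR (S (S j))) by (rewrite (S_INR (S j)); lra).
    assert (Hi1 : 0 < / INR (S j) <= 1) by (split; [apply Rinv_0_lt_compat; lra | rewrite <- Rinv_1; apply Rinv_le_contravar; lra]).
    assert (Hi2 : 0 < / INR (S (S j))) by (apply Rinv_0_lt_compat; lra).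
    assert (Hl0 : 0 < ln (INR (S (S j)))) by (rewrite <- ln_1; apply ln_increasing; lra).
    rewrite Rabs_mult, (Rabs_pos_eq (zseq j)) by lra.
    assert (Hl : Rabs (ln (zseq j)) <= ln (INR (S (S j)))).
    { apply Rabs_le. split.
      - rewrite <- ln_Rinv by lra. destruct Hz1 as [Hz1|Hz1]; [left; now apply ln_increasing | rewrite Hz1; lra].
      - apply Rle_trans with 0; [|lra]. rewrite <- ln_1.
        assert (Hz3 : zseq j <= 1) by lra. destruct Hz3 as [Hz3|Hz3]; [left; now apply ln_increasing | rewrite Hz3; lra]. }
    apply Rle_trans with (/ INR (S j) * ln (INR (S (S j)))); [|lra].
    apply Rmult_le_compat; [lra | apply Rabs_pos | assumption | assumption].
  - apply is_lim_seq_const.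
  - replace (Finite 0) with (Finite (0 + 1 * 0)) by (f_equal; ring).
    apply is_lim_seq_plus'; [apply ln_INR_over|]. apply (is_lim_seq_scal_l _ 1 0), inv_INR_lim.
Qed.

Lemma cont_seq (f : R -> R) (u : nat -> R) l : continuous f l -> is_lim_seq u l -> is_lim_seq (fun n => f (u n)) (f l).
Proof. intros Hf Hu. apply is_lim_seq_continuous; [|assumption]. now apply continuity_pt_filterlim. Qed.

Lemma is_derive_Lap0_scal v x : 0 < v -> 0 < x -> is_derive (fun x => Lap 0 (x * v)) x (- (v * Lap 1 (x * v))).
Proof.
  intros Hv Hx. eapply der_eq.
  - apply (is_derive_comp (Lap 0) (fun x => x * v)); [apply is_derive_Lap; [lia | nra]|]. auto_derive; [trivial | reflexivity].
  - unfold scal; simpl. unfold mult; simpl. rring.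
Qed.

Lemma is_derive_Lap1_scal v x : 0 < v -> 0 < x -> is_derive (fun x => Lap 1 (x * v)) x (v * Lap 0 (x * v) - / x).
Proof.
  intros Hv Hx. assert (Hz : 0 < x * v) by nra. eapply der_eq.
  - apply (is_derive_comp (Lap 1) (fun x => x * v)); [apply is_derive_Lap; [lia | nra]|]. auto_derive; [trivial | reflexivity].
  - replace (Lap 2 (x * v)) with (/ (x * v) - Lap 0 (x * v)) by (rewrite <- (Lap_02 _ Hz); ring).
    unfold scal; simpl. unfold mult; simpl. rfield. lra.
Qed.

(** [D1] is the difference of the two sides and [D2] that of the companion identity with sine and
    cosine exchanged. They satisfy [D1' = c D2] and [D2' = - c D1], so [D1^2 + D2^2] is constant on
    [x > 0]; the behaviour of [Lap 0] and [Lap 1] at 0 shows that the constant is 0. *)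
Lemma Lap0_expansion c x : -1 <= c < 1 -> 0 < x ->
  cos x * Lap 0 (x * (1 - c)) + sin x * Lap 1 (x * (1 - c))
  = PI / 2 * cos (c * x) - (euler_gamma + ln (x * (1 - c))) * sin (c * x) - TS (Ep c) x.
Proof.
  intros Hc Hx. set (v := 1 - c). assert (Hv : 0 < v) by (unfold v; lra).
  assert (Hc' : -1 <= c <= 1) by lra.
  set (D1 := fun x => cos x * Lap 0 (x * v) + sin x * Lap 1 (x * v)
     - (PI / 2 * cos (c * x) - (euler_gamma + ln (x * v)) * sin (c * x) - TS (Ep c) x)).
  set (D2 := fun x => cos x * Lap 1 (x * v) - sin x * Lap 0 (x * v)
     - (- (PI / 2) * sin (c * x) - (euler_gamma + ln (x * v)) * cos (c * x) - TC (Ep c) x)).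
  assert (Hln : forall y, 0 < y -> is_derive (fun y => ln (y * v)) y (/ y)).
  { intros y Hy. auto_derive; [nra|]. rfield. lra. }
  assert (Hsin : forall k y, is_derive (fun y => sin (k * y)) y (k * cos (k * y))).
  { intros k y. auto_derive; [trivial | rring]. }
  assert (Hcos : forall k y, is_derive (fun y => cos (k * y)) y (- k * sin (k * y))).
  { intros k y. auto_derive; [trivial | rring]. }
  assert (Hgl : forall y, 0 < y -> is_derive (fun y => euler_gamma + ln (y * v)) y (0 + / y)).
  { intros y Hy. apply (der_plus (fun _ => euler_gamma)); [apply @is_derive_const | now apply Hln]. }
  assert (HD1 : forall y, 0 < y -> is_derive D1 y (c * D2 y)).
  { intros y Hy. unfold D1. eapply der_eq.
    - apply der_minus; [apply der_plus; apply der_mult | apply der_minus; [apply der_minus; [apply der_scal | apply der_mult]|]].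
      + apply is_derive_cos.
      + now apply is_derive_Lap0_scal.
      + apply is_derive_sin.
      + now apply is_derive_Lap1_scal.
      + apply Hcos.
      + now apply Hgl.
      + apply Hsin.
      + now apply is_derive_TS_Ep.
    - unfold D2, v. rfield. lra. }
  assert (HD2 : forall y, 0 < y -> is_derive D2 y (- c * D1 y)).
  { intros y Hy. unfold D2. eapply der_eq.
    - apply der_minus; [apply der_minus; apply der_mult | apply der_minus; [apply der_minus; [apply der_scal | apply der_mult]|]].
      + apply is_derive_cos.
      + now apply is_derive_Lap1_scal.
      + apply is_derive_sin.
      + now apply is_derive_Lap0_scal.
      + apply Hsin.
      + now apply Hgl.
      + apply Hcos.
      + now apply is_derive_TC_Ep.
    - unfold D1, v. rfield. lra. }
  set (Fn := fun y => D1 y ^ 2 + D2 y ^ 2).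
  assert (HF : forall y, 0 < y -> is_derive Fn y 0).
  { intros y Hy. unfold Fn. eapply der_eq; [apply der_plus; apply is_derive_pow; [now apply HD1 | now apply HD2]|].
    simpl. rring. }
  assert (Hconst : forall y, 0 < y -> Fn y = Fn x).
  { intros y Hy. destruct (Rtotal_order y x) as [H|[H|H]]; [|now subst|symmetry];
    (apply eq_is_derive; [intros t Ht; apply HF; lra | assumption]). }
  (* Points at which the argument [x (1 - c)] equals [zseq j], along which the limits of [Lap 0] and
     [Lap 1] are known. *)
  set (xs := fun j => zseq j * / v).
  assert (Hxs : forall j, 0 < xs j) by (intros j; apply Rmult_lt_0_compat; [apply zseq_pos | now apply Rinv_0_lt_compat]).
  assert (Hxv : forall j, xs j * v = zseq j) by (intros j; unfold xs; field; lra).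
  assert (Lx : is_lim_seq xs 0).
  { replace (Finite 0) with (Finite (0 * / v)) by (f_equal; ring). apply (is_lim_seq_scal_r _ (/ v) 0), zseq_lim. }
  assert (Lcos : forall k, is_lim_seq (fun j => cos (k * xs j)) 1).
  { intros k. replace (Finite 1) with (Finite (cos (k * 0))) by (rewrite Rmult_0_r, cos_0; reflexivity).
    apply (cont_seq (fun y => cos (k * y))); [cont | exact Lx]. }
  assert (Lsin : forall k, is_lim_seq (fun j => sin (k * xs j)) 0).
  { intros k. replace (Finite 0) with (Finite (sin (k * 0))) by (rewrite Rmult_0_r, sin_0; reflexivity).
    apply (cont_seq (fun y => sin (k * y))); [cont | exact Lx]. }
  assert (Hmvt : forall (f f' : R -> R) j, (forall y, is_derive f y (f' y)) -> (forall y, Rabs (f' y) <= 2) -> Rabs (f (xs j) - f 0) <= 2 * xs j).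
  { intros f f' j Hf Hb. destruct (MVT_gen f 0 (xs j) f') as [t [_ Ht]].
    - intros; apply Hf.
    - intros; apply continuity_pt_filterlim, (der_cont _ _ _ (Hf _)).
    - rewrite Ht, Rabs_mult, Rminus_0_r, (Rabs_pos_eq (xs j)) by (left; apply Hxs).
      apply Rmult_le_compat_r; [left; apply Hxs | apply Hb]. }
  assert (Hcb : Rabs c <= 1) by now apply Rabs_le.
  assert (Hsb : forall y, Rabs (sin y) <= 1) by (intros; apply Rabs_le, SIN_bound).
  assert (Hcob : forall y, Rabs (cos y) <= 1) by (intros; apply Rabs_le, COS_bound).
  (* Once [Lap 1] is paired with a logarithm, the remaining logarithms have coefficients
     [sin (c x) - sin x] in [D1] and [cos (c x) - cos x] in [D2]. Both are [O(x)], so [z ln z -> 0]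
     disposes of them. *)
  assert (Lsmall : forall f : R -> R, (forall j, Rabs (f (xs j)) <= 2 * xs j) -> is_lim_seq (fun j => f (xs j) * ln (zseq j)) 0).
  { intros f Hf. apply is_lim_seq_abs_0.
    apply is_lim_seq_le_le with (fun _ => 0) (fun j => 2 * / v * Rabs (zseq j * ln (zseq j))).
    - intros j. split; [apply Rabs_pos|]. rewrite !Rabs_mult, (Rabs_pos_eq (zseq j)) by (left; apply zseq_pos).
      replace (2 * / v * (zseq j * Rabs (ln (zseq j)))) with (2 * xs j * Rabs (ln (zseq j))) by (unfold xs; ring).
      apply Rmult_le_compat_r; [apply Rabs_pos | apply Hf].
    - apply is_lim_seq_const.
    - replace (Finite 0) with (Rbar_mult (2 * / v) (Rbar_abs 0)) by (simpl; rewrite Rabs_R0; f_equal; ring).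
      apply is_lim_seq_scal_l, is_lim_seq_abs, zseq_ln_lim. }
  assert (LTS : is_lim_seq (fun j => TS (Ep c) (xs j)) 0).
  { replace (Finite 0) with (Finite (TS (Ep c) 0)).
    - apply cont_seq; [|exact Lx]. eapply der_cont. now apply is_derive_TS, geo_Ep.
    - unfold TS. rewrite PSeries_0. simpl. f_equal. field. }
  assert (LTC : is_lim_seq (fun j => TC (Ep c) (xs j)) 0).
  { replace (Finite 0) with (Finite (TC (Ep c) 0)).
    - apply cont_seq; [|exact Lx]. eapply der_cont. now apply is_derive_TC, geo_Ep.
    - unfold TC. rewrite PSeries_0. simpl. f_equal. field. }
  assert (L0 : is_lim_seq (fun j => Lap 0 (zseq j)) (PI / 2)) by (apply Lap0_lim; [apply zseq_pos | apply zseq_lim]).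
  pose proof Lap1_lim as L1.
  assert (LD1 : is_lim_seq (fun j => D1 (xs j)) 0).
  { apply is_lim_seq_ext with (fun j => cos (1 * xs j) * Lap 0 (zseq j) + sin (1 * xs j) * (Lap 1 (zseq j) + ln (zseq j))
        + (sin (c * xs j) - sin (1 * xs j)) * ln (zseq j) - PI / 2 * cos (c * xs j) + euler_gamma * sin (c * xs j) + TS (Ep c) (xs j)).
    - intros j. unfold D1. rewrite Hxv, Rmult_1_l. ring.
    - replace (Finite 0) with (Finite (1 * (PI / 2) + 0 * - euler_gamma + 0 - PI / 2 * 1 + euler_gamma * 0 + 0)) by (f_equal; ring).
      apply is_lim_seq_plus'; [|exact LTS].
      apply is_lim_seq_plus'; [|apply (is_lim_seq_scal_l _ euler_gamma 0), Lsin].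
      apply is_lim_seq_minus'; [|apply (is_lim_seq_scal_l _ (PI / 2) 1), Lcos].
      apply is_lim_seq_plus'; [apply is_lim_seq_plus'; apply is_lim_seq_mult'; auto|].
      apply (Lsmall (fun y => sin (c * y) - sin (1 * y))). intros j.
      pose proof (Hmvt (fun y => sin (c * y) - sin (1 * y)) (fun y => c * cos (c * y) - 1 * cos (1 * y)) j) as H.
      cbv beta in H. rewrite !Rmult_0_r, sin_0, Rminus_0_r, Rminus_0_r in H. apply H.
      + intros y. apply der_minus; apply Hsin.
      + intros y. apply Rle_trans with (1 := Rabs_triang _ _). rewrite Rabs_Ropp, !Rabs_mult, Rabs_R1.
        pose proof (Hcob (c * y)). pose proof (Hcob (1 * y)). pose proof (Rabs_pos c). pose proof (Rabs_pos (cos (c * y))). nra. }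
  assert (LD2 : is_lim_seq (fun j => D2 (xs j)) 0).
  { apply is_lim_seq_ext with (fun j => cos (1 * xs j) * (Lap 1 (zseq j) + ln (zseq j)) - sin (1 * xs j) * Lap 0 (zseq j)
        + (cos (c * xs j) - cos (1 * xs j)) * ln (zseq j) + PI / 2 * sin (c * xs j) + euler_gamma * cos (c * xs j) + TC (Ep c) (xs j)).
    - intros j. unfold D2. rewrite Hxv, Rmult_1_l. ring.
    - replace (Finite 0) with (Finite (1 * - euler_gamma - 0 * (PI / 2) + 0 + PI / 2 * 0 + euler_gamma * 1 + 0)) by (f_equal; ring).
      apply is_lim_seq_plus'; [|exact LTC].
      apply is_lim_seq_plus'; [|apply (is_lim_seq_scal_l _ euler_gamma 1), Lcos].
      apply is_lim_seq_plus'; [|apply (is_lim_seq_scal_l _ (PI / 2) 0), Lsin].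
      apply is_lim_seq_plus'; [apply is_lim_seq_minus'; apply is_lim_seq_mult'; auto|].
      apply (Lsmall (fun y => cos (c * y) - cos (1 * y))). intros j.
      pose proof (Hmvt (fun y => cos (c * y) - cos (1 * y)) (fun y => - c * sin (c * y) - - (1) * sin (1 * y)) j) as H.
      cbv beta in H. rewrite !Rmult_0_r, cos_0, Rminus_eq_0, Rminus_0_r in H. apply H.
      + intros y. apply der_minus; apply Hcos.
      + intros y. apply Rle_trans with (1 := Rabs_triang _ _). rewrite Rabs_Ropp, !Rabs_mult, !Rabs_Ropp, Rabs_R1.
        pose proof (Hsb (c * y)). pose proof (Hsb (1 * y)). pose proof (Rabs_pos c). pose proof (Rabs_pos (sin (c * y))). nra. }
  assert (LF : is_lim_seq (fun j => Fn (xs j)) 0).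
  { apply is_lim_seq_ext with (fun j => D1 (xs j) * D1 (xs j) + D2 (xs j) * D2 (xs j)); [intros; unfold Fn; ring|].
    replace (Finite 0) with (Finite (0 * 0 + 0 * 0)) by (f_equal; ring).
    apply is_lim_seq_plus'; apply is_lim_seq_mult'; assumption. }
  assert (H0 : Fn x = 0).
  { apply (is_lim_seq_ext _ (fun _ => Fn x)) in LF; [|intros; now apply Hconst].
    apply is_lim_seq_unique in LF. rewrite Lim_seq_const in LF. now injection LF. }
  unfold Fn in H0. pose proof (pow2_ge_0 (D1 x)). pose proof (pow2_ge_0 (D2 x)).
  apply Rminus_diag_uniq. fold (D1 x). apply Rsqr_0_uniq. rewrite Rsqr_pow2. lra.
Qed.

(** * Chebyshev polynomials *)

Lemma cheb_pair_eq k x : cheb_pair k x = (chebU k x, chebU (S k) x).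
Proof.
  unfold chebU. destruct (cheb_pair k x) as [a b] eqn:E. simpl. rewrite E. reflexivity.
Qed.

Lemma chebU_0 x : chebU 0 x = 1.
Proof. reflexivity. Qed.
Lemma chebU_1 x : chebU 1 x = 2 * x.
Proof. reflexivity. Qed.
Lemma chebU_rec k x : chebU (S (S k)) x = 2 * x * chebU (S k) x - chebU k x.
Proof. unfold chebU at 1. cbn [cheb_pair]. rewrite cheb_pair_eq. reflexivity. Qed.

Lemma chebU_ind (P : nat -> Prop) : P 0%nat -> P 1%nat -> (forall k, P k -> P (S k) -> P (S (S k))) -> forall k, P k.
Proof.
  intros H0 H1 HS k. enough (P k /\ P (S k)) by tauto.
  induction k as [|k [IH1 IH2]]; auto.
Qed.

Lemma chebU_cont k x : continuous (chebU k) x.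
Proof.
  induction k as [| |k IH1 IH2] using chebU_ind.
  - apply (continuous_ext (fun _ => 1)); [reflexivity | cont].
  - apply (continuous_ext (fun x => 2 * x)); [reflexivity | cont].
  - apply (continuous_ext (fun x => 2 * x * chebU (S k) x - chebU k x)); [intros; now rewrite chebU_rec | cont].
Qed.

Lemma chebU_cos_cont k (f : R -> R) x : continuous f x -> continuous (fun t => chebU k (f t)) x.
Proof. intros H. apply (continuous_comp f (chebU k)); [exact H | apply chebU_cont]. Qed.

Lemma chebU_sin k t : chebU k (cos t) * sin t = sin (INR (S k) * t).
Proof.
  induction k as [| |k IH1 IH2] using chebU_ind.
  - rewrite chebU_0. simpl. now rewrite !Rmult_1_l.
  - rewrite chebU_1. replace (INR 2 * t) with (2 * t) by (simpl; ring). rewrite sin_2a. ring.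
  - rewrite chebU_rec, Rmult_minus_distr_r, Rmult_assoc, IH1, IH2.
    replace (INR (S (S (S k))) * t) with (INR (S (S k)) * t + t) by (rewrite (S_INR (S (S k))); ring).
    replace (INR (S k) * t) with (INR (S (S k)) * t - t) by (rewrite (S_INR (S k)); ring).
    rewrite sin_plus, sin_minus. ring.
Qed.

Lemma chebU_at_1 k : chebU k 1 = INR (S k).
Proof.
  induction k as [| |k IH1 IH2] using chebU_ind; [reflexivity | rewrite chebU_1; simpl; ring |].
  rewrite chebU_rec, IH1, IH2, (S_INR (S (S k))), (S_INR (S k)). ring.
Qed.

Lemma chebU_step k t : (1 + cos t) * (chebU (S k) (cos t) - chebU k (cos t))
  = cos (INR (S (S k)) * t) + cos (INR (S k) * t).
Proof.
  assert (H : forall k, cos (INR (S (S (S k))) * t) = 2 * cos t * cos (INR (S (S k)) * t) - cos (INR (S k) * t)).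
  { intros j. replace (INR (S (S (S j))) * t) with (INR (S (S j)) * t + t) by (rewrite (S_INR (S (S j))); ring).
    replace (INR (S j) * t) with (INR (S (S j)) * t - t) by (rewrite (S_INR (S j)); ring).
    rewrite cos_plus, cos_minus. ring. }
  assert (H2 : cos (INR 2 * t) = 2 * cos t * cos t - 1).
  { replace (INR 2 * t) with (2 * t) by (simpl; ring). apply cos_2a_cos. }
  assert (H1 : cos (INR 1 * t) = cos t) by (simpl; now rewrite Rmult_1_l).
  induction k as [| |k IH1 IH2] using chebU_ind.
  - rewrite chebU_0, chebU_1, H2, H1. ring.
  - rewrite chebU_rec, chebU_0, chebU_1, H, H2, H1. ring.
  - rewrite (chebU_rec (S k)), (chebU_rec k), (H (S k)), (H k).
    replace ((1 + cos t) * (2 * cos t * (2 * cos t * chebU (S k) (cos t) - chebU k (cos t)) - chebU (S k) (cos t) -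
       (2 * cos t * chebU (S k) (cos t) - chebU k (cos t))))
     with (2 * cos t * ((1 + cos t) * (chebU (S (S k)) (cos t) - chebU (S k) (cos t))) - (1 + cos t) * (chebU (S k) (cos t) - chebU k (cos t)))
     by (rewrite chebU_rec; ring).
    rewrite IH1, IH2, (H k). ring.
Qed.

Lemma cos_nat_int m : RInt (fun t => cos (INR (S m) * t)) 0 PI = 0.
Proof.
  assert (Hm : INR (S m) <> 0) by (apply not_0_INR; lia). pose proof PI_RGT_0.
  set (r := INR (S m)) in *.
  rewrite (RInt_FTC (fun t => / r * sin (r * t))).
  - unfold r. rewrite sin_nat_PI, !Rmult_0_r, sin_0. rring.
  - lra.
  - intros t _. auto_derive; [trivial|]. rfield. assumption.
  - intros; cont.
Qed.

(** By [chebU_step] the integrals for [k] and [k + 1] differ by integrals of nonconstant cosines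
    over [[0, PI]], which vanish; the value is therefore that at [k = 0]. *)
Lemma chebU_weight_int k : RInt (fun t => (1 + cos t) * chebU k (cos t)) 0 PI = PI.
Proof.
  pose proof PI_RGT_0 as Hpi.
  assert (Hc : forall k, ex_RInt (fun t => (1 + cos t) * chebU k (cos t)) 0 PI).
  { intros j. apply ex_RInt_cont; [lra|]. intros. apply cont_mult; [cont | apply chebU_cos_cont; cont]. }
  assert (Hcc : forall m, ex_RInt (fun t => cos (INR (S m) * t)) 0 PI).
  { intros j. apply ex_RInt_cont; [lra|]. intros. cont. }
  induction k as [|k IH].
  - rewrite (RInt_FTC (fun t => t + sin t)).
    + rewrite sin_PI, sin_0. rring.
    + lra.
    + intros t _. rewrite chebU_0. auto_derive; [trivial | rring].
    + intros. apply cont_mult; [cont | apply chebU_cos_cont; cont].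
  - rewrite (RInt_ext _ (fun t => (1 + cos t) * chebU k (cos t) + (cos (INR (S (S k)) * t) + cos (INR (S k) * t)))).
    + rewrite (RInt_plus' _ _ _ _ (Hc k) (ex_RInt_plus' _ _ _ _ (Hcc (S k)) (Hcc k))).
      rewrite (RInt_plus' _ _ _ _ (Hcc (S k)) (Hcc k)), !cos_nat_int, IH. rring.
    + intros t _. rewrite <- chebU_step. rring.
Qed.

(** * Trigonometric moments *)

(** The mean of [cos t ^ (2k)] over [[0, PI]], that is the Wallis ratio [(2k)! / (4^k k!^2)].
    [Ac n k] is the mean with the extra factor [cos (2 n t)] and vanishes for [k < n]. *)
Fixpoint Aw (k : nat) : R :=
  match k with O => 1 | S j => (2 * INR j + 1) / (2 * INR j + 2) * Aw j end.
Fixpoint Ac (n k : nat) : R :=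
  match n with O => Aw k | S m => (INR k - INR m) / (INR k + INR m + 1) * Ac m k end.
(* [PI * (Yc n k - tau n k)] is the integral of [cos (2 n t) * Lam (2 k) (cos t)] over [0, PI]; the recursions
   for [Ac] and [Yc] come from integration by parts. *)
Fixpoint Yc (n k : nat) : R :=
  match n with
  | O => Aw k * (- ln 2 - harmonic k)
  | S m => ((INR k - INR m) * Yc m k + / 2 * (Ac m k - Ac (S m) k)) / (INR k + INR m + 1)
  end.

Lemma sin2c t : sin t ^ 2 = 1 - cos t ^ 2.
Proof. pose proof (sin2_cos2 t) as H. unfold Rsqr in H. simpl. lra. Qed.

(** The recursion in [k] at [n = 0] integrates the derivative of [sin t cos t ^ (2k+1)]; the one in
    [n] integrates that of [sin ((2n+1) t) cos t ^ (2k+1)]. *)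
Lemma cos_moment n k : RInt (fun t => cos (2 * INR n * t) * cos t ^ (2 * k)) 0 PI = PI * Ac n k.
Proof.
  pose proof PI_RGT_0 as Hpi.
  assert (Hc : forall n k, ex_RInt (fun t => cos (2 * INR n * t) * cos t ^ (2 * k)) 0 PI).
  { intros i j. apply ex_RInt_cont; [lra|]. intros; cont. }
  induction n as [|n IH].
  - induction k as [|k IH].
    + rewrite (RInt_ext _ (fun _ => 1)).
      * rewrite RInt_const'. simpl. rring.
      * intros t _. simpl. rewrite Rmult_0_r, Rmult_0_l, cos_0. rring.
    + pose proof (pos_INR k) as Hk.
      assert (E : RInt (fun t => (2 * INR k + 2) * (cos (2 * INR 0 * t) * cos t ^ (2 * S k)) + - (2 * INR k + 1) * (cos (2 * INR 0 * t) * cos t ^ (2 * k))) 0 PI = 0).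
      { rewrite (RInt_FTC (fun t => sin t * cos t ^ (S (2 * k)))).
        - rewrite sin_PI, sin_0. rring.
        - lra.
        - intros t _. eapply der_eq.
          + apply der_mult; [apply is_derive_sin|]. apply is_derive_pow, is_derive_cos.
          + replace (2 * INR 0 * t) with 0 by (simpl; ring). rewrite cos_0.
            replace (2 * S k)%nat with (S (S (2 * k))) by lia. rewrite S_INR, mult_INR. cbn [Init.Nat.pred].
            replace (sin t * ((INR 2 * INR k + 1) * - sin t * cos t ^ (2 * k))) with (- (2 * INR k + 1) * (sin t ^ 2) * cos t ^ (2 * k)) by (simpl; ring).
            rewrite sin2c. simpl. rring.
        - intros; cont. }
      rewrite (RInt_lin _ _ _ _ _ _ (Hc 0%nat (S k)) (Hc 0%nat k)), IH in E.
      cbn [Ac Aw] in *. apply Rmult_eq_reg_l with (2 * INR k + 2); [|lra].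
      replace ((2 * INR k + 2) * (PI * ((2 * INR k + 1) / (2 * INR k + 2) * Aw k))) with ((2 * INR k + 1) * (PI * Aw k)) by (field; lra).
      lra.
  - pose proof (pos_INR k) as Hk. pose proof (pos_INR n) as Hn.
    assert (E : RInt (fun t => (INR k + INR n + 1) * (cos (2 * INR (S n) * t) * cos t ^ (2 * k)) + (INR n - INR k) * (cos (2 * INR n * t) * cos t ^ (2 * k))) 0 PI = 0).
    { rewrite (RInt_FTC (fun t => sin ((2 * INR n + 1) * t) * cos t ^ (S (2 * k)))).
      - replace ((2 * INR n + 1) * PI) with (INR (2 * n + 1) * PI) by (rewrite plus_INR, mult_INR; simpl; ring).
        rewrite sin_nat_PI, Rmult_0_r, sin_0. rring.
      - lra.
      - intros t _. eapply der_eq.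
        + apply der_mult; [|apply is_derive_pow, is_derive_cos].
          instantiate (1 := (2 * INR n + 1) * cos ((2 * INR n + 1) * t)). auto_derive; [trivial | rring].
        + rewrite !S_INR, mult_INR. cbn [Init.Nat.pred].
          replace (2 * (INR n + 1) * t) with ((2 * INR n + 1) * t + t) by ring.
          replace (2 * INR n * t) with ((2 * INR n + 1) * t - t) by ring.
          rewrite cos_plus, cos_minus. simpl. rring.
      - intros; cont. }
    rewrite (RInt_lin _ _ _ _ _ _ (Hc (S n) k) (Hc n k)), IH in E.
    cbn [Ac]. apply Rmult_eq_reg_l with (INR k + INR n + 1); [|lra].
    replace ((INR k + INR n + 1) * (PI * ((INR k - INR n) / (INR k + INR n + 1) * Ac n k))) with ((INR k - INR n) * (PI * Ac n k)) by (field; lra).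
    lra.
Qed.

(** A particular solution of the inhomogeneous recursion in [n] obeyed by the logarithmic moments.
    The half interval makes the boundary term 1 instead of 0. Resummed over [k], it becomes the
    integral of [cos (x cos t) sin (2 n t)] that also occurs in the Fourier coefficients. *)
Definition tau (n k : nat) : R := RInt (fun t => cos t ^ (2 * k) * sin (2 * INR n * t)) 0 (PI / 2).

Lemma tau_0 k : tau 0 k = 0.
Proof.
  unfold tau. rewrite (RInt_ext _ (fun _ => 0)).
  - rewrite RInt_const'. rring.
  - intros t _. simpl. rewrite Rmult_0_r, Rmult_0_l, sin_0. rring.
Qed.

Lemma tau_S n k : (INR k + INR n + 1) * tau (S n) k + (INR n - INR k) * tau n k = 1.
Proof.
  pose proof PI_RGT_0 as Hpi.
  assert (Hc : forall n, ex_RInt (fun t => cos t ^ (2 * k) * sin (2 * INR n * t)) 0 (PI / 2)).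
  { intros j. apply ex_RInt_cont; [lra|]. intros; cont. }
  unfold tau. rewrite <- (RInt_lin _ _ _ _ _ _ (Hc (S n)) (Hc n)).
  rewrite (RInt_FTC (fun t => - (cos t ^ S (2 * k) * cos ((2 * INR n + 1) * t)))).
  - rewrite cos_PI2, Rmult_0_r, cos_0, pow1, pow_ne_zero by lia. rring.
  - lra.
  - intros t _. eapply der_eq.
    + apply @is_derive_opp. apply der_mult; [apply is_derive_pow, is_derive_cos|].
      instantiate (1 := - (2 * INR n + 1) * sin ((2 * INR n + 1) * t)). auto_derive; [trivial | rring].
    + rewrite !S_INR, mult_INR. cbn [Init.Nat.pred].
      replace (2 * (INR n + 1) * t) with ((2 * INR n + 1) * t + t) by ring.
      replace (2 * INR n * t) with ((2 * INR n + 1) * t - t) by ring.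
      rewrite sin_plus, sin_minus. unfold opp; simpl. rring.
  - intros; cont.
Qed.

(** * Logarithmic moments *)

Definition Lam (p : nat) (c : R) : R := c ^ p * ln (1 - c) + Ep c p.

Lemma Lam_S p c : Lam (S p) c = c * Lam p c + (1 - c ^ S p) / INR (S p).
Proof. unfold Lam. cbn [Ep]. simpl pow. ring. Qed.

Lemma is_derive_Lam p c : c < 1 -> is_derive (Lam p) c (INR p * Lam (pred p) c - / (1 - c)).
Proof.
  intros Hc. induction p as [|p IH].
  - apply (is_derive_ext (fun c => ln (1 - c))); [intros; unfold Lam; simpl; ring|].
    auto_derive; [lra|]. simpl. rfield. lra.
  - apply (is_derive_ext (fun c => c * Lam p c + / INR (S p) * (1 - c ^ S p))).
    { intros t. rewrite Lam_S. unfold Rdiv. rring. }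
    assert (Hp : INR (S p) <> 0) by (apply not_0_INR; lia).
    eapply der_eq.
    + apply der_plus; [apply der_mult; [apply der_id | exact IH]|].
      apply (der_scal (fun c => 1 - c ^ S p)), der_minus; [apply der_const | apply der_pow].
    + cbn [Init.Nat.pred]. 
      assert (E : INR p * (c * Lam (pred p) c) = INR p * Lam p c - (1 - c ^ p)).
      { destruct p as [|p]; [simpl; ring|]. cbn [pred]. rewrite (Lam_S p).
        assert (INR (S p) <> 0) by (apply not_0_INR; lia). field. assumption. }
      replace (1 * Lam p c + c * (INR p * Lam (pred p) c - / (1 - c)) + / INR (S p) * (0 - INR (S p) * c ^ p))
       with (Lam p c + INR p * (c * Lam (pred p) c) - c / (1 - c) - c ^ p) by (field; split; lra).
      rewrite E, S_INR. rfield. lra.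
Qed.

Lemma Ep_cont p c : continuous (fun c => Ep c p) c.
Proof.
  induction p as [|p IH]; cbn [Ep]; [cont|].
  assert (INR (S p) <> 0) by (apply not_0_INR; lia). apply cont_plus; [apply cont_mult; [cont | exact IH] | cont].
Qed.

Lemma cos_lt_1 t : -1 <= t <= PI -> t <> 0 -> cos t < 1.
Proof.
  intros Ht Ht0. pose proof PI2_3_2. pose proof PI_RGT_0.
  assert (H1 : forall s, 0 < s <= PI -> cos s < 1).
  { intros s Hs. rewrite <- cos_0. apply cos_decreasing_1; lra. }
  destruct (Rle_lt_dec 0 t); [apply H1; lra|]. rewrite <- cos_neg. apply H1; lra.
Qed.

(** Let [q] be the fourth root of [1 - cos t]. Near 0, [|sin t| <= 2 q^2] and [|ln (q^4)| <= 4/q],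
    so the product is at most [8 q]. The range starts at [-1] so that 0 is an interior point and
    continuity there is two-sided. *)
Lemma sin_ln_cont t : -1 <= t <= PI -> continuous (fun t => sin t * ln (1 - cos t)) t.
Proof.
  intros Ht. destruct (Req_dec t 0) as [->|Ht0].
  - apply continuity_pt_filterlim.
    assert (Hb : continuity_pt (fun t => 8 * sqrt (sqrt (1 - cos t))) 0).
    { apply continuity_pt_filterlim. change (continuous (fun t => 8 * sqrt (sqrt (1 - cos t))) 0). cont. }
    intros eps Heps. destruct (Hb eps Heps) as [d [Hd H]].
    exists (Rmin d 1). split; [apply Rmin_pos; lra|]. intros y [_ Hy]. simpl in *. unfold Rdist in *.
    rewrite Rminus_0_r in Hy. pose proof (Rmin_l d 1) as Hm1. pose proof (Rmin_r d 1) as Hm2.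
    rewrite sin_0, Rmult_0_l, Rminus_0_r.
    destruct (Req_dec y 0) as [->|Hy0]; [rewrite sin_0, Rmult_0_l, Rabs_R0; lra|].
    specialize (H y). rewrite cos_0, Rminus_eq_0, sqrt_0, sqrt_0, Rmult_0_r, !Rminus_0_r in H.
    assert (Hlt : Rabs (8 * sqrt (sqrt (1 - cos y))) < eps).
    { apply H. split; [split; [exact I | lra] | lra]. }
    apply Rle_lt_trans with (2 := Hlt).
    assert (Hyb : -1 < y < 1) by (apply Rabs_lt_between; lra).
    pose proof PI2_3_2.
    assert (Hx0 : 0 < 1 - cos y) by (pose proof (cos_lt_1 y ltac:(lra) Hy0); lra).
    assert (Hcy : 0 <= cos y) by (apply cos_ge_0; lra).
    set (x := 1 - cos y) in *. assert (Hx1 : x <= 1) by (unfold x; lra).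
    assert (Hq : 0 < sqrt (sqrt x)) by now apply sqrt_lt_R0, sqrt_lt_R0.
    set (q := sqrt (sqrt x)) in *.
    assert (Hqq : q * q = sqrt x) by (apply sqrt_sqrt, sqrt_pos).
    assert (Hq4 : (q * q) * (q * q) = x) by (rewrite Hqq; apply sqrt_sqrt; lra).
    assert (Hln : Rabs (ln x) <= 4 * / q).
    { rewrite Rabs_left1.
      - rewrite <- Hq4, !ln_mult by nra. pose proof (ln_le_sub1 (/ q) (Rinv_0_lt_compat _ Hq)) as Hl.
        rewrite ln_Rinv in Hl by assumption. lra.
      - rewrite <- ln_1. destruct Hx1 as [Hx1|Hx1]; [left; now apply ln_increasing | rewrite Hx1; lra]. }
    assert (Hs : Rabs (sin y) <= 2 * (q * q)).
    { rewrite <- (Rabs_pos_eq (2 * (q * q))) by nra. apply Rsqr_le_abs_0. rewrite !Rsqr_pow2, sin2c.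
      replace (cos y) with (1 - x) by (unfold x; ring). rewrite Rpow_mult_distr. 
      replace ((q * q) ^ 2) with x by (rewrite <- Hq4; ring). simpl. nra. }
    rewrite Rabs_mult, (Rabs_pos_eq (8 * q)) by lra.
    apply Rle_trans with (2 * (q * q) * (4 * / q)).
    + apply Rmult_le_compat; try apply Rabs_pos; assumption.
    + right. field. lra.
  - pose proof (cos_lt_1 t Ht Ht0). cont. lra.
Qed.

Lemma sin_Lam_cont p t : -1 <= t <= PI -> continuous (fun t => sin t * Lam p (cos t)) t.
Proof.
  intros Ht. apply (continuous_ext (fun t => cos t ^ p * (sin t * ln (1 - cos t)) + sin t * Ep (cos t) p)).
  { intros s. unfold Lam. rring. }
  apply cont_plus; apply cont_mult; [cont | now apply sin_ln_cont | cont |].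
  apply (continuous_comp cos (fun c => Ep c p)); [apply continuous_cos | apply Ep_cont].
Qed.

(* Lower limits of integration avoiding the logarithmic singularity at 0. *)
Definition es (j : nat) : R := / INR (1 + j).

Lemma es_bounds j : 0 < es j <= 1.
Proof.
  assert (1 <= INR (1 + j)) by (apply (le_INR 1); lia). unfold es. split; [apply Rinv_0_lt_compat; lra|].
  rewrite <- Rinv_1. apply Rinv_le_contravar; lra.
Qed.

(** The base point [-1] makes the integral differentiable in its upper limit at 0, and so continuous
    there. *)
Lemma RInt_es_lim (f : R -> R) : (forall t, -1 <= t <= PI -> continuous f t) ->
  is_lim_seq (fun j => RInt f (es j) PI) (RInt f 0 PI).
Proof.
  intros Hf. pose proof PI2_3_2 as Hpi.
  assert (Ex : forall a b, -1 <= a -> a <= b -> b <= PI -> ex_RInt f a b).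
  { intros a b Ha Hab Hb. apply ex_RInt_cont; [assumption|]. intros; apply Hf; lra. }
  assert (Hd : is_derive (fun x => RInt f (-1) x) 0 (f 0)).
  { apply (is_derive_RInt (V := R_NormedModule) f _ (-1)); [|apply Hf; lra].
    exists (mkposreal 1 Rlt_0_1). intros x Hx. apply (RInt_correct (V := R_CompleteNormedModule)).
    unfold ball in Hx; simpl in Hx. unfold AbsRing_ball, abs, minus, plus, opp in Hx; simpl in Hx. apply Rabs_lt_between in Hx. apply Ex; lra. }
  apply der_cont in Hd.
  apply is_lim_seq_ext with (fun j => RInt f (-1) PI - RInt f (-1) (es j)).
  { intros j. pose proof (es_bounds j). rewrite (RInt_Chasles' f (-1) (es j) PI); [lra | apply Ex; lra | apply Ex; lra]. }
  replace (RInt f 0 PI) with (RInt f (-1) PI - RInt f (-1) 0).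
  2:{ rewrite (RInt_Chasles' f (-1) 0 PI); [lra | apply Ex; lra | apply Ex; lra]. }
  apply is_lim_seq_minus'; [apply is_lim_seq_const|].
  apply (cont_seq (fun x => RInt f (-1) x)); [exact Hd | apply inv_INR_lim].
Qed.

Lemma es_lim_0 (f : R -> R) : (forall t, -1 <= t <= PI -> continuous f t) -> f 0 = 0 ->
  is_lim_seq (fun j => f (es j)) 0.
Proof.
  intros Hf H0. pose proof PI2_3_2. rewrite <- H0. apply cont_seq; [apply Hf; lra | apply inv_INR_lim].
Qed.

Definition Bs (n k j : nat) : R := RInt (fun t => cos (2 * INR n * t) * Lam (2 * k) (cos t)) (es j) PI.

Lemma Lam_cos_cont p t : -1 <= t <= PI -> t <> 0 -> continuous (fun t => Lam p (cos t)) t.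
Proof.
  intros Ht Ht0. pose proof (cos_lt_1 t Ht Ht0). unfold Lam.
  apply cont_plus; [cont; lra|]. apply (continuous_comp cos (fun c => Ep c p)); [apply continuous_cos | apply Ep_cont].
Qed.

Lemma ex_Bs n k j : ex_RInt (fun t => cos (2 * INR n * t) * Lam (2 * k) (cos t)) (es j) PI.
Proof.
  pose proof (es_bounds j). pose proof PI2_3_2. apply ex_RInt_cont; [lra|]. intros t Ht.
  apply cont_mult; [cont | apply Lam_cos_cont; lra].
Qed.

Lemma is_derive_Lam_cos p t : -1 <= t <= PI -> t <> 0 ->
  is_derive (fun t => Lam p (cos t)) t (- sin t * (INR p * Lam (pred p) (cos t) - / (1 - cos t))).
Proof.
  intros Ht Ht0. eapply der_eq.
  - apply (is_derive_comp (Lam p) cos); [apply is_derive_Lam, cos_lt_1; assumption | apply is_derive_cos].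
  - unfold scal; simpl. unfold mult; simpl. rring.
Qed.

(** Integrates the derivative of [sin ((2n+1) t) Lam (2k+1) (cos t)]. The pole [1/(1 - cos t)] in
    the derivative of [Lam] meets [sin ((2n+1) t) sin t = U_2n(cos t) (1 - cos t) (1 + cos t)] and
    leaves the weight of [chebU_weight_int], whence the term [- PI]. The boundary term at [es j]
    tends to 0 because of the factor [sin t]. *)
Lemma Bs_step_n n k l : is_lim_seq (Bs n k) (Finite l) ->
  is_lim_seq (Bs (S n) k) (((INR k - INR n) * l + PI / 2 * (Ac n k - Ac (S n) k) - PI) / (INR k + INR n + 1)).
Proof.
  intros Hl. pose proof PI2_3_2 as Hpi. pose proof (pos_INR k) as Hk. pose proof (pos_INR n) as Hn.
  set (m := 2 * INR n + 1). set (p := S (2 * k)).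
  assert (Hp : INR p = 2 * INR k + 1) by (unfold p; rewrite S_INR, mult_INR; simpl; ring).
  set (W := fun t => m / INR p * (cos (m * t) * (1 - cos t ^ p)) + (1 + cos t) * chebU (2 * n) (cos t)).
  assert (HU : forall t, chebU (2 * n) (cos t) * sin t = sin (m * t)).
  { intros t. rewrite chebU_sin. f_equal. unfold m. rewrite S_INR, mult_INR. simpl. ring. }
  assert (HWc : forall t, continuous W t).
  { intros t. unfold W. apply cont_plus; [cont | apply cont_mult; [cont | apply chebU_cos_cont; cont]]. }
  assert (HWint : RInt W 0 PI = - (PI / 2) * (Ac n k - Ac (S n) k) + PI).
  { unfold W.
    assert (E1 : ex_RInt (fun t => cos (m * t) * (1 - cos t ^ p)) 0 PI) by (apply ex_RInt_cont; [lra|]; intros; cont).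
    assert (E2 : ex_RInt (fun t => (1 + cos t) * chebU (2 * n) (cos t)) 0 PI).
    { apply ex_RInt_cont; [lra|]. intros; apply cont_mult; [cont | apply chebU_cos_cont; cont]. }
    rewrite (RInt_plus' _ _ _ _ (ex_RInt_scal' _ (m / INR p) _ _ E1) E2), chebU_weight_int, (RInt_scal' _ _ _ _ E1).
    f_equal.
    assert (Hmi : RInt (fun t => cos (m * t)) 0 PI = 0).
    { pose proof (cos_nat_int (2 * n)) as H. rewrite S_INR, mult_INR in H. exact H. }
    assert (Hc : forall n, ex_RInt (fun t => cos (2 * INR n * t) * cos t ^ (2 * k)) 0 PI).
    { intros i. apply ex_RInt_cont; [lra|]. intros; cont. }
    assert (E3 : RInt (fun t => cos (m * t) * (1 - cos t ^ p)) 0 PI = - (PI / 2) * (Ac n k + Ac (S n) k)).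
    { rewrite (RInt_ext _ (fun t => 1 * cos (m * t) + - / 2 * (1 * (cos (2 * INR n * t) * cos t ^ (2 * k)) + 1 * (cos (2 * INR (S n) * t) * cos t ^ (2 * k))))).
      - rewrite (RInt_lin (fun t => cos (m * t)) _ 1 (- / 2)), (RInt_lin _ _ 1 1 _ _ (Hc n) (Hc (S n))), !cos_moment, Hmi.
        + rfield.
        + apply ex_RInt_cont; [lra|]; intros; cont.
        + apply ex_RInt_plus'; apply ex_RInt_scal'; apply Hc.
      - intros t _. rewrite S_INR. replace (2 * (INR n + 1) * t) with (m * t + t) by (unfold m; ring).
        replace (2 * INR n * t) with (m * t - t) by (unfold m; ring). rewrite cos_plus, cos_minus. unfold p. simpl. rfield. }
    rewrite E3, Hp. cbn [Ac]. unfold m. rfield. split; lra. }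
  assert (Hid : forall j, (INR k + INR n + 1) * Bs (S n) k j + (INR n - INR k) * Bs n k j + RInt W (es j) PI
     = - (chebU (2 * n) (cos (es j)) * (sin (es j) * Lam p (cos (es j))))).
  { intros j. pose proof (es_bounds j) as He. unfold Bs.
    assert (EW : ex_RInt W (es j) PI) by (apply ex_RInt_cont; [lra|]; intros; apply HWc).
    rewrite <- (RInt_lin _ _ _ _ _ _ (ex_Bs (S n) k j) (ex_Bs n k j)).
    rewrite <- (RInt_plus' _ _ _ _ (ex_RInt_plus' _ _ _ _ (ex_RInt_scal' _ _ _ _ (ex_Bs (S n) k j)) (ex_RInt_scal' _ _ _ _ (ex_Bs n k j))) EW).
    rewrite (RInt_FTC (fun t => chebU (2 * n) (cos t) * (sin t * Lam p (cos t)))).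
    - rewrite sin_PI. rring.
    - lra.
    - intros t Ht. assert (Hct : cos t < 1) by (apply cos_lt_1; lra).
      apply (is_derive_ext (fun t => sin (m * t) * Lam p (cos t))); [intros s; rewrite <- HU; rring|].
      eapply der_eq.
      + apply der_mult; [|apply is_derive_Lam_cos; lra].
        instantiate (1 := m * cos (m * t)). auto_derive; [trivial | rring].
      + unfold p. cbn [pred]. rewrite Lam_S. fold p. rewrite S_INR.
        replace (2 * (INR n + 1) * t) with (m * t + t) by (unfold m; ring).
        replace (2 * INR n * t) with (m * t - t) by (unfold m; ring). rewrite cos_plus, cos_minus. unfold W.
        assert (HE : sin (m * t) * (sin t / (1 - cos t)) = (1 + cos t) * chebU (2 * n) (cos t)).
        { rewrite <- HU. replace (chebU (2 * n) (cos t) * sin t * (sin t / (1 - cos t))) with (chebU (2 * n) (cos t) * (sin t ^ 2) / (1 - cos t)) by (field; lra).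
          rewrite sin2c. field. lra. }
        rewrite <- HE, Hp. unfold m. rfield. lra.
    - intros t Ht. apply cont_plus; [|apply HWc].
      apply cont_plus; (apply cont_mult; [cont|]); (apply cont_mult; [cont | apply Lam_cos_cont; lra]). }
  apply is_lim_seq_ext with (fun j => (- (chebU (2 * n) (cos (es j)) * (sin (es j) * Lam p (cos (es j)))) - RInt W (es j) PI - (INR n - INR k) * Bs n k j) * / (INR k + INR n + 1)).
  { intros j. rewrite <- Hid. field. lra. }
  replace (((INR k - INR n) * l + PI / 2 * (Ac n k - Ac (S n) k) - PI) / (INR k + INR n + 1))
   with ((- 0 - RInt W 0 PI - (INR n - INR k) * l) * / (INR k + INR n + 1)) by (rewrite HWint; field; lra).
  apply (is_lim_seq_scal_r _ (/ (INR k + INR n + 1)) (Finite _)).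
  apply is_lim_seq_minus'; [apply is_lim_seq_minus'|].
  - apply (is_lim_seq_opp _ (Finite 0)).
    apply (es_lim_0 (fun t => chebU (2 * n) (cos t) * (sin t * Lam p (cos t)))).
    + intros t Ht. apply cont_mult; [apply chebU_cos_cont; cont | now apply sin_Lam_cont].
    + rewrite sin_0. ring.
  - apply RInt_es_lim. intros; apply HWc.
  - apply (is_lim_seq_scal_l _ _ (Finite l)), Hl.
Qed.

(** The counterpart at [n = 0], from the derivative of [sin t Lam (2k+1) (cos t)]; it links [k] to
    [k + 1], and is kept exact in [j] because it also determines the initial moment. *)
Lemma Bs_step_k_id k j : (2 * INR k + 2) * Bs 0 (S k) j + - (2 * INR k + 1) * Bs 0 k j
   + RInt (fun t => 2 * cos t ^ (2 * S k)) (es j) PI = - (sin (es j) * Lam (S (2 * k)) (cos (es j))).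
Proof.
  pose proof PI2_3_2 as Hpi. pose proof (pos_INR k) as Hk. pose proof (es_bounds j) as He. unfold Bs.
  assert (EW : ex_RInt (fun t => 2 * cos t ^ (2 * S k)) (es j) PI) by (apply ex_RInt_cont; [lra|]; intros; cont).
  rewrite <- (RInt_lin _ _ _ _ _ _ (ex_Bs 0 (S k) j) (ex_Bs 0 k j)).
  rewrite <- (RInt_plus' _ _ _ _ (ex_RInt_plus' _ _ _ _ (ex_RInt_scal' _ _ _ _ (ex_Bs 0 (S k) j)) (ex_RInt_scal' _ _ _ _ (ex_Bs 0 k j))) EW).
  rewrite (RInt_FTC (fun t => sin t * Lam (S (2 * k)) (cos t))).
  - rewrite sin_PI. rring.
  - lra.
  - intros t Ht. assert (Hct : cos t < 1) by (apply cos_lt_1; lra). eapply der_eq.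
    + apply der_mult; [apply is_derive_sin | apply is_derive_Lam_cos; lra].
    + replace (2 * INR 0 * t) with 0 by (simpl; ring). rewrite cos_0.
      assert (HI1 : INR (S (2 * k)) = 2 * INR k + 1) by (rewrite S_INR, mult_INR; simpl (INR 2); ring).
      assert (HI2 : INR (S (S (2 * k))) = 2 * INR k + 2) by (rewrite S_INR, HI1; ring).
      replace (2 * S k)%nat with (S (S (2 * k))) by lia. cbn [pred].
      rewrite (Lam_S (S (2 * k))), HI2, (Lam_S (2 * k)), HI1.
      replace (sin t * (- sin t * ((2 * INR k + 1) * Lam (2 * k) (cos t) - / (1 - cos t))))
       with (- (sin t ^ 2) * ((2 * INR k + 1) * Lam (2 * k) (cos t) - / (1 - cos t))) by ring.
      rewrite sin2c. rewrite <- !tech_pow_Rmult. set (q := cos t ^ (2 * k)). rfield. repeat split; lra.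
  - intros t Ht. apply cont_plus; [|cont].
    apply cont_plus; (apply cont_mult; [cont|]); (apply cont_mult; [cont | apply Lam_cos_cont; lra]).
Qed.

Lemma Aw_int k : RInt (fun t => 2 * cos t ^ (2 * k)) 0 PI = 2 * (PI * Aw k).
Proof.
  pose proof PI_RGT_0. assert (E : ex_RInt (fun t => cos t ^ (2 * k)) 0 PI) by (apply ex_RInt_cont; [lra|]; intros; cont).
  rewrite (RInt_scal' _ _ _ _ E). f_equal. change (Aw k) with (Ac 0 k). rewrite <- (cos_moment 0 k). apply RInt_ext. intros t _.
  simpl INR. rewrite Rmult_0_r, Rmult_0_l, cos_0. rring.
Qed.

Lemma Bs_step_k k l : is_lim_seq (Bs 0 k) (Finite l) ->
  is_lim_seq (Bs 0 (S k)) (((2 * INR k + 1) * l - 2 * (PI * Aw (S k))) / (2 * INR k + 2)).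
Proof.
  intros Hl. pose proof PI2_3_2 as Hpi. pose proof (pos_INR k) as Hk.
  apply is_lim_seq_ext with (fun j => (- (sin (es j) * Lam (S (2 * k)) (cos (es j))) - RInt (fun t => 2 * cos t ^ (2 * S k)) (es j) PI - - (2 * INR k + 1) * Bs 0 k j) * / (2 * INR k + 2)).
  { intros j. rewrite <- Bs_step_k_id. field. lra. }
  replace (((2 * INR k + 1) * l - 2 * (PI * Aw (S k))) / (2 * INR k + 2))
   with ((- 0 - 2 * (PI * Aw (S k)) - - (2 * INR k + 1) * l) * / (2 * INR k + 2)) by (field; lra).
  apply (is_lim_seq_scal_r _ (/ (2 * INR k + 2)) (Finite _)).
  apply is_lim_seq_minus'; [apply is_lim_seq_minus'|].
  - apply (is_lim_seq_opp _ (Finite 0)).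
    apply (es_lim_0 (fun t => sin t * Lam (S (2 * k)) (cos t))).
    + intros t Ht. now apply sin_Lam_cont.
    + rewrite sin_0. ring.
  - rewrite <- Aw_int. apply RInt_es_lim. intros; cont.
  - apply (is_lim_seq_scal_l _ _ (Finite l)), Hl.
Qed.

(* Since [sin t ^ 2 = (1 - cos t) * (1 + cos t)], the initial logarithmic moment reduces to the integral of
   [sin t ^ 2 * ln (sin t ^ 2)], which is found by Euler's duplication trick. *)
Definition ysq_ln (y : R) : R := y ^ 2 * ln (y ^ 2).

Lemma ysq_ln_bound y : Rabs y <= 1 -> Rabs (ysq_ln y) <= 2 * Rabs y.
Proof.
  intros Hy. unfold ysq_ln. destruct (Req_dec y 0) as [->|H0].
  - rewrite pow_ne_zero, Rmult_0_l, Rabs_R0 by lia. lra.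
  - assert (Ha : 0 < Rabs y) by now apply Rabs_pos_lt.
    rewrite <- (pow2_abs y). set (a := Rabs y) in *.
    assert (Hln : ln (a ^ 2) = - (2 * ln (/ a))) by (rewrite ln_Rinv by assumption; simpl; rewrite Rmult_1_r, ln_mult by assumption; ring).
    pose proof (ln_le_sub1 (/ a) (Rinv_0_lt_compat _ Ha)) as Hl.
    assert (Hl0 : 0 <= ln (/ a)).
    { rewrite ln_Rinv by assumption. apply Ropp_le_cancel. rewrite Ropp_0, Ropp_involutive, <- ln_1.
      destruct Hy as [Hy|Hy]; [left; now apply ln_increasing | rewrite Hy; lra]. }
    assert (Ha2 : 0 <= a ^ 2) by apply pow2_ge_0.
    rewrite Hln, Rabs_mult, Rabs_Ropp, !Rabs_pos_eq by lra.
    apply Rle_trans with (a ^ 2 * (2 * / a)); [apply Rmult_le_compat_l; lra|]. right. field. lra.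
Qed.

Lemma sq_pos y : y <> 0 -> 0 < y ^ 2.
Proof. intros H. rewrite <- Rsqr_pow2. now apply Rlt_0_sqr. Qed.

Lemma ysq_ln_0 : ysq_ln 0 = 0.
Proof. unfold ysq_ln. rewrite pow_ne_zero by lia. ring. Qed.

Lemma ysq_ln_cont y : continuous ysq_ln y.
Proof.
  destruct (Req_dec y 0) as [->|H0].
  - apply continuity_pt_filterlim. intros eps Heps. exists (Rmin 1 (eps / 2)).
    split; [apply Rmin_pos; lra|]. intros z [_ Hz]. simpl in *. unfold Rdist in *.
    rewrite Rminus_0_r in Hz. rewrite ysq_ln_0, Rminus_0_r.
    pose proof (Rmin_l 1 (eps / 2)). pose proof (Rmin_r 1 (eps / 2)).
    pose proof (ysq_ln_bound z ltac:(lra)). lra.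
  - apply (continuous_ext (fun y => y ^ 2 * ln (y ^ 2))); [reflexivity|]. pose proof (sq_pos y H0). cont. 
Qed.

Lemma is_derive_y_ysq_ln y : is_derive (fun y => y * ysq_ln y) y (3 * ysq_ln y + 2 * y ^ 2).
Proof.
  destruct (Req_dec y 0) as [->|H0].
  - apply der_quad with 1 2; [lra|]. intros h Hh. rewrite ysq_ln_0, Rplus_0_l.
    replace (h * ysq_ln h - 0 * 0 - h * (3 * 0 + 2 * 0 ^ 2)) with (h * ysq_ln h) by ring.
    pose proof (ysq_ln_bound h ltac:(lra)). rewrite Rabs_mult, <- (pow2_abs h). pose proof (Rabs_pos h). simpl. nra.
  - pose proof (sq_pos y H0). apply (is_derive_ext (fun y => y * (y ^ 2 * ln (y ^ 2)))); [reflexivity|].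
    unfold ysq_ln. auto_derive; [simpl in *; lra|]. simpl. rfield. assumption.
Qed.

Lemma RInt_reflect (f : R -> R) a : 0 <= a -> (forall t, 0 <= t <= a -> continuous f t) ->
  RInt (fun t => f (a - t)) 0 a = RInt f 0 a.
Proof.
  intros Ha Hf.
  pose proof (RInt_comp_lin (V := R_CompleteNormedModule) f (-1) a 0 a) as H.
  replace (-1 * 0 + a) with a in H by ring. replace (-1 * a + a) with 0 in H by ring.
  assert (E : ex_RInt f 0 a) by (apply ex_RInt_cont; assumption).
  specialize (H (ex_RInt_swap _ _ _ E)). 
  assert (H2 : RInt f a 0 = - RInt f 0 a).
  { rewrite <- (opp_RInt_swap (V := R_CompleteNormedModule) f a 0).
    - unfold opp; simpl. lra.
    - apply ex_RInt_swap, E. }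
  rewrite H2 in H. 
  assert (E2 : ex_RInt (fun t => f (a - t)) 0 a).
  { apply ex_RInt_cont; [assumption|]. intros t Ht. apply (continuous_comp (fun t => a - t) f); [cont | apply Hf; lra]. }
  assert (H3 : -1 * RInt (fun t => f (a - t)) 0 a = - RInt f 0 a).
  { rewrite <- H, <- (RInt_scal' _ _ _ _ E2). apply RInt_ext. intros t _. unfold scal; simpl. unfold mult; simpl.
    replace (-1 * t + a) with (a - t) by ring. reflexivity. }
  lra.
Qed.

Lemma RInt_shift (f : R -> R) a b v : (forall t, continuous f t) ->
  RInt (fun t => f (t + v)) a b = RInt f (a + v) (b + v).
Proof.
  intros Hf.
  pose proof (RInt_comp_lin (V := R_CompleteNormedModule) f 1 v a b) as H. rewrite !Rmult_1_l in H.
  rewrite <- H by (apply (ex_RInt_continuous (V := R_CompleteNormedModule)); intros; apply Hf).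
  apply RInt_ext. intros t _. unfold scal; simpl. unfold mult; simpl. now rewrite !Rmult_1_l.
Qed.

(** Two linear equations for [s1] and [s2]. Integrating the derivative of
    [cos t sin t ysq_ln (sin t)] gives [3 s1 - 4 s2 + PI/4 = 0]. By periodicity [q (2t)] has the
    same integral as [q], and [sin (2t) = 2 sin t cos t] splits its logarithm, which gives
    [s1 = PI ln 2 + 8 (s1 - s2)]. *)
Lemma sin_sq_ln_int : RInt (fun t => ysq_ln (sin t)) 0 PI = PI / 2 - PI * ln 2.
Proof.
  pose proof PI_RGT_0 as Hpi.
  assert (Hex : forall (f : R -> R) a b, (forall t, continuous f t) -> ex_RInt f a b).
  { intros f a b Hf. apply (ex_RInt_continuous (V := R_CompleteNormedModule)). intros; apply Hf. }
  assert (Cs : forall t, continuous (fun t => ysq_ln (sin t)) t).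
  { intros t. apply (continuous_comp sin ysq_ln); [apply continuous_sin | apply ysq_ln_cont]. }
  assert (Cc : forall t, continuous (fun t => ysq_ln (cos t)) t).
  { intros t. apply (continuous_comp cos ysq_ln); [apply continuous_cos | apply ysq_ln_cont]. }
  set (q := fun t => ysq_ln (sin t)) in *.
  set (s1 := RInt q 0 PI). set (s2 := RInt (fun t => sin t ^ 2 * q t) 0 PI).
  assert (C2 : forall t, continuous (fun t => sin t ^ 2 * q t) t) by (intros; cont).
  assert (C3 : forall t, continuous (fun t => cos t ^ 2 * q t) t) by (intros; cont).
  assert (C4 : forall t, continuous (fun t => sin t ^ 2 * cos t ^ 2) t) by (intros; cont).
  assert (I4 : RInt (fun t => sin t ^ 2 * cos t ^ 2) 0 PI = PI / 8).
  { rewrite (RInt_FTC (fun t => t / 8 - sin (4 * t) / 32)).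
    - replace (4 * PI) with (INR 4 * PI) by (simpl; ring). rewrite sin_nat_PI, Rmult_0_r, sin_0. rfield.
    - lra.
    - intros t _. auto_derive; [trivial|]. replace (4 * t) with (2 * (2 * t)) by ring.
      rewrite cos_2a_sin, sin_2a. rfield.
    - intros; apply C4. }
  assert (H1 : 3 * s1 - 4 * s2 + 2 * (PI / 8) = 0).
  { rewrite <- I4. unfold s1, s2.
    assert (E : RInt (fun t => (3 * q t + - 4 * (sin t ^ 2 * q t)) + 2 * (sin t ^ 2 * cos t ^ 2)) 0 PI = 0).
    { rewrite (RInt_FTC (fun t => cos t * (sin t * ysq_ln (sin t)))).
      - rewrite sin_PI, sin_0. rring.
      - lra.
      - intros t _. eapply der_eq.
        + apply der_mult; [apply is_derive_cos|].
          apply (is_derive_comp (fun y => y * ysq_ln y) sin); [apply is_derive_y_ysq_ln | apply is_derive_sin].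
        + unfold scal; simpl. unfold mult; simpl. fold (q t). 
          replace (cos t * (cos t * (3 * q t + 2 * (sin t * (sin t * 1))))) with (cos t ^ 2 * (3 * q t) + 2 * (sin t * (sin t * 1) * cos t ^ 2)) by (simpl; ring).
          pose proof (sin2c t) as Hs. simpl in *. replace (cos t * (cos t * 1) * (3 * q t)) with (3 * q t * (1 - sin t * (sin t * 1))) by (rewrite Hs; ring).
          rring.
      - intros t _. apply cont_plus; [apply cont_plus; apply cont_mult; cont | cont]. }
    rewrite (RInt_plus' (fun t => 3 * q t + - 4 * (sin t ^ 2 * q t)) (fun t => 2 * (sin t ^ 2 * cos t ^ 2))) in E by (apply Hex; intros; cont).
    rewrite (RInt_lin q (fun t => sin t ^ 2 * q t)) in E by (apply Hex; assumption).
    rewrite (RInt_scal' (fun t => sin t ^ 2 * cos t ^ 2)) in E by (apply Hex; assumption). lra. }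
  assert (Hper : forall t, q (t + PI) = q t).
  { intros t. unfold q, ysq_ln. rewrite neg_sin. replace ((- sin t) ^ 2) with (sin t ^ 2) by ring. reflexivity. }
  assert (H2 : RInt (fun t => q (2 * t)) 0 PI = s1).
  { pose proof (RInt_comp_lin (V := R_CompleteNormedModule) q 2 0 0 PI (Hex _ _ _ Cs)) as H.
    rewrite Rmult_0_r, !Rplus_0_r in H.
    assert (E : 2 * RInt (fun t => q (2 * t)) 0 PI = RInt q 0 (2 * PI)).
    { rewrite <- H, <- RInt_scal'.
      - apply RInt_ext. intros t _. unfold scal; simpl. unfold mult; simpl. now rewrite Rplus_0_r.
      - apply Hex. intros t. apply (continuous_comp (fun t => 2 * t) q); [cont | apply Cs]. }
    rewrite (RInt_Chasles' q 0 PI (2 * PI)) in E by (apply Hex, Cs).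
    assert (E2 : RInt q PI (2 * PI) = s1).
    { replace PI with (0 + PI) at 1 by ring. replace (2 * PI) with (PI + PI) by ring.
      rewrite <- (RInt_shift q 0 PI PI Cs). apply RInt_ext. intros; apply Hper. }
    fold s1 in E. lra. }
  assert (H3 : RInt (fun t => sin t ^ 2 * ysq_ln (cos t)) 0 PI = s1 - s2).
  { set (W := fun t => cos t ^ 2 * q t).
    assert (E1 : RInt (fun t => sin t ^ 2 * ysq_ln (cos t)) 0 PI = RInt (fun t => W (t + PI / 2)) 0 PI).
    { apply RInt_ext. intros t _. unfold W, q. rewrite sin_plus, cos_plus, sin_PI2, cos_PI2.
      replace (sin t * 0 + cos t * 1) with (cos t) by ring. replace (cos t * 0 - sin t * 1) with (- sin t) by ring.
      replace ((- sin t) ^ 2) with (sin t ^ 2) by ring. reflexivity. }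
    rewrite E1, (RInt_shift W 0 PI (PI / 2) C3), Rplus_0_l.
    rewrite (RInt_Chasles' W (PI / 2) PI (PI + PI / 2)) by (apply Hex, C3).
    assert (E2 : RInt W PI (PI + PI / 2) = RInt W 0 (PI / 2)).
    { replace PI with (0 + PI) at 1 by ring. replace (PI + PI / 2) with (PI / 2 + PI) by ring.
      rewrite <- (RInt_shift W 0 (PI / 2) PI C3). apply RInt_ext. intros t _. unfold W. rewrite Hper, neg_cos.
      replace ((- cos t) ^ 2) with (cos t ^ 2) by ring. reflexivity. }
    assert (E3 : RInt W 0 PI = s1 - s2).
    { unfold s1, s2. rewrite <- (RInt_minus' q (fun t => sin t ^ 2 * q t)) by (apply Hex; assumption).
      apply RInt_ext. intros t _. unfold W. rewrite sin2c. rring. }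
    rewrite (RInt_Chasles' W 0 (PI / 2) PI) in E3 by (apply Hex, C3). lra. }
  assert (H4 : s1 = 4 * ln 4 * (PI / 8) + 4 * (s1 - s2) + 4 * (s1 - s2)).
  { rewrite <- H3 at 2. replace (s1 - s2) with (RInt (fun t => cos t ^ 2 * q t) 0 PI).
    2:{ unfold s1, s2. rewrite <- (RInt_minus' q (fun t => sin t ^ 2 * q t)) by (apply Hex; assumption).
        apply RInt_ext. intros t _. rewrite sin2c. rring. }
    rewrite <- I4, <- H2.
    assert (C5 : forall t, continuous (fun t => sin t ^ 2 * ysq_ln (cos t)) t) by (intros; cont).
    rewrite <- (RInt_lin (fun t => sin t ^ 2 * cos t ^ 2) (fun t => cos t ^ 2 * q t)) by (apply Hex; assumption).
    rewrite <- (RInt_scal' (fun t => sin t ^ 2 * ysq_ln (cos t))) by (apply Hex; assumption).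
    rewrite <- (RInt_plus' (fun t => 4 * ln 4 * (sin t ^ 2 * cos t ^ 2) + 4 * (cos t ^ 2 * q t)) (fun t => 4 * (sin t ^ 2 * ysq_ln (cos t)))) by (apply Hex; intros; cont).
    apply RInt_ext. intros t _. unfold q, ysq_ln. rewrite sin_2a.
    destruct (Req_dec (sin t) 0) as [Hs|Hs]; [rewrite Hs; simpl; rring|].
    destruct (Req_dec (cos t) 0) as [Hc|Hc]; [rewrite Hc; simpl; rring|].
    pose proof (sq_pos _ Hs). pose proof (sq_pos _ Hc).
    replace ((2 * sin t * cos t) ^ 2) with (4 * (sin t ^ 2 * cos t ^ 2)) by ring.
    rewrite ln_mult by nra. rewrite ln_mult by assumption. rring. }
  replace (ln 4) with (2 * ln 2) in H4 by (replace 4 with (2 * 2) by ring; rewrite ln_mult; lra).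
  lra.
Qed.

(** The reflection [t -> PI - t] exchanges [ln (1 - cos t)] and [ln (1 + cos t)], whose sum is
    [ln (sin t ^ 2)]; so this is half of [sin_sq_ln_int]. *)
Lemma sin_sq_ln_int' : RInt (fun t => sin t * (sin t * ln (1 - cos t))) 0 PI = PI / 4 - PI / 2 * ln 2.
Proof.
  pose proof PI2_3_2 as Hpi.
  set (f := fun t => sin t * (sin t * ln (1 - cos t))).
  assert (Cf : forall t, 0 <= t <= PI -> continuous f t).
  { intros t Ht. apply cont_mult; [cont | apply sin_ln_cont; lra]. }
  assert (Cf2 : forall t, 0 <= t <= PI -> continuous (fun t => f (PI - t)) t).
  { intros t Ht. apply (continuous_comp (fun t => PI - t) f); [cont | apply Cf; lra]. }
  assert (E : RInt f 0 PI + RInt (fun t => f (PI - t)) 0 PI = PI / 2 - PI * ln 2).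
  { rewrite <- sin_sq_ln_int, <- RInt_plus' by (apply ex_RInt_cont; [lra | assumption]).
    apply RInt_ext. intros t Ht. rewrite Rmin_left, Rmax_right in Ht by lra.
    unfold f, ysq_ln.
    replace (sin (PI - t)) with (sin t) by (rewrite sin_minus, sin_PI, cos_PI; ring).
    replace (cos (PI - t)) with (- cos t) by (rewrite cos_minus, sin_PI, cos_PI; ring).
    assert (H1 : cos t < 1) by (apply cos_lt_1; lra).
    assert (H2 : 0 < sin t) by (apply sin_gt_0; lra).
    assert (H3 : -1 < cos t).
    { destruct (Rle_lt_dec (cos t) (-1)) as [H|H]; [|assumption]. pose proof (COS_bound t). pose proof (sin2c t) as Hs.
      replace (cos t) with (-1) in Hs by lra. nra. }
    replace (sin t ^ 2) with ((1 - cos t) * (1 - - cos t)) at 2 by (rewrite sin2c; ring).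
    rewrite ln_mult by lra. simpl. rring. }
  rewrite (RInt_reflect f PI ltac:(lra) Cf) in E. lra.
Qed.

(** As [cos t ^ 2 = 1 - sin t ^ 2], the moments for [k = 0] and [k = 1] differ by the regular
    integrals of [P] and [Q]. Inserted into [Bs_step_k_id] at [k = 0], this determines the singular
    one. *)
Lemma Bs_base : is_lim_seq (Bs 0 0) (- PI * ln 2).
Proof.
  pose proof PI2_3_2 as Hpi.
  set (P := fun t => sin t * (sin t * ln (1 - cos t))).
  set (Q := fun t => Ep (cos t) 2).
  assert (CP : forall t, -1 <= t <= PI -> continuous P t).
  { intros t Ht. apply cont_mult; [cont | now apply sin_ln_cont]. }
  assert (CQ : forall t, continuous Q t).
  { intros t. apply (continuous_comp cos (fun c => Ep c 2)); [apply continuous_cos | apply Ep_cont]. }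
  assert (IQ : RInt Q 0 PI = - PI / 4).
  { rewrite (RInt_FTC (fun t => sin t - 3 / 4 * (t + sin t * cos t) + t / 2)).
    - rewrite sin_PI, sin_0. rfield.
    - lra.
    - intros t _. unfold Q. cbn [Ep]. auto_derive; [trivial|].
      replace (sin t * (1 * - sin t)) with (- (sin t ^ 2)) by (simpl; ring). rewrite sin2c. simpl. rfield.
    - intros; apply CQ. }
  assert (Hid : forall j, Bs 0 0 j = 2 * RInt P (es j) PI - 2 * RInt Q (es j) PI - RInt (fun t => 2 * cos t ^ (2 * 1)) (es j) PI - sin (es j) * Lam 1 (cos (es j))).
  { intros j. pose proof (es_bounds j) as He. pose proof (Bs_step_k_id 0 j) as H.
    assert (E : Bs 0 1 j = Bs 0 0 j - RInt P (es j) PI + RInt Q (es j) PI).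
    { unfold Bs.
      assert (EP : ex_RInt P (es j) PI) by (apply ex_RInt_cont; [lra|]; intros; apply CP; lra).
      assert (EQ : ex_RInt Q (es j) PI) by (apply ex_RInt_cont; [lra|]; intros; apply CQ).
      rewrite <- (RInt_minus' _ _ _ _ (ex_Bs 0 0 j) EP), <- (RInt_plus' _ _ _ _ (ex_RInt_minus' _ _ _ _ (ex_Bs 0 0 j) EP) EQ).
      apply RInt_ext. intros t _. simpl INR. rewrite Rmult_0_r, Rmult_0_l, cos_0.
      unfold P, Q, Lam. replace (2 * 1)%nat with 2%nat by lia. replace (2 * 0)%nat with 0%nat by lia. cbn [Ep].
      replace (sin t * (sin t * ln (1 - cos t))) with (sin t ^ 2 * ln (1 - cos t)) by (simpl; ring). rewrite sin2c. simpl. rfield. }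
    change (2 * 0)%nat with 0%nat in H. rewrite E in H. simpl (INR 0) in H. lra. }
  apply (is_lim_seq_ext _ _ _ (fun j => eq_sym (Hid j))).
  replace (- PI * ln 2) with (2 * (PI / 4 - PI / 2 * ln 2) - 2 * (- PI / 4) - 2 * (PI * Aw 1) - 0) by (simpl; field).
  apply is_lim_seq_minus'; [apply is_lim_seq_minus'; [apply is_lim_seq_minus'|]|].
  - rewrite <- sin_sq_ln_int'. apply (is_lim_seq_scal_l _ 2 (Finite _)), RInt_es_lim, CP.
  - rewrite <- IQ. apply (is_lim_seq_scal_l _ 2 (Finite _)), RInt_es_lim. intros; apply CQ.
  - rewrite <- (Aw_int 1). apply RInt_es_lim. intros; cont.
  - apply (es_lim_0 (fun t => sin t * Lam 1 (cos t))); [intros; now apply sin_Lam_cont | rewrite sin_0; ring].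
Qed.

Lemma log_moment n k : is_lim_seq (Bs n k) (PI * (Yc n k - tau n k)).
Proof.
  pose proof PI_RGT_0 as Hpi. pose proof (pos_INR k) as Hk.
  induction n as [|n IH].
  - rewrite tau_0, Rminus_0_r. clear Hk. induction k as [|k IH].
    + replace (PI * Yc 0 0) with (- PI * ln 2) by (simpl; ring). apply Bs_base.
    + apply Bs_step_k in IH. pose proof (pos_INR k) as Hk.
      replace (PI * Yc 0 (S k)) with (((2 * INR k + 1) * (PI * Yc 0 k) - 2 * (PI * Aw (S k))) / (2 * INR k + 2)); [exact IH|].
      cbn [Yc Aw harmonic]. rewrite S_INR. field. lra.
  - apply Bs_step_n in IH. pose proof (pos_INR n) as Hn. pose proof (tau_S n k) as Ht.
    replace (PI * (Yc (S n) k - tau (S n) k)) with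
     (((INR k - INR n) * (PI * (Yc n k - tau n k)) + PI / 2 * (Ac n k - Ac (S n) k) - PI) / (INR k + INR n + 1)); [exact IH|].
    cbn [Yc]. replace (tau (S n) k) with ((1 - (INR n - INR k) * tau n k) / (INR k + INR n + 1)).
    + field. lra.
    + replace (1 - (INR n - INR k) * tau n k) with ((INR k + INR n + 1) * tau (S n) k) by lra. field. lra.
Qed.

(** Integration by parts of [sin (2 n t) (Lam (2k+2) (cos t) - Lam 0 (cos t))]: subtracting [Lam 0]
    cancels the pole [1/(1 - cos t)] that each derivative contains, and accounts for the moment with
    index 0. *)
Lemma log_moment_sin n k : (1 <= n)%nat ->
  RInt (fun t => sin (2 * INR n * t) * sin t * Lam (S (2 * k)) (cos t)) 0 PI
  = INR n / INR (S k) * (PI * (Yc n (S k) - tau n (S k)) - PI * (Yc n 0 - tau n 0)).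
Proof.
  intros Hn. pose proof PI2_3_2 as Hpi.
  assert (Hk : 0 < INR (S k)) by (apply lt_0_INR; lia).
  assert (HU : forall t, chebU (2 * n - 1) (cos t) * sin t = sin (2 * INR n * t)).
  { intros t. rewrite chebU_sin. f_equal. replace (S (2 * n - 1)) with (2 * n)%nat by lia. rewrite mult_INR. simpl. ring. }
  set (f := fun t => sin (2 * INR n * t) * sin t * Lam (S (2 * k)) (cos t)).
  assert (Cf : forall t, -1 <= t <= PI -> continuous f t).
  { intros t Ht. apply (continuous_ext (fun t => sin (2 * INR n * t) * (sin t * Lam (S (2 * k)) (cos t)))); [intros; unfold f; rring|].
    apply cont_mult; [cont | now apply sin_Lam_cont]. }
  set (G := fun t => chebU (2 * n - 1) (cos t) * (sin t * Lam (2 * S k) (cos t) - sin t * Lam 0 (cos t))).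
  assert (CG : forall t, -1 <= t <= PI -> continuous G t).
  { intros t Ht. apply cont_mult; [apply chebU_cos_cont; cont | apply cont_minus; now apply sin_Lam_cont]. }
  assert (Hid : forall j, RInt f (es j) PI = / (2 * INR (S k)) * (2 * INR n * (Bs n (S k) j - Bs n 0 j) + G (es j))).
  { intros j. pose proof (es_bounds j) as He.
    assert (Ef : ex_RInt f (es j) PI) by (apply ex_RInt_cont; [lra|]; intros; apply Cf; lra).
    assert (E : 2 * INR n * (Bs n (S k) j - Bs n 0 j) + - (2 * INR (S k)) * RInt f (es j) PI = - G (es j)).
    { unfold Bs. rewrite <- (RInt_minus' _ _ _ _ (ex_Bs n (S k) j) (ex_Bs n 0 j)).
      rewrite <- (RInt_lin _ _ _ _ _ _ (ex_RInt_minus' _ _ _ _ (ex_Bs n (S k) j) (ex_Bs n 0 j)) Ef).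
      rewrite (RInt_FTC G).
      - unfold G at 1. rewrite sin_PI. rring.
      - lra.
      - intros t Ht. assert (Hct : cos t < 1) by (apply cos_lt_1; lra).
        apply (is_derive_ext (fun t => sin (2 * INR n * t) * (Lam (2 * S k) (cos t) - Lam 0 (cos t)))).
        { intros s. unfold G. rewrite <- HU. rring. }
        eapply der_eq.
        + apply der_mult; [|apply der_minus; apply is_derive_Lam_cos; lra].
          instantiate (1 := 2 * INR n * cos (2 * INR n * t)). auto_derive; [trivial | rring].
        + unfold f. replace (2 * S k)%nat with (S (S (2 * k))) by lia. cbn [pred]. simpl (2 * 0)%nat.
          replace (INR (S (S (2 * k)))) with (2 * INR (S k)) by (rewrite !S_INR, mult_INR; simpl; ring).
          simpl (INR 0). rfield. lra.
      - intros t Ht. apply cont_plus; apply cont_mult; try apply cont_const; [|apply Cf; lra].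
        apply cont_minus; (apply cont_mult; [cont | apply Lam_cos_cont; lra]). }
    apply Rmult_eq_reg_l with (2 * INR (S k)); [|lra].
    rewrite <- Rmult_assoc, Rinv_r, Rmult_1_l by lra. lra. }
  pose proof (RInt_es_lim f Cf) as L1.
  assert (L2 : is_lim_seq (fun j => RInt f (es j) PI) (/ (2 * INR (S k)) * (2 * INR n * (PI * (Yc n (S k) - tau n (S k)) - PI * (Yc n 0 - tau n 0)) + 0))).
  { apply (is_lim_seq_ext _ _ _ (fun j => eq_sym (Hid j))).
    apply (is_lim_seq_scal_l _ _ (Finite _)). apply is_lim_seq_plus'.
    - apply (is_lim_seq_scal_l _ _ (Finite _)). apply is_lim_seq_minus'; apply log_moment.
    - apply (es_lim_0 G CG). unfold G. rewrite sin_0. ring. }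
  apply is_lim_seq_unique in L1. apply is_lim_seq_unique in L2. rewrite L1 in L2. injection L2 as L2. fold f. rewrite L2.
  change (match k with 0%nat => 1 | S _ => INR k + 1 end) with (INR (S k)). rfield. lra.
Qed.

(** * The Bessel function of the second kind *)

(** Termwise integration under a summable majorant, whose tail bounds the remainder uniformly on the
    interval. *)
Lemma RInt_series (f : nat -> R -> R) (g : R -> R) (b : nat -> R) a c : a <= c ->
  (forall k t, a <= t <= c -> continuous (f k) t) -> (forall k t, a <= t <= c -> Rabs (f k t) <= b k) ->
  ex_series b -> (forall t, a <= t <= c -> is_series (fun k => f k t) (g t)) -> ex_RInt g a c ->
  is_series (fun k => RInt (f k) a c) (RInt g a c).
Proof.
  intros Hac Hf Hb Eb Hg Eg.
  assert (Ef : forall k, ex_RInt (f k) a c) by (intros; apply ex_RInt_cont; auto).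
  apply is_series_lim.
  apply is_lim_seq_ext with (fun n => RInt g a c - (RInt g a c - sum_f_R0 (fun k => RInt (f k) a c) n)); [intros; ring|].
  replace (Finite (RInt g a c)) with (Finite (RInt g a c - 0)) by (f_equal; ring).
  apply is_lim_seq_minus'; [apply is_lim_seq_const|]. apply is_lim_seq_abs_0.
  apply is_lim_seq_le_le with (fun _ => 0) (fun n => (c - a) * Series (fun j => b (S n + j)%nat)).
  - intros n. split; [apply Rabs_pos|]. destruct (RInt_sum f a c n Ef) as [Es Hs].
    rewrite <- Hs, <- (RInt_minus' _ _ _ _ Eg Es), <- RInt_const'.
    apply RInt_Rabs_le; [assumption | now apply ex_RInt_minus' | apply ex_RInt_const|].
    intros t Ht.
    assert (H : g t - sum_f_R0 (fun k => f k t) n = Series (fun j => f (S n + j)%nat t)).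
    { rewrite <- (is_series_unique _ _ (Hg t ltac:(lra))), (Series_incr_n _ (S n)) by (try lia; eexists; apply Hg; lra).
      cbn [pred]. ring. }
    rewrite H. apply Rabs_Series_le; [intros j; apply Hb; lra | now apply (ex_series_shift b (S n))].
  - apply is_lim_seq_const.
  - replace (Finite 0) with (Rbar_mult (c - a) 0) by (simpl; f_equal; ring).
    apply is_lim_seq_scal_l, Series_tail_lim, Eb.
Qed.

Lemma cs_even k : cs (2 * k) = (-1) ^ k.
Proof.
  induction k as [|k IH]; [reflexivity|].
  replace (2 * S k)%nat with (S (S (2 * k))) by lia. cbn [cs pow]. rewrite IH. ring.
Qed.

Lemma cs_odd k : cs (S (2 * k)) = 0.
Proof.
  induction k as [|k IH]; [reflexivity|].
  replace (S (2 * S k)) with (S (S (S (2 * k)))) by lia. rewrite cs_S, sn_S, IH. ring.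
Qed.

Lemma TS_odd E x : geo E ->
  is_series (fun k => (-1) ^ k * E (S (2 * k)) / INR (fact (S (2 * k))) * x ^ S (2 * k)) (TS E x).
Proof.
  intros HE. set (u := fun p => sn p * E p / INR (fact p) * x ^ p).
  assert (H : is_series u (TS E x)).
  { apply is_pseries_R, PSeries_correct, CV_radius_inside, radius_S, HE. }
  apply is_series_lim in H. apply is_series_lim.
  apply is_lim_seq_ext with (fun n => sum_f_R0 u (S (2 * n))).
  - intros n. induction n as [|n IH].
    + unfold u. simpl. field.
    + replace (2 * S n)%nat with (S (S (2 * n))) by lia. cbn [sum_f_R0] in *. rewrite IH.
      unfold u at 1 2. rewrite !sn_S, cs_odd. replace (S (S (2 * n))) with (2 * S n)%nat by lia. rewrite cs_even.
      unfold Rdiv. ring.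
  - apply (is_lim_seq_subseq (sum_f_R0 u) (TS E x) (fun n => S (2 * n))); [|assumption].
    apply eventually_subseq. intros; lia.
Qed.

Lemma geo_lin E F a b : geo E -> geo F -> geo (fun p => a * E p + b * F p).
Proof.
  intros [M [B [HM [HB HE]]]] [M' [B' [HM' [HB' HF]]]].
  exists (Rabs a * M + Rabs b * M'), (Rmax B B'). pose proof (Rabs_pos a). pose proof (Rabs_pos b).
  pose proof (Rmax_l B B'). pose proof (Rmax_r B B').
  split; [nra|]. split; [lra|]. intros p.
  apply Rle_trans with (1 := Rabs_triang _ _). rewrite !Rabs_mult, Rmult_plus_distr_r, !Rmult_assoc.
  apply Rplus_le_compat; apply Rmult_le_compat_l; try apply Rabs_pos.
  - apply Rle_trans with (1 := HE p). apply Rmult_le_compat_l; [assumption|]. apply pow_incr. lra.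
  - apply Rle_trans with (1 := HF p). apply Rmult_le_compat_l; [assumption|]. apply pow_incr. lra.
Qed.

Lemma Ac_small n k : (k < n)%nat -> Ac n k = 0.
Proof.
  induction n as [|n IH]; [lia|]. intros H. cbn [Ac]. destruct (Nat.eq_dec k n) as [->|Hk].
  - unfold Rminus, Rdiv. rewrite Rplus_opp_r. ring.
  - rewrite IH by lia. ring.
Qed.

Lemma INR_fact_S m : INR (fact (S m)) = INR (S m) * INR (fact m).
Proof. rewrite fact_simpl. apply mult_INR. Qed.

Lemma Aw_closed k : Aw k * (INR (fact k) * INR (fact k)) * 4 ^ k = INR (fact (2 * k)).
Proof.
  induction k as [|k IH]; [simpl; ring|].
  replace (2 * S k)%nat with (S (S (2 * k))) by lia. rewrite !INR_fact_S, <- IH. cbn [Aw pow].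
  rewrite !S_INR, mult_INR. replace (INR 2) with 2 by (simpl; ring). pose proof (pos_INR k). field. lra.
Qed.

Lemma Ac_closed n j : Ac n (n + j) * (INR (fact j) * INR (fact (2 * n + j))) * 4 ^ (n + j) = INR (fact (2 * (n + j))).
Proof.
  revert j. induction n as [|n IH]; intros j.
  - apply (Aw_closed j).
  - replace (S n + j)%nat with (n + S j)%nat by lia. rewrite <- (IH (S j)). cbn [Ac].
    replace (2 * S n + j)%nat with (S (2 * n + S j)) by lia. rewrite (INR_fact_S j), (INR_fact_S (2 * n + S j)).
    rewrite !plus_INR, !S_INR, !plus_INR, mult_INR, !S_INR. replace (INR 0) with 0 by reflexivity. pose proof (pos_INR n). pose proof (pos_INR j). field. lra.
Qed.

(** The two harmonic numbers are those of the digamma values in the logarithmic series of [Y_2n];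
    [2 ln 2] later changes [ln x] into [ln (x/2)]. *)
Lemma Yc_closed n j : Yc n (n + j) = / 2 * Ac n (n + j) * (- (2 * ln 2) - harmonic j - harmonic (2 * n + j)).
Proof.
  revert j. induction n as [|n IH]; intros j.
  - cbn [Yc Ac Nat.add Nat.mul]. field.
  - replace (S n + j)%nat with (n + S j)%nat by lia. cbn [Yc]. rewrite (IH (S j)).
    cbn [Ac]. replace (2 * S n + j)%nat with (S (2 * n + S j)) by lia. cbn [harmonic].
    replace (2 * n + S j)%nat with (S (2 * n + j)) by lia. cbn [harmonic].
    rewrite !plus_INR, !S_INR, !plus_INR, mult_INR. replace (INR 2) with 2 by (simpl; ring).
    pose proof (pos_INR n). pose proof (pos_INR j). field. lra.
Qed.

(** Below the diagonal [Ac] vanishes and [Yc] obeys a homogeneous recursion started by [Ac k k].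
    These values produce the factorials in the finite part of [Y_2n]. *)
Lemma Yc_small k d : Yc (k + S d) k * (INR (fact (2 * k + S d)) * 4 ^ k) = / 2 * (-1) ^ d * (INR (fact (2 * k)) * INR (fact d)).
Proof.
  induction d as [|d IH].
  - replace (k + 1)%nat with (S k) by lia. cbn [Yc]. rewrite (Ac_small (S k)) by lia.
    pose proof (Ac_closed k 0) as H. rewrite !Nat.add_0_r in H. replace (2 * k + 1)%nat with (S (2 * k)) by lia.
    rewrite (INR_fact_S (2 * k)), S_INR, mult_INR. replace (INR 2) with 2 by (simpl; ring).
    simpl (fact 0) in *. replace (INR 1) with 1 in * by reflexivity. pose proof (pos_INR k).
    transitivity (/ 2 * (Ac k k * (1 * INR (fact (2 * k))) * 4 ^ k)); [field; lra | rewrite H; simpl; ring].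
  - replace (k + S (S d))%nat with (S (k + S d)) by lia. cbn [Yc]. rewrite (Ac_small (S (k + S d))), (Ac_small (k + S d)) by lia.
    replace (2 * k + S (S d))%nat with (S (2 * k + S d)) by lia. rewrite (INR_fact_S (2 * k + S d)), (INR_fact_S d).
    replace (/ 2 * (-1) ^ S d * (INR (fact (2 * k)) * (INR (S d) * INR (fact d)))) with (- INR (S d) * (/ 2 * (-1) ^ d * (INR (fact (2 * k)) * INR (fact d)))) by (simpl; ring).
    rewrite <- IH, !plus_INR, !S_INR, !plus_INR, !mult_INR, !S_INR. replace (INR 0) with 0 by reflexivity.
    pose proof (pos_INR k). pose proof (pos_INR d). field. lra.
Qed.

Lemma cos_nPI n : cos (INR n * PI) = (-1) ^ n.
Proof.
  induction n as [|n IH]; [simpl; rewrite Rmult_0_l; apply cos_0|].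
  rewrite S_INR, Rmult_plus_distr_r, Rmult_1_l, neg_cos, IH. simpl. ring.
Qed.

Lemma Yc_tau_0 n : (1 <= n)%nat -> Yc n 0 - tau n 0 = - / (2 * INR n).
Proof.
  intros Hn. assert (Hn' : 0 < INR n) by (apply lt_0_INR; lia). pose proof PI_RGT_0 as Hpi.
  assert (H1 : Yc n 0 = - (-1) ^ n / (2 * INR n)).
  { destruct n as [|d]; [lia|]. pose proof (Yc_small 0 d) as H. simpl (0 + S d)%nat in H. simpl (2 * 0)%nat in H. simpl (0 + S d)%nat in H.
    rewrite INR_fact_S in H. simpl (fact 0) in H. pose proof (INR_fact_lt_0 d) as Hf.
    replace (Yc (S d) 0) with (Yc (S d) 0 * (INR (S d) * INR (fact d) * 4 ^ 0) / (INR (S d) * INR (fact d))) by (simpl pow; field; lra).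
    rewrite H. replace (INR 1) with 1 by reflexivity. simpl pow. field. lra. }
  assert (H2 : tau n 0 = (1 - (-1) ^ n) / (2 * INR n)).
  { unfold tau. rewrite (RInt_ext _ (fun t => sin (2 * INR n * t))) by (intros; simpl; rring).
    rewrite (RInt_FTC (fun t => - cos (2 * INR n * t) / (2 * INR n))).
    - rewrite Rmult_0_r, cos_0. replace (2 * INR n * (PI / 2)) with (INR n * PI) by field. rewrite cos_nPI. rfield. lra.
    - lra.
    - intros t _. auto_derive; [trivial|]. rfield. lra.
    - intros; cont. }
  rewrite H1, H2. field. lra.
Qed.
Ltac unscal := match goal with |- @scal _ _ ?a ?b = ?c => change (@eq R (a * b) c) end.

Lemma TC_even E x : geo E ->
  is_series (fun k => (-1) ^ k * E (2 * k)%nat / INR (fact (2 * k)) * x ^ (2 * k)) (TC E x).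
Proof.
  intros HE. set (u := fun p => cs p * E p / INR (fact p) * x ^ p).
  assert (H : is_series u (TC E x)).
  { apply is_pseries_R, PSeries_correct, CV_radius_inside, radius_C, HE. }
  apply is_series_lim in H. apply is_series_lim.
  apply is_lim_seq_ext with (fun n => sum_f_R0 u (2 * n)).
  - intros n. induction n as [|n IH].
    + unfold u. simpl. field.
    + replace (2 * S n)%nat with (S (S (2 * n))) by lia. cbn [sum_f_R0] in *. rewrite IH.
      unfold u at 1 2. rewrite cs_odd. replace (S (S (2 * n))) with (2 * S n)%nat by lia. rewrite cs_even.
      unfold Rdiv. ring.
  - apply (is_lim_seq_subseq (sum_f_R0 u) (TC E x) (fun n => (2 * n)%nat)); [|assumption].
    apply eventually_subseq. intros; lia.
Qed.

(** [pow_fact_le_exp] at [2 y]; it supplies the geometric majorants for termwise integration. *)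
Lemma fact_geo y p : 0 <= y -> y ^ p / INR (fact p) <= exp (2 * y) * (/ 2) ^ p.
Proof.
  intros Hy. pose proof (pow_fact_le_exp (2 * y) p ltac:(lra)) as H. rewrite Rpow_mult_distr in H.
  rewrite pow_inv. pose proof (pow_lt 2 p ltac:(lra)) as H2.
  apply Rmult_le_reg_l with (2 ^ p); [assumption|].
  replace (2 ^ p * (exp (2 * y) * / 2 ^ p)) with (exp (2 * y)) by (field; lra). unfold Rdiv in *. lra.
Qed.

Lemma half_pow_le p k : (k <= p)%nat -> (/ 2) ^ p <= (/ 2) ^ k.
Proof.
  intros H. rewrite !pow_inv. apply Rinv_le_contravar; [apply pow_lt; lra|]. apply Rle_pow; [lra | assumption].
Qed.

Lemma ex_series_half C : ex_series (fun k => C * (/ 2) ^ k).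
Proof.
  apply (ex_series_scal_l C (fun k => (/ 2) ^ k)). exists (/ (1 - / 2)). apply is_series_geom. rewrite Rabs_pos_eq; lra.
Qed.

Lemma cont_bounded (f : R -> R) a b : a <= b -> (forall t, a <= t <= b -> continuous f t) ->
  exists M, 0 <= M /\ forall t, a <= t <= b -> Rabs (f t) <= M.
Proof.
  intros Hab Hf. destruct (continuity_ab_maj (fun t => Rabs (f t)) a b Hab) as [m [Hm _]].
  - intros t Ht. apply continuity_pt_filterlim. apply cont_Rabs, Hf, Ht.
  - exists (Rabs (f m)). split; [apply Rabs_pos | exact Hm].
Qed.

Lemma sin_sin_moment n k : RInt (fun t => sin (2 * INR n * t) * sin t * cos t ^ S (2 * k)) 0 PI = INR n / INR (S k) * (PI * Ac n (S k)).
Proof.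
  pose proof PI_RGT_0 as Hpi. assert (Hk : 0 < INR (S k)) by (apply lt_0_INR; lia).
  set (f := fun t => sin (2 * INR n * t) * sin t * cos t ^ S (2 * k)).
  assert (Cf : forall t, continuous f t) by (intros; unfold f; cont).
  assert (Ef : ex_RInt f 0 PI) by (apply ex_RInt_cont; [lra | intros; apply Cf]).
  assert (Ec : ex_RInt (fun t => cos (2 * INR n * t) * cos t ^ (2 * S k)) 0 PI) by (apply ex_RInt_cont; [lra | intros; cont]).
  assert (E : 2 * INR n * (PI * Ac n (S k)) + - (2 * INR (S k)) * RInt f 0 PI = 0).
  { rewrite <- cos_moment, <- (RInt_lin _ _ _ _ _ _ Ec Ef).
    rewrite (RInt_FTC (fun t => sin (2 * INR n * t) * cos t ^ (2 * S k))).
    - replace (2 * INR n * PI) with (INR (2 * n) * PI) by (rewrite mult_INR; simpl; ring).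
      rewrite sin_nat_PI, Rmult_0_r, sin_0. rring.
    - lra.
    - intros t _. eapply der_eq.
      + apply (der_mult (fun t => sin (2 * INR n * t)) (fun t => cos t ^ (2 * S k))).
        * instantiate (1 := 2 * INR n * cos (2 * INR n * t)). auto_derive; [trivial | rring].
        * apply (is_derive_pow cos (2 * S k)), is_derive_cos.
      + unfold f. replace (2 * S k)%nat with (S (S (2 * k))) by lia. cbn [pred].
        replace (INR (S (S (2 * k)))) with (2 * INR (S k)) by (rewrite !S_INR, mult_INR; simpl; ring). rring.
    - intros t _. apply cont_plus; cont. }
  apply Rmult_eq_reg_l with (2 * INR (S k)); [|lra].
  replace (2 * INR (S k) * (INR n / INR (S k) * (PI * Ac n (S k)))) with (2 * INR n * (PI * Ac n (S k))) by (field; lra). lra.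
Qed.

(** The argument [x (1 - cos t)] is written with [sin (t/2) ^ 2], so that continuity at [t = 0]
    comes from [hfun_sq_cont]. *)
Definition Ux (n : nat) (x t : R) : R := chebU (2 * n - 1) (cos t) * ((1 + cos t) * hfun (2 * x * sin (t / 2) ^ 2)).

Lemma Ux_cont n x t : 0 < x -> continuous (Ux n x) t.
Proof.
  intros Hx. unfold Ux. apply cont_mult; [apply chebU_cos_cont; cont|]. apply cont_mult; [cont|].
  apply (continuous_comp (fun t => sin (t / 2)) (fun u => hfun (2 * x * u ^ 2))); [|apply hfun_sq_cont; lra].
  unfold Rdiv. cont.
Qed.

(** Up to factors, the coefficient of an even power of [x] in the integrated expansion. The constant
    [1/(2n)] is minus the moment with index 0 of [log_moment_sin]; it makes [Qm n x 0 = 0]. *)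
Definition Qm (n : nat) (x : R) (j : nat) : R :=
  (euler_gamma + ln x) * Ac n j + Yc n j - tau n j + / (2 * INR n).

Lemma sin_2n n t : (1 <= n)%nat -> chebU (2 * n - 1) (cos t) * sin t = sin (2 * INR n * t).
Proof.
  intros Hn. rewrite chebU_sin. f_equal. replace (S (2 * n - 1)) with (2 * n)%nat by lia. rewrite mult_INR. simpl. ring.
Qed.

(** With [cos x = 1] and [sin x = 0], [Lap0_expansion] isolates [Lap 0]. Since [sin (2 n t) sin t =
    U(cos t) (1 - cos t) (1 + cos t)], the factor [1 - cos t] completes [Lap 0] to
    [x (1 - cos t) Lap 0 (x (1 - cos t))], which is 1 minus [hfun]. *)
Lemma Ux_pointwise n x t : (1 <= n)%nat -> 0 < x -> cos x = 1 -> sin x = 0 -> 0 <= t <= PI ->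
  sin (2 * INR n * t) * sin t * TS (fun p => (euler_gamma + ln x + ln (1 - cos t)) * cos t ^ p + 1 * Ep (cos t) p) x
  = PI / 2 * (sin (2 * INR n * t) * sin t * cos (x * cos t)) - / x * (chebU (2 * n - 1) (cos t) * (1 + cos t) - Ux n x t).
Proof.
  intros Hn Hx Hc Hs Ht. unfold Ux.
  replace (2 * x * sin (t / 2) ^ 2) with (x * (1 - cos t)) by (replace (cos t) with (cos (2 * (t / 2))) by (f_equal; field); rewrite cos_2a_sin; ring).
  destruct (Req_dec t 0) as [->|Ht0].
  - rewrite sin_0, cos_0. replace (x * (1 - 1)) with 0 by ring. unfold hfun. ring.
  - assert (Hct : cos t < 1) by (apply cos_lt_1; lra). pose proof (COS_bound t) as Hb.
    rewrite TS_lin by (try apply geo_pow; apply geo_Ep; lra). rewrite (proj1 (TSC_pow _ _)).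
    pose proof (Lap0_expansion (cos t) x ltac:(lra) Hx) as H. rewrite Hc, Hs in H. rewrite ln_mult in H by lra.
    unfold hfun. replace (chebU (2 * n - 1) (cos t) * (1 + cos t) - chebU (2 * n - 1) (cos t) * ((1 + cos t) * (1 - x * (1 - cos t) * Lap 0 (x * (1 - cos t)))))
      with (x * (chebU (2 * n - 1) (cos t) * (1 - cos t ^ 2) * Lap 0 (x * (1 - cos t)))) by ring.
    rewrite <- sin2c. replace (chebU (2 * n - 1) (cos t) * sin t ^ 2) with (sin (2 * INR n * t) * sin t) by (rewrite <- sin_2n by assumption; ring).
    rewrite <- (Rmult_assoc (/ x) x), Rinv_l, Rmult_1_l by lra.
    replace (Lap 0 (x * (1 - cos t))) with (PI / 2 * cos (cos t * x) - (euler_gamma + (ln x + ln (1 - cos t))) * sin (cos t * x) - TS (Ep (cos t)) x) by lra.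
    rewrite (Rmult_comm x (cos t)). ring.
Qed.

(** [Ux_pointwise] is integrated over [[0, PI]], its left side termwise as a sine series in [x]. The
    factor [sin t] tames the logarithm, so that the coefficients are bounded by a multiple of [2^p]
    and the factorial yields a geometric majorant. *)
Lemma log_series_terms n x : (1 <= n)%nat -> 0 < x -> cos x = 1 -> sin x = 0 ->
  is_series (fun j => 2 * ((-1) ^ j * x ^ (2 * j) / INR (fact (2 * j))) * Qm n x j)
    (/ INR n - / (PI * INR n) * RInt (Ux n x) 0 PI).
Proof.
  intros Hn Hx Hc Hs. pose proof PI2_3_2 as Hpi. assert (Hn' : 0 < INR n) by (apply lt_0_INR; lia).
  set (E := fun t p => (euler_gamma + ln x + ln (1 - cos t)) * cos t ^ p + 1 * Ep (cos t) p).
  set (g := fun t => sin (2 * INR n * t) * sin t * TS (E t) x).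
  set (L := fun p t => sin (2 * INR n * t) * sin t * ((euler_gamma + ln x) * cos t ^ p) + sin (2 * INR n * t) * (sin t * Lam p (cos t))).
  set (d := fun k => (-1) ^ k / INR (fact (S (2 * k))) * x ^ S (2 * k)).
  set (f := fun k t => d k * L (S (2 * k)) t).
  assert (CL : forall p t, -1 <= t <= PI -> continuous (L p) t).
  { intros p t Ht. apply cont_plus; [cont|]. apply cont_mult; [cont | now apply sin_Lam_cont]. }
  destruct (cont_bounded (fun t => sin t * ln (1 - cos t)) 0 PI) as [B [HB0 HB]]; [lra | intros; apply sin_ln_cont; lra|].
  set (A := Rabs (euler_gamma + ln x)). assert (HA : 0 <= A) by apply Rabs_pos.
  assert (Hpow : forall t p, Rabs (cos t ^ p) <= 1).
  { intros t p. rewrite <- RPow_abs. rewrite <- (pow1 p). apply pow_incr. split; [apply Rabs_pos|]. apply Rabs_le, COS_bound. }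
  assert (Hsin : forall t, Rabs (sin t) <= 1) by (intros; apply Rabs_le, SIN_bound).
  assert (BL : forall p t, 0 <= t <= PI -> Rabs (L p t) <= A + (B + 2 * INR p)).
  { intros p t Ht. unfold L. apply Rle_trans with (1 := Rabs_triang _ _). apply Rplus_le_compat.
    - rewrite !Rabs_mult. fold A. pose proof (Rabs_pos (sin (2 * INR n * t))). pose proof (Rabs_pos (sin t)). pose proof (Rabs_pos (cos t ^ p)).
      pose proof (Hsin t). pose proof (Hsin (2 * INR n * t)). pose proof (Hpow t p).
      assert (Rabs (sin (2 * INR n * t)) * Rabs (sin t) <= 1) by nra.
      assert (A * Rabs (cos t ^ p) <= A) by nra. assert (0 <= A * Rabs (cos t ^ p)) by nra. nra.
    - rewrite Rabs_mult. apply Rle_trans with (1 * Rabs (sin t * Lam p (cos t))).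
      { apply Rmult_le_compat_r; [apply Rabs_pos | apply Hsin]. }
      rewrite Rmult_1_l. unfold Lam.
      replace (sin t * (cos t ^ p * ln (1 - cos t) + Ep (cos t) p)) with (cos t ^ p * (sin t * ln (1 - cos t)) + sin t * Ep (cos t) p) by ring.
      apply Rle_trans with (1 := Rabs_triang _ _). rewrite !(Rabs_mult (cos t ^ p)), !(Rabs_mult (sin t) (Ep _ _)).
      pose proof (HB t Ht) as H1. cbv beta in H1. pose proof (Ep_bound (cos t) p (COS_bound t)) as H2. pose proof (Hpow t p). pose proof (Hsin t).
      pose proof (Rabs_pos (cos t ^ p)). pose proof (Rabs_pos (sin t)). pose proof (Rabs_pos (sin t * ln (1 - cos t))). pose proof (Rabs_pos (Ep (cos t) p)).
      apply Rplus_le_compat; nra. }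
  assert (Hg : forall t, 0 <= t <= PI -> g t = PI / 2 * (sin (2 * INR n * t) * sin t * cos (x * cos t)) - / x * (chebU (2 * n - 1) (cos t) * (1 + cos t) - Ux n x t)).
  { intros t Ht. now apply Ux_pointwise. }
  set (w := fun t => sin (2 * INR n * t) * sin t * cos (x * cos t)).
  assert (Ew : ex_RInt w 0 PI) by (apply ex_RInt_cont; [lra | intros; unfold w; cont]).
  set (v := fun t => chebU (2 * n - 1) (cos t) * (1 + cos t)).
  assert (Cv : forall t, continuous v t) by (intros; apply cont_mult; [apply chebU_cos_cont; cont | cont]).
  assert (Ev : ex_RInt v 0 PI) by (apply ex_RInt_cont; [lra | intros; apply Cv]).
  assert (EU : ex_RInt (Ux n x) 0 PI) by (apply ex_RInt_cont; [lra | intros; now apply Ux_cont]).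
  assert (Evu : ex_RInt (fun t => v t - Ux n x t) 0 PI) by now apply ex_RInt_minus'.
  assert (Eg' : ex_RInt (fun t => PI / 2 * w t + - / x * (v t - Ux n x t)) 0 PI) by (apply ex_RInt_plus'; now apply ex_RInt_scal').
  assert (Hgw : forall t, 0 < t < PI -> PI / 2 * w t + - / x * (v t - Ux n x t) = g t).
  { intros t Ht. rewrite Hg by lra. unfold v, w. ring. }
  assert (Eg : ex_RInt g 0 PI).
  { apply (ex_RInt_ext (fun t => PI / 2 * w t + - / x * (v t - Ux n x t))); [|exact Eg'].
    rewrite Rmin_left, Rmax_right by lra. exact Hgw. }
  (* Under [t -> PI - t] the factors [sin t] and [cos (x cos t)] are even, while [sin (2 n t)] is
     odd. *)
  assert (Iw : RInt w 0 PI = 0).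
  { assert (H : RInt (fun t => w (PI - t)) 0 PI = RInt w 0 PI) by (apply RInt_reflect; [lra | intros; unfold w; cont]).
    rewrite (RInt_ext _ (fun t => - (1) * w t)) in H.
    - rewrite (RInt_scal' _ _ _ _ Ew) in H. lra.
    - intros t _. unfold w. replace (sin (PI - t)) with (sin t) by (rewrite sin_minus, sin_PI, cos_PI; ring).
      replace (cos (PI - t)) with (- cos t) by (rewrite cos_minus, sin_PI, cos_PI; ring).
      replace (2 * INR n * (PI - t)) with (INR (2 * n) * PI - 2 * INR n * t) by (rewrite mult_INR; simpl; ring).
      rewrite sin_minus, sin_nat_PI, cos_nPI. rewrite pow_mult. replace ((-1) ^ 2) with 1 by ring. rewrite pow1.
      replace (x * - cos t) with (- (x * cos t)) by ring. rewrite cos_neg. rring. }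
  assert (Iv : RInt v 0 PI = PI).
  { transitivity (RInt (fun t => (1 + cos t) * chebU (2 * n - 1) (cos t)) 0 PI); [apply RInt_ext; intros; unfold v; rring | apply chebU_weight_int]. }
  assert (Ig : RInt g 0 PI = - / x * (PI - RInt (Ux n x) 0 PI)).
  { rewrite <- (RInt_ext (fun t => PI / 2 * w t + - / x * (v t - Ux n x t))) by (rewrite Rmin_left, Rmax_right by lra; exact Hgw).
    rewrite (RInt_lin _ _ _ _ _ _ Ew Evu), (RInt_minus' _ _ _ _ Ev EU), Iw, Iv. rring. }
  assert (S1 : is_series (fun k => RInt (f k) 0 PI) (RInt g 0 PI)).
  { apply (RInt_series f g (fun k => (A + (B + 2)) * exp (2 * (2 * x)) * (/ 2) ^ k)).
    - lra.
    - intros k t Ht. apply cont_mult; [cont | apply CL; lra].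
    - intros k t Ht. unfold f. rewrite Rabs_mult. set (p := S (2 * k)).
      assert (Hd : Rabs (d k) = x ^ p / INR (fact p)).
      { unfold d. fold p. unfold Rdiv. rewrite !Rabs_mult, pow_1_abs, Rabs_inv, !Rabs_pos_eq; [ring | apply pow_le; lra | apply pos_INR]. }
      assert (H1 : 1 <= 2 ^ p) by (apply pow_R1_Rle; lra). pose proof (INR_le_pow2 p) as H2.
      pose proof (BL p t Ht) as H3. pose proof (fact_geo (2 * x) p ltac:(lra)) as H4. rewrite Rpow_mult_distr in H4.
      pose proof (half_pow_le p k ltac:(lia)) as H5. pose proof (pow_lt x p Hx) as H6. pose proof (INR_fact_lt_0 p) as H7.
      assert (H8 : 0 < x ^ p / INR (fact p)) by now apply Rdiv_lt_0_compat.
      assert (H9 : 2 ^ p * (x ^ p / INR (fact p)) <= exp (2 * (2 * x)) * (/ 2) ^ k).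
      { apply Rle_trans with (exp (2 * (2 * x)) * (/ 2) ^ p); [unfold Rdiv in *; lra|]. apply Rmult_le_compat_l; [left; apply exp_pos | exact H5]. }
      rewrite Hd. apply Rle_trans with (x ^ p / INR (fact p) * ((A + (B + 2)) * 2 ^ p)).
      + apply Rmult_le_compat_l; [lra|]. nra.
      + replace (x ^ p / INR (fact p) * ((A + (B + 2)) * 2 ^ p)) with ((A + (B + 2)) * (2 ^ p * (x ^ p / INR (fact p)))) by ring.
        rewrite Rmult_assoc. apply Rmult_le_compat_l; [lra | exact H9].
    - apply ex_series_half.
    - intros t Ht. unfold g.
      pose proof (TS_odd (E t) x) as H.
      assert (HE : geo (E t)) by (apply geo_lin; [apply geo_pow | apply geo_Ep, COS_bound]).
      specialize (H HE). apply (is_series_scal_l (sin (2 * INR n * t) * sin t)) in H.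
      refine (is_series_ext _ _ _ _ H). intros k. unscal. unfold f, d, L, E, Lam. field. apply INR_fact_neq_0.
    - exact Eg. }
  assert (If : forall k, RInt (f k) 0 PI = d k * (INR n / INR (S k) * (PI * Qm n x (S k)))).
  { intros k. unfold f.
    assert (Ek : ex_RInt (L (S (2 * k))) 0 PI) by (apply ex_RInt_cont; [lra | intros; apply CL; lra]).
    rewrite (RInt_scal' _ _ _ _ Ek). f_equal.
    rewrite (RInt_ext _ (fun t => (euler_gamma + ln x) * (sin (2 * INR n * t) * sin t * cos t ^ S (2 * k)) + 1 * (sin (2 * INR n * t) * sin t * Lam (S (2 * k)) (cos t)))) by (intros; unfold L; rring).
    rewrite RInt_lin.
    - rewrite sin_sin_moment, log_moment_sin by assumption. unfold Qm. pose proof (Yc_tau_0 n Hn) as H.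
      replace (PI * Yc n 0 - PI * tau n 0) with (PI * (- / (2 * INR n))) by (rewrite <- H; ring).
      rewrite <- Rmult_minus_distr_l, H. change (match k with O => 1 | S _ => INR k + 1 end) with (INR (S k)).
      assert (INR (S k) <> 0) by (apply not_0_INR; lia). set (r := INR (S k)) in *. rfield. lra.
    - apply ex_RInt_cont; [lra | intros; cont].
    - apply ex_RInt_cont; [lra|]. intros t Ht.
      apply (continuous_ext (fun t => sin (2 * INR n * t) * (sin t * Lam (S (2 * k)) (cos t)))); [intros; rring|].
      apply cont_mult; [cont | apply sin_Lam_cont; lra]. }
  (* The odd powers [x^(2k+1)], times [x], are the even powers with index [k + 1]; the missing index
     0 has coefficient 0. *)
  apply is_series_decr_1.
  match goal with |- is_series ?u (plus ?a (opp ?b)) => change (is_series u (a - b)) end. cbv beta.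
  assert (Q0 : Qm n x 0 = 0).
  { unfold Qm. rewrite Ac_small by lia. pose proof (Yc_tau_0 n Hn) as H. rewrite Rmult_0_r, Rplus_0_l, H. ring. }
  rewrite Q0, Rmult_0_r, Rminus_0_r.
  replace (/ INR n - / (PI * INR n) * RInt (Ux n x) 0 PI) with (- (x / (PI * INR n)) * RInt g 0 PI) by (rewrite Ig; rfield; lra).
  apply (is_series_scal_l (- (x / (PI * INR n)))) in S1.
  refine (is_series_ext _ _ _ _ S1). intros k. rewrite If. unscal. unfold d.
  replace (2 * S k)%nat with (S (S (2 * k))) by lia. cbn [pow].
  rewrite (INR_fact_S (S (2 * k))). replace (INR (S (S (2 * k)))) with (2 * INR (S k)) by (rewrite !S_INR, mult_INR; simpl; ring).
  assert (INR (S k) <> 0) by (apply not_0_INR; lia). set (r := INR (S k)) in *. 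
  pose proof (INR_fact_neq_0 (S (2 * k))). set (F := INR (fact (S (2 * k)))) in *. rfield. repeat split; lra.
Qed.

Lemma cos_series x : is_series (fun j => (-1) ^ j * x ^ (2 * j) / INR (fact (2 * j))) (cos x).
Proof.
  pose proof (TC_even (fun p => 1 ^ p) x (geo_pow 1)) as H. rewrite (proj2 (TSC_pow 1 x)), Rmult_1_l in H.
  refine (is_series_ext _ _ _ _ H). intros k. rewrite pow1. rfield. apply INR_fact_neq_0.
Qed.

Lemma tau_series n x : 0 < x ->
  is_series (fun j => (-1) ^ j * x ^ (2 * j) / INR (fact (2 * j)) * tau n j)
    (RInt (fun t => cos (x * cos t) * sin (2 * INR n * t)) 0 (PI / 2)).
Proof.
  intros Hx. pose proof PI_RGT_0 as Hpi.
  set (d := fun j => (-1) ^ j * x ^ (2 * j) / INR (fact (2 * j))).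
  set (f := fun j t => d j * (cos t ^ (2 * j) * sin (2 * INR n * t))).
  assert (H : is_series (fun j => RInt (f j) 0 (PI / 2)) (RInt (fun t => cos (x * cos t) * sin (2 * INR n * t)) 0 (PI / 2))).
  { apply (RInt_series f _ (fun k => exp (2 * x) * (/ 2) ^ k)).
    - lra.
    - intros; unfold f; cont.
    - intros k t _. unfold f. rewrite Rabs_mult.
      assert (Hd : Rabs (d k) = x ^ (2 * k) / INR (fact (2 * k))).
      { unfold d, Rdiv. rewrite !Rabs_mult, pow_1_abs, Rabs_inv, !Rabs_pos_eq; [ring | apply pos_INR | apply pow_le; lra]. }
      pose proof (fact_geo x (2 * k) ltac:(lra)) as H4. pose proof (half_pow_le (2 * k) k ltac:(lia)) as H5.
      assert (H6 : exp (2 * x) * (/ 2) ^ (2 * k) <= exp (2 * x) * (/ 2) ^ k) by (apply Rmult_le_compat_l; [left; apply exp_pos | exact H5]).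
      assert (H7 : Rabs (cos t ^ (2 * k) * sin (2 * INR n * t)) <= 1).
      { rewrite Rabs_mult, <- (Rmult_1_r 1). apply Rmult_le_compat; try apply Rabs_pos; [|apply Rabs_le, SIN_bound].
        rewrite <- RPow_abs, <- (pow1 (2 * k)). apply pow_incr. split; [apply Rabs_pos | apply Rabs_le, COS_bound]. }
      rewrite Hd. assert (H8 : 0 < x ^ (2 * k) / INR (fact (2 * k))) by (apply Rdiv_lt_0_compat; [now apply pow_lt | apply INR_fact_lt_0]).
      pose proof (Rabs_pos (cos t ^ (2 * k) * sin (2 * INR n * t))). nra.
    - apply ex_series_half.
    - intros t _. pose proof (TC_even (fun p => cos t ^ p) x (geo_pow _)) as H. rewrite (proj2 (TSC_pow _ _)) in H.
      apply (is_series_scal_l (sin (2 * INR n * t))) in H.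
      replace (cos (x * cos t) * sin (2 * INR n * t)) with (sin (2 * INR n * t) * cos (cos t * x)) by (rewrite (Rmult_comm x); ring).
      refine (is_series_ext _ _ _ _ H). intros k. unscal. unfold f, d. field. apply INR_fact_neq_0.
    - apply ex_RInt_cont; [lra | intros; cont]. }
  refine (is_series_ext _ _ _ _ H). intros k. unfold f, tau. apply RInt_scal', ex_RInt_cont; [lra | intros; cont].
Qed.

Lemma ex_besselJ_series N y : 0 < y ->
  ex_series (fun k => (-1) ^ k / (INR (fact k) * INR (fact (N + k))) * y ^ (2 * k + N)).
Proof.
  intros Hy. refine (proj1 (Rabs_Series_le _ (fun k => y ^ N * exp (2 * y ^ 2) * (/ 2) ^ k) _ (ex_series_half _))).
  intros k. unfold Rdiv. rewrite !Rabs_mult, pow_1_abs, Rabs_inv.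
  pose proof (INR_fact_lt_0 k) as H1. pose proof (INR_fact_lt_0 (N + k)) as H2.
  assert (H3 : 1 <= INR (fact (N + k))) by (apply (le_INR 1), lt_O_fact).
  rewrite Rabs_pos_eq, Rabs_pos_eq by (try apply pow_le; nra).
  pose proof (fact_geo (y ^ 2) k (pow2_ge_0 y)) as H4. rewrite <- pow_mult in H4. rewrite pow_add, Rinv_mult.
  assert (H5 : / INR (fact (N + k)) <= 1) by (rewrite <- Rinv_1; apply Rinv_le_contravar; lra).
  assert (H6 : 0 < / INR (fact (N + k))) by now apply Rinv_0_lt_compat.
  assert (H7 : 0 < y ^ (2 * k) / INR (fact k)) by (apply Rdiv_lt_0_compat; [now apply pow_lt | assumption]).
  assert (H8 : 0 < y ^ N) by now apply pow_lt.
  replace (1 * (/ INR (fact k) * / INR (fact (N + k))) * (y ^ (2 * k) * y ^ N)) with (y ^ N * (/ INR (fact (N + k)) * (y ^ (2 * k) / INR (fact k)))) by (unfold Rdiv; ring).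
  rewrite Rmult_assoc. apply Rmult_le_compat_l; nra.
Qed.

Lemma Ac_term n k y : 0 < y ->
  (2 * y) ^ (2 * (n + k)) / INR (fact (2 * (n + k))) * Ac n (n + k) = y ^ (2 * k + 2 * n) / (INR (fact k) * INR (fact (2 * n + k))).
Proof.
  intros Hy. rewrite <- Ac_closed. rewrite Rpow_mult_distr, (pow_mult 2). replace (2 ^ 2) with 4 by ring.
  replace (2 * (n + k))%nat with (2 * k + 2 * n)%nat by lia.
  pose proof (INR_fact_neq_0 k). pose proof (INR_fact_neq_0 (2 * n + k)). pose proof (pow_lt 4 (n + k) ltac:(lra)).
  enough (Ac n (n + k) <> 0) by (field; repeat split; lra).
  intros HA. pose proof (Ac_closed n k) as H3. rewrite HA, !Rmult_0_l in H3. symmetry in H3. now apply INR_fact_neq_0 in H3.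
Qed.

Lemma Yc_term n j y : (j < n)%nat -> 0 < y ->
  2 * ((-1) ^ j * (2 * y) ^ (2 * j) / INR (fact (2 * j)) * Yc n j) = - (-1) ^ n * (INR (fact (n - j - 1)) / INR (fact (n + j)) * y ^ (2 * j)).
Proof.
  intros Hj Hy. assert (exists d, n = j + S d)%nat as [d ->] by (exists (n - S j)%nat; lia). clear Hj.
  pose proof (Yc_small j d) as H. replace (j + S d - j - 1)%nat with d by lia. replace (j + S d + j)%nat with (2 * j + S d)%nat by lia.
  pose proof (INR_fact_neq_0 (2 * j + S d)). pose proof (INR_fact_neq_0 (2 * j)). pose proof (pow_lt 4 j ltac:(lra)).
  replace (Yc (j + S d) j) with (/ 2 * (-1) ^ d * (INR (fact (2 * j)) * INR (fact d)) / (INR (fact (2 * j + S d)) * 4 ^ j)) by (rewrite <- H; field; lra).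
  rewrite Rpow_mult_distr, (pow_mult 2). replace (2 ^ 2) with 4 by ring.
  rewrite pow_add. cbn [pow]. field. lra.
Qed.

(** Adding twice [tau_series] and [- 1/n] times the cosine series to [log_series_terms] leaves the
    coefficients with [Ac] and [Yc] only; since [cos x = 1], the two terms in [1/n] cancel. Indices
    [j >= n] give the logarithmic and digamma series of [Y_2n], indices [j < n] half of its finite
    part. *)
Lemma besselY_formula n x : (1 <= n)%nat -> 0 < x -> cos x = 1 -> sin x = 0 ->
  (-1) ^ n * PI * besselY (2 * n) x
  = 2 * RInt (fun t => cos (x * cos t) * sin (2 * INR n * t)) 0 (PI / 2)
    - (-1) ^ n * sum_f_R0 (fun i => INR (fact (2 * n - i - 1)) / INR (fact i) * (x / 2) ^ (2 * i) / (x / 2) ^ (2 * n)) (n - 1)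
    - / (PI * INR n) * RInt (Ux n x) 0 PI.
Proof.
  intros Hn Hx Hc Hs. pose proof PI_RGT_0 as Hpi. assert (Hn' : 0 < INR n) by (apply lt_0_INR; lia).
  set (I0 := RInt (fun t => cos (x * cos t) * sin (2 * INR n * t)) 0 (PI / 2)). set (IU := RInt (Ux n x) 0 PI).
  set (a := fun j => 2 * ((-1) ^ j * x ^ (2 * j) / INR (fact (2 * j))) * ((euler_gamma + ln x) * Ac n j + Yc n j)).
  set (T := 2 * I0 - / (PI * INR n) * IU).
  assert (Sa : is_series a T).
  { pose proof (log_series_terms n x Hn Hx Hc Hs) as H1. pose proof (is_series_scal_l 2 _ _ (tau_series n x Hx)) as H2.
    pose proof (is_series_scal_l (- / INR n) _ _ (cos_series x)) as H3.
    pose proof (is_series_plus _ _ _ _ (is_series_plus _ _ _ _ H1 H2) H3) as H4. rewrite Hc in H4.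
    replace T with (plus (plus (/ INR n - / (PI * INR n) * IU) (scal 2 I0)) (scal (- / INR n) 1)).
    - refine (is_series_ext _ _ _ _ H4). intros j. unfold plus, scal; cbn -[INR fact pow Nat.mul tau Ac Yc digamma_nat1]. unfold mult; cbn -[INR fact pow Nat.mul tau Ac Yc digamma_nat1].
      unfold a, Qm. rfield. split; [apply INR_fact_neq_0 | lra].
    - unfold plus, scal, T; simpl. unfold mult; simpl. rring. }
  set (y := x / 2). assert (Hy : 0 < y) by (unfold y; lra). assert (Hxy : x = 2 * y) by (unfold y; field).
  assert (San : is_series (fun k => a (n + k)%nat) (T - sum_f_R0 a (n - 1))).
  { apply (is_series_incr_n a n); [lia|]. replace (pred n) with (n - 1)%nat by lia. rewrite sum_n_Reals.
    unfold plus; cbn -[sum_f_R0]. replace (T - sum_f_R0 a (n - 1) + sum_f_R0 a (n - 1)) with T by ring. exact Sa. }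
  set (b := fun k => (-1) ^ k / (INR (fact k) * INR (fact (2 * n + k))) * y ^ (2 * k + 2 * n)).
  pose proof (Series_correct _ (ex_besselJ_series (2 * n) y Hy)) as Sb. fold b in Sb.
  set (J := Series b) in *.
  assert (HJ : besselJ (2 * n) x = J) by (unfold besselJ; apply series_eq; exact Sb).
  assert (Hab : forall k, a (n + k)%nat = (-1) ^ n * (2 * ln y * b k - (digamma_nat1 k + digamma_nat1 (2 * n + k)) * (-1) ^ k * y ^ (2 * k + 2 * n) / (INR (fact k) * INR (fact (2 * n + k))))).
  { intros k. unfold a, b. rewrite Yc_closed. pose proof (Ac_term n k y Hy) as HA. rewrite <- Hxy in HA.
    replace (2 * ((-1) ^ (n + k) * x ^ (2 * (n + k)) / INR (fact (2 * (n + k)))) * ((euler_gamma + ln x) * Ac n (n + k) + / 2 * Ac n (n + k) * (- (2 * ln 2) - harmonic k - harmonic (2 * n + k))))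
    with ((-1) ^ (n + k) * (x ^ (2 * (n + k)) / INR (fact (2 * (n + k))) * Ac n (n + k)) * (2 * (euler_gamma + ln x) - 2 * ln 2 - harmonic k - harmonic (2 * n + k))) by (field; apply INR_fact_neq_0).
    rewrite HA, Hxy, ln_mult, pow_add by lra. unfold digamma_nat1. field. split; apply INR_fact_neq_0. }
  assert (Hsq : (-1) ^ n * (-1) ^ n = 1) by (rewrite <- pow_add; replace (n + n)%nat with (2 * n)%nat by lia; apply pow_1_even).
  assert (Sg : is_series (fun k => (digamma_nat1 k + digamma_nat1 (2 * n + k)) * (-1) ^ k * y ^ (2 * k + 2 * n) / (INR (fact k) * INR (fact (2 * n + k))))
     (2 * ln y * J - (-1) ^ n * (T - sum_f_R0 a (n - 1)))).
  { pose proof (is_series_minus _ _ _ _ (is_series_scal_l (2 * ln y) _ _ Sb) (is_series_scal_l ((-1) ^ n) _ _ San)) as H.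
    refine (is_series_ext _ _ _ _ H). intros k. rewrite Hab. unfold plus, opp, scal; cbn -[INR fact pow Nat.mul tau Ac Yc digamma_nat1]. unfold mult; cbn -[INR fact pow Nat.mul tau Ac Yc digamma_nat1].
    match goal with |- _ = ?X => set (X0 := X) end. 
    transitivity (2 * ln y * b k - (-1) ^ n * (-1) ^ n * (2 * ln y * b k - X0)); [unfold X0; rring | rewrite Hsq; rring]. }
  unfold besselY. rewrite HJ. fold y. rewrite (series_eq _ _ Sg). destruct (Nat.eqb_spec (2 * n) 0) as [He|_]; [lia|].
  set (c := fun i => INR (fact (2 * n - i - 1)) / INR (fact i) * y ^ (2 * i) / y ^ (2 * n)).
  change (fun k : nat => INR (fact (2 * n - k - 1)) / INR (fact k) * y ^ (2 * k) / y ^ (2 * n)) with c.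
  (* The finite part of [Y_2n] has [2n] terms. Its upper half, with index [n + j], cancels against
     the terms [a j] with [j < n]; the lower half stays in the formula and is matched later by
     [zA_cos]. *)
  rewrite (tech2 c (n - 1) (2 * n - 1)) by lia. replace (2 * n - 1 - S (n - 1))%nat with (n - 1)%nat by lia.
  assert (Hca : sum_f_R0 (fun i => c (S (n - 1) + i)%nat) (n - 1) = - (-1) ^ n * sum_f_R0 a (n - 1)).
  { rewrite <- sum_mult. apply sum_eq. intros j Hj. replace (S (n - 1) + j)%nat with (n + j)%nat by lia. unfold c, a.
    rewrite (Ac_small n j) by lia. pose proof (Yc_term n j y ltac:(lia) Hy) as H. rewrite <- Hxy in H.
    replace (2 * ((-1) ^ j * x ^ (2 * j) / INR (fact (2 * j))) * ((euler_gamma + ln x) * 0 + Yc n j)) with (2 * ((-1) ^ j * x ^ (2 * j) / INR (fact (2 * j)) * Yc n j)) by ring.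
    rewrite H. replace (2 * n - (n + j) - 1)%nat with (n - j - 1)%nat by lia. replace (2 * (n + j))%nat with (2 * j + 2 * n)%nat by lia.
    rewrite pow_add. pose proof (pow_lt y (2 * n) Hy). pose proof (INR_fact_neq_0 (n + j)).
    transitivity ((-1) ^ n * (-1) ^ n * (INR (fact (n - j - 1)) / INR (fact (n + j)) * y ^ (2 * j))); [rewrite Hsq; field; lra | ring]. }
  rewrite Hca. unfold T. set (s1 := sum_f_R0 c (n - 1)). set (s2 := sum_f_R0 a (n - 1)).
  transitivity ((-1) ^ n * (-1) ^ n * (2 * I0 - / (PI * INR n) * IU) - (-1) ^ n * s1); [|rewrite Hsq; ring].
  field. lra.
Qed.

Ltac unscals := repeat match goal with |- context [@scal ?K ?V ?a ?b] => change (@scal K V a b) with (Rmult a b) end; req.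

(** * Bernoulli and Zagier polynomials *)

(* Unlike [Binomial.C], which uses truncated subtraction, [bin n k = 0] for [k > n]. *)
Fixpoint bin (n k : nat) : R :=
  match k with
  | O => 1
  | S j => match n with O => 0 | S m => bin m j + bin m (S j) end
  end.

Lemma bin_gt n k : (n < k)%nat -> bin n k = 0.
Proof.
  revert k. induction n as [|n IH]; intros [|k] H; try lia; [reflexivity|].
  cbn [bin]. rewrite !IH by lia. ring.
Qed.

Lemma C_0 n : Binomial.C n 0 = 1.
Proof. unfold Binomial.C. rewrite Nat.sub_0_r. simpl (fact 0). simpl (INR 1). pose proof (INR_fact_neq_0 n). field. assumption. Qed.

Lemma C_diag n : Binomial.C n n = 1.
Proof. unfold Binomial.C. rewrite Nat.sub_diag. simpl (fact 0). simpl (INR 1). pose proof (INR_fact_neq_0 n). field. assumption. Qed.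

Lemma bin_C n k : (k <= n)%nat -> bin n k = Binomial.C n k.
Proof.
  revert k. induction n as [|n IH]; intros [|k] H; try lia; try (now rewrite C_0); [].
  cbn [bin]. rewrite IH by lia. destruct (Nat.eq_dec k n) as [->|Hk].
  - rewrite bin_gt, !C_diag by lia. ring.
  - rewrite IH by lia. apply pascal. lia.
Qed.

Lemma chebU_at_0 m z : forall K, (m <= K)%nat ->
  chebU m z = sum_f_R0 (fun k => (-1) ^ k * bin (m - k) k * (2 * z) ^ (m - 2 * k)) K.
Proof.
  induction m as [| |m IH0 IH1] using chebU_ind; intros K HK.
  - rewrite chebU_0. induction K as [|K IH]; [simpl; ring|].
    cbn [sum_f_R0]. rewrite <- IH by lia. rewrite bin_gt by lia. ring.
  - rewrite chebU_1. destruct K as [|K]; [lia|]. clear HK. induction K as [|K IH]; [simpl; ring|].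
    cbn [sum_f_R0] in *. rewrite <- IH. rewrite bin_gt by lia. ring.
  - rewrite chebU_rec. destruct K as [|K]; [lia|]. rewrite (IH1 (S K)), (IH0 K) by lia.
    rewrite (decomp_sum _ (S K)), (decomp_sum (fun k => (-1) ^ k * bin (S (S m) - k) k * (2 * z) ^ (S (S m) - 2 * k)) (S K)) by lia. cbn [pred].
    rewrite (sum_eq (fun i => (-1) ^ S i * bin (S (S m) - S i) (S i) * (2 * z) ^ (S (S m) - 2 * S i))
      (fun i => 2 * z * ((-1) ^ S i * bin (S m - S i) (S i) * (2 * z) ^ (S m - 2 * S i)) - (-1) ^ i * bin (m - i) i * (2 * z) ^ (m - 2 * i))).
    + rewrite minus_sum, sum_mult.
      rewrite !Nat.mul_0_r, !Nat.sub_0_r. simpl bin. cbn [pow]. ring.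
    + intros i Hi. replace (S (S m) - 2 * S i)%nat with (m - 2 * i)%nat by lia.
      destruct (Nat.le_gt_cases i m) as [Him|Him].
      * replace (S (S m) - S i)%nat with (S (m - i)) by lia. replace (S m - S i)%nat with (m - i)%nat by lia. cbn [bin].
        destruct (Nat.le_gt_cases (S i) (m - i)) as [H|H].
        -- replace (m - 2 * i)%nat with (S (S m - 2 * S i)) by lia. cbn [pow]. ring.
        -- rewrite (bin_gt (m - i) (S i)) by lia. cbn [pow]. ring.
      * rewrite !bin_gt by lia. ring.
Qed.

(** The expansion of the Chebyshev polynomial about 1, whose binomials are those of the differences
    of Zagier polynomials. *)
Lemma chebU_at_1_expand m x : forall K, (m <= K)%nat ->
  chebU m (1 + x / 2) = sum_f_R0 (fun r => bin (S m + r) (S (2 * r)) * x ^ r) K.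
Proof.
  induction m as [| |m IH0 IH1] using chebU_ind; intros K HK.
  - rewrite chebU_0. induction K as [|K IH]; [simpl; ring|].
    cbn [sum_f_R0]. rewrite <- IH by lia. rewrite bin_gt by lia. ring.
  - rewrite chebU_1. destruct K as [|K]; [lia|]. clear HK. induction K as [|K IH]; [simpl; field|].
    cbn [sum_f_R0] in *. rewrite <- IH. rewrite bin_gt by lia. ring.
  - rewrite chebU_rec. replace (2 * (1 + x / 2)) with (2 + x) by field.
    destruct K as [|K]; [lia|]. rewrite Rmult_plus_distr_r. rewrite (IH1 (S K)) at 1 by lia. rewrite (IH1 K), (IH0 (S K)) by lia.
    rewrite (decomp_sum (fun r => bin (S (S m) + r) (S (2 * r)) * x ^ r) (S K)), (decomp_sum (fun r => bin (S (S (S m)) + r) (S (2 * r)) * x ^ r) (S K)), (decomp_sum (fun r => bin (S m + r) (S (2 * r)) * x ^ r) (S K)) by lia. cbn [pred].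
    rewrite (sum_eq (fun r => bin (S (S (S m)) + S r) (S (2 * S r)) * x ^ S r)
      (fun r => 2 * (bin (S (S m) + S r) (S (2 * S r)) * x ^ S r) + x * (bin (S (S m) + r) (S (2 * r)) * x ^ r) - bin (S m + S r) (S (2 * S r)) * x ^ S r)).
    + rewrite minus_sum, plus_sum, !sum_mult. rewrite !Nat.mul_0_r, !Nat.add_0_r. cbn [bin pow].
      assert (Hb0 : forall n, bin n 0 = 1) by (now intros []). assert (Hb1 : forall n, bin n 1 = INR n).
      { intros n. induction n as [|n IHn]; [reflexivity|]. cbn [bin]. rewrite IHn, Hb0, S_INR. ring. }
      rewrite !Hb0, !Hb1. ring.
    + intros r _. replace (S (S (S m)) + S r)%nat with (S (S (S m + S r))) by lia. replace (S (S m) + S r)%nat with (S (S m + S r)) by lia.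
      replace (S (2 * S r)) with (S (S (S (2 * r)))) by lia. replace (S (S m) + r)%nat with (S m + S r)%nat by lia.
      set (M := (S m + S r)%nat). set (j := S (2 * r)). cbn [bin pow]. ring.
Qed.

(** [bern_aux p] is a table filled up to index [p]; enlarging it leaves the earlier entries
    unchanged. *)
Lemma bern_aux_stable p d k : (k <= p)%nat -> bern_aux (p + d) k = bern_aux p k.
Proof.
  intros H. induction d as [|d IH]; [now rewrite Nat.add_0_r|].
  rewrite Nat.add_succ_r. cbn [bern_aux]. destruct (Nat.leb_spec k (p + d)); [exact IH | lia].
Qed.

Lemma bernoulli_rec p :
  INR (p + 2) * bernoulli (S p) = - sum_f_R0 (fun j => Binomial.C (p + 2) j * bernoulli j) p.
Proof.
  unfold bernoulli at 1. cbn [bern_aux]. destruct (Nat.leb_spec (S p) p) as [H|_]; [lia|].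
  rewrite (sum_eq (fun j => Binomial.C (p + 2) j * bern_aux p j) (fun j => Binomial.C (p + 2) j * bernoulli j)).
  - field. apply not_0_INR. lia.
  - intros i Hi. f_equal. replace p with (i + (p - i))%nat at 1 by lia. now apply bern_aux_stable.
Qed.

Lemma C_pred p : Binomial.C (S p) p = INR (S p).
Proof.
  unfold Binomial.C. replace (S p - p)%nat with 1%nat by lia. rewrite INR_fact_S. simpl (fact 1). simpl (INR 1).
  pose proof (INR_fact_neq_0 p). field. assumption.
Qed.

Lemma bernoulli_poly_0 r : bernoulli_poly r 0 = bernoulli r.
Proof.
  unfold bernoulli_poly. destruct r as [|r].
  - simpl. rewrite C_0. ring.
  - cbn [sum_f_R0]. rewrite (sum_eq _ (fun _ => 0)).
    + rewrite sum_eq_R0 by auto. rewrite C_diag, Nat.sub_diag. simpl. ring.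
    + intros i Hi. rewrite pow_ne_zero by lia. ring.
Qed.

Lemma bernoulli_poly_1 r : bernoulli_poly (S (S r)) 1 = bernoulli_poly (S (S r)) 0.
Proof.
  rewrite bernoulli_poly_0. unfold bernoulli_poly. rewrite (sum_eq _ (fun k => Binomial.C (S (S r)) k * bernoulli k)) by (intros; rewrite pow1; ring).
  cbn [sum_f_R0]. pose proof (bernoulli_rec r) as H. replace (r + 2)%nat with (S (S r)) in H by lia. rewrite C_diag, C_pred. lra.
Qed.

Lemma C_succ_mul r k : (k <= r)%nat -> Binomial.C (S r) k * INR (S r - k) = INR (S r) * Binomial.C r k.
Proof.
  intros H. unfold Binomial.C. replace (S r - k)%nat with (S (r - k)) by lia. rewrite !INR_fact_S.
  pose proof (INR_fact_neq_0 k). pose proof (INR_fact_neq_0 (r - k)). pose proof (not_0_INR (S (r - k)) ltac:(lia)).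
  set (q := INR (S (r - k))) in *. set (s := INR (S r)). field. repeat split; assumption.
Qed.

Lemma is_derive_bernoulli r x : is_derive (bernoulli_poly (S r)) x (INR (S r) * bernoulli_poly r x).
Proof.
  apply (is_derive_ext (fun x => sum_f_R0 (fun k => Binomial.C (S r) k * bernoulli k * x ^ (S r - k)) r + bernoulli (S r))).
  - intros t. unfold bernoulli_poly. cbn [sum_f_R0]. rewrite C_diag, Nat.sub_diag. simpl. rring.
  - replace (INR (S r) * bernoulli_poly r x) with (sum_f_R0 (fun k => INR (S r) * (Binomial.C r k * bernoulli k * x ^ (r - k))) r + 0).
    2:{ unfold bernoulli_poly. rewrite sum_mult. ring. }
    apply der_plus; [|apply der_const].
    assert (H : forall m, (m <= r)%nat -> is_derive (fun x => sum_f_R0 (fun k => Binomial.C (S r) k * bernoulli k * x ^ (S r - k)) m) x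
      (sum_f_R0 (fun k => INR (S r) * (Binomial.C r k * bernoulli k * x ^ (r - k))) m)).
    { assert (H1 : forall k, (k <= r)%nat -> is_derive (fun x => Binomial.C (S r) k * bernoulli k * x ^ (S r - k)) x (INR (S r) * (Binomial.C r k * bernoulli k * x ^ (r - k)))).
      { intros k Hk. eapply der_eq; [apply der_scal, der_pow|]. replace (pred (S r - k)) with (r - k)%nat by lia.
        req. transitivity (Binomial.C (S r) k * INR (S r - k) * (bernoulli k * x ^ (r - k))); [ring | rewrite C_succ_mul by assumption; ring]. }
      intros m. induction m as [|m IH]; intros Hm; cbn [sum_f_R0]; [now apply H1|].
      apply der_plus; [apply IH; lia | now apply H1]. }
    now apply H.
Qed.

Lemma bernoulli_poly_deg0 x : bernoulli_poly 0 x = 1.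
Proof. unfold bernoulli_poly. simpl. rewrite C_0. unfold bernoulli. simpl. ring. Qed.

(** By the case of lower degree the difference of both sides has derivative 0, and at [x = 0] it
    vanishes by [bernoulli_poly_1]. *)
Lemma bernoulli_diff r x : bernoulli_poly (S r) (x + 1) - bernoulli_poly (S r) x = INR (S r) * x ^ r.
Proof.
  revert x. induction r as [|r IH]; intros x.
  - unfold bernoulli_poly. cbn [sum_f_R0]. rewrite C_0, C_diag. simpl. unfold bernoulli. simpl. ring.
  - set (F := fun x => bernoulli_poly (S (S r)) (x + 1) - bernoulli_poly (S (S r)) x - INR (S (S r)) * x ^ S r).
    assert (HF : forall y, is_derive F y 0).
    { intros y. eapply der_eq.
      - apply der_minus; [apply der_minus|apply der_scal, der_pow].
        + apply (is_derive_comp (bernoulli_poly (S (S r))) (fun x => x + 1)); [apply is_derive_bernoulli|].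
          apply der_plus; [apply der_id | apply der_const].
        + apply is_derive_bernoulli.
      - unscals. cbn [pred]. specialize (IH y). 
        transitivity (INR (S (S r)) * ((bernoulli_poly (S r) (y + 1) - bernoulli_poly (S r) y) - INR (S r) * y ^ r)); [ring | rewrite IH; ring]. }
    pose proof (const_on_R F HF x 0) as H. unfold F in H. rewrite Rplus_0_l, bernoulli_poly_1, pow_ne_zero in H by lia. lra.
Qed.

Lemma sum_zero_tail (f : nat -> R) M d : (forall k, (M < k)%nat -> f k = 0) -> sum_f_R0 f (M + d) = sum_f_R0 f M.
Proof.
  intros H. induction d as [|d IH]; [now rewrite Nat.add_0_r|].
  rewrite Nat.add_succ_r. cbn [sum_f_R0]. rewrite IH, H by lia. ring.
Qed.

Lemma C_absorb n k : (k <= n)%nat -> Binomial.C (S n) (S k) * INR (S k) / INR (S n) = Binomial.C n k.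
Proof.
  intros H. unfold Binomial.C. replace (S n - S k)%nat with (n - k)%nat by lia. rewrite !INR_fact_S.
  pose proof (INR_fact_neq_0 k). pose proof (INR_fact_neq_0 (n - k)). pose proof (not_0_INR (S k) ltac:(lia)). pose proof (not_0_INR (S n) ltac:(lia)).
  set (q := INR (S k)) in *. set (s := INR (S n)) in *. field. repeat split; assumption.
Qed.

(** The constant Bernoulli polynomial drops out. For [r >= 1] and degree [N = M + 1], the factor [r]
    from [bernoulli_diff] turns [C(N+r, 2r) / (N+r)] into [C(N+r-1, 2r-1) / 2], the coefficient in
    the expansion of [U_M] about 1. *)
Lemma zagier_diff M x : zagier_poly (S M) (x + 1) - zagier_poly (S M) x = / 2 * chebU M (1 + x / 2).
Proof.
  unfold zagier_poly. rewrite <- minus_sum, (decomp_sum _ (S M)) by lia. cbn [pred].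
  rewrite !bernoulli_poly_deg0, Rminus_diag, Rplus_0_l by reflexivity.
  rewrite (chebU_at_1_expand M x M) by lia. rewrite <- sum_mult. apply sum_eq. intros s Hs.
  replace (S M + S s)%nat with (S (S M + s)) by lia. replace (2 * S s)%nat with (S (S (2 * s))) by lia.
  rewrite bin_C, <- (C_absorb (S M + s) (S (2 * s))) by lia.
  replace (INR (S (S (2 * s)))) with (2 * INR (S s)) by (rewrite !S_INR, mult_INR; simpl; ring).
  pose proof (bernoulli_diff s x) as H. pose proof (not_0_INR (S (S M + s)) ltac:(lia)).
  set (q := INR (S (S M + s))) in *.
  transitivity (Binomial.C (S (S M + s)) (S (S (2 * s))) / q * (bernoulli_poly (S s) (x + 1) - bernoulli_poly (S s) x)); [field; assumption|].
  rewrite H. field. assumption.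
Qed.

(* Polynomial functions of degree at most [d], through their iterated derivatives. *)
Fixpoint polyn (d : nat) (F : R -> R) : Prop :=
  match d with
  | O => exists c, forall y, F y = c
  | S e => exists F', (forall y, is_derive F y (F' y)) /\ polyn e F'
  end.

Lemma polyn_S d F : polyn d F -> polyn (S d) F.
Proof.
  revert F. induction d as [|d IH]; intros F.
  - intros [c Hc]. exists (fun _ => 0). split; [|now exists 0].
    intros y. apply (is_derive_ext (fun _ => c)); [intros; symmetry; apply Hc | apply der_const].
  - intros [F' [HF' HF]]. exists F'. split; [exact HF' | now apply IH].
Qed.

Lemma polyn_le d e F : (d <= e)%nat -> polyn d F -> polyn e F.
Proof. induction 1; [auto | intros; apply polyn_S; auto]. Qed.

Lemma polyn_lin d F G a b : polyn d F -> polyn d G -> polyn d (fun y => a * F y + b * G y).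
Proof.
  revert F G. induction d as [|d IH]; intros F G.
  - intros [c Hc] [e He]. exists (a * c + b * e). intros y. now rewrite Hc, He.
  - intros [F' [HF' HF]] [G' [HG' HG]]. exists (fun y => a * F' y + b * G' y). split; [|now apply IH].
    intros y. apply der_plus; now apply der_scal.
Qed.

Lemma polyn_affine d F a b : polyn d F -> polyn d (fun y => F (a * y + b)).
Proof.
  revert F. induction d as [|d IH]; intros F.
  - intros [c Hc]. exists c. intros; apply Hc.
  - intros [F' [HF' HF]]. exists (fun y => a * F' (a * y + b) + 0 * F' (a * y + b)). split; [|now apply polyn_lin; apply (IH F')].
    intros y. eapply der_eq.
    + apply (is_derive_comp F (fun y => a * y + b)); [apply HF'|]. apply der_plus; [apply der_scal, der_id | apply der_const].
    + unscals. ring.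
Qed.

Lemma polyn_ext d F G : (forall y, F y = G y) -> polyn d F -> polyn d G.
Proof.
  intros H. destruct d as [|d].
  - intros [c Hc]. exists c. intros y. now rewrite <- H.
  - intros [F' [HF' HF]]. exists F'. split; [|exact HF]. intros y. now apply (is_derive_ext F).
Qed.

Lemma polyn_sum d (f : nat -> R -> R) c M : (forall k, (k <= M)%nat -> polyn d (f k)) -> polyn d (fun y => sum_f_R0 (fun k => c k * f k y) M).
Proof.
  induction M as [|M IH]; intros H.
  - apply (polyn_ext d (fun y => c 0%nat * f 0%nat y + 0 * f 0%nat y)); [intros; cbn [sum_f_R0]; ring|].
    apply polyn_lin; apply H; lia.
  - apply (polyn_ext d (fun y => 1 * sum_f_R0 (fun k => c k * f k y) M + c (S M) * f (S M) y)); [intros; cbn [sum_f_R0]; ring|].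
    apply polyn_lin; [apply IH; intros; apply H; lia | apply H; lia].
Qed.

Lemma polyn_cont d F y : polyn d F -> continuous F y.
Proof. intros H. apply polyn_S in H. destruct H as [F' [H _]]. exact (der_cont _ _ _ (H y)). Qed.

Lemma polyn_bernoulli r : polyn r (bernoulli_poly r).
Proof.
  induction r as [|r IH]; [exists 1; apply bernoulli_poly_deg0|].
  exists (fun y => INR (S r) * bernoulli_poly r y). split; [intros; apply is_derive_bernoulli|].
  apply (polyn_ext r (fun y => INR (S r) * bernoulli_poly r y + 0 * bernoulli_poly r y)); [intros; ring | now apply polyn_lin].
Qed.

Lemma polyn_zagier N : polyn N (zagier_poly N).
Proof.
  apply (polyn_ext N (fun y => sum_f_R0 (fun r => Binomial.C (N + r) (2 * r) / INR (N + r) * bernoulli_poly r y) N)).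
  - intros y. unfold zagier_poly. apply sum_eq. intros; unfold Rdiv; ring.
  - apply polyn_sum. intros k Hk. apply (polyn_le k); [assumption | apply polyn_bernoulli].
Qed.

(** The derivative is periodic of lower degree, hence a constant [c] by induction; [F y - c y] is
    then constant, and [F 1 = F 0] forces [c = 0]. *)
Lemma polyn_periodic d F : polyn d F -> (forall y, F (y + 1) = F y) -> forall y, F y = F 0.
Proof.
  revert F. induction d as [|d IH]; intros F.
  - intros [c Hc] _ y. now rewrite !Hc.
  - intros [F' [HF' HF]] Hp.
    assert (Hp' : forall y, F' (y + 1) = F' y).
    { intros y. assert (H : is_derive F y (F' (y + 1))).
      { apply (is_derive_ext (fun y => F (y + 1))); [exact Hp|]. eapply der_eq.
        - apply (is_derive_comp F (fun y => y + 1)); [apply HF'|]. apply der_plus; [apply der_id | apply der_const].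
        - unscals. ring. }
      apply is_derive_unique in H. rewrite <- H. apply is_derive_unique, HF'. }
    pose proof (IH F' HF Hp') as Hc. set (c := F' 0) in *.
    assert (H : forall y, is_derive (fun y => F y - c * y) y 0).
    { intros y. eapply der_eq; [apply der_minus; [apply HF' | apply der_scal, der_id]|]. rewrite Hc. rring. }
    pose proof (fun y => const_on_R _ H y 0) as H0. cbv beta in H0.
    pose proof (H0 1) as H1. pose proof (Hp 0) as H2. rewrite Rplus_0_l in H2.
    intros y. specialize (H0 y). assert (c = 0) by lra. rewrite H3 in H0. lra.
Qed.

(** Two integrations by parts lower the degree by 2. The boundary term is a difference of a
    Bernoulli polynomial between 0 and 1, which is nonzero only at degree 1, so it enters only at
    [i = 0]. *)
Lemma bern_cos i w : w <> 0 -> cos w = 1 -> sin w = 0 ->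
  RInt (fun y => bernoulli_poly (S (S (2 * i))) y * cos (w * y)) 0 1 = (-1) ^ i * INR (fact (S (S (2 * i)))) / w ^ (2 * i + 2).
Proof.
  intros Hw Hc Hs.
  assert (Ex : forall r, ex_RInt (fun y => bernoulli_poly r y * cos (w * y)) 0 1).
  { intros r. apply ex_RInt_cont; [lra|]. intros y _. apply cont_mult; [apply (polyn_cont r), polyn_bernoulli | cont]. }
  assert (Hr : forall r, RInt (fun y => bernoulli_poly (S (S r)) y * cos (w * y)) 0 1
     = INR (S (S r)) / w ^ 2 * (bernoulli_poly (S r) 1 - bernoulli_poly (S r) 0) - INR (S (S r)) * INR (S r) / w ^ 2 * RInt (fun y => bernoulli_poly r y * cos (w * y)) 0 1).
  { intros r. set (b := INR (S (S r))). set (a := INR (S r)).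
    assert (E : 1 * RInt (fun y => bernoulli_poly (S (S r)) y * cos (w * y)) 0 1 + b * a / w ^ 2 * RInt (fun y => bernoulli_poly r y * cos (w * y)) 0 1
      = b / w ^ 2 * (bernoulli_poly (S r) 1 - bernoulli_poly (S r) 0)).
    { rewrite <- (RInt_lin _ _ _ _ _ _ (Ex (S (S r))) (Ex r)).
      rewrite (RInt_FTC (fun y => bernoulli_poly (S (S r)) y * (/ w * sin (w * y)) + b / w ^ 2 * bernoulli_poly (S r) y * cos (w * y))).
      - cbv beta. replace (w * 1) with w by ring. replace (w * 0) with 0 by ring. rewrite sin_0, cos_0, Hs, Hc. rring.
      - lra.
      - intros y _. eapply der_eq.
        + apply der_plus.
          * apply der_mult; [apply is_derive_bernoulli|]. apply der_scal. instantiate (1 := w * cos (w * y)). auto_derive; [trivial | rring].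
          * apply (der_mult (fun y => b / w ^ 2 * bernoulli_poly (S r) y) (fun y => cos (w * y))); [apply der_scal, is_derive_bernoulli|].
            instantiate (1 := - (w * sin (w * y))). auto_derive; [trivial | rring].
        + fold a b. cbv beta. rfield. assumption.
      - intros y _. apply cont_plus; apply cont_mult; try apply cont_const; (apply cont_mult; [eapply polyn_cont, polyn_bernoulli | cont]). }
    assert (H2 : w ^ 2 <> 0) by now apply pow_nonzero. lra. }
  induction i as [|i IH].
  - change (2 * 0)%nat with 0%nat. rewrite Hr.
    rewrite (RInt_ext (fun y => bernoulli_poly 0 y * cos (w * y)) (fun y => cos (w * y))) by (intros; rewrite bernoulli_poly_deg0; rring).
    rewrite (RInt_FTC (fun y => / w * sin (w * y))).
    + cbv beta. replace (w * 1) with w by ring. replace (w * 0) with 0 by ring. rewrite sin_0, Hs. pose proof (bernoulli_diff 0 0) as H. rewrite Rplus_0_l in H. rewrite H. simpl. rfield. assumption.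
    + lra.
    + intros y _. auto_derive; [trivial|]. rfield. assumption.
    + intros; cont.
  - rewrite Hr. replace (2 * S i)%nat with (S (S (2 * i))) by lia. rewrite IH, bernoulli_poly_1, Rminus_diag by reflexivity.
    rewrite (INR_fact_S (S (S (S (2 * i))))), (INR_fact_S (S (S (2 * i)))).
    replace (S (S (2 * i)) + 2)%nat with (S (S (2 * i + 2))) by lia. cbn [pow].
    set (q := INR (S (S (S (S (2 * i)))))). set (s := INR (S (S (S (2 * i))))). set (t := INR (fact (S (S (2 * i))))).
    pose proof (pow_nonzero w (2 * i + 2) Hw). rfield. split; assumption.
Qed.

(* A polynomial is determined up to a constant by its first difference, so [F] is a constant plus
   a combination of Bernoulli polynomials. *)
Lemma poly_cos d F c M w : polyn d F -> w <> 0 -> cos w = 1 -> sin w = 0 ->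
  (forall y, F (y + 1) - F y = sum_f_R0 (fun k => c k * y ^ S (2 * (M - k))) M) ->
  RInt (fun y => F y * cos (w * y)) 0 1 = sum_f_R0 (fun k => c k * ((-1) ^ (M - k) * INR (fact (S (2 * (M - k)))) / w ^ (2 * (M - k) + 2))) M.
Proof.
  intros HF Hw Hc Hs HD.
  set (e := fun k => c k / INR (S (S (2 * (M - k))))). set (b := fun k => bernoulli_poly (S (S (2 * (M - k))))).
  set (G := fun y => 1 * F y + - (1) * sum_f_R0 (fun k => e k * b k y) M).
  assert (HG : polyn (d + S (S (2 * M))) G).
  { apply polyn_lin; [apply (polyn_le d); [lia | assumption]|]. apply polyn_sum. intros k Hk.
    apply (polyn_le (S (S (2 * (M - k))))); [lia | apply polyn_bernoulli]. }
  assert (HGc : forall y, G y = G 0).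
  { apply (polyn_periodic _ _ HG). intros y. unfold G. apply Rminus_diag_uniq.
    transitivity ((F (y + 1) - F y) - (sum_f_R0 (fun k => e k * b k (y + 1)) M - sum_f_R0 (fun k => e k * b k y) M)); [ring|].
    rewrite HD, <- !minus_sum. apply sum_eq_R0. intros k Hk. unfold e, b.
    pose proof (bernoulli_diff (S (2 * (M - k))) y) as H. pose proof (not_0_INR (S (S (2 * (M - k)))) ltac:(lia)) as H0.
    replace (c k / INR (S (S (2 * (M - k)))) * bernoulli_poly (S (S (2 * (M - k)))) (y + 1) - c k / INR (S (S (2 * (M - k)))) * bernoulli_poly (S (S (2 * (M - k)))) y)
      with (c k / INR (S (S (2 * (M - k)))) * (bernoulli_poly (S (S (2 * (M - k)))) (y + 1) - bernoulli_poly (S (S (2 * (M - k)))) y)) by ring.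
    rewrite H. set (q := INR (S (S (2 * (M - k))))) in *. field. assumption. }
  assert (Eb : forall k, ex_RInt (fun y => e k * (b k y * cos (w * y))) 0 1).
  { intros k. apply ex_RInt_cont; [lra|]. intros y _. apply cont_mult; [cont|]. apply cont_mult; [eapply polyn_cont, polyn_bernoulli | cont]. }
  destruct (RInt_sum (fun k y => e k * (b k y * cos (w * y))) 0 1 M Eb) as [Es Hsum].
  assert (Ec : ex_RInt (fun y => cos (w * y)) 0 1) by (apply ex_RInt_cont; [lra | intros; cont]).
  rewrite (RInt_ext _ (fun y => G 0 * cos (w * y) + 1 * sum_f_R0 (fun k => e k * (b k y * cos (w * y))) M)).
  - rewrite (RInt_lin _ _ _ _ _ _ Ec Es), Hsum.
    rewrite (RInt_FTC (fun y => / w * sin (w * y))); [| lra | intros y _; auto_derive; [trivial | rfield; assumption] | intros; cont].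
    cbv beta. replace (w * 1) with w by ring. replace (w * 0) with 0 by ring. rewrite sin_0, Hs. replace (G 0 * (/ w * 0 - / w * 0)) with 0 by ring. rewrite Rplus_0_l, Rmult_1_l.
    apply sum_eq. intros k Hk. rewrite RInt_scal'.
    + unfold b. rewrite bern_cos by assumption. unfold e. rewrite (INR_fact_S (S (2 * (M - k)))).
      pose proof (not_0_INR (S (S (2 * (M - k)))) ltac:(lia)) as H0. pose proof (pow_nonzero w (2 * (M - k) + 2) Hw).
      set (q := INR (S (S (2 * (M - k))))) in *. field. split; assumption.
    + apply ex_RInt_cont; [lra|]. intros y _. apply cont_mult; [eapply polyn_cont, polyn_bernoulli | cont].
  - intros y _. rewrite <- (HGc y). unfold G.
    replace (sum_f_R0 (fun k => e k * (b k y * cos (w * y))) M) with (cos (w * y) * sum_f_R0 (fun k => e k * b k y) M); [rring|].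
    rewrite <- sum_mult. apply sum_eq. intros; ring.
Qed.

Lemma is_derive_int (f : R -> R) x : (forall t, continuous f t) -> is_derive (fun s => RInt f 0 s) x (f x).
Proof.
  intros Hf. apply (is_derive_RInt (V := R_NormedModule) f _ 0); [|apply Hf].
  exists (mkposreal 1 Rlt_0_1). intros y _. apply (RInt_correct (V := R_CompleteNormedModule)).
  apply (ex_RInt_continuous (V := R_CompleteNormedModule)). intros; apply Hf.
Qed.

(** The two half-step arguments make a unit difference of [zA] telescope to a unit difference of a
    single Zagier polynomial. *)
Definition zA (n : nat) (y : R) : R := zagier_poly (2 * n) (/ 2 * y) + zagier_poly (2 * n) (/ 2 * y + / 2).

Lemma polyn_zA n : polyn (2 * n) (zA n).
Proof.
  apply (polyn_ext _ (fun y => 1 * zagier_poly (2 * n) (/ 2 * y + 0) + 1 * zagier_poly (2 * n) (/ 2 * y + / 2))).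
  - intros y. unfold zA. rewrite Rplus_0_r. ring.
  - apply polyn_lin; apply polyn_affine, polyn_zagier.
Qed.

Lemma zA_cont n y : continuous (zA n) y.
Proof. eapply polyn_cont, polyn_zA. Qed.

Lemma zA_diff n y : (1 <= n)%nat -> zA n (y + 1) - zA n y = / 2 * chebU (2 * n - 1) (1 + y / 4).
Proof.
  intros Hn. unfold zA. replace (/ 2 * (y + 1) + / 2) with (/ 2 * y + 1) by field. replace (/ 2 * (y + 1)) with (/ 2 * y + / 2) by field.
  assert (exists M, 2 * n = S M)%nat as [M HM] by (exists (2 * n - 1)%nat; lia). replace (2 * n - 1)%nat with M by lia. rewrite HM.
  replace (1 + y / 4) with (1 + / 2 * y / 2) by field. rewrite <- zagier_diff. ring.
Qed.

Lemma zA_1 n : (1 <= n)%nat -> zA n 1 = zA n 0 + INR n.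
Proof.
  intros Hn. pose proof (zA_diff n 0 Hn) as H. rewrite Rplus_0_l in H. replace (1 + 0 / 4) with 1 in H by field.
  rewrite chebU_at_1 in H. replace (S (2 * n - 1)) with (2 * n)%nat in H by lia. rewrite mult_INR in H. simpl (INR 2) in H. lra.
Qed.

(** Two unit steps, from [-3/2] to [-1/2] and from there to [1/2], cost the Chebyshev values at
    [1/4] and [3/4]; the values at 0 and [1/2] make up [zA n 0]. *)
Lemma zagier_special n : (1 <= n)%nat -> zagier_poly (2 * n) (-3/2) + zagier_poly (2 * n) 0
  = zA n 0 - / 2 * (chebU (2 * n - 1) (1/4) + chebU (2 * n - 1) (3/4)).
Proof.
  intros Hn. assert (exists M, 2 * n = S M)%nat as [M HM] by (exists (2 * n - 1)%nat; lia). replace (2 * n - 1)%nat with M by lia.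
  unfold zA. rewrite HM. pose proof (zagier_diff M (-3/2)) as H1. pose proof (zagier_diff M (-1/2)) as H2.
  replace (-3/2 + 1) with (-1/2) in H1 by field. replace (-1/2 + 1) with (/ 2) in H2 by field.
  replace (1 + -3/2/2) with (1/4) in H1 by field. replace (1 + -1/2/2) with (3/4) in H2 by field.
  rewrite Rmult_0_r, Rplus_0_l. lra.
Qed.

(** In the antiderivative [ZI] every Bernoulli polynomial of degree at least 2 has equal values at 0
    and 1, so only the term [r = 0], with coefficient [1/(2n)], contributes. *)
Lemma zA_int n : (1 <= n)%nat -> RInt (zA n) 0 1 = / INR n.
Proof.
  intros Hn. set (N := (2 * n)%nat). assert (Hn' : 0 < INR n) by (apply lt_0_INR; lia).
  set (e := fun r => Binomial.C (N + r) (2 * r) / INR (N + r)).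
  set (ZI := fun y => sum_f_R0 (fun r => e r * (bernoulli_poly (S r) y / INR (S r))) N).
  assert (HZ : forall y, is_derive ZI y (zagier_poly N y)).
  { intros y. unfold ZI, zagier_poly.
    replace (sum_f_R0 (fun r => Binomial.C (N + r) (2 * r) * bernoulli_poly r y / INR (N + r)) N) with (sum_f_R0 (fun r => e r * bernoulli_poly r y) N)
      by (apply sum_eq; intros; unfold e, Rdiv; ring).
    generalize N at 1 2. intros M.
    assert (H1 : forall r, is_derive (fun y => e r * (bernoulli_poly (S r) y / INR (S r))) y (e r * bernoulli_poly r y)).
    { intros r. assert (Hr : INR (S r) <> 0) by (apply not_0_INR; lia).
      apply (is_derive_ext (fun y => e r / INR (S r) * bernoulli_poly (S r) y)); [intros; rfield; assumption|].
      eapply der_eq; [apply der_scal, is_derive_bernoulli|]. set (q := INR (S r)) in *. rfield. assumption. }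
    induction M as [|M IH]; cbn [sum_f_R0]; [apply H1 | apply der_plus; [exact IH | apply H1]]. }
  rewrite (RInt_FTC (fun y => 2 * ZI (/ 2 * y) + 2 * ZI (/ 2 * y + / 2))).
  - rewrite !Rmult_0_r, Rplus_0_l, Rmult_1_r. replace (/ 2 + / 2) with 1 by field.
    transitivity (2 * (ZI 1 - ZI 0)); [rring|]. unfold ZI. rewrite <- minus_sum.
    assert (exists M, N = S M)%nat as [M HM] by (exists (2 * n - 1)%nat; unfold N; lia). rewrite HM at 1. rewrite decomp_sum by lia. cbn [pred].
    rewrite sum_eq_R0.
    + pose proof (bernoulli_diff 0 0) as H. rewrite Rplus_0_l in H. simpl (INR 1) in *. rewrite pow_O, Rmult_1_r in H.
      unfold e. rewrite Nat.add_0_r. change (2 * 0)%nat with 0%nat. rewrite C_0. unfold N. rewrite mult_INR. simpl (INR 2).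
      req; transitivity (2 * (1 / (2 * INR n) * (bernoulli_poly 1 1 - bernoulli_poly 1 0))); [field; lra | rewrite H; field; lra].
    + intros r _. rewrite bernoulli_poly_1. ring.
  - lra.
  - intros y _. eapply der_eq.
    + apply der_plus; apply der_scal.
      * apply (is_derive_comp ZI (fun y => / 2 * y)); [apply HZ | apply der_scal, der_id].
      * apply (is_derive_comp ZI (fun y => / 2 * y + / 2)); [apply HZ | apply der_plus; [apply der_scal, der_id | apply der_const]].
    + unscals. unfold zA. fold N. field.
  - intros; apply zA_cont.
Qed.

(* [cos (4 w t) * U(t)] is a difference of shifts of [q = A * cos (w .)], whose integrals telescope to
   the unit intervals starting at 0 and at -4; the latter is computed by [poly_cos]. *)
Lemma zA_cos n w : (1 <= n)%nat -> 0 < w -> cos w = 1 -> sin w = 0 ->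
  RInt (fun y => zA n y * cos (w * y)) 0 1
  = 2 * RInt (fun t => cos (4 * w * cos t) * sin (2 * INR n * t)) 0 (PI / 2)
    - (-1) ^ n * sum_f_R0 (fun i => INR (fact (2 * n - i - 1)) / INR (fact i) * (4 * w / 2) ^ (2 * i) / (4 * w / 2) ^ (2 * n)) (n - 1).
Proof.
  intros Hn Hw Hc Hs. pose proof PI_RGT_0 as Hpi.
  assert (exists M, n = S M)%nat as [M HM] by (exists (n - 1)%nat; lia).
  set (q := fun y => zA n y * cos (w * y)).
  assert (Cq : forall y, continuous q y) by (intros y; apply cont_mult; [apply zA_cont | cont]).
  pose (Q := (fun s => RInt q 0 s) : R -> R).
  assert (HQ : forall s, is_derive Q s (q s)) by (intros; now apply is_derive_int).
  assert (Hper : forall y, cos (w * (y - 1)) = cos (w * y)).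
  { intros y. replace (w * (y - 1)) with (w * y - w) by ring. rewrite cos_minus, Hc, Hs. ring. }
  assert (Hp4 : forall y, cos (w * (y - 4)) = cos (w * y)).
  { intros y. replace (y - 4) with (y - 1 - 1 - 1 - 1) by ring. now rewrite !Hper. }
  assert (Hp3 : forall y, cos (w * (y - 3)) = cos (w * y)).
  { intros y. replace (y - 3) with (y - 1 - 1 - 1) by ring. now rewrite !Hper. }
  assert (H1 : 2 * RInt (fun t => cos (4 * w * cos t) * sin (2 * INR n * t)) 0 (PI / 2) = (Q 1 - Q 0) - (Q (-3) - Q (-4))).
  { rewrite (RInt_FTC (fun t => - (1) * (/ 2 * (Q (4 * cos t + -3) - Q (4 * cos t + -4))))).
    - rewrite cos_0, cos_PI2. replace (4 * 0 + -3) with (-3) by ring. replace (4 * 0 + -4) with (-4) by ring.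
      replace (4 * 1 + -3) with 1 by ring. replace (4 * 1 + -4) with 0 by ring. rfield.
    - lra.
    - intros t _. eapply der_eq.
      + apply der_scal, der_scal, der_minus.
        * apply (is_derive_comp Q (fun t => 4 * cos t + -3)); [apply HQ|]. apply der_plus; [apply der_scal, is_derive_cos | apply der_const].
        * apply (is_derive_comp Q (fun t => 4 * cos t + -4)); [apply HQ|]. apply der_plus; [apply der_scal, is_derive_cos | apply der_const].
      + unscals. unfold q. replace (4 * cos t + -3) with (4 * cos t - 3) by ring. replace (4 * cos t + -4) with (4 * cos t - 4) by ring.
        rewrite Hp3, Hp4. pose proof (zA_diff n (4 * cos t - 4) Hn) as H. replace (4 * cos t - 4 + 1) with (4 * cos t - 3) in H by ring.
        replace (1 + (4 * cos t - 4) / 4) with (cos t) in H by field. rewrite <- sin_2n by assumption.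
        replace (w * (4 * cos t)) with (4 * w * cos t) by ring.
        transitivity (2 * sin t * cos (4 * w * cos t) * (zA n (4 * cos t - 3) - zA n (4 * cos t - 4))); [field | rewrite H; field].
    - intros; cont. }
  (* The shift by 4 moves the Chebyshev argument from [1 + y/4] to [y/4]. The difference of [F] then
     has odd powers of [y] only, as [poly_cos] requires. *)
  rewrite H1. set (F := fun y => zA n (1 * y + -4)).
  assert (H2 : Q (-3) - Q (-4) = RInt (fun y => F y * cos (w * y)) 0 1).
  { rewrite (RInt_FTC (fun y => Q (1 * y + -4))).
    - replace (1 * 1 + -4) with (-3) by ring. replace (1 * 0 + -4) with (-4) by ring. rring.
    - lra.
    - intros y _. eapply der_eq.
      + apply (is_derive_comp Q (fun y => 1 * y + -4)); [apply HQ|]. apply der_plus; [apply der_scal, der_id | apply der_const].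
      + unscals. unfold q, F. replace (w * (1 * y + -4)) with (w * (y - 4)) by ring. rewrite Hp4. ring.
    - intros y _. apply cont_mult; [eapply polyn_cont, polyn_affine, polyn_zA | cont]. }
  assert (H0 : Q 0 = 0) by (unfold Q; apply (RInt_point (V := R_CompleteNormedModule))).
  rewrite H2, H0, Rminus_0_r. 
  set (c := fun k => / 2 * ((-1) ^ k * bin (2 * n - 1 - k) k) * (/ 2) ^ S (2 * (M - k))).
  assert (HD : forall y, F (y + 1) - F y = sum_f_R0 (fun k => c k * y ^ S (2 * (M - k))) M).
  { intros y. unfold F. replace (1 * (y + 1) + -4) with (1 * y + -4 + 1) by ring. rewrite zA_diff by assumption.
    replace (1 + (1 * y + -4) / 4) with (y / 4) by field.
    (* The degree is [2n - 1 = 2M + 1]; the terms beyond [M] vanish because [bin (2n-1-k) k = 0]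
       there. *)
    rewrite (chebU_at_0 _ _ (M + M + 1)) by lia. replace (M + M + 1)%nat with (M + (M + 1))%nat by lia.
    rewrite sum_zero_tail by (intros; rewrite bin_gt by lia; ring). rewrite <- sum_mult. apply sum_eq. intros k Hk.
    unfold c. replace (2 * n - 1 - 2 * k)%nat with (S (2 * (M - k))) by lia.
    replace (2 * (y / 4)) with (/ 2 * y) by field. rewrite Rpow_mult_distr. ring. }
  rewrite (poly_cos (2 * n) F c M w (polyn_affine _ _ _ _ (polyn_zA n)) ltac:(lra) Hc Hs HD).
  replace (n - 1)%nat with M by lia.
  assert (E : sum_f_R0 (fun k => c k * ((-1) ^ (M - k) * INR (fact (S (2 * (M - k)))) / w ^ (2 * (M - k) + 2))) M
    = - (-1) ^ n * sum_f_R0 (fun i => INR (fact (2 * n - i - 1)) / INR (fact i) * (4 * w / 2) ^ (2 * i) / (4 * w / 2) ^ (2 * n)) M).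
  { rewrite <- sum_mult. apply sum_eq. intros k Hk. unfold c. rewrite bin_C by lia. unfold Binomial.C.
    replace (2 * n - 1 - k - k)%nat with (S (2 * (M - k))) by lia. replace (2 * n - k - 1)%nat with (2 * n - 1 - k)%nat by lia.
    replace (4 * w / 2) with (2 * w) by field. replace ((-1) ^ n) with (- ((-1) ^ k * (-1) ^ (M - k))).
    2:{ rewrite <- pow_add. replace (k + (M - k))%nat with M by lia. rewrite HM. simpl. ring. }
    replace (2 * n)%nat with (2 * k + S (S (2 * (M - k))))%nat by lia. rewrite (pow_add (2 * w)), (Rpow_mult_distr 2 w (S (S _))).
    replace (2 * (M - k) + 2)%nat with (S (S (2 * (M - k)))) by lia. rewrite pow_inv.
    pose proof (INR_fact_neq_0 k). pose proof (INR_fact_neq_0 (S (2 * (M - k)))).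
    pose proof (pow_lt (2 * w) (2 * k) ltac:(lra)). pose proof (pow_lt w (S (S (2 * (M - k)))) Hw). pose proof (pow_lt 2 (S (2 * (M - k))) ltac:(lra)).
    change (2 ^ S (S (2 * (M - k)))) with (2 * 2 ^ S (2 * (M - k))).
    set (a := 2 ^ S (2 * (M - k))) in *. set (b := w ^ S (S (2 * (M - k)))) in *. set (d := (2 * w) ^ (2 * k)) in *.
    set (g := INR (fact (S (2 * (M - k))))) in *. rfield. repeat split; lra. }
  rewrite E. match goal with |- _ = ?r => change (@eq R (Q 1) r) end. ring.
Qed.

(** [fourier_end] gives the end point mean minus the integral; [zA_1] supplies [n/2] and [zA_int]
    supplies [1/n]. *)
Lemma zA_fourier n : (1 <= n)%nat ->
  is_series (fun m => 2 * RInt (fun y => zA n y * cos (2 * PI * INR (S m) * y)) 0 1) (zA n 0 + INR n / 2 - / INR n).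
Proof.
  intros Hn. assert (HF : polyn (S (2 * n)) (zA n)) by (apply polyn_S, polyn_zA).
  destruct HF as [F' [HF' HF]].
  destruct (cont_bounded F' 0 1) as [B [HB0 HB]]; [lra | intros; eapply polyn_cont, HF|].
  apply is_series_lim. set (u := sum_f_R0 _). set (l := zA n 0 + INR n / 2 - / INR n).
  assert (Hb : forall M, Rabs (u M - l) <= B * Feps M).
  { intros M. pose proof (fourier_end (zA n) F' B M (fun y _ => HF' y) (fun y _ => polyn_cont _ _ y HF) HB) as H.
    rewrite zA_int, zA_1 in H by assumption. replace l with ((zA n 0 + (zA n 0 + INR n)) / 2 - / INR n) by (unfold l; field; apply not_0_INR; lia). exact H. }
  apply is_lim_seq_ext with (fun M => (u M - l) + l); [intros; ring|].
  replace (Finite l) with (Finite (0 + l)) by (f_equal; ring).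
  apply is_lim_seq_plus'; [|apply is_lim_seq_const].
  apply is_lim_seq_abs_0. apply is_lim_seq_le_le with (fun _ => 0) (fun M => B * Feps M).
  - intros M. split; [apply Rabs_pos | apply Hb].
  - apply is_lim_seq_const.
  - replace (Finite 0) with (Rbar_mult B 0) by (simpl; f_equal; ring). apply is_lim_seq_scal_l, Feps_lim.
Qed.

(** * Integrals over the angle *)

(** With [q = t - s] a root of [q^2 - 2 t q + 1], the integrals and [q^m] satisfy the same
    three-term recursion: multiplying the kernel by [2 (t - cos y)] leaves a plain cosine, which
    integrates to 0 for [m >= 1]. *)
Lemma poisson_kernel_int t : 1 < t -> forall m,
  RInt (fun y => cos (INR m * y) / (t - cos y)) 0 PI = PI * (t - sqrt (t ^ 2 - 1)) ^ m / sqrt (t ^ 2 - 1).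
Proof.
  intros Ht. pose proof PI_RGT_0 as Hpi. set (s := sqrt (t ^ 2 - 1)). set (q := t - s).
  assert (Hs : 0 < s) by (apply sqrt_lt_R0; nra).
  assert (Hs2 : s * s = t ^ 2 - 1) by (apply sqrt_sqrt; nra).
  assert (Hst : s < t) by (apply Rsqr_incrst_0; unfold Rsqr; nra).
  assert (Hq : 0 < q) by (unfold q; lra). assert (Hq2 : q * q = 2 * t * q - 1) by (unfold q; nra).
  assert (Hq1 : q < 1).
  { assert (t - 1 < s) by (apply Rsqr_incrst_0; unfold Rsqr; nra). unfold q; lra. }
  assert (Hd : forall y, 0 < t - cos y) by (intros y; pose proof (COS_bound y); lra).
  assert (Hc : forall m y, continuous (fun y => cos (INR m * y) / (t - cos y)) y).
  { intros m y. apply cont_div; [specialize (Hd y); lra | cont | cont]. }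
  assert (Ex : forall m, ex_RInt (fun y => cos (INR m * y) / (t - cos y)) 0 PI) by (intros; apply ex_RInt_cont; [lra | intros; apply Hc]).
  assert (H0 : RInt (fun y => cos (INR 0 * y) / (t - cos y)) 0 PI = PI / s).
  { rewrite (RInt_FTC (fun y => / s * (y + 2 * atan (q * sin y / (1 - q * cos y))))).
    - rewrite sin_PI, sin_0. rewrite !Rmult_0_r. unfold Rdiv at 1 2. rewrite !Rmult_0_l, atan_0. rfield. lra.
    - lra.
    - intros y _. pose proof (COS_bound y) as Hb. assert (H1 : 0 < 1 - q * cos y) by nra.
      assert (Hsc : sin y * sin y = 1 - cos y * cos y) by (pose proof (sin2c y); simpl in *; lra).
      assert (H2 : 1 - 2 * q * cos y + q * q = 2 * q * (t - cos y)) by (rewrite Hq2; ring).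
      eapply der_eq.
      + apply der_scal, der_plus; [apply der_id|]. apply der_scal.
        apply (is_derive_comp atan (fun y => q * sin y / (1 - q * cos y))); [apply is_derive_atan'|].
        instantiate (1 := q * (cos y - q) / (1 - q * cos y) ^ 2). auto_derive; [lra|].
        req. transitivity ((q * cos y * (1 - q * cos y) + q * q * (- (sin y * sin y))) / (1 - q * cos y) ^ 2); [field; lra | rewrite Hsc; field; lra].
      + unscals. simpl (INR 0). rewrite Rmult_0_l, cos_0. specialize (Hd y).
        assert (H3 : 1 + (q * sin y / (1 - q * cos y)) ^ 2 = 2 * q * (t - cos y) / (1 - q * cos y) ^ 2).
        { rewrite <- H2. replace ((q * sin y / (1 - q * cos y)) ^ 2) with (q * q * (sin y * sin y) / (1 - q * cos y) ^ 2) by (field; lra). rewrite Hsc. field. lra. }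
        rewrite H3. replace (q * (cos y - q)) with (q * (cos y - t + s)) by (unfold q; ring). field. repeat split; lra.
    - intros; apply Hc. }
  assert (HR : forall m, RInt (fun y => cos (INR (S (S m)) * y) / (t - cos y)) 0 PI
     = 2 * t * RInt (fun y => cos (INR (S m) * y) / (t - cos y)) 0 PI - RInt (fun y => cos (INR m * y) / (t - cos y)) 0 PI).
  { intros m. pose proof (cos_nat_int m) as Hz.
    assert (Ec : ex_RInt (fun y => cos (INR (S m) * y)) 0 PI) by (apply ex_RInt_cont; [lra | intros; cont]).
    assert (E : 2 * t * RInt (fun y => cos (INR (S m) * y) / (t - cos y)) 0 PI + - (2) * RInt (fun y => cos (INR (S m) * y)) 0 PI
      = RInt (fun y => cos (INR (S (S m)) * y) / (t - cos y)) 0 PI + RInt (fun y => cos (INR m * y) / (t - cos y)) 0 PI).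
    { rewrite <- (RInt_lin _ _ _ _ _ _ (Ex (S m)) Ec), <- (RInt_plus' _ _ _ _ (Ex (S (S m))) (Ex m)). apply RInt_ext. intros y _.
      replace (cos (INR m * y)) with (2 * cos y * cos (INR (S m) * y) - cos (INR (S (S m)) * y)).
      - specialize (Hd y). set (c1 := cos (INR (S m) * y)). set (c2 := cos (INR (S (S m)) * y)). rfield. lra.
      - replace (INR (S (S m)) * y) with (INR (S m) * y + y) by (rewrite (S_INR (S m)); ring).
        replace (INR m * y) with (INR (S m) * y - y) by (rewrite (S_INR m); ring). rewrite cos_plus, cos_minus. ring. }
    rewrite Hz in E. lra. }
  intros m. induction m as [| |m IH0 IH1] using chebU_ind.
  - rewrite H0. simpl. field. lra.
  - assert (E : t * RInt (fun y => cos (INR 0 * y) / (t - cos y)) 0 PI + - (1) * RInt (fun y => 1) 0 PI = RInt (fun y => cos (INR 1 * y) / (t - cos y)) 0 PI).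
    { rewrite <- (RInt_lin _ _ _ _ _ _ (Ex 0%nat)) by apply ex_RInt_const. apply RInt_ext. intros y _. specialize (Hd y).
      simpl (INR 0). simpl (INR 1). rewrite Rmult_0_l, Rmult_1_l, cos_0. rfield. lra. }
    rewrite <- E, H0, RInt_const'. unfold q. rfield. lra.
  - rewrite HR, IH0, IH1. cbn [pow]. replace (q * (q * q ^ m)) with ((2 * t * q - 1) * q ^ m) by (rewrite <- Hq2; ring). rfield. lra.
Qed.

Definition phi (n k : nat) : R :=
  let t := 1 + INR (S k) / 4 in (t - sqrt (t ^ 2 - 1)) ^ (2 * n) / sqrt (t ^ 2 - 1).

Definition vt (t : R) : R := 8 * sin (t / 2) ^ 2.

Lemma vt_cos t : vt t = 4 * (1 - cos t).
Proof. unfold vt. replace (cos t) with (cos (2 * (t / 2))) by (f_equal; field). rewrite cos_2a_sin. ring. Qed.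

Lemma vt_cont t : continuous vt t.
Proof. apply (continuous_ext (fun t => 4 * (1 - cos t))); [intros; symmetry; apply vt_cos | cont]. Qed.

Lemma vt_bounds t : 0 <= vt t <= 8.
Proof. rewrite vt_cos. pose proof (COS_bound t). lra. Qed.

Definition Uw (n : nat) (t : R) : R := chebU (2 * n - 1) (cos t) * (1 + cos t).

Lemma Uw_cont n t : continuous (Uw n) t.
Proof. apply cont_mult; [apply chebU_cos_cont; cont | cont]. Qed.

(** Here [k + 1 + v = 4 (t0 - cos y)] and [U(cos y) (1 + cos y) (1 - cos y) = sin (2 n y) sin y].
    Hence four times the integrand is [sin (2 n y)] times the derivative of [- 1/(t0 - cos y)], and
    integration by parts leaves the Poisson kernel. *)
Lemma Uw_int_kernel n k : (1 <= n)%nat ->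
  RInt (fun t => Uw n t * (vt t / (INR (S k) + vt t) ^ 2)) 0 PI = PI * INR n * (/ 2 * phi n k).
Proof.
  intros Hn. pose proof PI_RGT_0 as Hpi. assert (Hk : 0 < INR (S k)) by (apply lt_0_INR; lia). assert (Hn' : 0 < INR n) by (apply lt_0_INR; lia).
  set (r := INR (S k)) in *. set (t0 := 1 + r / 4). assert (Ht0 : 1 < t0) by (unfold t0; lra).
  assert (Hd : forall y, 0 < t0 - cos y) by (intros y; pose proof (COS_bound y); lra).
  assert (E1 : ex_RInt (fun t => Uw n t * (vt t / (r + vt t) ^ 2)) 0 PI).
  { apply ex_RInt_cont; [lra|]. intros t _. apply cont_mult; [apply Uw_cont|]. pose proof (vt_bounds t).
    apply cont_div; [apply pow_nonzero; lra | apply vt_cont|]. apply cont_pow, cont_plus; [cont | apply vt_cont]. }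
  assert (E2 : ex_RInt (fun y => cos (INR (2 * n) * y) / (t0 - cos y)) 0 PI).
  { apply ex_RInt_cont; [lra|]. intros y _. apply cont_div; [specialize (Hd y); lra | cont | cont]. }
  assert (E : 4 * RInt (fun t => Uw n t * (vt t / (r + vt t) ^ 2)) 0 PI + - (2 * INR n) * RInt (fun y => cos (INR (2 * n) * y) / (t0 - cos y)) 0 PI = 0).
  { rewrite <- (RInt_lin _ _ _ _ _ _ E1 E2).
    rewrite (RInt_FTC (fun y => - (1) * (sin (2 * INR n * y) / (t0 - cos y)))).
    - replace (2 * INR n * PI) with (INR (2 * n) * PI) by (rewrite mult_INR; simpl; ring).
      rewrite sin_nat_PI, Rmult_0_r, sin_0. unfold Rdiv. rring.
    - lra.
    - intros y _. specialize (Hd y). eapply der_eq.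
      + apply der_scal. instantiate (1 := (2 * INR n * cos (2 * INR n * y) * (t0 - cos y) - sin (2 * INR n * y) * sin y) / (t0 - cos y) ^ 2).
        auto_derive; [lra|]. rfield. lra.
      + unfold Uw. rewrite vt_cos. replace (r + 4 * (1 - cos y)) with (4 * (t0 - cos y)) by (unfold t0; field).
        rewrite mult_INR. replace (INR 2) with 2 by (simpl; ring). rewrite <- sin_2n by assumption.
        replace (chebU (2 * n - 1) (cos y) * sin y * sin y) with (chebU (2 * n - 1) (cos y) * (1 - cos y ^ 2)) by (rewrite <- sin2c; ring).
        rfield. lra.
    - intros y _. specialize (Hd y). apply cont_plus; apply cont_mult; try apply cont_const.
      + apply cont_mult; [apply Uw_cont|]. pose proof (vt_bounds y).
        apply cont_div; [apply pow_nonzero; lra | apply vt_cont|]. apply cont_pow, cont_plus; [cont | apply vt_cont].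
      + apply cont_div; [lra | cont | cont]. }
  rewrite poisson_kernel_int in E by assumption. unfold phi. fold r. fold t0. cbv zeta. unfold Rdiv in *. lra.
Qed.

(* The quotient of [U_k(1) - U_k(c)] by [4 (1 - c)]. *)
Fixpoint Vp (k : nat) (c : R) : R :=
  match k with
  | O => 0
  | S j => match j with O => / 2 | S i => 2 * Vp j c - Vp i c + / 2 * chebU j c end
  end.

Lemma Vp_SS k c : Vp (S (S k)) c = 2 * Vp (S k) c - Vp k c + / 2 * chebU (S k) c.
Proof. reflexivity. Qed.

Lemma chebU_Vp k c : chebU k c = INR (S k) - 4 * (1 - c) * Vp k c.
Proof.
  induction k as [| |k IH0 IH1] using chebU_ind.
  - rewrite chebU_0. simpl. ring.
  - rewrite chebU_1. simpl. field.
  - rewrite Vp_SS, chebU_rec, IH0, IH1, (S_INR (S (S k))), (S_INR (S k)). set (r := INR (S k)). field.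
Qed.

Lemma Vp_cont k t : continuous (fun t => Vp k (cos t)) t.
Proof.
  induction k as [| |k IH0 IH1] using chebU_ind; [apply cont_const | apply cont_const |].
  apply (continuous_ext (fun t => 2 * Vp (S k) (cos t) - Vp k (cos t) + / 2 * chebU (S k) (cos t))); [reflexivity|].
  pose proof (chebU_cos_cont (S k) cos t (continuous_cos t)). cont.
Qed.

Lemma Vp_weight_int k : RInt (fun t => (1 + cos t) * Vp k (cos t)) 0 PI = PI * (INR k * (INR k + 1)) / 4.
Proof.
  pose proof PI_RGT_0 as Hpi.
  assert (Ex : forall k, ex_RInt (fun t => (1 + cos t) * Vp k (cos t)) 0 PI).
  { intros j. apply ex_RInt_cont; [lra|]. intros t _. apply cont_mult; [cont | apply Vp_cont]. }
  induction k as [| |k IH0 IH1] using chebU_ind.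
  - rewrite (RInt_ext _ (fun _ => 0)) by (intros; simpl; rring). rewrite RInt_const'. simpl. rfield.
  - rewrite (RInt_ext _ (fun t => / 2 * ((1 + cos t) * chebU 0 (cos t)))) by (intros; rewrite chebU_0; simpl; rring).
    rewrite RInt_scal', chebU_weight_int.
    + simpl. rfield.
    + apply ex_RInt_cont; [lra|]. intros t _. apply cont_mult; [cont | apply chebU_cos_cont; cont].
  - assert (EU : ex_RInt (fun t => (1 + cos t) * chebU (S k) (cos t)) 0 PI).
    { apply ex_RInt_cont; [lra|]. intros t _. apply cont_mult; [cont | apply chebU_cos_cont; cont]. }
    rewrite (RInt_ext _ (fun t => 1 * (2 * ((1 + cos t) * Vp (S k) (cos t)) + - (1) * ((1 + cos t) * Vp k (cos t))) + / 2 * ((1 + cos t) * chebU (S k) (cos t)))).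
    + rewrite (RInt_lin _ _ _ _ _ _ (ex_RInt_plus' _ _ _ _ (ex_RInt_scal' _ _ _ _ (Ex (S k))) (ex_RInt_scal' _ _ _ _ (Ex k))) EU).
      rewrite (RInt_lin _ _ _ _ _ _ (Ex (S k)) (Ex k)), IH0, IH1, chebU_weight_int, !S_INR. rfield.
    + intros t _. rewrite Vp_SS. rring.
Qed.

(* [(cos (t/2) - Uw n t / (4 n)) / sin (t/2) ^ 2] with its removable singularity removed. *)
Definition rho (n : nat) (t : R) : R :=
  cos (t / 2) / (1 + cos (t / 2)) + 2 / INR n * ((1 + cos t) * Vp (2 * n - 1) (cos t)).

Lemma cos_half_pos t : 0 <= t <= PI -> 0 <= cos (t / 2).
Proof. intros Ht. apply cos_ge_0; lra. Qed.

Lemma rho_cont n t : 0 <= t <= PI -> continuous (rho n) t.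
Proof.
  intros Ht. pose proof (cos_half_pos t Ht). apply cont_plus.
  - apply cont_div; [lra | unfold Rdiv; cont | unfold Rdiv; cont].
  - apply cont_mult; [cont|]. apply cont_mult; [cont | apply Vp_cont].
Qed.

(** [cos (t/2)] is the weight from the substitution for the half line, and [Uw n 0 = 4 n] because
    [U_(2n-1)(1) = 2n]. The factor [vt t] on the right is the cancellation that makes the sum over
    [m] converge. *)
Lemma rho_spec n t : (1 <= n)%nat -> 0 <= t <= PI ->
  cos (t / 2) - Uw n t / (4 * INR n) = rho n t * vt t / 8.
Proof.
  intros Hn Ht. pose proof (cos_half_pos t Ht) as Hc. assert (Hn' : 0 < INR n) by (apply lt_0_INR; lia).
  unfold Uw, rho. rewrite chebU_Vp. replace (S (2 * n - 1)) with (2 * n)%nat by lia. rewrite mult_INR. simpl (INR 2). rewrite vt_cos.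
  set (V := Vp (2 * n - 1) (cos t)). replace (cos t) with (2 * cos (t / 2) * cos (t / 2) - 1) by (rewrite <- cos_2a_cos; f_equal; field).
  set (h := cos (t / 2)) in *. field. lra.
Qed.

Lemma rho_int n : (1 <= n)%nat -> RInt (rho n) 0 PI = 2 * PI * INR n - 2.
Proof.
  intros Hn. pose proof PI_RGT_0 as Hpi. assert (Hn' : 0 < INR n) by (apply lt_0_INR; lia).
  assert (E1 : ex_RInt (fun t => cos (t / 2) / (1 + cos (t / 2))) 0 PI).
  { apply ex_RInt_cont; [lra|]. intros t Ht. pose proof (cos_half_pos t Ht). apply cont_div; [lra | unfold Rdiv; cont | unfold Rdiv; cont]. }
  assert (E2 : ex_RInt (fun t => (1 + cos t) * Vp (2 * n - 1) (cos t)) 0 PI).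
  { apply ex_RInt_cont; [lra|]. intros t _. apply cont_mult; [cont | apply Vp_cont]. }
  unfold rho. rewrite (RInt_plus' _ (fun t => 2 / INR n * ((1 + cos t) * Vp (2 * n - 1) (cos t))) _ _ E1 (ex_RInt_scal' _ _ _ _ E2)), (RInt_scal' _ _ _ _ E2), Vp_weight_int.
  rewrite (RInt_FTC (fun t => t - 2 * (sin (t / 2) / (1 + cos (t / 2))))).
  - replace (0 / 2) with 0 by field. rewrite sin_0, cos_0, sin_PI2, cos_PI2, minus_INR, mult_INR by lia. simpl. rfield. lra.
  - lra.
  - intros t Ht. pose proof (cos_half_pos t Ht). auto_derive; [lra|].
    assert (Hs : sin (t * / 2) * sin (t * / 2) = 1 - cos (t * / 2) * cos (t * / 2)) by (pose proof (sin2c (t * / 2)); simpl in *; lra).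
    unfold Rdiv. fold (t / 2) in *. unfold Rdiv in *. set (s := sin (t * / 2)) in *. set (c := cos (t * / 2)) in *.
    req. transitivity (1 - ((c * (1 + c) + s * s) / (1 + c) ^ 2)); [field; lra | rewrite Hs; field; lra].
  - intros t Ht. pose proof (cos_half_pos t Ht). apply cont_div; [lra | unfold Rdiv; cont | unfold Rdiv; cont].
Qed.

Lemma Uw_int n : RInt (Uw n) 0 PI = PI.
Proof. transitivity (RInt (fun t => (1 + cos t) * chebU (2 * n - 1) (cos t)) 0 PI); [apply RInt_ext; intros; unfold Uw; rring | apply chebU_weight_int]. Qed.

(** * The value of zeta at 1/2 *)

Definition hz (L : nat) : R := sum_f_R0 (fun k => / sqrt (INR (S k))) L.

Lemma sqrt_step r : 0 < r -> / (2 * sqrt (r + 1)) <= sqrt (r + 1) - sqrt r <= / (2 * sqrt r).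
Proof.
  intros Hr. assert (H1 : 0 < sqrt r) by now apply sqrt_lt_R0. assert (H2 : 0 < sqrt (r + 1)) by (apply sqrt_lt_R0; lra).
  pose proof (sqrt_sqrt r ltac:(lra)) as H3. pose proof (sqrt_sqrt (r + 1) ltac:(lra)) as H4.
  assert (H5 : sqrt r <= sqrt (r + 1)) by (apply sqrt_le_1; lra).
  set (a := sqrt r) in *. set (b := sqrt (r + 1)) in *.
  assert (H6 : (b - a) * (b + a) = 1) by nra.
  replace (b - a) with (/ (b + a)) by (apply Rmult_eq_reg_r with (b + a); [rewrite H6; field; lra | lra]).
  split; apply Rinv_le_contravar; lra.
Qed.

Lemma INR_S_pos k : 0 < INR (S k).
Proof. apply lt_0_INR; lia. Qed.

Lemma hz_cv : exists l : R, is_lim_seq (fun L => hz L - 2 * sqrt (INR (S L))) l.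
Proof.
  set (u := fun L => - (hz L - 2 * sqrt (INR (S L)))).
  assert (Hu : forall L, u L <= u (S L)).
  { intros L. unfold u, hz. cbn [sum_f_R0]. pose proof (sqrt_step (INR (S L)) (INR_S_pos L)) as H. rewrite (S_INR (S L)).
    rewrite Rinv_mult in H. lra. }
  assert (Hb : forall L, u L <= 2).
  { intros L. unfold u. enough (hz L >= 2 * (sqrt (INR (S (S L))) - 1)).
    { assert (sqrt (INR (S L)) <= sqrt (INR (S (S L)))) by (apply sqrt_le_1_alt; rewrite (S_INR (S L)); lra). lra. }
    unfold hz. induction L as [|L IH].
    - simpl. rewrite sqrt_1, Rinv_1. replace (1 + 1) with 2 by ring. 
      assert (sqrt 2 <= 3 / 2) by (rewrite <- (sqrt_pow2 (3/2)) by lra; apply sqrt_le_1_alt; lra). lra.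
    - cbn [sum_f_R0]. pose proof (sqrt_step (INR (S (S L))) (INR_S_pos _)) as H. rewrite (S_INR (S (S L))). rewrite !Rinv_mult in H. lra. }
  exists (- real (Lim_seq u)). apply is_lim_seq_ext with (fun L => - u L); [intros; unfold u; ring|].
  exact (proj1 (is_lim_seq_opp u (real (Lim_seq u))) (lim_incr_bounded u 2 Hu Hb)).
Qed.

(** Subtract twice the terms with even denominators [2 j], each of which is [1/sqrt 2] times
    [1/sqrt j]. *)
Lemma eta_even L : sum_f_R0 (fun k => (-1) ^ k * Rpower (INR (k + 1)) (- (1/2))) (S (2 * L)) = hz (S (2 * L)) - sqrt 2 * hz L.
Proof.
  assert (Hp : forall k, Rpower (INR (k + 1)) (- (1/2)) = / sqrt (INR (S k))).
  { intros k. rewrite Rpower_Ropp. f_equal. replace (1/2) with (/ 2) by field. rewrite Rpower_sqrt; [now rewrite Nat.add_1_r | rewrite Nat.add_1_r; apply INR_S_pos]. }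
  assert (Hs : 0 < sqrt 2) by (apply sqrt_lt_R0; lra). pose proof (sqrt_sqrt 2 ltac:(lra)) as Hs2.
  rewrite (sum_eq _ (fun k => (-1) ^ k * / sqrt (INR (S k)))) by (intros; now rewrite Hp).
  assert (Hev : forall j, / sqrt (INR (S (S (2 * j)))) = / sqrt 2 * / sqrt (INR (S j))).
  { intros j. rewrite <- Rinv_mult, <- sqrt_mult by (try apply pos_INR; lra). f_equal. f_equal. rewrite !S_INR, mult_INR. simpl. ring. }
  assert (H2 : 2 * / sqrt 2 = sqrt 2) by (rewrite <- Hs2 at 1; field; lra).
  set (i := / sqrt 2) in *. unfold hz. induction L as [|L IH].
  - cbn [sum_f_R0]. pose proof (Hev 0%nat) as H. change (S (S (2 * 0))) with 2%nat in H. change (2 * 0)%nat with 0%nat. cbn [sum_f_R0].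
    rewrite H. rewrite <- H2. simpl (INR 1). rewrite sqrt_1, Rinv_1. cbn [pow]. ring.
  - replace (S (2 * S L)) with (S (S (S (2 * L)))) by lia. cbn [sum_f_R0]. cbn [sum_f_R0] in IH.
    replace (S (S (S (S (2 * L))))) with (S (S (2 * S L))) by lia. rewrite (Hev (S L)).
    replace ((-1) ^ S (S (2 * L))) with 1 by (replace (S (S (2 * L))) with (2 * S L)%nat by lia; now rewrite pow_1_even).
    replace ((-1) ^ S (S (S (2 * L)))) with (- (1)) by (replace (S (S (S (2 * L)))) with (S (2 * S L))%nat by lia; rewrite pow_1_odd; ring).
    set (a := / sqrt (INR (S (S (S (2 * L)))))) in *. set (b := / sqrt (INR (S (S L)))) in *.
    transitivity ((sum_f_R0 (fun k => / sqrt (INR (S k))) (2 * L) + / sqrt (INR (S (S (2 * L)))) - sqrt 2 * sum_f_R0 (fun k => / sqrt (INR (S k))) L) + a - i * b); [rewrite <- IH; ring|].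
    rewrite <- H2. ring.
Qed.

(** In [eta_even] the corrections [2 sqrt(2(L+1))] and [sqrt 2 * 2 sqrt(L+1)] cancel, so the
    alternating sum equals [1 - sqrt 2] times the limit; [1 - sqrt 2] is also the factor by which
    [zeta_real] divides. *)
Lemma hz_lim : is_lim_seq (fun L => hz L - 2 * sqrt (INR (S L))) (zeta_real (1/2)).
Proof.
  destruct hz_cv as [l Hl]. assert (Hs : 1 < sqrt 2) by (rewrite <- sqrt_1; apply sqrt_lt_1_alt; lra).
  set (e := fun k => (-1) ^ k * Rpower (INR (k + 1)) (- (1/2))).
  assert (Hp : forall k, Rpower (INR (k + 1)) (- (1/2)) = / sqrt (INR (S k))).
  { intros k. rewrite Rpower_Ropp. f_equal. replace (1/2) with (/ 2) by field. rewrite Rpower_sqrt; [now rewrite Nat.add_1_r | rewrite Nat.add_1_r; apply INR_S_pos]. }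
  assert (Hex : exists s, is_series e s).
  { destruct (alternated_series (fun k => / sqrt (INR (S k)))) as [s Hsum].
    - intros k. apply Rinv_le_contravar; [apply sqrt_lt_R0, INR_S_pos | apply sqrt_le_1_alt; rewrite (S_INR (S k)); lra].
    - apply is_lim_seq_Reals. apply (is_lim_seq_ext (fun k => sqrt (/ INR (1 + k)))).
      + intros k. rewrite sqrt_inv. reflexivity.
      + rewrite <- sqrt_0. apply (cont_seq sqrt _ 0); [apply continuity_pt_filterlim, continuity_pt_sqrt; lra | apply inv_INR_lim].
    - exists s. apply is_series_lim. apply is_lim_seq_Reals in Hsum. refine (is_lim_seq_ext _ _ _ _ Hsum).
      intros n. apply sum_eq. intros i _. unfold tg_alt, e. now rewrite Hp. }
  destruct Hex as [s Hser].
  assert (H1 : is_lim_seq (fun L => sum_f_R0 e (S (2 * L))) s).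
  { apply (is_lim_seq_subseq (sum_f_R0 e) s (fun L => S (2 * L))); [apply eventually_subseq; intros; lia | now apply is_series_lim]. }
  assert (H2 : is_lim_seq (fun L => sum_f_R0 e (S (2 * L))) ((1 - sqrt 2) * l)).
  { apply is_lim_seq_ext with (fun L => (hz (S (2 * L)) - 2 * sqrt (INR (S (S (2 * L))))) - sqrt 2 * (hz L - 2 * sqrt (INR (S L)))).
    - intros L. unfold e. rewrite eta_even. replace (INR (S (S (2 * L)))) with (2 * INR (S L)) by (rewrite !S_INR, mult_INR; simpl; ring).
      rewrite sqrt_mult by (try apply pos_INR; lra). ring.
    - replace ((1 - sqrt 2) * l) with (l - sqrt 2 * l) by ring. apply is_lim_seq_minus'.
      + apply (is_lim_seq_subseq (fun L => hz L - 2 * sqrt (INR (S L))) l (fun L => S (2 * L))); [apply eventually_subseq; intros; lia | assumption].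
      + apply (is_lim_seq_scal_l _ (sqrt 2) l), Hl. }
  apply is_lim_seq_unique in H1. apply is_lim_seq_unique in H2. rewrite H1 in H2. injection H2 as H2.
  replace (zeta_real (1/2)) with l; [exact Hl|].
  unfold zeta_real. fold e. rewrite (series_eq _ _ Hser), H2. replace (1 - 1/2) with (/ 2) by field. rewrite Rpower_sqrt by lra. field. lra.
Qed.

(* [theta X k = PI / (4 sqrt k) - pk X k], and [Pk X] is an antiderivative of the decreasing function [pk X]. *)
Definition pk (X r : R) : R := / 2 * (atan (sqrt r / X) / sqrt r + X / (r + X ^ 2)).
Definition Pk (X r : R) : R := sqrt r * atan (sqrt r / X).

Lemma is_derive_Pk X r : 0 < X -> 0 < r -> is_derive (Pk X) r (pk X r).
Proof.
  intros HX Hr. assert (Hs : 0 < sqrt r) by now apply sqrt_lt_R0. pose proof (sqrt_sqrt r ltac:(lra)) as H2.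
  eapply der_eq.
  - apply der_mult; [apply is_derive_Reals, derivable_pt_lim_sqrt; assumption|].
    apply (is_derive_comp atan (fun r => sqrt r / X)); [apply is_derive_atan'|].
    instantiate (1 := / (2 * sqrt r) / X). unfold Rdiv. apply (is_derive_ext (fun r => / X * sqrt r)); [intros; rring|].
    rewrite Rmult_comm. apply der_scal. apply is_derive_Reals, derivable_pt_lim_sqrt; assumption.
  - unscals. unfold pk. replace (1 + (sqrt r / X) ^ 2) with ((r + X ^ 2) / X ^ 2).
    2:{ transitivity (1 + sqrt r * sqrt r / X ^ 2); [rewrite H2; field; lra | field; lra]. }
    assert (0 < X ^ 2) by now apply pow_lt. field. repeat split; lra.
Qed.

Lemma atan_ge y : 0 <= y -> y / (1 + y ^ 2) <= atan y.
Proof.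
  intros Hy. assert (H : atan 0 - 0 / (1 + 0 ^ 2) <= atan y - y / (1 + y ^ 2)).
  { apply (mono_le (fun y => atan y - y / (1 + y ^ 2)) (fun y => 2 * y ^ 2 / (1 + y ^ 2) ^ 2)); [assumption | |].
    - intros x _. pose proof (one_sq_pos x) as H. eapply der_eq.
      + apply der_minus; [apply is_derive_atan'|]. instantiate (1 := (1 - x ^ 2) / (1 + x ^ 2) ^ 2). auto_derive; [simpl in *; lra|]. rfield. simpl in *; lra.
      + rfield. lra.
    - intros x _. pose proof (one_sq_pos x) as H. pose proof (pow2_ge_0 x). apply Rmult_le_pos; [lra|]. left. apply Rinv_0_lt_compat. apply pow_lt. lra. }
  rewrite atan_0 in H. lra.
Qed.

Lemma atan_div_decr y z : 0 < y <= z -> atan z / z <= atan y / y.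
Proof.
  intros H. apply Ropp_le_cancel.
  apply (mono_le (fun y => - (atan y / y)) (fun y => (atan y - y / (1 + y ^ 2)) / y ^ 2)); [lra | |].
  - intros x Hx. eapply der_eq.
    + apply (is_derive_ext (fun y => - (1) * (atan y * / y))); [intros; unfold Rdiv; rring|].
      apply der_scal, der_mult; [apply is_derive_atan'|]. instantiate (1 := - / x ^ 2). auto_derive; [lra|]. rfield. lra.
    + pose proof (one_sq_pos x). rfield. split; lra.
  - intros x Hx. pose proof (atan_ge x ltac:(lra)). apply Rmult_le_pos; [lra|]. left. apply Rinv_0_lt_compat, pow_lt. lra.
Qed.

Lemma pk_decr X a b : 0 < X -> 0 < a <= b -> pk X b <= pk X a.
Proof.
  intros HX Hab. unfold pk. apply Rmult_le_compat_l; [lra|].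
  assert (Ha : 0 < sqrt a) by (apply sqrt_lt_R0; lra). assert (Hb : sqrt a <= sqrt b) by (apply sqrt_le_1_alt; lra).
  apply Rplus_le_compat.
  - assert (H : 0 < sqrt a / X <= sqrt b / X).
    { split; [now apply Rdiv_lt_0_compat|]. apply Rmult_le_compat_r; [left; now apply Rinv_0_lt_compat | assumption]. }
    pose proof (atan_div_decr _ _ H) as H1.
    replace (atan (sqrt b / X) / sqrt b) with (/ X * (atan (sqrt b / X) / (sqrt b / X))) by (field; lra).
    replace (atan (sqrt a / X) / sqrt a) with (/ X * (atan (sqrt a / X) / (sqrt a / X))) by (field; lra).
    apply Rmult_le_compat_l; [left; now apply Rinv_0_lt_compat | assumption].
  - apply Rmult_le_compat_l; [lra|]. assert (0 < X ^ 2) by now apply pow_lt. apply Rinv_le_contravar; lra.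
Qed.

(** Comparison of sum and integral for the decreasing function [pk X]; the discrepancy is at most
    [Pk X 1 = atan (1/X)]. The lower bound rests on [pk X 1 <= Pk X 1]. *)
Lemma pk_sum_bounds X L : 0 < X ->
  0 <= Pk X (INR (S L)) - sum_f_R0 (fun k => pk X (INR (S k))) L <= / X.
Proof.
  intros HX. assert (HX' : 0 < / X) by now apply Rinv_0_lt_compat.
  assert (Hstep : forall k, pk X (INR (S (S k))) <= Pk X (INR (S (S k))) - Pk X (INR (S k)) <= pk X (INR (S k))).
  { intros k. pose proof (INR_S_pos k) as Hk. rewrite (S_INR (S k)). set (r := INR (S k)) in *.
    destruct (MVT_gen (Pk X) r (r + 1) (pk X)) as [x [Hx Hm]].
    - rewrite Rmin_left, Rmax_right by lra. intros y Hy. apply is_derive_Pk; lra.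
    - rewrite Rmin_left, Rmax_right by lra. intros y Hy. apply continuity_pt_filterlim. refine (der_cont _ _ _ (is_derive_Pk X y HX _)). lra.
    - rewrite Rmin_left, Rmax_right in Hx by lra. rewrite Hm. replace (r + 1 - r) with 1 by ring. rewrite Rmult_1_r. split; apply pk_decr; lra. }
  assert (H1 : Pk X 1 <= / X).
  { unfold Pk. rewrite sqrt_1, Rmult_1_l. unfold Rdiv. rewrite Rmult_1_l. apply atan_le; lra. }
  assert (H2 : pk X 1 <= Pk X 1).
  { unfold Pk, pk. rewrite sqrt_1. pose proof (atan_ge (1 / X) ltac:(unfold Rdiv; lra)) as H.
    replace (1 / X / (1 + (1 / X) ^ 2)) with (X / (1 + X ^ 2)) in H by (pose proof (one_sq_pos X); field; repeat split; lra).
    lra. }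
  assert (H3 : forall L, sum_f_R0 (fun k => pk X (INR (S k))) L <= Pk X (INR (S L))).
  { intros K. induction K as [|K IH]; cbn [sum_f_R0]; [exact H2|]. pose proof (Hstep K). lra. }
  assert (H4 : forall L, Pk X (INR (S (S L))) - Pk X 1 <= sum_f_R0 (fun k => pk X (INR (S k))) L).
  { intros K. induction K as [|K IH]; cbn [sum_f_R0].
    - pose proof (Hstep 0%nat) as H. simpl (INR 1) in *. lra.
    - pose proof (Hstep (S K)). lra. }
  specialize (H3 L). specialize (H4 L). pose proof (Hstep L) as H5.
  assert (H6 : 0 <= pk X (INR (S (S L)))).
  { unfold pk. pose proof (INR_S_pos (S L)) as Hp. assert (0 < sqrt (INR (S (S L)))) by now apply sqrt_lt_R0.
    apply Rmult_le_pos; [lra|]. apply Rplus_le_le_0_compat; apply Rmult_le_pos; try lra; try (left; now apply Rinv_0_lt_compat).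
    - rewrite <- atan_0. assert (0 < sqrt (INR (S (S L))) / X) by now apply Rdiv_lt_0_compat. left. now apply atan_increasing.
    - left. apply Rinv_0_lt_compat. pose proof (pow_lt X 2 HX). lra. }
  lra.
Qed.

Definition theta (X k : R) : R := RInt (fun u => u ^ 2 / (k + u ^ 2) ^ 2) 0 X.

Lemma theta_pk X k : 0 < X -> 0 < k -> theta X k = PI / 4 * / sqrt k - pk X k.
Proof.
  intros HX Hk. assert (Hs : 0 < sqrt k) by now apply sqrt_lt_R0. pose proof (sqrt_sqrt k ltac:(lra)) as Hs2.
  assert (Hp : forall u, 0 < k + u ^ 2) by (intros u; pose proof (pow2_ge_0 u); lra).
  unfold theta. rewrite (RInt_FTC (fun u => / 2 * (atan (u / sqrt k) / sqrt k - u / (k + u ^ 2)))).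
  - unfold pk. unfold Rdiv at 4 5 6. rewrite !Rmult_0_l, atan_0.
    replace (sqrt k / X) with (/ (X / sqrt k)) by (field; lra). rewrite atan_inv by now apply Rdiv_lt_0_compat.
    specialize (Hp X). rfield. repeat split; lra.
  - lra.
  - intros u _. specialize (Hp u). eapply der_eq.
    + apply der_scal, der_minus.
      * apply (is_derive_ext (fun u => / sqrt k * atan (/ sqrt k * u))); [intros t; rewrite (Rmult_comm (/ sqrt k) t); unfold Rdiv; rring|].
        apply der_scal. apply (is_derive_comp atan (fun u => / sqrt k * u)); [apply is_derive_atan' | apply der_scal, der_id].
      * instantiate (1 := (k - u ^ 2) / (k + u ^ 2) ^ 2). auto_derive; [simpl in *; lra|]. rfield. simpl in *. lra.
    + unscals. replace (1 + (/ sqrt k * u) ^ 2) with ((k + u ^ 2) / k).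
      2:{ transitivity (1 + u ^ 2 / (sqrt k * sqrt k)); [rewrite Hs2; field; lra | field; lra]. }
      transitivity (/ 2 * (/ (sqrt k * sqrt k) * (k / (k + u ^ 2)) - (k - u ^ 2) / (k + u ^ 2) ^ 2)); [field; repeat split; lra|].
      rewrite Hs2. field. split; lra.
  - intros u _. specialize (Hp u). apply cont_div; [apply pow_nonzero; lra | cont | cont].
Qed.

(** By [theta_pk] the partial sums are [PI/4 * hz L] minus sums of [pk X]. Replacing the latter by
    [Pk X] costs at most [1/X], and [Pk X r = PI/2 sqrt r - X + o(1)]. The divergent square roots
    cancel, leaving [X] and the regularised sum from [hz_lim]. *)
Lemma theta_sum X s : 0 < X -> is_series (fun k => theta X (INR (S k))) s ->
  Rabs (s - X - PI / 4 * zeta_real (1/2)) <= / X.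
Proof.
  intros HX Hs. apply is_series_lim in Hs. pose proof PI_RGT_0 as Hpi.
  set (Z := PI / 4 * zeta_real (1/2)).
  set (e := fun L => Pk X (INR (S L)) - sum_f_R0 (fun k => pk X (INR (S k))) L).
  (* By [atan_inv] the expression equals [sqrt r * atan (X / sqrt r)], and
     [y/(1 + y^2) <= atan y <= y] squeezes it to [X]. *)
  assert (HP : is_lim_seq (fun L => PI / 2 * sqrt (INR (S L)) - Pk X (INR (S L))) X).
  { apply is_lim_seq_ext with (fun L => sqrt (INR (S L)) * atan (X / sqrt (INR (S L)))).
    - intros L. unfold Pk. pose proof (sqrt_lt_R0 _ (INR_S_pos L)) as H. set (r := sqrt (INR (S L))) in *.
      replace (r / X) with (/ (X / r)) by (field; lra). rewrite atan_inv by now apply Rdiv_lt_0_compat. ring.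
    - apply is_lim_seq_le_le with (fun L => X / (1 + X ^ 2 * / INR (1 + L))) (fun _ => X).
      + intros L. change (1 + L)%nat with (S L). pose proof (INR_S_pos L) as Hp. pose proof (sqrt_lt_R0 _ Hp) as H. pose proof (sqrt_sqrt (INR (S L)) ltac:(lra)) as H2.
        rewrite <- H2 at 1. set (r := sqrt (INR (S L))) in *. assert (H3 : 0 < X / r) by now apply Rdiv_lt_0_compat.
        pose proof (atan_ge (X / r) ltac:(lra)) as H4. pose proof (atan_le (X / r) ltac:(lra)) as H5. pose proof (pow_lt X 2 HX). pose proof (pow_lt r 2 H).
        split.
        * apply Rle_trans with (r * (X / r / (1 + (X / r) ^ 2))); [right; field; split; nra | apply Rmult_le_compat_l; lra].
        * apply Rle_trans with (r * (X / r)); [apply Rmult_le_compat_l; lra | right; field; lra].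
      + replace (Finite X) with (Finite (X / (1 + X ^ 2 * 0))) by (f_equal; field).
        apply is_lim_seq_div'; [apply is_lim_seq_const | | lra].
        apply is_lim_seq_plus'; [apply is_lim_seq_const | apply (is_lim_seq_scal_l _ (X ^ 2) 0), inv_INR_lim].
      + apply is_lim_seq_const. }
  assert (He : is_lim_seq e (s - X - Z)).
  { apply is_lim_seq_ext with (fun L => sum_f_R0 (fun k => theta X (INR (S k))) L - (PI / 2 * sqrt (INR (S L)) - Pk X (INR (S L))) - PI / 4 * (hz L - 2 * sqrt (INR (S L)))).
    - intros L. unfold e. rewrite (sum_eq _ (fun k => PI / 4 * / sqrt (INR (S k)) - pk X (INR (S k)))) by (intros; apply theta_pk; [assumption | apply INR_S_pos]).
      rewrite minus_sum, sum_mult. fold (hz L). field.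
    - apply is_lim_seq_minus'; [apply is_lim_seq_minus'; assumption|]. apply (is_lim_seq_scal_l _ (PI / 4) (zeta_real (1/2))), hz_lim. }
  assert (Hi : 0 < / X) by now apply Rinv_0_lt_compat.
  assert (H0 : 0 <= s - X - Z) by (apply (lim_ge_const e _ 0 He); intros L; apply (pk_sum_bounds X L HX)).
  apply Rabs_le. split.
  - lra.
  - apply (lim_le_const e _ (/ X) He). intros L. apply (pk_sum_bounds X L HX).
Qed.

(** * Interchange of sums and integrals *)

(** [T2] is Lipschitz on the nonnegative reals, by termwise comparison with [1/k^2]; [Rabs] extends
    this to the whole line and gives two-sided continuity at 0. *)
Lemma T2_abs_cont v : continuous (fun v => T2 (Rabs v)) v.
Proof.
  assert (HL : forall a b, 0 <= a -> 0 <= b -> Rabs (T2 a - T2 b) <= Series (fun k => 2 * Rabs (a - b) * / INR (S k) ^ 2)).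
  { intros a b Ha Hb. unfold T2.
    rewrite <- Series_minus by (eexists; apply T2_ex; assumption).
    apply Rabs_Series_le; [|apply (ex_series_scal_l (2 * Rabs (a - b)) (fun k => / INR (S k) ^ 2)), ex_series_inv_sq].
    intros k. pose proof (INR_S_pos k) as Hk. assert (H1 : 1 <= INR (S k)) by (apply (le_INR 1); lia). set (r := INR (S k)) in *.
    assert (H2 : / (r + a) ^ 2 - / (r + b) ^ 2 = (b - a) * ((/ (r + a)) * (/ (r + b)) * (/ (r + a) + / (r + b)))) by (field; lra).
    rewrite H2, Rabs_mult, (Rabs_minus_sym b a).
    assert (Ia : 0 < / (r + a) <= / r) by (split; [apply Rinv_0_lt_compat; lra | apply Rinv_le_contravar; lra]).
    assert (Ib : 0 < / (r + b) <= / r) by (split; [apply Rinv_0_lt_compat; lra | apply Rinv_le_contravar; lra]).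
    assert (Ir : / r <= 1) by (rewrite <- Rinv_1; apply Rinv_le_contravar; lra).
    rewrite <- pow_inv. set (x := / (r + a)) in *. set (y := / (r + b)) in *. set (z := / r) in *.
    pose proof (Rabs_pos (a - b)). rewrite (Rabs_pos_eq (x * y * (x + y))) by (apply Rmult_le_pos; nra).
    replace (2 * Rabs (a - b) * z ^ 2) with (Rabs (a - b) * (2 * z ^ 2)) by ring. apply Rmult_le_compat_l; [assumption|].
    assert (x * y <= z * z) by nra. assert (0 < x * y) by nra. simpl. nra. }
  assert (HC : forall a b, Rabs (T2 (Rabs a) - T2 (Rabs b)) <= 4 * Rabs (a - b)).
  { intros a b. apply Rle_trans with (1 := HL _ _ (Rabs_pos a) (Rabs_pos b)). rewrite Series_scal_l.
    assert (H : Series (fun k => / INR (S k) ^ 2) <= 2).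
    { destruct ex_series_inv_sq as [s Hs]. rewrite (is_series_unique _ _ Hs). apply is_series_lim in Hs. apply (lim_le_const _ _ 2 Hs), sum_inv_sq_le. }
    pose proof (Rabs_triang_inv2 a b). pose proof (Rabs_pos (Rabs a - Rabs b)). nra. }
  apply continuity_pt_filterlim. intros eps Heps. exists (eps / 4). split; [lra|]. intros x [_ Hx]. simpl in *. unfold Rdist in *.
  specialize (HC x v). lra.
Qed.

Lemma T2_cont (f : R -> R) x : (forall y, 0 <= f y) -> continuous f x -> continuous (fun y => T2 (f y)) x.
Proof.
  intros Hf Hc. apply (continuous_ext (fun y => T2 (Rabs (f y)))); [intros; now rewrite Rabs_pos_eq|].
  apply (continuous_comp f (fun v => T2 (Rabs v))); [assumption | apply T2_abs_cont].
Qed.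

Lemma T2_vt_cont t : continuous (fun t => T2 (vt t)) t.
Proof. apply T2_cont; [intros; apply vt_bounds | apply vt_cont]. Qed.

Lemma T2_sq_cont u : continuous (fun u => T2 (u ^ 2)) u.
Proof. apply T2_cont; [intros; apply pow2_ge_0 | cont]. Qed.

Lemma kernel_le k v : 0 <= v -> 0 <= v / (INR (S k) + v) ^ 2 <= v * / INR (S k) ^ 2.
Proof.
  intros Hv. pose proof (INR_S_pos k) as Hk. assert (H1 : 0 < INR (S k) ^ 2) by now apply pow_lt.
  assert (H2 : 0 < (INR (S k) + v) ^ 2) by (apply pow_lt; lra).
  split; [apply Rmult_le_pos; [assumption | left; now apply Rinv_0_lt_compat]|].
  apply Rmult_le_compat_l; [assumption|]. apply Rinv_le_contravar; [assumption|]. apply pow_incr. lra.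
Qed.

Lemma T2_series v : 0 <= v -> is_series (fun k => v / (INR (S k) + v) ^ 2) (v * T2 v).
Proof. intros Hv. apply (is_series_scal_l v _ _ (T2_ex v Hv)). Qed.

Lemma Uw_T2_series n : (1 <= n)%nat ->
  is_series (fun k => PI * INR n * (/ 2 * phi n k)) (RInt (fun t => Uw n t * (vt t * T2 (vt t))) 0 PI).
Proof.
  intros Hn. pose proof PI_RGT_0 as Hpi.
  destruct (cont_bounded (Uw n) 0 PI) as [B [HB0 HB]]; [lra | intros; apply Uw_cont|].
  apply (is_series_ext (fun k => RInt (fun t => Uw n t * (vt t / (INR (S k) + vt t) ^ 2)) 0 PI)); [intros; now apply Uw_int_kernel|].
  apply (RInt_series _ _ (fun k => B * 8 * / INR (S k) ^ 2)).
  - lra.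
  - intros k t _. pose proof (vt_bounds t). pose proof (INR_S_pos k). apply cont_mult; [apply Uw_cont|].
    apply cont_div; [apply pow_nonzero; lra | apply vt_cont | apply cont_pow, cont_plus; [cont | apply vt_cont]].
  - intros k t Ht. pose proof (vt_bounds t) as Hv. pose proof (kernel_le k (vt t) ltac:(lra)) as Hk. specialize (HB t Ht).
    rewrite Rabs_mult, (Rabs_pos_eq (_ / _)) by lra. rewrite Rmult_assoc.
    assert (Hi : 0 < / INR (S k) ^ 2) by apply Rinv_0_lt_compat, pow_lt, INR_S_pos.
    apply Rmult_le_compat; [apply Rabs_pos | lra | assumption|]. nra.
  - apply (ex_series_scal_l (B * 8) (fun k => / INR (S k) ^ 2)), ex_series_inv_sq.
  - intros t _. pose proof (vt_bounds t) as Hv. exact (is_series_scal_l (Uw n t) _ _ (T2_series (vt t) (proj1 Hv))).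
  - apply ex_RInt_cont; [lra|]. intros t _. apply cont_mult; [apply Uw_cont|]. apply cont_mult; [apply vt_cont | apply T2_vt_cont].
Qed.

Lemma theta_series X : 0 <= X ->
  is_series (fun k => theta X (INR (S k))) (RInt (fun u => u ^ 2 * T2 (u ^ 2)) 0 X).
Proof.
  intros HX. apply (RInt_series _ _ (fun k => X ^ 2 * / INR (S k) ^ 2)).
  - assumption.
  - intros k u _. pose proof (INR_S_pos k). pose proof (pow2_ge_0 u). apply cont_div; [apply pow_nonzero; lra | cont | cont].
  - intros k u Hu. pose proof (kernel_le k (u ^ 2) (pow2_ge_0 u)) as Hk. rewrite Rabs_pos_eq by lra.
    apply Rle_trans with (1 := proj2 Hk). apply Rmult_le_compat_r; [left; apply Rinv_0_lt_compat, pow_lt, INR_S_pos | apply pow_incr; lra].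
  - apply (ex_series_scal_l (X ^ 2) (fun k => / INR (S k) ^ 2)), ex_series_inv_sq.
  - intros u _. apply T2_series, pow2_ge_0.
  - apply ex_RInt_cont; [assumption|]. intros u _. apply cont_mult; [cont | apply T2_sq_cont].
Qed.

(** The substitution [u = sqrt 8 sin (t/2)]: [u^2 = vt t] and [du = sqrt 2 cos (t/2) dt]. *)
Lemma half_angle_subst (f : R -> R) : (forall u, continuous (fun u => f (u ^ 2)) u) ->
  RInt (fun u => f (u ^ 2)) 0 (sqrt 8) = sqrt 2 * RInt (fun t => cos (t / 2) * f (vt t)) 0 PI.
Proof.
  intros Hf. pose proof PI_RGT_0 as Hpi. assert (H8 : sqrt 8 = 2 * sqrt 2).
  { replace 8 with (2 ^ 2 * 2) by ring. rewrite sqrt_mult, sqrt_pow2 by lra. reflexivity. }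
  pose proof (sqrt_sqrt 8 ltac:(lra)) as Hs8.
  pose (H := (fun s => RInt (fun u => f (u ^ 2)) 0 s) : R -> R).
  assert (Hv : forall t, (sqrt 8 * sin (t / 2)) ^ 2 = vt t).
  { intros t. unfold vt. rewrite <- Hs8 at 2. ring. }
  assert (Cf : forall t, continuous (fun t => cos (t / 2) * f (vt t)) t).
  { intros t. apply cont_mult; [unfold Rdiv; cont|]. apply (continuous_ext (fun t => f ((sqrt 8 * sin (t / 2)) ^ 2))); [intros; now rewrite Hv|].
    apply (continuous_comp (fun t => sqrt 8 * sin (t / 2)) (fun u => f (u ^ 2))); [unfold Rdiv; cont | apply Hf]. }
  rewrite <- RInt_scal' by (apply ex_RInt_cont; [lra | intros; apply Cf]).
  change (RInt (fun u => f (u ^ 2)) 0 (sqrt 8)) with (H (sqrt 8)). symmetry.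
  rewrite (RInt_FTC (fun t => H (sqrt 8 * sin (t / 2)))).
  - replace (0 / 2) with 0 by field. rewrite sin_PI2, sin_0, Rmult_0_r, Rmult_1_r.
    assert (H0 : H 0 = 0) by (unfold H; apply (RInt_point (V := R_CompleteNormedModule))). rewrite H0. rring.
  - lra.
  - intros t _. eapply der_eq.
    + apply (is_derive_comp H (fun t => sqrt 8 * sin (t / 2))); [apply (is_derive_int (fun u => f (u ^ 2))), Hf|].
      instantiate (1 := sqrt 2 * cos (t / 2)). rewrite H8. auto_derive; [trivial|]. unfold Rdiv. rfield.
    + unscals. rewrite Hv. ring.
  - intros t _. apply cont_mult; [cont | apply Cf].
Qed.

Lemma hfun_vt_cont a t : 0 < a -> continuous (fun t => hfun (a * vt t)) t.
Proof.
  intros Ha. apply (continuous_ext (fun t => hfun (a * 8 * sin (t / 2) ^ 2))); [intros; unfold vt; f_equal; ring|].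
  apply (continuous_comp (fun t => sin (t / 2)) (fun u => hfun (a * 8 * u ^ 2))); [unfold Rdiv; cont | apply hfun_sq_cont; lra].
Qed.

Lemma two_pi_S_pos m : 0 < 2 * PI * INR (S m).
Proof. pose proof PI_RGT_0. pose proof (INR_S_pos m). nra. Qed.

Lemma hfun_partial_le v L : 0 < v -> 0 <= sum_f_R0 (fun m => hfun (2 * PI * INR (S m) * v)) L <= Hs v.
Proof.
  intros Hv. pose proof (hfun_sum v Hv) as H. apply is_series_lim in H.
  assert (Hp : forall m, 0 <= hfun (2 * PI * INR (S m) * v)) by (intros m; apply hfun_pos; pose proof (two_pi_S_pos m); nra).
  split; [now apply cond_pos_sum|].
  apply (lim_ge_const (fun d => sum_f_R0 (fun m => hfun (2 * PI * INR (S m) * v)) (L + d)) (Hs v)).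
  - apply (is_lim_seq_incr_n (sum_f_R0 (fun m => hfun (2 * PI * INR (S m) * v))) L) in H. refine (is_lim_seq_ext _ _ _ _ H). intros d. f_equal. lia.
  - intros d. induction d as [|d IH]; [rewrite Nat.add_0_r; lra|]. rewrite Nat.add_succ_r. cbn [sum_f_R0]. specialize (Hp (S (L + d))). lra.
Qed.

(* [v * Hs v], which stays continuous at [v = 0]. *)
Definition Wv (v : R) : R := / 2 * (v * (v * T2 v) + / 2 - v).

Lemma Wv_Hs v : 0 < v -> Wv v = v * Hs v.
Proof. intros Hv. unfold Wv, Hs. field. lra. Qed.

Lemma Wv_cont t : continuous (fun t => Wv (vt t)) t.
Proof.
  pose proof (vt_cont t). pose proof (T2_vt_cont t). unfold Wv.
  apply cont_mult; [cont|]. apply cont_minus; [|assumption]. apply cont_plus; [|cont]. apply cont_mult; [assumption | now apply cont_mult].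
Qed.

(** Abstracts the splitting of an interval at [d]: the part near the singularity costs [B d], the
    rest converges at a rate whose constant [K] may blow up as [d] decreases. *)
Lemma lim_zero_split (a F : nat -> R) B : is_lim_seq F 0 -> (forall L, 0 <= F L) -> (forall d, 0 < d <= 1 -> exists K, 0 <= K /\ forall L, Rabs (a L) <= B * d + K * F L) ->
  0 <= B -> is_lim_seq a 0.
Proof.
  intros HF HF0 H HB. apply is_lim_seq_spec. intros eps. 
  set (d := Rmin 1 (eps / (2 * (B + 1)))). pose proof (cond_pos eps) as He.
  assert (Hd : 0 < d <= 1).
  { unfold d. split; [apply Rmin_pos; [lra | apply Rdiv_lt_0_compat; lra] | apply Rmin_l]. }
  destruct (H d Hd) as [K [HK Hb]].
  apply is_lim_seq_spec in HF. assert (He2 : 0 < eps / (2 * (K + 1))) by (apply Rdiv_lt_0_compat; lra).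
  specialize (HF (mkposreal _ He2)). destruct HF as [N0 HN]. exists N0. intros L HL. specialize (HN L HL). simpl in HN.
  rewrite Rminus_0_r in *. rewrite Rabs_pos_eq in HN by apply HF0. specialize (Hb L).
  assert (H1 : d * (2 * (B + 1)) <= eps).
  { apply Rle_trans with (eps / (2 * (B + 1)) * (2 * (B + 1))); [apply Rmult_le_compat_r; [lra | apply Rmin_r] | right; field; lra]. }
  assert (H2 : F L * (2 * (K + 1)) < eps).
  { apply Rlt_le_trans with (eps / (2 * (K + 1)) * (2 * (K + 1))); [apply Rmult_lt_compat_r; lra | right; field; lra]. }
  specialize (HF0 L). nra.
Qed.

(** The bound of [hfun_sum_approx] degenerates as [v -> 0], so the interval is split at [d]. On
    [[0,d]] the partial sums stay below [Hs], and [v Hs(v) <= (128 + 1/2)/2 <= 70] for [v <= 8]. On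
    [[d, PI]] one has [v >= d^2/2], and the explicit error applies. *)
Lemma rho_exchange n : (1 <= n)%nat ->
  is_series (fun m => RInt (fun t => rho n t * vt t / 8 * hfun (2 * PI * INR (S m) * vt t)) 0 PI) (RInt (fun t => rho n t / 8 * Wv (vt t)) 0 PI).
Proof.
  intros Hn. pose proof PI2_3_2 as Hpi. pose proof PI_4 as Hpi4.
  destruct (cont_bounded (rho n) 0 PI) as [Br [HB0 HB]]; [lra | intros; now apply rho_cont|].
  set (f := fun m t => rho n t / 8 * (vt t * hfun (2 * PI * INR (S m) * vt t))).
  assert (Cf : forall m t, 0 <= t <= PI -> continuous (f m) t).
  { intros m t Ht. apply cont_mult; [unfold Rdiv; apply cont_mult; [now apply rho_cont | cont]|].
    apply cont_mult; [apply vt_cont | apply hfun_vt_cont, two_pi_S_pos]. }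
  assert (CW : forall t, 0 <= t <= PI -> continuous (fun t => rho n t / 8 * Wv (vt t)) t).
  { intros t Ht. apply cont_mult; [unfold Rdiv; apply cont_mult; [now apply rho_cont | cont] | apply Wv_cont]. }
  apply (is_series_ext (fun m => RInt (f m) 0 PI)); [intros m; apply RInt_ext; intros; unfold f; rfield|].
  apply is_series_lim. set (I := RInt (fun t => rho n t / 8 * Wv (vt t)) 0 PI).
  apply is_lim_seq_ext with (fun L => (sum_f_R0 (fun m => RInt (f m) 0 PI) L - I) + I); [intros; ring|].
  replace (Finite I) with (Finite (0 + I)) by (f_equal; ring).
  apply is_lim_seq_plus'; [|apply is_lim_seq_const].
  apply (lim_zero_split _ Feps (Br / 8 * 70)); [apply Feps_lim | apply Feps_pos | | lra].
  intros d Hd. exists (Br / 8 * (4 * (2 / d ^ 2 + 128))).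
  assert (Hd2 : 0 < d ^ 2) by (apply pow_lt; lra). assert (Hi2 : 0 < 2 / d ^ 2) by (apply Rdiv_lt_0_compat; lra).
  split; [apply Rmult_le_pos; lra|]. intros L. pose proof (Feps_pos L) as HFL.
  set (e := fun t => rho n t / 8 * (vt t * sum_f_R0 (fun m => hfun (2 * PI * INR (S m) * vt t)) L - Wv (vt t))).
  assert (Ef : forall a b, 0 <= a -> a <= b -> b <= PI -> forall m, ex_RInt (f m) a b) by (intros; apply ex_RInt_cont; [lra | intros; apply Cf; lra]).
  assert (EW : ex_RInt (fun t => rho n t / 8 * Wv (vt t)) 0 PI) by (apply ex_RInt_cont; [lra | assumption]).
  destruct (RInt_sum f 0 PI L (Ef 0 PI ltac:(lra) ltac:(lra) ltac:(lra))) as [Es Hsum].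
  assert (Ce : forall t, 0 <= t <= PI -> continuous e t).
  { intros t Ht. unfold e. apply (continuous_ext (fun t => sum_f_R0 (fun m => f m t) L - rho n t / 8 * Wv (vt t))).
    - intros s. unfold f. rewrite sum_mult, sum_mult. rring.
    - apply cont_minus; [|now apply CW]. clear - Cf Ht. induction L as [|L IH]; cbn [sum_f_R0]; [now apply Cf | apply cont_plus; [exact IH | now apply Cf]]. }
  assert (HI : sum_f_R0 (fun m => RInt (f m) 0 PI) L - I = RInt e 0 d + RInt e d PI).
  { rewrite <- (RInt_Chasles' e 0 d PI) by (apply ex_RInt_cont; [lra | intros; apply Ce; lra]).
    unfold I. rewrite <- Hsum, <- (RInt_minus' _ _ _ _ Es EW). apply RInt_ext. intros t _. unfold e, f. rewrite sum_mult, sum_mult. rring. }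
  rewrite HI.
  assert (Hvp : forall t, 0 < t <= PI -> 0 < vt t).
  { intros t Ht. unfold vt. assert (0 < sin (t / 2)) by (apply sin_gt_0; lra). pose proof (pow_lt _ 2 H). lra. }
  assert (Hr : forall t, 0 <= t <= PI -> Rabs (rho n t / 8) <= Br / 8).
  { intros t Ht. unfold Rdiv. rewrite Rabs_mult, (Rabs_pos_eq (/ 8)) by lra. specialize (HB t Ht). lra. }
  assert (b1 : Rabs (RInt e 0 d) <= Br / 8 * 70 * d).
  { replace (Br / 8 * 70 * d) with (RInt (fun _ => Br / 8 * 70) 0 d) by (rewrite RInt_const'; rring).
    apply RInt_Rabs_le; [lra | apply ex_RInt_cont; [lra | intros; apply Ce; lra] | apply ex_RInt_const|].
    intros t Ht. unfold e. rewrite Rabs_mult. apply Rmult_le_compat; try apply Rabs_pos; [apply Hr; lra|].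
    pose proof (Hvp t ltac:(lra)) as Hv. pose proof (hfun_partial_le (vt t) L Hv) as Hp. rewrite Wv_Hs by assumption.
    rewrite <- Rmult_minus_distr_l, Rabs_mult, Rabs_pos_eq by lra. rewrite Rabs_minus_sym, Rabs_pos_eq by lra.
    apply Rle_trans with (vt t * Hs (vt t)); [apply Rmult_le_compat_l; lra|]. rewrite <- Wv_Hs by assumption. unfold Wv.
    pose proof (T2_bounds (vt t) ltac:(lra)). pose proof (vt_bounds t).
    assert (vt t * T2 (vt t) <= 8 * 2) by (apply Rmult_le_compat; lra). assert (0 <= vt t * T2 (vt t)) by (apply Rmult_le_pos; lra).
    assert (vt t * (vt t * T2 (vt t)) <= 8 * (8 * 2)) by (apply Rmult_le_compat; lra). lra. }
  assert (b2 : Rabs (RInt e d PI) <= Br / 8 * (4 * (2 / d ^ 2 + 128)) * Feps L).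
  { apply Rle_trans with (RInt (fun _ => Br / 8 * ((2 / d ^ 2 + 128) * Feps L)) d PI).
    - apply RInt_Rabs_le; [lra | apply ex_RInt_cont; [lra | intros; apply Ce; lra] | apply ex_RInt_const|].
      intros t Ht. unfold e. rewrite Rabs_mult. apply Rmult_le_compat; try apply Rabs_pos; [apply Hr; lra|].
      pose proof (Hvp t ltac:(lra)) as Hv. rewrite Wv_Hs by assumption. rewrite <- Rmult_minus_distr_l, Rabs_mult, Rabs_pos_eq by lra.
      pose proof (hfun_sum_approx L (vt t) Hv) as Ha. pose proof (vt_bounds t) as Hvb.
      apply Rle_trans with (vt t * ((/ vt t ^ 2 + 2 * vt t) * Feps L)); [apply Rmult_le_compat_l; lra|].
      rewrite <- Rmult_assoc. apply Rmult_le_compat_r; [assumption|].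
      replace (vt t * (/ vt t ^ 2 + 2 * vt t)) with (/ vt t + 2 * (vt t * vt t)) by (field; lra).
      assert (Hlow : d ^ 2 / 2 <= vt t).
      { unfold vt. pose proof (sin_ge_half (t / 2) ltac:(lra)) as Hs. assert (H1 : d ^ 2 <= t ^ 2) by (apply pow_incr; lra).
        assert (H2 : (t / 2 / 2) ^ 2 <= sin (t / 2) ^ 2) by (apply pow_incr; lra). replace ((t / 2 / 2) ^ 2) with (t ^ 2 / 16) in H2 by field. lra. }
      assert (H3 : / vt t <= 2 / d ^ 2).
      { replace (2 / d ^ 2) with (/ (d ^ 2 / 2)) by (field; lra). apply Rinv_le_contravar; lra. }
      assert (vt t * vt t <= 8 * 8) by (apply Rmult_le_compat; lra). lra.
    - rewrite RInt_const'. replace (Br / 8 * (4 * (2 / d ^ 2 + 128)) * Feps L) with (4 * (Br / 8 * ((2 / d ^ 2 + 128) * Feps L))) by ring.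
      apply Rmult_le_compat_r; [|lra]. apply Rmult_le_pos; [lra|]. apply Rmult_le_pos; lra. }
  apply Rle_trans with (1 := Rabs_triang _ _). lra.
Qed.

Lemma Hs_sq_cont u : 0 < u -> continuous (fun u => Hs (u ^ 2)) u.
Proof.
  intros Hu. pose proof (T2_sq_cont u). pose proof (pow_lt u 2 Hu). unfold Hs.
  apply cont_mult; [cont|]. apply cont_minus; [|cont]. apply cont_plus; [apply cont_mult; [cont | assumption]|]. apply cont_inv; [lra | cont].
Qed.

(** For [u >= 1] the error in [hfun_sum_approx] is at most [(1 + 2 X^2) Feps L], so the convergence
    is uniform. *)
Lemma tail_exchange a X : 1 <= a -> a <= X ->
  is_series (fun m => RInt (fun u => hfun (2 * PI * INR (S m) * u ^ 2)) a X) (RInt (fun u => Hs (u ^ 2)) a X).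
Proof.
  intros Ha HX. set (f := fun m u => hfun (2 * PI * INR (S m) * u ^ 2)).
  assert (Ef : forall m, ex_RInt (f m) a X) by (intros; apply ex_RInt_cont; [assumption | intros; apply hfun_sq_cont, two_pi_S_pos]).
  assert (EH : ex_RInt (fun u => Hs (u ^ 2)) a X) by (apply ex_RInt_cont; [assumption | intros; apply Hs_sq_cont; lra]).
  change (is_series (fun m => RInt (f m) a X) (RInt (fun u => Hs (u ^ 2)) a X)).
  apply is_series_lim. set (I := RInt (fun u => Hs (u ^ 2)) a X).
  apply is_lim_seq_ext with (fun L => (sum_f_R0 (fun m => RInt (f m) a X) L - I) + I); [intros; ring|].
  replace (Finite I) with (Finite (0 + I)) by (f_equal; ring).
  apply is_lim_seq_plus'; [|apply is_lim_seq_const].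
  apply is_lim_seq_abs_0. apply is_lim_seq_le_le with (fun _ => 0) (fun L => (X - a) * (1 + 2 * X ^ 2) * Feps L).
  - intros L. split; [apply Rabs_pos|]. destruct (RInt_sum f a X L Ef) as [Es Hsum].
    unfold I. rewrite <- Hsum, <- (RInt_minus' _ _ _ _ Es EH), Rmult_assoc, <- RInt_const'.
    apply RInt_Rabs_le; [assumption | now apply ex_RInt_minus' | apply ex_RInt_const|].
    intros u Hu. pose proof (pow_lt u 2 ltac:(lra)) as H2. pose proof (hfun_sum_approx L (u ^ 2) H2) as H.
    apply Rle_trans with (1 := H). apply Rmult_le_compat_r; [apply Feps_pos|].
    assert (H3 : u ^ 2 <= X ^ 2) by (apply pow_incr; lra). assert (H4 : 1 <= u ^ 2) by (apply pow_R1_Rle; lra).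
    assert (H5 : 1 <= (u ^ 2) ^ 2) by (apply pow_R1_Rle; lra).
    assert (/ (u ^ 2) ^ 2 <= 1) by (rewrite <- Rinv_1; apply Rinv_le_contravar; lra). lra.
  - apply is_lim_seq_const.
  - replace (Finite 0) with (Rbar_mult ((X - a) * (1 + 2 * X ^ 2)) 0) by (simpl; f_equal; ring). apply is_lim_seq_scal_l, Feps_lim.
Qed.

(** * Evaluation of the sum over [m] and conclusion *)

Lemma phi_series n : (1 <= n)%nat -> exists s, is_series (phi n) s /\
  RInt (fun t => Uw n t * (vt t * T2 (vt t))) 0 PI = PI * INR n * (/ 2 * s).
Proof.
  intros Hn. pose proof PI_RGT_0 as Hpi. assert (Hn' : 0 < INR n) by (apply lt_0_INR; lia).
  pose proof (Uw_T2_series n Hn) as H. set (J := RInt (fun t => Uw n t * (vt t * T2 (vt t))) 0 PI) in *.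
  exists (2 / (PI * INR n) * J). split.
  - apply (is_series_scal_l (2 / (PI * INR n))) in H. refine (is_series_ext _ _ _ _ H). intros k. unscal. field. lra.
  - assert (G : forall j : R, j = PI * INR n * (/ 2 * (2 / (PI * INR n) * j))) by (intros; field; lra). apply G.
Qed.

Lemma sqrt8_bounds : 1 <= sqrt 8 <= 3.
Proof.
  split; [rewrite <- sqrt_1; apply sqrt_le_1_alt; lra|]. rewrite <- (sqrt_pow2 3) by lra. apply sqrt_le_1_alt; lra.
Qed.

(** The integral of [cos (t/2) * fT (vt t)] and that of [fT (u^2)] from [sqrt 8] on combine, through
    [half_angle_subst], into the single integral over [[0,X]] handled by [theta_sum]. The integrals
    of [rho] and [Uw] supply [n/2] and [1/n], and [- 1/(2X)] comes from the term [1/(2v)] of [Hs].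
    The assumption [3 <= X] ensures [sqrt 8 <= X]. *)
Lemma cut_value n X s : (1 <= n)%nat -> 3 <= X ->
  RInt (fun t => Uw n t * (vt t * T2 (vt t))) 0 PI = PI * INR n * (/ 2 * s) ->
  4 / PI * RInt (fun t => rho n t / 8 * Wv (vt t)) 0 PI + 2 * sqrt 2 / PI * RInt (fun u => Hs (u ^ 2)) (sqrt 8) X
  = / 2 * (2 * sqrt 2 / PI * (RInt (fun u => u ^ 2 * T2 (u ^ 2)) 0 X - X) + / INR n + INR n / 2 - 2 * sqrt 2 / PI / (2 * X) - / 2 * s).
Proof.
  intros Hn HX HU. pose proof PI_RGT_0 as Hpi. assert (Hn' : 0 < INR n) by (apply lt_0_INR; lia).
  pose proof sqrt8_bounds as H8b. assert (H8 : sqrt 8 = 2 * sqrt 2).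
  { replace 8 with (2 ^ 2 * 2) by ring. rewrite sqrt_mult, sqrt_pow2 by lra. reflexivity. }
  assert (Hs2 : 0 < sqrt 2) by (apply sqrt_lt_R0; lra). pose proof (sqrt_sqrt 2 ltac:(lra)) as Hss.
  set (fT := fun v => v * T2 v).
  assert (CfT : forall t, continuous (fun t => fT (vt t)) t) by (intros t; apply cont_mult; [apply vt_cont | apply T2_vt_cont]).
  assert (CfT2 : forall u, continuous (fun u => fT (u ^ 2)) u) by (intros u; apply cont_mult; [cont | apply T2_sq_cont]).
  set (c := fun t => cos (t / 2) * fT (vt t)). set (U := fun t => Uw n t * fT (vt t)).
  assert (Cc : forall t, continuous c t) by (intros t; apply cont_mult; [unfold Rdiv; cont | apply CfT]).
  assert (CU : forall t, continuous U t) by (intros t; apply cont_mult; [apply Uw_cont | apply CfT]).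
  assert (Ec : ex_RInt c 0 PI) by (apply ex_RInt_cont; [lra | intros; apply Cc]).
  assert (EU : ex_RInt U 0 PI) by (apply ex_RInt_cont; [lra | intros; apply CU]).
  assert (Er : ex_RInt (rho n) 0 PI) by (apply ex_RInt_cont; [lra | intros; now apply rho_cont]).
  assert (Eh : ex_RInt (fun t => cos (t / 2)) 0 PI) by (apply ex_RInt_cont; [lra | intros; unfold Rdiv; cont]).
  assert (Ew : ex_RInt (Uw n) 0 PI) by (apply ex_RInt_cont; [lra | intros; apply Uw_cont]).
  assert (Ih : RInt (fun t => cos (t / 2)) 0 PI = 2).
  { rewrite (RInt_FTC (fun t => 2 * sin (t / 2))); [| lra | intros t _; auto_derive; [trivial | unfold Rdiv; rfield] | intros; unfold Rdiv; cont].
    replace (0 / 2) with 0 by field. rewrite sin_PI2, sin_0. rring. }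
  assert (E1 : RInt (fun t => rho n t / 8 * Wv (vt t)) 0 PI
    = / 2 * (RInt c 0 PI - / (4 * INR n) * (PI * INR n * (/ 2 * s)) + / 16 * (2 * PI * INR n - 2) - (2 - / (4 * INR n) * PI))).
  { change (RInt (fun t => Uw n t * (vt t * T2 (vt t))) 0 PI) with (RInt U 0 PI) in HU.
    assert (F1 : ex_RInt (fun t => 1 * c t + - / (4 * INR n) * U t) 0 PI) by (apply ex_RInt_plus'; now apply ex_RInt_scal').
    assert (F2 : ex_RInt (fun t => 1 * cos (t / 2) + - / (4 * INR n) * Uw n t) 0 PI) by (apply ex_RInt_plus'; now apply ex_RInt_scal').
    assert (F3 : ex_RInt (fun t => / 2 * (1 * c t + - / (4 * INR n) * U t) + / 32 * rho n t) 0 PI) by (apply ex_RInt_plus'; now apply ex_RInt_scal').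
    rewrite (RInt_ext _ (fun t => (/ 2 * (1 * c t + - / (4 * INR n) * U t) + / 32 * rho n t) + - / 2 * (1 * cos (t / 2) + - / (4 * INR n) * Uw n t))).
    - rewrite (RInt_plus' _ _ _ _ F3 (ex_RInt_scal' _ (- / 2) _ _ F2)), (RInt_lin _ _ _ _ _ _ F1 Er), (RInt_scal' _ _ _ _ F2).
      rewrite (RInt_lin _ _ _ _ _ _ Ec EU), (RInt_lin _ _ _ _ _ _ Eh Ew), HU, rho_int, Ih, Uw_int by assumption. rfield. lra.
    - intros t Ht. rewrite Rmin_left, Rmax_right in Ht by lra. pose proof (rho_spec n t Hn ltac:(lra)) as Hr.
      unfold c, U, Wv. fold (fT (vt t)). req.
      transitivity (/ 2 * (rho n t * vt t / 8) * fT (vt t) + / 32 * rho n t - / 2 * (rho n t * vt t / 8)); [field | rewrite <- Hr; field; lra]. }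
  assert (EfT : forall a b, ex_RInt (fun u => fT (u ^ 2)) a b) by (intros; apply (ex_RInt_continuous (V := R_CompleteNormedModule)); intros; apply CfT2).
  assert (E2 : RInt (fun u => Hs (u ^ 2)) (sqrt 8) X
    = / 2 * RInt (fun u => fT (u ^ 2)) (sqrt 8) X + (- / (4 * X) - X / 2 + / (4 * sqrt 8) + sqrt 8 / 2)).
  { assert (Cq : forall u, 0 < u -> continuous (fun u => / (4 * u ^ 2) - / 2) u).
    { intros u Hu. pose proof (pow_lt u 2 Hu). cont. lra. }
    assert (Eq : ex_RInt (fun u => / (4 * u ^ 2) - / 2) (sqrt 8) X) by (apply ex_RInt_cont; [lra | intros; apply Cq; lra]).
    rewrite (RInt_ext _ (fun u => / 2 * fT (u ^ 2) + 1 * (/ (4 * u ^ 2) - / 2))).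
    - rewrite (RInt_lin _ _ _ _ _ _ (EfT _ _) Eq).
      rewrite (RInt_FTC (fun u => - / (4 * u) - u / 2) (fun u => / (4 * u ^ 2) - / 2)).
      + rfield. lra.
      + lra.
      + intros u Hu. auto_derive; [lra|]. rfield. lra.
      + intros; apply Cq; lra.
    - intros u Hu. rewrite Rmin_left, Rmax_right in Hu by lra. unfold Hs, fT. rfield. lra. }
  assert (E3 : RInt (fun u => u ^ 2 * T2 (u ^ 2)) 0 X = sqrt 2 * RInt c 0 PI + RInt (fun u => fT (u ^ 2)) (sqrt 8) X).
  { unfold c. rewrite <- (half_angle_subst fT CfT2). change (RInt (fun u => fT (u ^ 2)) 0 X = RInt (fun u => fT (u ^ 2)) 0 (sqrt 8) + RInt (fun u => fT (u ^ 2)) (sqrt 8) X).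
    apply RInt_Chasles'; apply EfT. }
  rewrite E1, E2, E3, H8.
  assert (G : forall a b : R, 4 / PI * (/ 2 * (a - / (4 * INR n) * (PI * INR n * (/ 2 * s)) + / 16 * (2 * PI * INR n - 2) - (2 - / (4 * INR n) * PI)))
    + 2 * sqrt 2 / PI * (/ 2 * b + (- / (4 * X) - X / 2 + / (4 * (2 * sqrt 2)) + 2 * sqrt 2 / 2))
    = / 2 * (2 * sqrt 2 / PI * (sqrt 2 * a + b - X) + / INR n + INR n / 2 - 2 * sqrt 2 / PI / (2 * X) - / 2 * s)).
  { intros a b. set (q := sqrt 2) in *. apply Rminus_diag_uniq.
    transitivity ((2 - q * q) * (a - 2) / PI); [field; repeat split; lra | rewrite Hss; field; lra]. }
  apply G.
Qed.

Lemma trig_2piN M : cos (2 * PI * INR M) = 1 /\ sin (2 * PI * INR M) = 0.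
Proof.
  replace (2 * PI * INR M) with (INR (2 * M) * PI) by (rewrite mult_INR; simpl; ring).
  rewrite cos_nPI, sin_nat_PI, pow_1_even. auto.
Qed.

(** What remains of a summand of the first series once the cosine coefficient of [zA] is removed. *)
Definition defect (n m : nat) : R := 1 / (2 * sqrt (2 * INR (S m))) - / (PI * INR n) * RInt (Ux n (8 * PI * INR (S m))) 0 PI.

(** [1/(2 sqrt(2m))] is [2 sqrt 2 / PI] times the half-line integral of [hfun], which is cut at
    [sqrt 8] and at [X]. The first piece, taken over the angle, merges with the integral of [Ux] by
    [rho_spec]; the last is the nonnegative tail estimated in [hfun_half]. *)
Lemma defect_split n m X : (1 <= n)%nat -> 3 <= X ->
  defect n m = 4 / PI * RInt (fun t => rho n t * vt t / 8 * hfun (2 * PI * INR (S m) * vt t)) 0 PI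
   + 2 * sqrt 2 / PI * RInt (fun u => hfun (2 * PI * INR (S m) * u ^ 2)) (sqrt 8) X
   + 2 * sqrt 2 / PI * (sqrt PI / 4 * (PI / sqrt 2) / sqrt (2 * PI * INR (S m)) - RInt (fun u => hfun (2 * PI * INR (S m) * u ^ 2)) 0 X).
Proof.
  intros Hn HX. pose proof PI_RGT_0 as Hpi. assert (Hn' : 0 < INR n) by (apply lt_0_INR; lia).
  pose proof sqrt8_bounds as H8b. assert (Hs2 : 0 < sqrt 2) by (apply sqrt_lt_R0; lra). pose proof (sqrt_sqrt 2 ltac:(lra)) as Hss.
  pose proof (two_pi_S_pos m) as Ha. pose proof (INR_S_pos m) as HM.
  set (M := INR (S m)) in *. set (a := 2 * PI * M) in *.
  set (f := fun z => hfun (a * z)).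
  assert (Cf2 : forall u, continuous (fun u => f (u ^ 2)) u) by (intros; now apply hfun_sq_cont).
  assert (Cfv : forall t, continuous (fun t => f (vt t)) t) by (intros; now apply hfun_vt_cont).
  assert (Ef : forall a b, ex_RInt (fun u => f (u ^ 2)) a b) by (intros; apply (ex_RInt_continuous (V := R_CompleteNormedModule)); intros; apply Cf2).
  assert (Ec : ex_RInt (fun t => cos (t / 2) * f (vt t)) 0 PI) by (apply ex_RInt_cont; [lra | intros; apply cont_mult; [unfold Rdiv; cont | apply Cfv]]).
  assert (EU : ex_RInt (fun t => Uw n t * f (vt t)) 0 PI) by (apply ex_RInt_cont; [lra | intros; apply cont_mult; [apply Uw_cont | apply Cfv]]).
  assert (E1 : RInt (fun t => rho n t * vt t / 8 * hfun (a * vt t)) 0 PI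
    = 1 * RInt (fun t => cos (t / 2) * f (vt t)) 0 PI + - / (4 * INR n) * RInt (fun t => Uw n t * f (vt t)) 0 PI).
  { rewrite <- (RInt_lin _ _ _ _ _ _ Ec EU). apply RInt_ext. intros t Ht. rewrite Rmin_left, Rmax_right in Ht by lra.
    rewrite <- rho_spec by (try assumption; lra). unfold f. rfield. lra. }
  assert (E2 : RInt (Ux n (8 * PI * M)) 0 PI = RInt (fun t => Uw n t * f (vt t)) 0 PI).
  { apply RInt_ext. intros t _. unfold Ux, Uw, f, vt, a. replace (2 * (8 * PI * M) * sin (t / 2) ^ 2) with (2 * PI * M * (8 * sin (t / 2) ^ 2)) by ring. rring. }
  assert (E3 : RInt (fun u => f (u ^ 2)) 0 X = sqrt 2 * RInt (fun t => cos (t / 2) * f (vt t)) 0 PI + RInt (fun u => f (u ^ 2)) (sqrt 8) X).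
  { rewrite <- (half_angle_subst f Cf2). apply RInt_Chasles'; apply Ef. }
  change (fun u => hfun (a * u ^ 2)) with (fun u => f (u ^ 2)). rewrite E1, E3. unfold defect. fold M. rewrite E2.
  assert (E4 : 2 * sqrt 2 / PI * (sqrt PI / 4 * (PI / sqrt 2) / sqrt a) = 1 / (2 * sqrt (2 * M))).
  { assert (0 < sqrt PI) by now apply sqrt_lt_R0. assert (0 < sqrt (2 * M)) by (apply sqrt_lt_R0; lra).
    replace (sqrt a) with (sqrt PI * sqrt (2 * M)) by (rewrite <- sqrt_mult by lra; f_equal; unfold a; ring). field. repeat split; lra. }
  rewrite <- E4.
  assert (G : forall b c d e : R, 2 * sqrt 2 / PI * e - / (PI * INR n) * c = 4 / PI * (1 * b + - / (4 * INR n) * c) + 2 * sqrt 2 / PI * d + 2 * sqrt 2 / PI * (e - (sqrt 2 * b + d))).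
  { intros b c d e. apply Rminus_diag_uniq. set (q := sqrt 2) in *.
    transitivity ((2 * (q * q) - 4) * b / PI); [field; lra | rewrite Hss; field; lra]. }
  apply G.
Qed.

(** [X] is fixed in terms of [eps] before summing. Up to [X] the sum has the value [P], which
    differs from [V] by at most [1/X]; the tails beyond [X] add at most [2/X] to every partial sum,
    since they are bounded by [1/X] times [1/m^2]. *)
Lemma defect_series n s : (1 <= n)%nat ->
  RInt (fun t => Uw n t * (vt t * T2 (vt t))) 0 PI = PI * INR n * (/ 2 * s) ->
  is_series (defect n) (/ 2 * (1 / sqrt 2 * zeta_real (1/2) + / INR n + INR n / 2 - / 2 * s)).
Proof.
  intros Hn HJ. set (V := / 2 * _). pose proof PI2_3_2 as Hpi. pose proof sqrt8_bounds as H8b.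
  assert (Hs2 : 0 < sqrt 2 < 3 / 2).
  { split; [apply sqrt_lt_R0; lra|]. rewrite <- (sqrt_pow2 (3/2)) by lra. apply sqrt_lt_1_alt; lra. }
  pose proof (sqrt_sqrt 2 ltac:(lra)) as Hss.
  set (kap := 2 * sqrt 2 / PI).
  assert (Hkap : 0 < kap <= 1).
  { unfold kap. split; [apply Rdiv_lt_0_compat; lra|]. apply Rmult_le_reg_r with PI; [lra|]. unfold Rdiv. rewrite Rmult_assoc, Rinv_l by lra. lra. }
  apply is_series_lim, is_lim_seq_spec. intros eps. pose proof (cond_pos eps) as Heps.
  (* [8/eps] makes the total cut error [3/X] smaller than [eps/2], leaving the other half for the
     partial sums of [p]. *)
  set (X := Rmax 3 (8 / eps)). assert (HX : 3 <= X) by apply Rmax_l. assert (HX8 : 8 / eps <= X) by apply Rmax_r.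
  assert (HX1 : 4 * / X <= eps / 2).
  { assert (H : / X <= / (8 / eps)) by (apply Rinv_le_contravar; [apply Rdiv_lt_0_compat; lra | assumption]).
    replace (/ (8 / eps)) with (eps / 8) in H by (field; lra). lra. }
  assert (HXi : 0 < / X) by (apply Rinv_0_lt_compat; lra).
  set (p := fun m => 4 / PI * RInt (fun t => rho n t * vt t / 8 * hfun (2 * PI * INR (S m) * vt t)) 0 PI
   + kap * RInt (fun u => hfun (2 * PI * INR (S m) * u ^ 2)) (sqrt 8) X).
  set (P := 4 / PI * RInt (fun t => rho n t / 8 * Wv (vt t)) 0 PI + kap * RInt (fun u => Hs (u ^ 2)) (sqrt 8) X).
  assert (Hp : is_series p P).
  { apply (is_series_plus (fun m => 4 / PI * RInt (fun t => rho n t * vt t / 8 * hfun (2 * PI * INR (S m) * vt t)) 0 PI)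
      (fun m => kap * RInt (fun u => hfun (2 * PI * INR (S m) * u ^ 2)) (sqrt 8) X)).
    - exact (is_series_scal_l (4 / PI) _ _ (rho_exchange n Hn)).
    - exact (is_series_scal_l kap _ _ (tail_exchange (sqrt 8) X (proj1 H8b) ltac:(lra))). }
  assert (HPV : Rabs (P - V) <= / X).
  { assert (HP : P = / 2 * (kap * (RInt (fun u => u ^ 2 * T2 (u ^ 2)) 0 X - X) + / INR n + INR n / 2 - kap / (2 * X) - / 2 * s)) by (exact (cut_value n X s Hn HX HJ)).
    pose proof (theta_sum X _ ltac:(lra) (theta_series X ltac:(lra))) as HT. set (Th := RInt (fun u => u ^ 2 * T2 (u ^ 2)) 0 X) in *.
    assert (HV : P - V = / 2 * (kap * (Th - X - PI / 4 * zeta_real (1/2)) - kap * / 2 * / X)).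
    { rewrite HP. unfold V. replace (1 / sqrt 2) with (kap * (PI / 4)).
      - assert (G : forall th : R, / 2 * (kap * (th - X) + / INR n + INR n / 2 - kap / (2 * X) - / 2 * s) - / 2 * (kap * (PI / 4) * zeta_real (1/2) + / INR n + INR n / 2 - / 2 * s)
          = / 2 * (kap * (th - X - PI / 4 * zeta_real (1/2)) - kap * / 2 * / X)) by (intros; field; split; [lra | apply not_0_INR; lia]). apply G.
      - unfold kap. replace (2 * sqrt 2 / PI * (PI / 4)) with (sqrt 2 / 2) by (field; lra). rewrite <- Hss at 2. field. lra. }
    rewrite HV. apply Rabs_le_between in HT. destruct HT as [HT1 HT2]. set (D := Th - X - PI / 4 * zeta_real (1/2)) in *.
    assert (HD1 : kap * D <= / X) by (apply Rle_trans with (kap * / X); [apply Rmult_le_compat_l; lra | nra]).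
    assert (HD2 : - / X <= kap * D) by (apply Rle_trans with (kap * - / X); [nra | apply Rmult_le_compat_l; lra]).
    apply Rabs_le. assert (0 <= kap * / 2 * / X <= / X) by nra. lra. }
  assert (Hr : forall L, 0 <= sum_f_R0 (defect n) L - sum_f_R0 p L <= 2 * / X).
  { intros L. rewrite <- minus_sum.
    assert (Hm : forall m, 0 <= defect n m - p m <= / X * / INR (S m) ^ 2).
    { intros m. rewrite (defect_split n m X Hn HX). fold kap. pose proof (two_pi_S_pos m) as Ha. pose proof (hfun_half (2 * PI * INR (S m)) X Ha ltac:(lra)) as Hh.
      unfold p. set (r := sqrt PI / 4 * (PI / sqrt 2) / sqrt (2 * PI * INR (S m)) - RInt (fun u => hfun (2 * PI * INR (S m) * u ^ 2)) 0 X) in *.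
      assert (G : forall b c : R, b + c + kap * r - (b + c) = kap * r) by (intros; ring). rewrite G.
      split; [apply Rmult_le_pos; lra|]. apply Rle_trans with (1 * r); [apply Rmult_le_compat_r; lra|]. rewrite Rmult_1_l.
      apply Rle_trans with (1 := proj2 Hh). pose proof (INR_S_pos m) as HM. pose proof (pow_lt _ 2 HM) as HM2.
      assert (H1 : 2 / (3 * (2 * PI * INR (S m)) ^ 2 * X ^ 3) = / X * / INR (S m) ^ 2 * (/ (6 * PI ^ 2 * X ^ 2))) by (field; repeat split; lra).
      rewrite H1. rewrite <- (Rmult_1_r (/ X * / INR (S m) ^ 2)) at 2. apply Rmult_le_compat_l; [apply Rmult_le_pos; [lra | left; now apply Rinv_0_lt_compat]|].
      rewrite <- Rinv_1. apply Rinv_le_contravar; [lra|]. assert (1 <= PI ^ 2) by (apply pow_R1_Rle; lra). assert (1 <= X ^ 2) by (apply pow_R1_Rle; lra). nra. }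
    split.
    - apply cond_pos_sum. intros m. apply Hm.
    - apply Rle_trans with (sum_f_R0 (fun m => / X * / INR (S m) ^ 2) L); [apply sum_Rle; intros; apply Hm|].
      rewrite sum_mult. pose proof (sum_inv_sq_le L). nra. }
  apply is_series_lim, is_lim_seq_spec in Hp. specialize (Hp (pos_div_2 eps)). destruct Hp as [N0 HN]. exists N0. intros L HL.
  specialize (HN L HL). simpl in HN. specialize (Hr L). apply Rabs_def2 in HN. apply Rabs_le_between in HPV. apply Rabs_def1; lra.
Qed.

(** With [t = 1 + m/4] and [s = sqrt(t^2 - 1)], the root is [4 s] and the base of the power is
    [4 (t - s)]. *)
Lemma kernel_term n k : (1 <= n)%nat ->
  let m := INR (k + 1) in
  (m + 4 - sqrt (m * (m + 8))) ^ (2 * n) / sqrt (m * (m + 8)) = 2 ^ (4 * n - 1) / 2 * phi n k.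
Proof.
  intros Hn. unfold phi. rewrite Nat.add_1_r. set (m := INR (S k)). cbv zeta. assert (Hm : 0 < m) by apply INR_S_pos.
  set (r := sqrt (m * (m + 8))). assert (Hr : 0 < r) by (apply sqrt_lt_R0; nra).
  replace (sqrt ((1 + m / 4) ^ 2 - 1)) with (r / 4).
  - replace (m + 4 - r) with (4 * (1 + m / 4 - r / 4)) by field. rewrite Rpow_mult_distr, pow_mult.
    replace (4 ^ 2) with (2 ^ 4) by ring. rewrite <- pow_mult. replace (2 ^ (4 * n)) with (2 * 2 ^ (4 * n - 1)) by (change (2 ^ S (4 * n - 1) = 2 ^ (4 * n)); f_equal; lia).
    field. lra.
  - replace ((1 + m / 4) ^ 2 - 1) with (m * (m + 8) / 4 ^ 2) by field. rewrite sqrt_div_alt by lra. rewrite sqrt_pow2 by lra. reflexivity.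
Qed.

Theorem theorem1p5 (n : nat) (hn : (1 <= n)%nat) :
  exists S1 S2 : R,
    infinite_sum (fun k => let m := INR (k + 1) in
        (-1) ^ n * PI * besselY (2 * n) (8 * PI * m) + 1 / (2 * sqrt (2 * m))) S1 /\
    infinite_sum (fun k => let m := INR (k + 1) in
        (m + 4 - sqrt (m * (m + 8))) ^ (2 * n) / sqrt (m * (m + 8))) S2 /\
    zagier_poly (2 * n) (-3/2) + zagier_poly (2 * n) 0 =
      2 * S1 - INR n
      - 1/2 * (chebU (2 * n - 1) (1/4) + chebU (2 * n - 1) (3/4))
      - 1 / sqrt 2 * zeta_real (1/2)
      + S2 / 2 ^ (4 * n - 1).
Proof.
  pose proof PI_RGT_0 as Hpi. assert (Hn' : 0 < INR n) by (apply lt_0_INR; lia).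
  destruct (phi_series n hn) as [s [Hs HJ]]. pose proof (defect_series n s hn HJ) as Hd. set (V := / 2 * _) in Hd.
  pose proof (zA_fourier n hn) as Hz. pose proof (pow_lt 2 (4 * n - 1) ltac:(lra)) as Hp.
  (* Half of the value in [zA_fourier], because that series carries doubled coefficients, plus the
     sum [V] of the defects. *)
  exists (/ 2 * (zA n 0 + INR n / 2 - / INR n) + V), (2 ^ (4 * n - 1) / 2 * s). split; [|split].
  - apply is_series_Reals.
    pose proof (is_series_plus _ _ _ _ (is_series_scal_l (/ 2) _ _ Hz) Hd) as H. refine (is_series_ext _ _ _ _ H).
    intros k. cbv zeta. rewrite Nat.add_1_r.
    match goal with |- plus (scal ?a ?b) ?c = ?d => change (a * b + c = d) end.
    set (w := 2 * PI * INR (S k)). assert (Hw : 0 < w) by apply two_pi_S_pos.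
    destruct (trig_2piN (S k)) as [Hc1 Hs1]. fold w in Hc1, Hs1.
    (* The Bessel argument is [4 w] with [w = 2 PI m]; both are multiples of [2 PI], as
       [besselY_formula] and [zA_cos] respectively require. Their finite sums cancel and the
       integrals of [cos (4 w cos t) sin (2 n t)] agree. *)
    assert (E4 : 4 * w = 2 * PI * INR (4 * S k)) by (unfold w; rewrite mult_INR; simpl (INR 4); ring).
    destruct (trig_2piN (4 * S k)) as [Hc4 Hs4]. rewrite <- E4 in Hc4, Hs4.
    pose proof (besselY_formula n (4 * w) hn ltac:(lra) Hc4 Hs4) as HB. pose proof (zA_cos n w hn Hw Hc1 Hs1) as HZ.
    unfold defect. replace (8 * PI * INR (S k)) with (4 * w) by (unfold w; ring). rewrite HB, HZ.
    pose proof (INR_S_pos k) as HM. pose proof (sqrt_lt_R0 (2 * INR (S k)) ltac:(lra)) as HsM.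
    set (M := INR (S k)) in *. rfield. repeat split; lra.
  - apply is_series_Reals. refine (is_series_ext _ _ _ _ (is_series_scal_l (2 ^ (4 * n - 1) / 2) _ _ Hs)).
    intros k. symmetry. now apply kernel_term.
  (* In [2 S1] the mean [1/n] of [zA] cancels the [1/n] in [V], the two halves of [n] add up, and
     [s/2] is the normalised second series. *)
  - rewrite zagier_special by assumption. unfold V. field. pose proof (sqrt_lt_R0 2 ltac:(lra)). repeat split; lra.
Qed.
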